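(* Let $X$ be a compact complex manifold and let $E$ be an RC-positive holomorphic vector bundle over $X$. Then for any holomorphic vector bundle $A$ over $X$ there exists a positive integer $c_A=c(A,E)$ such that $$H^0(X,\mathrm{Sym}^{\otimes \ell}E^*\otimes A^{\otimes k})=0$$ for all integers $\ell\geq c_A(k+1)$ and $k\geq 0$. Moreover, if $X$ is a projective manifold, then any invertible subsheaf $\mathcal{F}$ of $\mathcal{O}(E^* )$ is not pseudo-effective.
   Context: For a Hermitian holomorphic vector bundle $(E,h)$ over a complex manifold $X$, the Chern curvature tensor $R^{(E,h)}\in\Gamma(X,\Lambda^{1,1}T_X^*\otimes \mathrm{End}(E))$ has components, in local holomorphic coordinates $\{z^i\}$ and a local holomorphic frame $\{e_\alpha\}$, $R_{i\bar j\alpha\bar\beta}=-\frac{\partial^2 h_{\alpha\bar\beta}}{\partial z^i\partial\bar z^j}+h^{\gamma\bar\delta}\frac{\partial h_{\alpha\bar\delta}}{\partial z^i}\frac{\partial h_{\gamma\bar\beta}}{\partial\bar z^j}$, and $R^{(E,h)}(v,\bar v,a,\bar a)=\sum R_{i\bar j\alpha\bar\beta}v^i\bar v^j a^\alpha\bar a^\beta$. $(E,h)$ is RC-positive if at every point $q\in X$, for each nonzero $a\in E_q$ there is a vector $v\in T_qX$ (holomorphic tangent space) with $R^{(E,h)}(v,\bar v,a,\bar a)>0$. A holomorphic vector bundle $E$ is called RC-positive if it admits a smooth Hermitian metric $h$ such that $(E,h)$ is RC-positive. $\mathrm{Sym}^{\otimes\ell}$ denotes the $\ell$-th symmetric power,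 and $\mathcal{O}(E^* )$ the sheaf of holomorphic sections of the dual bundle $E^*$. A line bundle (invertible sheaf) is pseudo-effective if it admits a possibly singular Hermitian metric whose curvature is semi-positive in the sense of currents. *)

(* Defs.v *)
(* The complex numbers are R[i], for an arbitrary realType R. *)
From HB Require Import structures.
From mathcomp Require Import all_boot all_order all_algebra all_fingroup.
From mathcomp Require Import all_classical all_reals all_analysis.
From mathcomp Require Import complex mxtens.

Set Implicit Arguments.
Unset Strict Implicit.
Unset Printing Implicit Defensive.

Import Order.TTheory GRing.Theory Num.Theory.
Import numFieldNormedType.Exports.

Local Open Scope classical_set_scope.
Local Open Scope ring_scope.

(* The topology and norm of R[i] as a normed module over itself; thus
   [differentiable] for maps between 'rV[R[i]]_n and R[i] means
   C-differentiable. *)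
HB.instance Definition _ (R : realType) := GRing.ComAlgebra.copy R[i] R[i]^o.
HB.instance Definition _ (R : realType) := Vector.copy R[i] R[i]^o.
HB.instance Definition _ (R : realType) := NormedModule.copy R[i] R[i]^o.

Section Calculus.
Variables (R : realType) (n : nat).
Implicit Types (f : 'rV[R[i]]_n -> R[i]) (z v : 'rV[R[i]]_n).

Definition real_slice f z v (t : R) : R[i] := f (z + (t%:C)%C *: v).

(* The derivative along v is a real directional derivative of a C-valued
   function; f need not be holomorphic. *)
Definition rderivable f z v : Prop :=
  derivable (fun t => complex.Re (real_slice f z v t)) 0 1 /\
  derivable (fun t => complex.Im (real_slice f z v t)) 0 1.

Definition rderive v f z : R[i] :=
  Complex (derive1 (fun t => complex.Re (real_slice f z v t)) 0)
          (derive1 (fun t => complex.Im (real_slice f z v t)) 0).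

Fixpoint Ck (k : nat) (W : set 'rV[R[i]]_n) f : Prop :=
  (forall z, W z -> {for z, continuous f}) /\
  match k with
  | 0 => True
  | k'.+1 => forall v, (forall z, W z -> rderivable f z v) /\
                       Ck k' W (rderive v f)
  end.

(* meaningful for W open *)
Definition smooth_on (W : set 'rV[R[i]]_n) f : Prop := forall k, Ck k W f.

Let e (p : 'I_n) : 'rV[R[i]]_n := delta_mx 0 p.

(* Wirtinger derivatives d/dz^p and d/d(conj z^p) *)
Definition dz (p : 'I_n) f z : R[i] :=
  2^-1 * (rderive (e p) f z - 'i%C * rderive ('i%C *: e p) f z).
Definition dzbar (p : 'I_n) f z : R[i] :=
  2^-1 * (rderive (e p) f z + 'i%C * rderive ('i%C *: e p) f z).

End Calculus.

Section LebesgueCn.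
Variable R : realType.

Record measure_space := MeasureSpace {
  ms_disp : measure_display;
  ms_type : measurableType ms_disp;
  ms_meas : {measure set ms_type -> \bar R} }.

(* C^n as the iterated product ((... * R) * R), with the product of Lebesgue
   measures; R carries its Borel sigma-algebra. *)
Fixpoint lebC (n : nat) : measure_space :=
  match n with
  | 0 => @MeasureSpace _ unit (@dirac _ unit tt R)
  | n'.+1 => @MeasureSpace _
      ((ms_type (lebC n') * measurableTypeR R) * measurableTypeR R)%type
      ((ms_meas (lebC n') \x @lebesgue_measure R) \x @lebesgue_measure R)%E
  end.

Fixpoint vecC (n : nat) : ms_type (lebC n) -> 'rV[R[i]]_n :=
  match n return ms_type (lebC n) -> 'rV[R[i]]_n with
  | 0 => fun _ => 0
  | n'.+1 => fun u =>
      row_mx (const_mx (Complex u.1.2 u.2) : 'rV_1) (vecC u.1.1)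
  end.

Definition integrableC n (K : set 'rV[R[i]]_n) (f : 'rV[R[i]]_n -> \bar R) : Prop :=
  (ms_meas (lebC n)).-integrable (@vecC n @^-1` K) (f \o @vecC n).

Definition integralC n (K : set 'rV[R[i]]_n) (f : 'rV[R[i]]_n -> \bar R) : \bar R :=
  (\int[ms_meas (lebC n)]_(u in @vecC n @^-1` K) f (vecC u))%E.

Definition locally_integrable n (W : set 'rV[R[i]]_n) (f : 'rV[R[i]]_n -> \bar R) :=
  forall K, compact K -> K `<=` W -> integrableC K f.

(* i ddbar f >= 0 on W in the sense of currents: for every constant vector xi,
   the distribution sum_pq xi_p conj(xi_q) d^2 f / dz^p d(conj z^q) is
   nonnegative on nonnegative test functions supported in W. *)
Definition ddbar_nonneg n (W : set 'rV[R[i]]_n) (f : 'rV[R[i]]_n -> \bar R) :=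
  forall (xi : 'rV[R[i]]_n) (chi : 'rV[R[i]]_n -> R) (K : set 'rV[R[i]]_n),
    compact K -> K `<=` W ->
    (forall z, ~ K z -> chi z = 0) ->
    (forall z, 0 <= chi z) ->
    let chiC z : R[i] := ((chi z)%:C)%C in
    smooth_on setT chiC ->
    (0 <= integralC K (fun z => f z *
       (complex.Re (\sum_p \sum_q
          xi 0 p * (xi 0 q)^* * dz p (dzbar q chiC) z))%:E))%E.

End LebesgueCn.

Record chart (R : realType) (X : topologicalType) (n : nat) := Chart {
  chart_dom : set X;
  chart_fun : X -> 'rV[R[i]]_n;
  chart_inv : 'rV[R[i]]_n -> X;
  chart_dom_open : open chart_dom;
  chart_img_open : open (chart_fun @` chart_dom);
  chart_funK : forall x, chart_dom x -> chart_inv (chart_fun x) = x;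
  chart_fun_cont : {within chart_dom, continuous chart_fun};
  chart_inv_cont : {within chart_fun @` chart_dom, continuous chart_inv} }.

Record complex_manifold (R : realType) := ComplexManifold {
  mfd_space :> topologicalType;
  mfd_dim : nat;
  atlas : set (chart R mfd_space mfd_dim);
  mfd_nonempty : [set: mfd_space] !=set0;
  mfd_hausdorff : hausdorff_space mfd_space;
  mfd_second_countable : @second_countable mfd_space;
  atlas_cover : forall x, exists2 c, atlas c & chart_dom c x;
  atlas_holo : forall c c', atlas c -> atlas c' ->
    forall x, chart_dom c x -> chart_dom c' x ->
    differentiable (chart_fun c' \o chart_inv c) (chart_fun c x) }.

Section Functions.
Variables (R : realType) (X : complex_manifold R).

(* Both are meaningful for U open. *)
Definition holo_on (U : set X) (f : X -> R[i]) : Prop :=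
  forall c x, atlas c -> U x -> chart_dom c x ->
    differentiable (f \o chart_inv c) (chart_fun c x).

Definition mfd_smooth_on (U : set X) (f : X -> R[i]) : Prop :=
  forall c, atlas c ->
    smooth_on (chart_fun c @` (U `&` chart_dom c)) (f \o chart_inv c).

Lemma holo_on_sub (U V : set X) f : V `<=` U -> holo_on U f -> holo_on V f.
Proof. by move=> VU hf c x ac Vx; apply: hf => //; exact: VU. Qed.

Lemma holo_on_cst (U : set X) (a : R[i]) : holo_on U (fun=> a).
Proof. by move=> c x _ _ _; exact: differentiable_cst. Qed.

Lemma holo_onM (U : set X) f g :
  holo_on U f -> holo_on U g -> holo_on U (fun x => f x * g x).
Proof.
move=> hf hg c x ac Ux cx.
exact: (differentiableM (hf _ _ ac Ux cx) (hg _ _ ac Ux cx)).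
Qed.

Lemma holo_on_sum (U : set X) (I : Type) (r : seq I) (P : pred I)
    (f : I -> X -> R[i]) : (forall i, holo_on U (f i)) ->
  holo_on U (fun x => \sum_(i <- r | P i) f i x).
Proof.
move=> hf; elim: r => [|i r IH].
  under eq_fun do rewrite big_nil; exact: holo_on_cst.
under eq_fun do rewrite big_cons.
case: (P i) => // c x ac Ux cx.
exact: (differentiableD (hf i _ _ ac Ux cx) (IH _ _ ac Ux cx)).
Qed.

Lemma holo_on_prod (U : set X) (I : Type) (r : seq I) (f : I -> X -> R[i]) :
  (forall i, holo_on U (f i)) -> holo_on U (fun x => \prod_(i <- r) f i x).
Proof.
move=> hf; elim: r => [|i r IH].
  under eq_fun do rewrite big_nil; exact: holo_on_cst.
by under eq_fun do rewrite big_cons; exact: holo_onM.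
Qed.

End Functions.

Record hol_bundle (R : realType) (X : complex_manifold R) := HolBundle {
  rank : nat;
  bidx : Type;
  triv_dom : bidx -> set X;
  (* coordinate columns transform by s_i = (trans i j) s_j *)
  trans : bidx -> bidx -> X -> 'M[R[i]]_rank;
  triv_open : forall i, open (triv_dom i);
  triv_cover : forall x, exists i, triv_dom i x;
  trans_holo : forall i j a b,
    holo_on (triv_dom i `&` triv_dom j) (fun x => trans i j x a b);
  trans_id : forall i x, triv_dom i x -> trans i i x = 1%:M;
  trans_cocycle : forall i j k x,
    triv_dom i x -> triv_dom j x -> triv_dom k x ->
    trans i j x *m trans j k x = trans i k x }.

Section SymPower.
Variables (K : comNzRingType) (r l : nat).

(* The monomials e_(t_0) ... e_(t_(l-1)), t nondecreasing, form a basis of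
   Sym^l(K^r). *)
Definition sym_basis : {set l.-tuple 'I_r} :=
  [set t : l.-tuple 'I_r | sorted leq (map val t)].

Definition sym_mono (M : 'I_#|sym_basis|) : l.-tuple 'I_r := enum_val M.

(* Sym^l(g): e_N = prod_k e_(N_k) is sent to prod_k (sum_i g_(i,N_k) e_i), whose
   e_M-coefficient collects the index tuples that are rearrangements of M. *)
Definition symmx (g : 'M[K]_r) : 'M[K]_#|sym_basis| :=
  \matrix_(M, N) \sum_(t : l.-tuple 'I_r | perm_eq t (sym_mono M))
     \prod_(k < l) g (tnth t k) (tnth (sym_mono N) k).

Let leqr : rel 'I_r := fun a b => (a <= b)%N.

Let sorted_leqr (t : seq 'I_r) : sorted leqr t = sorted leq (map val t).
Proof. by rewrite sorted_map. Qed.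

Let sortedI (t u : seq 'I_r) :
  sorted leq (map val t) -> sorted leq (map val u) -> perm_eq t u -> t = u.
Proof.
rewrite -!sorted_leqr; apply: sorted_eq.
- by move=> a b c; exact: leq_trans.
- by move=> a b /anti_leq /val_inj.
Qed.

Let sort_ex (p : l.-tuple 'I_r) :
  exists P : 'I_#|sym_basis|, perm_eq p (sym_mono P).
Proof.
have sp : [tuple of sort leqr p] \in sym_basis.
  rewrite inE /= -sorted_leqr; apply: sort_sorted => a b; exact: leq_total.
exists (enum_rank_in sp [tuple of sort leqr p]).
by rewrite /sym_mono enum_rankK_in // perm_sym perm_sort.
Qed.

Let enum_uniq (P Q : 'I_#|sym_basis|) :
  perm_eq (sym_mono P) (sym_mono Q) -> P = Q.
Proof.
move=> PQ; apply: enum_val_inj; apply: val_inj => /=; apply: sortedI => //.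
- by have := enum_valP P; rewrite inE.
- by have := enum_valP Q; rewrite inE.
Qed.

Lemma symmx1 : symmx 1%:M = 1%:M.
Proof.
apply/matrixP => M N; rewrite !mxE.
have H (t : l.-tuple 'I_r) : \prod_(k < l) (1%:M : 'M[K]_r) (tnth t k)
    (tnth (sym_mono N) k) = (t == sym_mono N)%:R.
  case: eqP => [->|/eqP neq].
    by rewrite big1 // => k _; rewrite mxE eqxx.
  have /existsP[k nk] : [exists k, tnth t k != tnth (sym_mono N) k].
    apply: contraNT neq => /existsPn h; apply/eqP/eq_from_tnth => k.
    by apply/eqP; move: (h k); rewrite negbK.
  by rewrite (bigD1 k) //= mxE (negbTE nk) mul0r.
under eq_bigr do rewrite H.
rewrite big_mkcond /= (bigD1 (sym_mono N)) //= eqxx big1 ?addr0.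
  case: (M =P N) => [->|/eqP neq]; first by rewrite perm_refl.
  by case: ifP => // /enum_uniq NM; rewrite NM eqxx in neq.
by move=> t /negbTE ->; rewrite if_same.
Qed.

Let S (g : 'M[K]_r) (M p : l.-tuple 'I_r) :=
  \sum_(t : l.-tuple 'I_r | perm_eq t M)
     \prod_(k < l) g (tnth t k) (tnth p k).

Let S_perm g M (p q : l.-tuple 'I_r) : perm_eq p q -> S g M p = S g M q.
Proof.
case/tuple_permP => s sE.
have pE : p = [tuple tnth q (s i) | i < l] by exact: val_inj.
rewrite /S.
pose h (t : l.-tuple 'I_r) := [tuple tnth t (s i) | i < l].
pose h' (t : l.-tuple 'I_r) := [tuple tnth t ((s^-1)%g i) | i < l].
have hK : cancel h h'.
  by move=> t; apply: eq_from_tnth => i; rewrite !tnth_mktuple permKV.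
have h'K : cancel h' h.
  by move=> t; apply: eq_from_tnth => i; rewrite !tnth_mktuple permK.
rewrite (reindex h); last by exists h' => t _; [exact: hK|exact: h'K].
apply: eq_big => [t|t _].
  have : perm_eq (h t) t by apply/tuple_permP; exists s.
  by move/permPl => ->.
rewrite [RHS](reindex_inj (@perm_inj _ s)) /=; apply: eq_bigr => k _.
by rewrite pE !tnth_mktuple.
Qed.

Lemma symmxM (g h : 'M[K]_r) : symmx (g *m h) = symmx g *m symmx h.
Proof.
apply/matrixP => M N; rewrite !mxE.
transitivity (\sum_(p : l.-tuple 'I_r) S g (sym_mono M) p *
    \prod_(k < l) h (tnth p k) (tnth (sym_mono N) k)).
  under [RHS]eq_bigr do rewrite /S mulr_suml.
  rewrite exchange_big /=; apply: eq_bigr => t _.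
  under eq_bigr do rewrite mxE.
  rewrite bigA_distr_bigA /=.
  rewrite (reindex (fun p : l.-tuple 'I_r => [ffun k => tnth p k])) /=; last first.
    exists (fun f : {ffun 'I_l -> 'I_r} => [tuple f i | i < l]) => [p _|f _].
      by apply: eq_from_tnth => i; rewrite tnth_mktuple ffunE.
    by apply/ffunP => i; rewrite ffunE tnth_mktuple.
  apply: eq_bigr => p _; rewrite -big_split /=; apply: eq_bigr => k _.
  by rewrite ffunE.
transitivity (\sum_(p : l.-tuple 'I_r) \sum_(P | perm_eq p (sym_mono P))
  S g (sym_mono M) p * \prod_(k < l) h (tnth p k) (tnth (sym_mono N) k)).
  apply: eq_bigr => p _; have [P pP] := sort_ex p.
  rewrite [RHS](bigD1 P) //= [X in _ = _ + X]big1 ?addr0 // => Q /andP[pQ QP].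
  move: QP; rewrite (@enum_uniq Q P) ?eqxx //.
  by apply: perm_trans pP; rewrite perm_sym.
rewrite (exchange_big_dep predT) //=; apply: eq_bigr => P _.
rewrite !mxE mulr_sumr; apply: eq_bigr => p pP.
by rewrite (S_perm g _ pP).
Qed.

End SymPower.

Section BundleOps.
Variables (R : realType) (X : complex_manifold R).
Implicit Types E F : hol_bundle X.

Program Definition trivial_line : hol_bundle X :=
  @HolBundle R X 1 unit (fun=> setT) (fun _ _ _ => 1%:M) _ _ _ _ _.
Next Obligation. by move=> i; exact: openT. Qed.
Next Obligation. by move=> x; exists tt. Qed.
Next Obligation. by move=> *; exact: holo_on_cst. Qed.
Next Obligation. by []. Qed.
Next Obligation. by move=> *; rewrite mulmx1. Qed.

(* (g_ij^-1)^T = (g_ji)^T *)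
Program Definition dual E : hol_bundle X :=
  @HolBundle R X (rank E) (bidx E) (@triv_dom _ _ E)
    (fun i j x => (trans (h := E) j i x)^T) _ _ _ _ _.
Next Obligation. by move=> *; exact: triv_open. Qed.
Next Obligation. by move=> *; exact: triv_cover. Qed.
Next Obligation.
by move=> E i j a b; under eq_fun do rewrite /= mxE; rewrite setIC; exact: trans_holo.
Qed.
Next Obligation. by move=> * /=; rewrite trans_id // trmx1. Qed.
Next Obligation. by move=> * /=; rewrite -trmx_mul trans_cocycle. Qed.

Let tensmx11 m n : (1%:M : 'M[R[i]]_m) *t (1%:M : 'M[R[i]]_n) = 1%:M.
Proof.
apply/matrixP => a b; case: (mxtens_indexP a) => a1 a2.
case: (mxtens_indexP b) => b1 b2; rewrite tensmxE !mxE -natrM mulnb.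
by rewrite (can_eq (@mxtens_indexK m n)) xpair_eqE.
Qed.

Program Definition tensor E F : hol_bundle X :=
  @HolBundle R X (rank E * rank F)%N (bidx E * bidx F)%type
    (fun i => triv_dom i.1 `&` triv_dom i.2)
    (fun i j x => trans i.1 j.1 x *t trans i.2 j.2 x) _ _ _ _ _.
Next Obligation. by move=> *; apply: openI; exact: triv_open. Qed.
Next Obligation.
by move=> E F x; have [i xi] := triv_cover E x; have [j xj] := triv_cover F x; exists (i, j).
Qed.
Next Obligation.
move=> E F i j a b; case: (mxtens_indexP a) => a1 a2.
case: (mxtens_indexP b) => b1 b2; under eq_fun do rewrite tensmxE.
apply: holo_onM; apply: holo_on_sub (@trans_holo _ _ _ _ _ _ _).
- by move=> x [[? ?] [? ?]].
- by move=> x [[? ?] [? ?]].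
Qed.
Next Obligation. by move=> E F i x [? ?] /=; rewrite !trans_id // tensmx11. Qed.
Next Obligation.
by move=> E F i j k x [? ?] [? ?] [? ?] /=; rewrite tensmx_mul !trans_cocycle.
Qed.

Fixpoint tensor_power E (k : nat) : hol_bundle X :=
  if k is k'.+1 then tensor E (tensor_power E k') else trivial_line.

Program Definition sym_power (l : nat) E : hol_bundle X :=
  @HolBundle R X _ (bidx E) (@triv_dom _ _ E)
    (fun i j x => symmx l (trans (h := E) i j x)) _ _ _ _ _.
Next Obligation. by move=> *; exact: triv_open. Qed.
Next Obligation. by move=> *; exact: triv_cover. Qed.
Next Obligation.
move=> l E i j a b; under eq_fun do rewrite /= mxE.
by apply: holo_on_sum => t; apply: holo_on_prod => k; exact: trans_holo.
Qed.
Next Obligation. by move=> * /=; rewrite trans_id // symmx1. Qed.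
Next Obligation. by move=> * /=; rewrite -symmxM trans_cocycle. Qed.

(* A section is the family of its coordinate columns in the trivializations;
   values outside U `&` triv_dom i are irrelevant. *)
Definition presection E := bidx E -> X -> 'cV[R[i]]_(rank E).

Definition eq_section E (U : set X) (s t : presection E) : Prop :=
  forall i x, U x -> triv_dom i x -> s i x = t i x.

Definition zero_section E : presection E := fun _ _ => 0.
Arguments zero_section : clear implicits.
Definition add_section E (s t : presection E) : presection E :=
  fun i x => s i x + t i x.
Definition scale_section E (f : X -> R[i]) (s : presection E) : presection E :=
  fun i x => f x *: s i x.

Definition is_section E (U : set X) (s : presection E) : Prop :=
  (forall i a, holo_on (U `&` triv_dom i) (fun x => s i x a 0)) /\
  (forall i j x, U x -> triv_dom i x -> triv_dom j x ->
     s i x = trans i j x *m s j x).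

Definition H0_vanishes E : Prop :=
  forall s : presection E, is_section setT s -> eq_section setT s (zero_section E).

End BundleOps.
Arguments zero_section {R X} E i x.

Section RCPositivity.
Variables (R : realType) (X : complex_manifold R) (E : hol_bundle X).

(* hmat i x is the Gram matrix h_(alpha, conj beta) = h(e_alpha, e_beta) of the
   holomorphic frame of the i-th trivialization. *)
Record hermitian_metric := HermitianMetric {
  hmat : bidx E -> X -> 'M[R[i]]_(rank E);
  hmat_smooth : forall i a b, mfd_smooth_on (triv_dom i) (fun x => hmat i x a b);
  hmat_herm : forall i x a b, triv_dom i x -> hmat i x b a = (hmat i x a b)^*;
  hmat_pos : forall i x (u : 'I_(rank E) -> R[i]), triv_dom i x ->
    (exists a, u a != 0) -> 0 < \sum_a \sum_b hmat i x a b * u a * (u b)^*;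
  hmat_trans : forall i j x, triv_dom i x -> triv_dom j x ->
    hmat j x = (trans i j x)^T *m hmat i x *m map_mx Num.conj (trans i j x) }.

(* R_(p, conj q, a, conj b) at x, in the coordinates c and the i-th frame;
   h^(g, conj d) is the (d, g) entry of the inverse matrix, since it is defined
   by sum_d h^(g, conj d) h_(a, conj d) = delta_(a, g). *)
Definition chern_curvature (h : hermitian_metric) (c : chart R X (mfd_dim X))
    (i : bidx E) (x : X) (p q : 'I_(mfd_dim X)) (a b : 'I_(rank E)) : R[i] :=
  let H a b z : R[i] := hmat h i (chart_inv c z) a b in
  let z := chart_fun c x in
  - dz p (dzbar q (H a b)) z
  + \sum_g \sum_d invmx (hmat h i x) d g * dz p (H a d) z * dzbar q (H g b) z.

Definition chern_form (h : hermitian_metric) (c : chart R X (mfd_dim X))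
    (i : bidx E) (x : X) (v : 'rV[R[i]]_(mfd_dim X)) (u : 'cV[R[i]]_(rank E)) :=
  \sum_p \sum_q \sum_a \sum_b chern_curvature h c i x p q a b
    * v 0 p * (v 0 q)^* * u a 0 * (u b 0)^*.

(* 0 < z in R[i] says that z is real and positive. *)
Definition RC_positive_metric (h : hermitian_metric) : Prop :=
  forall (x : X) c i, atlas c -> chart_dom c x -> triv_dom i x ->
  forall u : 'cV[R[i]]_(rank E), u != 0 ->
  exists v : 'rV[R[i]]_(mfd_dim X), 0 < chern_form h c i x v u.

Definition RC_positive : Prop := exists h, RC_positive_metric h.

End RCPositivity.

Section Projective.
Variable R : realType.

(* lines through 0 in C^(N+1) *)
Definition proj_space (N : nat) := {L : {vspace 'rV[R[i]]_N.+1} | \dim L == 1%N}.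

Definition homog_coords N (L : proj_space N) : 'rV[R[i]]_N.+1 := vpick (val L).

Definition aff_dom N (i : 'I_N.+1) : set (proj_space N) :=
  [set L | homog_coords L 0 i != 0].
Definition aff_fun N (i : 'I_N.+1) (L : proj_space N) : 'rV[R[i]]_N :=
  \row_j (homog_coords L 0 (lift i j) / homog_coords L 0 i).

Variable X : complex_manifold R.

Definition holo_to_proj N (f : X -> proj_space N) : Prop :=
  forall i, open (f @^-1` aff_dom i) /\
    forall c x, atlas c -> chart_dom c x -> aff_dom i (f x) ->
      differentiable (aff_fun i \o f \o chart_inv c) (chart_fun c x).

Definition immersion_to_proj N (f : X -> proj_space N) : Prop :=
  forall i c x, atlas c -> chart_dom c x -> aff_dom i (f x) ->
    injective ('d (aff_fun i \o f \o chart_inv c) (chart_fun c x)).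

(* An injective holomorphic immersion of a compact manifold is an embedding
   onto a closed submanifold. *)
Definition projective_manifold : Prop :=
  compact [set: X] /\
  exists (N : nat) (f : X -> proj_space N),
    [/\ injective f, holo_to_proj f & immersion_to_proj f].

End Projective.

Section Subsheaves.
Variables (R : realType) (X : complex_manifold R) (E : hol_bundle X).

Definition is_generator (F : set X -> set (presection E)) (U : set X)
    (s : presection E) : Prop :=
  [/\ open U, F U s &
    forall V, open V -> V `<=` U ->
      (forall t, F V t -> exists2 f : X -> R[i],
         holo_on V f & eq_section V t (scale_section f s)) /\
      (forall f, holo_on V f -> eq_section V (scale_section f s) (zero_section E) ->
         forall x, V x -> f x = 0)].

(* Locally free rank one O_X-submodules of O(E). *)
Record invertible_subsheaf := InvertibleSubsheaf {
  sh :> set X -> set (presection E);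
  sh_section : forall U s, open U -> sh U s -> is_section U s;
  sh_ext : forall U s t, open U -> is_section U t -> eq_section U s t ->
    sh U s -> sh U t;
  sh_restrict : forall U V s, open U -> open V -> V `<=` U -> sh U s -> sh V s;
  sh_glue : forall U s, open U -> is_section U s ->
    (forall x, U x -> exists V, [/\ open V, V x, V `<=` U & sh V s]) -> sh U s;
  sh_zero : forall U, open U -> sh U (zero_section E);
  sh_add : forall U s t, open U -> sh U s -> sh U t -> sh U (add_section s t);
  sh_scale : forall U f s, open U -> holo_on U f -> sh U s ->
    sh U (scale_section f s);
  sh_locally_free : forall x, exists U s, U x /\ is_generator sh U s }.

(* A singular Hermitian metric on the line bundle F: each local generator s
   over U (i.e. local holomorphic frame) has a weight phi U s, locally
   integrable in coordinates, with |s|^2 = exp (- phi U s); f s then has weight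
   phi U s - ln |f|^2. *)
Definition singular_metric (F : invertible_subsheaf)
    (phi : set X -> presection E -> X -> \bar R) : Prop :=
  (forall U V W s t (f : X -> R[i]),
     is_generator F U s -> is_generator F V t ->
     open W -> W `<=` U `&` V -> holo_on W f ->
     eq_section W t (scale_section f s) ->
     forall x, W x ->
       phi V t x = (phi U s x - (ln (complex.Re `|f x| ^+ 2))%:E)%E) /\
  (forall U s c, is_generator F U s -> atlas c ->
     locally_integrable (chart_fun c @` (U `&` chart_dom c))
       (phi U s \o chart_inv c)).

(* the curvature of exp (- phi) is i ddbar phi *)
Definition pseudo_effective (F : invertible_subsheaf) : Prop :=
  exists2 phi, singular_metric F phi &
    forall U s c, is_generator F U s -> atlas c ->
      ddbar_nonneg (chart_fun c @` (U `&` chart_dom c))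
        (phi U s \o chart_inv c).

End Subsheaves.

(* Main.v *)
From HB Require Import structures.
Require Import Defs.
From mathcomp Require Import all_boot all_order all_algebra.
From mathcomp Require Import all_classical all_reals all_analysis.
From mathcomp Require Import measurable_realfun complex mxtens ring lra.

Set Implicit Arguments.
Unset Strict Implicit.
Unset Printing Implicit Defensive.

Import Order.TTheory GRing.Theory Num.Theory.
Import numFieldNormedType.Exports.

Local Open Scope classical_set_scope.
Local Open Scope ring_scope.

(* RC-positivity of h at (x, u) yields a holomorphic disc z(t) through x with a
   quadratic lift u(t) of u along whose boundary |u(t)|_h^2 <= q |u|_h^2, with
   q < 1 uniform by compactness.
   Vanishing: a section of Sym^l E^* (x) A^k is a family of forms of degree l in
   u, and |P_x(u)|^2 / |u|_h^(2l) is bounded. By the maximum principle on the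
   discs a bound M improves to K^(2k) q^l M, where K bounds the changes of frame
   of A, and K^(2k) q^l <= 1/2 once l >= c_A (k+1).
   Non-pseudo-effectivity: if s generates F in O(E^* ) with psh weight phi, then
   |s_x(u)|^2 exp(phi(x)) is log-psh in (x, u) and independent of s. The maximum
   principle on the same discs improves |s(u)|^2 exp(phi) <= M |u|_h^2 to the
   same bound with q M, so that phi = -oo almost everywhere near a point with
   s <> 0, which contradicts integrability. As phi is a current only, bounds on
   it are essential bounds, and the maximum principle is obtained by
   regularization with radial kernels. *)

(** * Norms on C and C^n *)

(** The disc comes from the expansion $|u(t)|_h^2 = |u|_h^2 - R(v,\bar v,u,\bar u)|t|^2 + o(|t|^2)$
    for $u(t) = u + tb + t^2 d$: the choice of $b$ makes the lift covariantly constant to first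
    order, which turns the coefficient of $t\bar t$ into minus the curvature, and $d$ removes the
    pure $t^2$ and $\bar t^2$ terms. Since $v$ depends on $u$, positivity is available on single
    discs only. A disc gains just one factor $q$, so each bound is stated on finitely many compact
    patches that contain all the discs: the improved bound has the same form, and the step can be
    repeated. Squares replace round discs because Cauchy's theorem is used for Riemann sums, which
    bisect exactly. For pseudo-effectivity the obstacle is that a disc is a null set, so an
    integrable weight has no restriction to it. Its averages against kernels centred at $x$ do: they
    have second order jets in $x$ with nonnegative Levi form. The maximum principle is applied to
    the averages on all translates of a disc, and the conclusion returns to the weight almost
    everywhere. *)

Section ComplexNorm.
Variable R : realType.
Implicit Types (z w : R[i]) (r : R).

(** The norm of [R[i]] takes its values in [R[i]], which is only partially ordered; this real copy,
    and [vn] below for vectors, keep the estimates in [R]. *)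
Definition nrm z : R := Normc.normc z.

Lemma nrmE z : `|z| = (nrm z)%:C%C. Proof. by []. Qed.

Lemma nrm_ge0 z : 0 <= nrm z.
Proof. by case: z => a b; exact: sqrtr_ge0. Qed.

Lemma nrm_sqr z : nrm z ^+ 2 = complex.Re z ^+ 2 + complex.Im z ^+ 2.
Proof. by case: z => a b /=; rewrite sqr_sqrtr // addr_ge0 ?sqr_ge0. Qed.

Lemma nrm0 : nrm 0 = 0. Proof. exact: Normc.normc0. Qed.
Lemma nrm1 : nrm 1 = 1. Proof. exact: Normc.normc1. Qed.
Lemma nrmM z w : nrm (z * w) = nrm z * nrm w. Proof. exact: Normc.normcM. Qed.
Lemma nrmD z w : nrm (z + w) <= nrm z + nrm w. Proof. exact: le_normcD. Qed.
Lemma nrmN z : nrm (- z) = nrm z. Proof. exact: normcN. Qed.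
Lemma nrmB z w : nrm (z - w) = nrm (w - z). Proof. by rewrite -nrmN opprB. Qed.
Lemma nrmV z : nrm z^-1 = (nrm z)^-1. Proof. exact: Normc.normcV. Qed.
Lemma nrmX z n : nrm (z ^+ n) = nrm z ^+ n.
Proof. by elim: n => [|n IH]; rewrite ?expr0 ?nrm1 // !exprS nrmM IH. Qed.
Lemma nrm_eq0 z : (nrm z == 0) = (z == 0).
Proof. by apply/eqP/eqP => [/Normc.eq0_normc //|->]; exact: nrm0. Qed.
Lemma nrm_gt0 z : (0 < nrm z) = (z != 0).
Proof. by rewrite lt_def nrm_ge0 nrm_eq0 andbT. Qed.
Lemma nrm_real r : nrm r%:C%C = `|r|.
Proof. by rewrite /nrm /= expr0n /= addr0 sqrtr_sqr. Qed.
Lemma nrm_i : nrm 'i%C = 1.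
Proof. by rewrite /nrm /= expr0n /= expr1n add0r sqrtr1. Qed.
Lemma nrmJ z : nrm z^* = nrm z.
Proof. by case: z => a b; rewrite /nrm /= sqrrN. Qed.
Lemma Re_le_nrm z : `|complex.Re z| <= nrm z.
Proof. by rewrite -(ler_pXn2r (n := 2)) ?nnegrE ?nrm_ge0 // nrm_sqr real_normK ?num_real // lerDl sqr_ge0. Qed.
Lemma Im_le_nrm z : `|complex.Im z| <= nrm z.
Proof. by rewrite -(ler_pXn2r (n := 2)) ?nnegrE ?nrm_ge0 // nrm_sqr real_normK ?num_real // lerDr sqr_ge0. Qed.
Lemma nrm_le_ReIm z : nrm z <= `|complex.Re z| + `|complex.Im z|.
Proof.
rewrite [z in nrm z]complexE; apply: (le_trans (nrmD _ _)).
by rewrite nrmM nrm_i mul1r !nrm_real.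
Qed.
Lemma nrm_sum (I : Type) (s : seq I) (P : pred I) (F : I -> R[i]) :
  nrm (\sum_(i <- s | P i) F i) <= \sum_(i <- s | P i) nrm (F i).
Proof.
elim/big_rec2: _ => [|i x y _ h]; first by rewrite nrm0.
exact: (le_trans (nrmD _ _) (lerD (lexx _) h)).
Qed.

Lemma nbhs_CP z (P : set R[i]) :
  nbhs z P <-> exists2 e : R, 0 < e & forall w, nrm (w - z) < e -> P w.
Proof.
split.
  move/nbhs_ballP => [e /= e0 h].
  (* A positive element of [R[i]] is real, so a radius there is a real radius. *)
  have er : e = (complex.Re e)%:C%C.
    by move: e0; rewrite ltcE /= => /andP[/eqP i0 _]; rewrite [LHS]complexE i0 mulr0 addr0.
  exists (complex.Re e); first by move: e0; rewrite ltcE => /andP[].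
  move=> w hw; apply: h; rewrite /ball /= er; rewrite distrC nrmE ltcR //.
move=> [e e0 h]; apply/nbhs_ballP; exists e%:C%C => /=; first by rewrite ltcR.
by move=> w; rewrite /ball /= distrC nrmE ltcR => /h.
Qed.

Variable n : nat.
Implicit Types (x y : 'rV[R[i]]_n).

Definition vn x : R := complex.Re `|x|.

Lemma vnE x : `|x| = (vn x)%:C%C.
Proof.
have := normr_ge0 x.
by rewrite /vn lecE => /andP[/eqP /= i0 _]; rewrite [LHS]complexE i0 mulr0 addr0.
Qed.
Lemma vn_ge0 x : 0 <= vn x. Proof. by rewrite -lecR -vnE; have := normr_ge0 x. Qed.
Lemma vnD x y : vn (x + y) <= vn x + vn y.
Proof. by rewrite -lecR rmorphD /= -!vnE ler_normD. Qed.
Lemma vnB x y : vn (x - y) = vn (y - x). Proof. by rewrite /vn distrC. Qed.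
Lemma vn0 : vn 0 = 0. Proof. by rewrite /vn normr0. Qed.
Lemma vnZ z x : vn (z *: x) = nrm z * vn x.
Proof. by apply: complexI; rewrite rmorphM /= -!vnE -nrmE normrZ. Qed.
Lemma vn_eq0 x : (vn x == 0) = (x == 0).
Proof. by rewrite -[RHS]normr_eq0 vnE eq_complex /= eqxx andbT. Qed.
Lemma vn_gt0 x : (0 < vn x) = (x != 0).
Proof. by rewrite lt_def vn_ge0 vn_eq0 andbT. Qed.
(** The norm of a row is the maximum over its coordinates; the strict form with [0 < r] covers the
    empty row too. *)
Lemma vn_ltP x r : 0 < r -> (vn x < r <-> forall j, nrm (x 0 j) < r).
Proof.
move=> r0; rewrite -ltcR -vnE -[x in `|x|]subr0 distrC.
change (ball_ (fun x : 'rV[R[i]]_n => `|x|) 0 r%:C%C x <-> forall j, nrm (x 0 j) < r).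
rewrite -mx_norm_ball; split => [[_ h] j|h].
  by have := h 0 j; rewrite /ball /= mxE sub0r normrN nrmE ltcR.
split => [|i j]; first by rewrite ltcR.
by rewrite /ball /= ord1 mxE sub0r normrN nrmE ltcR; exact: h.
Qed.
Lemma vn_coord x j : nrm (x 0 j) <= vn x.
Proof.
apply/ler_addgt0Pr => e e0; apply/ltW; move: j; apply/vn_ltP; last by rewrite ltrDl.
by rewrite ltr_wpDl // vn_ge0.
Qed.
Lemma vn_lt x r : 0 < r -> (forall j, nrm (x 0 j) < r) -> vn x < r.
Proof. by move=> r0 h; apply/vn_ltP. Qed.

Lemma nbhs_VP x (P : set 'rV[R[i]]_n) :
  nbhs x P <-> exists2 e : R, 0 < e & forall y, vn (y - x) < e -> P y.
Proof.
split.
  move/nbhs_ballP => [e /= e0 h].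
  have er : e = (complex.Re e)%:C%C.
    by move: e0; rewrite ltcE /= => /andP[/eqP i0 _]; rewrite [LHS]complexE i0 mulr0 addr0.
  exists (complex.Re e); first by move: e0; rewrite ltcE => /andP[].
  by move=> y hy; apply: h; rewrite -ball_normE /ball_ /= er distrC vnE ltcR.
move=> [e e0 h]; apply/nbhs_ballP; exists e%:C%C => /=; first by rewrite ltcR.
by move=> y; rewrite -ball_normE /ball_ /= distrC vnE ltcR => /h.
Qed.

Lemma cvg_CP (T : topologicalType) (f : T -> R[i]) (x : T) : {for x, continuous f} <->
  forall e : R, 0 < e -> \forall y \near x, nrm (f y - f x) < e.
Proof.
split => [cf e e0|h P].
  have := cf [set w | nrm (w - f x) < e]; apply.
  by apply/nbhs_CP; exists e.
by case/nbhs_CP => e e0 eP; apply: filterS (h e e0) => y; exact: eP.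
Qed.
End ComplexNorm.

(** * Estimates from complex differentiability *)

Section Diff.
Variables (R : realType) (n : nat).

Lemma diff_eps (V W : normedModType R[i]) (f : V -> W) x : differentiable f x ->
  forall e : R, 0 < e -> \forall y \near x,
   `|f y - f x - 'd f x (y - x)| <= e%:C%C * `|y - x|.
Proof.
move=> df e e0; have ec : (0 : R[i]) < e%:C%C by rewrite ltcR.
have [_ /eqaddoP /(_ _ ec) h] := (diff_locallyP _ _).1 df.
have : (fun y => y - x) @ x --> (0 : V).
  have := @cvgB _ _ _ (nbhs x) _ id (cst x) x x (@cvg_id _ _) (@cvg_cst _ x _ _ _).
  by rewrite subrr => h'; exact: h'.
move=> /(_ _ h) H; apply: (@filterS _ (nbhs x) _ _ _ _ H) => y /=.
rewrite [X in `|X| <= _ -> _](_ : _ = f y - f x - 'd f x (y - x)) //.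
by rewrite !fctE /= subrK opprD addrA.
Qed.

(** A C-linear map on C is multiplication by its value at 1. *)
Lemma diff_C (g : R[i] -> R[i]) z : differentiable g z -> exists a, forall e : R, 0 < e ->
  exists2 d : R, 0 < d & forall w, nrm (w - z) < d ->
    nrm (g w - g z - a * (w - z)) <= e * nrm (w - z).
Proof.
move=> dg; exists ('d g z 1) => e e0.
have /nbhs_CP [d d0 h] := diff_eps dg e0.
exists d => // w /h; rewrite !nrmE -rmorphM lecR.
have -> : 'd g z (w - z) = 'd g z 1 * (w - z) by rewrite -[in LHS](mulr1 (w - z)) linearZ /= mulrC.
by [].
Qed.

(** The differential is continuous at 0, hence bounded, and the remainder adds 1 to the constant.
    This pointwise Lipschitz bound is what lets a change of charts preserve null sets. *)
Lemma diff_lipschitz (m : nat) (f : 'rV[R[i]]_n -> 'rV[R[i]]_m) x : differentiable f x ->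
  exists L, exists2 d : R, 0 < d & 0 < L /\ forall y, vn (y - x) < d ->
    vn (f y - f x) <= L * vn (y - x).
Proof.
move=> df; have /nbhs_VP[d d0 h] := diff_eps df ltr01.
have dc : continuous ('d f x) by exact: diff_continuous.
have /nbhs_VP[d' d'0 h'] : nbhs (0 : 'rV[R[i]]_n) [set y | vn ('d f x y) < 1].
  apply: (dc 0 [set y | vn y < 1]); rewrite linear0; apply/nbhs_VP; exists 1 => // y.
  by rewrite subr0.
have B v : vn ('d f x v) <= (2 / d') * vn v.
  have [->|v0] := eqVneq v 0; first by rewrite linear0 !vn0 mulr0.
  have v0' : 0 < vn v by rewrite vn_gt0.
  (* Scaling [v] to norm [d' / 2] puts it where the differential has norm below 1. *)
  pose t := d' / (2 * vn v).
  have t0 : 0 < t by rewrite divr_gt0 // mulr_gt0.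
  have /h' /= : vn (t%:C%C *: v - 0) < d'.
    rewrite subr0 vnZ nrm_real gtr0_norm // /t invfM mulrA mulrVK ?unitfE ?gt_eqF //.
    by rewrite gtr_pMr // invf_lt1 // ltr1n.
  rewrite linearZ /= vnZ nrm_real gtr0_norm // -ltr_pdivlMl // => /ltW /le_trans; apply.
  by rewrite mulr1 /t invf_div mulrAC.
exists (1 + 2 / d'), d => //; split; first by rewrite addr_gt0 // divr_gt0.
move=> y yd; have := h _ yd; rewrite !vnE -rmorphM lecR mul1r => hy.
rewrite mulrDl mul1r -[f y - f x](subrK ('d f x (y - x))).
by apply: (le_trans (vnD _ _)); exact: lerD.
Qed.
End Diff.

Arguments nrm {R} z : simpl never.

(** * The maximum modulus principle on squares *)

Lemma double_frac (F : numFieldType) (d x : F) (N : nat) : (0 < N)%N ->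
  x / (N + N)%:R * (d + d) = x / N%:R * d.
Proof.
move=> N0; have N0' : (N%:R : F) != 0 by rewrite pnatr_eq0 -lt0n.
by rewrite natrD -(mulr2n N%:R) -(mulr_natl N%:R) -(mulr2n d) -(mulr_natl d); field; rewrite N0'.
Qed.

Lemma double_frac2 (F : numFieldType) (d : F) (N : nat) : (0 < N)%N ->
  (d + d) / (N + N)%:R = d / N%:R.
Proof. by move=> /(double_frac d 1); rewrite !mul1r mulrC => ->; rewrite mulrC. Qed.

Lemma double_frac3 (F : numFieldType) (d x : F) (N : nat) : (0 < N)%N ->
  (N%:R + x) / (N + N)%:R * (d + d) = d + x / N%:R * d.
Proof.
move=> N0; rewrite double_frac // !mulrDl divff ?mul1r //.
by rewrite pnatr_eq0 -lt0n.
Qed.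

Section Goursat.
Variable R : realType.
Local Notation C := R[i].
Implicit Types (g : C -> C) (p d : C) (N : nat) (t : R).

(** The left Riemann sum, with [N] nodes, of the integral of [g dz] over the segment from [p] to
    [p + d]. *)
Definition edge N g p d : C := \sum_(j < N) g (p + j%:R / N%:R * d) * (d / N%:R).

(** The Riemann sum around the square with vertex [p] and side [d], counterclockwise; top and left
    sides are summed in the opposite direction and subtracted. *)
Definition contour N g p d : C :=
  edge N g p d - edge N g (p + 'i%C * d) d
  + edge N g (p + d) ('i%C * d) - edge N g p ('i%C * d).

Lemma edge_split N g p d : (0 < N)%N ->
  edge (N + N) g p (d + d) = edge N g p d + edge N g (p + d) d.
Proof.
move=> N0; rewrite /edge big_split_ord /=; congr (_ + _); apply: eq_bigr => j _.
  by rewrite double_frac // double_frac2.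
by rewrite natrD double_frac3 // double_frac2 // addrA.
Qed.

Lemma contour_split N g p d : (0 < N)%N ->
  contour (N + N) g p (d + d) = contour N g p d + contour N g (p + d) d
    + contour N g (p + 'i%C * d) d + contour N g (p + d + 'i%C * d) d.
Proof.
move=> N0; rewrite /contour mulrDr !edge_split // !addrA.
rewrite [RHS](_ : _ = edge N g p d + edge N g (p + d) d
  - (edge N g (p + 'i%C * d + 'i%C * d) d + edge N g (p + d + 'i%C * d + 'i%C * d) d)
  + (edge N g (p + d + d) ('i%C * d) + edge N g (p + d + 'i%C * d + d) ('i%C * d))
  - (edge N g p ('i%C * d) + edge N g (p + 'i%C * d) ('i%C * d))); last first.
  rewrite (addrAC p ('i%C * d) d).
  set e1 := edge _ _ _ _; set e2 := edge _ _ _ _; set e3 := edge _ _ _ _.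
  set e4 := edge _ _ _ _; set e5 := edge _ _ _ _; set e6 := edge _ _ _ _.
  set e7 := edge _ _ _ _; set e8 := edge _ _ _ _; set e9 := edge _ _ _ _.
  set e10 := edge _ _ _ _; set e11 := edge _ _ _ _; set e12 := edge _ _ _ _.
  clearbody e1 e2 e3 e4 e5 e6 e7 e8 e9 e10 e11 e12; ring.
by rewrite !addrA (addrAC (p + 'i%C * d) ('i%C * d) d) (addrAC p ('i%C * d) d) (addrAC (p + d) ('i%C * d) d).
Qed.

Lemma edge_bound N g p d (B : R) : (0 < N)%N ->
  (forall j : 'I_N, nrm (g (p + j%:R / N%:R * d)) <= B) -> nrm (edge N g p d) <= B * nrm d.
Proof.
move=> N0 h; apply: (le_trans (nrm_sum _ _ _)).
apply: (@le_trans _ _ (\sum_(j < N) B * (nrm d / N%:R))).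
  apply: ler_sum => j _; rewrite nrmM; apply: ler_pM => //; rewrite ?nrm_ge0 //.
  by rewrite nrmM nrmV -(rmorph_nat (real_complex R)) nrm_real ger0_norm // ler0n.
rewrite sumr_const card_ord -(mulr_natr (B * _)) -mulrA divfK //.
by rewrite pnatr_eq0 -lt0n.
Qed.

Lemma edge_lin N g1 g2 p d : edge N (fun z => g1 z - g2 z) p d = edge N g1 p d - edge N g2 p d.
Proof. by rewrite /edge -sumrB; apply: eq_bigr => j _; rewrite mulrBl. Qed.

Lemma contour_lin N g1 g2 p d :
  contour N (fun z => g1 z - g2 z) p d = contour N g1 p d - contour N g2 p d.
Proof. rewrite /contour !edge_lin; ring. Qed.

(** The discretization error of an edge sum does not depend on the starting point when the function
    is affine, so it cancels between opposite sides and the contour sum vanishes for every [N]. *)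
Lemma contour_affine N a b p d : (0 < N)%N -> contour N (fun z => a + b * z) p d = 0.
Proof.
move=> N0; have NC : (N%:R : C) != 0 by rewrite pnatr_eq0 -lt0n.
have E q e : edge N (fun z => a + b * z) q e =
    (a + b * q) * e + b * e ^+ 2 * (\sum_(j < N) j%:R / N%:R / N%:R).
  rewrite /edge (eq_bigr (fun j : 'I_N => (a + b * q) * e / N%:R + b * e ^+ 2 * (j%:R / N%:R / N%:R))).
    by rewrite big_split /= -!mulr_sumr sumr_const card_ord -(mulr_natr N%:R^-1) mulVf // mulr1.
  by move=> j _; field.
have i2 : 'i%C ^+ 2 = -1 :> C := sqr_i R.
rewrite /contour !E !exprMn i2; ring: i2.
Qed.

Definition square p t : set C := [set z | (complex.Re p <= complex.Re z <= complex.Re p + t) /\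
  (complex.Im p <= complex.Im z <= complex.Im p + t)].

Definition square_bd p t : set C := [set z | square p t z /\
  [\/ complex.Re z = complex.Re p, complex.Re z = complex.Re p + t,
      complex.Im z = complex.Im p | complex.Im z = complex.Im p + t]].

Lemma contour_bound N g p t (B : R) : (0 < N)%N -> 0 <= t ->
  (forall z, square_bd p t z -> nrm (g z) <= B) -> nrm (contour N g p t%:C%C) <= 4 * B * t.
Proof.
move=> N0 t0 h.
have fr (j : 'I_N) : 0 <= (j%:R / N%:R : R) <= 1.
  rewrite divr_ge0 //= ler_pdivrMr ?ltr0n // mul1r ler_nat; exact/ltnW.
have jN (j : 'I_N) : (j%:R / N%:R : C) = (j%:R / N%:R : R)%:C%C.
  by rewrite rmorphM fmorphV !rmorph_nat.
have K (j : 'I_N) : 0 <= (j%:R / N%:R : R) * t <= t.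
  by case/andP: (fr j) => a b; rewrite mulr_ge0 //= ler_piMl.
have nt : nrm t%:C%C = t by rewrite nrm_real ger0_norm.
have E1 : nrm (edge N g p t%:C%C) <= B * t.
  rewrite -{2}nt; apply: edge_bound => // j; apply: h; rewrite jN; move: {+}p => [a b].
  have /andP[k1 k2] := K j; split; [split => /=; apply/andP; split; lra|apply: Or43 => /=; lra].
have E2 : nrm (edge N g (p + 'i%C * t%:C%C) t%:C%C) <= B * t.
  rewrite -{3}nt; apply: edge_bound => // j; apply: h; rewrite jN; move: {+}p => [a b].
  have /andP[k1 k2] := K j; split; [split => /=; apply/andP; split; lra|apply: Or44 => /=; lra].
have E3 : nrm (edge N g (p + t%:C%C) ('i%C * t%:C%C)) <= B * t.
  have -> : B * t = B * nrm ('i%C * t%:C%C) by rewrite nrmM nrm_i mul1r nt.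
  apply: edge_bound => // j; apply: h; rewrite jN; move: {+}p => [a b].
  have /andP[k1 k2] := K j; split; [split => /=; apply/andP; split; lra|apply: Or42 => /=; lra].
have E4 : nrm (edge N g p ('i%C * t%:C%C)) <= B * t.
  have -> : B * t = B * nrm ('i%C * t%:C%C) by rewrite nrmM nrm_i mul1r nt.
  apply: edge_bound => // j; apply: h; rewrite jN; move: {+}p => [a b].
  have /andP[k1 k2] := K j; split; [split => /=; apply/andP; split; lra|apply: Or41 => /=; lra].
rewrite /contour.
have := nrmD (edge N g p t%:C%C - edge N g (p + 'i%C * t%:C%C) t%:C%C + edge N g (p + t%:C%C) ('i%C * t%:C%C)) (- edge N g p ('i%C * t%:C%C)).
have := nrmD (edge N g p t%:C%C - edge N g (p + 'i%C * t%:C%C) t%:C%C) (edge N g (p + t%:C%C) ('i%C * t%:C%C)).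
have := nrmD (edge N g p t%:C%C) (- edge N g (p + 'i%C * t%:C%C) t%:C%C).
rewrite !nrmN; lra.
Qed.

Lemma nested_intervals (a s : nat -> R) : (forall k, 0 <= s k) ->
  (forall k, a k <= a k.+1) -> (forall k, a k.+1 + s k.+1 <= a k + s k) ->
  exists x, forall k, a k <= x <= a k + s k.
Proof.
move=> s0 ha hb.
have incr k m : (k <= m)%N -> a k <= a m.
  by elim: m => [|m IH]; rewrite leq_eqVlt => /orP[/eqP->//|]//; rewrite ltnS => /IH /le_trans; apply.
have decr k m : (k <= m)%N -> a m + s m <= a k + s k.
  by elim: m => [|m IH]; rewrite leq_eqVlt => /orP[/eqP->//|]//; rewrite ltnS => /IH; exact: le_trans.
have ub k : ubound (range a) (a k + s k).
  move=> _ [m _ <-]; have [km|mk] := leqP k m.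
    by apply: le_trans (decr _ _ km); rewrite lerDl.
  by apply: (le_trans (incr _ _ (ltnW mk))); rewrite lerDl.
exists (sup (range a)) => k; apply/andP; split.
  by apply: ub_le_sup; [exists (a k + s k); exact: ub|exists k].
by apply: ge_sup; [exists (a k), k|exact: ub].
Qed.

Lemma square_dist p t z w : square p t z -> square p t w -> nrm (w - z) <= 2 * t.
Proof.
case: z w p => [a b] [c d] [e f] [/= h1 h2] [/= h3 h4].
apply: (le_trans (nrm_le_ReIm _)) => /=; rewrite mulrDl mul1r; apply: lerD; rewrite ler_norml; lra.
Qed.

Lemma double_half (t : R) : t%:C%C = (t / 2)%:C%C + (t / 2)%:C%C.
Proof. by rewrite -rmorphD /=; congr (_%:C)%C; lra. Qed.

Lemma expn2_double n : (2 ^ n.+1 = 2 ^ n + 2 ^ n)%N.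
Proof. by rewrite expnS mul2n addnn. Qed.

Lemma contour_halve n g p t :
  contour (2 ^ n.+1) g p t%:C%C = \sum_(a : bool) \sum_(b : bool)
    contour (2 ^ n) g (p + (a%:R * (t / 2)) +i* (b%:R * (t / 2)))%C (t / 2)%:C%C.
Proof.
rewrite double_half expn2_double contour_split ?expn_gt0 //.
rewrite !big_bool /= !mul1r !mul0r.
set h := t / 2.
have -> : p + (h +i* h)%C = p + h%:C%C + 'i%C * h%:C%C.
  by rewrite [X in p + X = _]complexE addrA.
have -> : p + (h +i* 0)%C = p + h%:C%C by [].
have -> : p + (0 +i* h)%C = p + 'i%C * h%:C%C.
  by rewrite [X in p + X = _]complexE add0r.
have -> : p + (0 +i* 0)%C = p by exact: addr0.
set e1 := contour _ _ _ _; set e2 := contour _ _ _ _; set e3 := contour _ _ _ _.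
set e4 := contour _ _ _ _; clearbody e1 e2 e3 e4; ring.
Qed.

(** Goursat's argument on sums with $2^n$ nodes per side. If the bound fails for a square, it fails
    for one of its quarters; the bad squares shrink to a point, where [g] is too close to its
    tangent affine map, whose contour sums vanish. *)
Lemma goursat g p t : 0 < t -> (forall z, square p t z -> differentiable g z) ->
  forall e, 0 < e -> exists n0, forall n, (n0 <= n)%N ->
    nrm (contour (2 ^ n) g p t%:C%C) <= e * t ^+ 2.
Proof.
move=> t0 dg e e0.
pose good q s := exists n0, forall n, (n0 <= n)%N -> nrm (contour (2 ^ n) g q s%:C%C) <= e * s ^+ 2.
apply: contrapT; rewrite -/(good p t) => bad0.
have step q s : 0 < s -> ~ good q s -> exists q', [/\ ~ good q' (s / 2),
    complex.Re q <= complex.Re q' <= complex.Re q + s / 2 &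
    complex.Im q <= complex.Im q' <= complex.Im q + s / 2].
  move=> s0 bq; apply: contrapT => noq; apply: bq.
  have h (ab : bool * bool) : good (q + (ab.1%:R * (s / 2)) +i* (ab.2%:R * (s / 2)))%C (s / 2).
    apply: contrapT => nq; apply: noq; exists (q + (ab.1%:R * (s / 2)) +i* (ab.2%:R * (s / 2)))%C.
    by case: ab nq => [[] []] nq; split => //; case: (q) => x y /=; apply/andP; split; lra.
  pose N ab := sval (cid (h ab)).
  have hN ab n : (N ab <= n)%N -> nrm (contour (2 ^ n) g (q + (ab.1%:R * (s / 2)) +i* (ab.2%:R * (s / 2)))%C (s / 2)%:C%C) <= e * (s / 2) ^+ 2.
    exact: (svalP (cid (h ab))).
  (* The sum with $2^{n+1}$ nodes splits into sums with $2^n$ nodes over the quarters, hence the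
     successor. *)
  exists (\max_ab N ab).+1 => -[//|n]; rewrite ltnS => hn.
  rewrite contour_halve pair_bigA /=; apply: (le_trans (nrm_sum _ _ _)).
  apply: (@le_trans _ _ (\sum_(ab : bool * bool) e * (s / 2) ^+ 2)).
    by apply: ler_sum => ab _; apply: hN; exact: leq_trans (leq_bigmax ab) hn.
  by rewrite sumr_const card_prod card_bool -mulr_natr; lra.
pose s k := t / 2 ^+ k.
have s0 k : 0 < s k by rewrite divr_gt0 // exprn_gt0.
have sS k : s k.+1 = s k / 2 by rewrite /s exprSr invfM mulrA.
pose rel k q q' := [/\ ~ good q' (s k / 2),
    complex.Re q <= complex.Re q' <= complex.Re q + s k / 2 &
    complex.Im q <= complex.Im q' <= complex.Im q + s k / 2].
pose q := fix q k := if k is k'.+1 then xget 0 (rel k' (q k')) else p.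
have bq k : ~ good (q k) (s k).
  elim: k => [|k IH]; first by rewrite /s expr0 divr1.
  by rewrite sS; have [h _ _] := xgetPex 0 (step _ _ (s0 k) IH); exact: h.
have rq k : rel k (q k) (q k.+1).
  exact: (xgetPex 0 (step _ _ (s0 k) (bq k))).
have [x hx] : exists x, forall k, complex.Re (q k) <= x <= complex.Re (q k) + s k.
  apply: nested_intervals => k; first exact: ltW.
  - by case: (rq k) => _ /andP[].
  - by case: (rq k) => _ /andP[_ h] _; rewrite sS; lra.
have [y hy] : exists y, forall k, complex.Im (q k) <= y <= complex.Im (q k) + s k.
  apply: nested_intervals => k; first exact: ltW.
  - by case: (rq k) => _ _ /andP[].
  - by case: (rq k) => _ _ /andP[_ h]; rewrite sS; lra.
pose z := (x +i* y)%C.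
have zk k : square (q k) (s k) z by split => /=.
have sp : square p t z by have := zk 0%N; rewrite /s expr0 divr1.
have [a /(_ (e / 16))] := diff_C (dg _ sp).
case; first by rewrite divr_gt0.
move=> d d0 hd.
have [k sk] : exists k, 2 * s k < d.
  have [k kd] : exists k : nat, 2 * t / d < k%:R.
    by exists (Num.bound (2 * t / d)); apply: archi_boundP; rewrite divr_ge0 ?mulr_ge0 // ltW.
  exists k; rewrite /s mulrA ltr_pdivrMr ?exprn_gt0 // (mulrC d) -ltr_pdivrMr //.
  apply: (lt_le_trans kd); rewrite -natrX ler_nat; exact/ltnW/ltn_expl.
apply: (bq k); exists 0%N => n _.
have n2 : (0 < 2 ^ n)%N by rewrite expn_gt0.
(* On a square of side [s] containing [z], this remainder is at most [(e / 16) * (2 * s)], and the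
   four sides give [e * s ^+ 2 / 2]. *)
pose f w := g w - (g z - a * z + a * w).
have -> : contour (2 ^ n) g (q k) (s k)%:C%C = contour (2 ^ n) f (q k) (s k)%:C%C.
  by rewrite /f contour_lin contour_affine // subr0.
have B w : square (q k) (s k) w -> nrm (f w) <= e / 16 * (2 * s k).
  move=> sw; have wz := square_dist (zk k) sw.
  have := hd w (le_lt_trans wz sk); rewrite /f.
  have -> : g w - (g z - a * z + a * w) = g w - g z - a * (w - z) by ring.
  by move/le_trans; apply; rewrite ler_pM2l // divr_gt0.
apply: (le_trans (contour_bound n2 (ltW (s0 k)) (fun z sz => B z sz.1))).
by rewrite expr2; have := mulr_gt0 e0 (mulr_gt0 (s0 k) (s0 k)); lra.
Qed.

(** The lower left vertex of the square of side [t] that has 0 as a vertex; the booleans select the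
    quadrant. *)
Let corner (a b : bool) t : C := (- (a%:R * t) +i* - (b%:R * t))%C.

(** A bounded isolated singularity contributes nothing: of the four quarters, three avoid 0 and fall
    under [goursat], the fourth is again a square with vertex 0. After [k] bisections its side is
    [t / 2 ^+ k], and the trivial bound applies. *)
Lemma contour_corner F (a b : bool) (B d : R) : 0 < d -> 0 <= B ->
  (forall z, nrm z < d -> nrm (F z) <= B) ->
  forall k t, 0 < t -> 2 * t < d * 2 ^+ k ->
  (forall z, square (corner a b t) t z -> z != 0 -> differentiable F z) ->
  forall e, 0 < e -> exists n0, forall n, (n0 <= n)%N ->
    nrm (contour (2 ^ n) F (corner a b t) t%:C%C) <= e + 4 * B * (t / 2 ^+ k).
Proof.
move=> d0 B0 hB; elim=> [|k IH] t t0 td dF e e0.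
  exists 0%N => n _; rewrite expr0 divr1 -[leLHS]add0r; apply: lerD; first exact: ltW.
  apply: contour_bound; rewrite ?expn_gt0 ?ltW // => z [sz _]; apply: hB.
  rewrite expr0 mulr1 in td; apply: le_lt_trans td; rewrite -[z]subr0.
  apply: (square_dist (p := corner a b t)) => //.
  by split => /=; case: (a) (b) => [] [] /=; apply/andP; split; lra.
pose p (ab : bool * bool) := corner a b t + (ab.1%:R * (t / 2) +i* (ab.2%:R * (t / 2)))%C.
have pab : p (a, b) = corner a b (t / 2).
  by rewrite /p /corner; simpc; congr (_ +i* _)%C; lra.
have sub ab z : square (p ab) (t / 2) z -> square (corner a b t) t z.
  by case: z => x y; rewrite /p /corner /square /=; case: ab => [[] []] /= [/andP[? ?] /andP[? ?]]; split; apply/andP; split; lra.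
have t2 : 0 < t / 2 by rewrite divr_gt0.
have td2 : 2 * (t / 2) < d * 2 ^+ k by move: td; rewrite exprS; lra.
have dF2 z : square (corner a b (t / 2)) (t / 2) z -> z != 0 -> differentiable F z.
  by rewrite -pab => /sub; exact: dF.
have e2 : 0 < e / 2 by rewrite divr_gt0.
have [m hm] := IH _ t2 td2 dF2 _ e2.
have good ab : ab != (a, b) -> exists n0, forall n, (n0 <= n)%N ->
    nrm (contour (2 ^ n) F (p ab) (t / 2)%:C%C) <= e / 8.
  move=> ne.
  have dFp z : square (p ab) (t / 2) z -> differentiable F z.
    move=> sz; apply: dF; first exact: sub sz.
    apply: contraNneq ne => z0; move: sz; rewrite {}z0 /p /corner /square /=.
    by case: ab => [[] []]; case: (a) (b) => [] [] /= [/andP[? ?] /andP[? ?]]; rewrite ?eqxx //; exfalso; lra.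
  have e8 : 0 < e / 8 / (t / 2) ^+ 2 by rewrite !divr_gt0 // exprn_gt0 // divr_gt0.
  have [n0 h] := goursat t2 dFp e8.
  exists n0 => n /h; rewrite divfK // expf_neq0 // gt_eqF //.
have {}good ab : exists n0, forall n, (n0 <= n)%N -> ab != (a, b) ->
    nrm (contour (2 ^ n) F (p ab) (t / 2)%:C%C) <= e / 8.
  have [->|/good [n0 h]] := eqVneq ab (a, b); first by exists 0%N => n _; rewrite ?eqxx.
  by exists n0 => n nn _; exact: h.
pose N ab := sval (cid (good ab)).
exists (maxn m (\max_ab N ab)).+1 => -[//|n]; rewrite ltnS geq_max => /andP[mn Nn].
rewrite contour_halve pair_bigA /= (bigD1 (a, b)) //=.
apply: (le_trans (nrmD _ _)).
have -> : e + 4 * B * (t / 2 ^+ k.+1) = (e / 2 + 4 * B * (t / 2 / 2 ^+ k)) + e / 2.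
  by rewrite exprS invfM; lra.
apply: lerD; first by have := hm n mn; rewrite -pab.
apply: (le_trans (nrm_sum _ _ _)).
apply: (@le_trans _ _ (\sum_(ab : bool * bool | ab != (a, b)) e / 8)).
  apply: ler_sum => ab nab; apply: (svalP (cid (good ab))) => //.
  exact: leq_trans (leq_bigmax ab) Nn.
apply: (@le_trans _ _ (\sum_(ab : bool * bool) e / 8)).
  by rewrite [leRHS](bigD1 (a, b)) //= lerDr; apply: divr_ge0 => //; exact: ltW.
by rewrite sumr_const card_prod card_bool -mulr_natr; lra.
Qed.

Lemma Im_sum (I : Type) (s : seq I) (P : pred I) (G : I -> C) :
  complex.Im (\sum_(i <- s | P i) G i) = \sum_(i <- s | P i) complex.Im (G i).
Proof. by apply: (big_morph (@complex.Im R)) => // -[a b] [c d]. Qed.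

(* On the square of half-side r the four values of dz/z at the points of the
   four sides with the same parameter add up to 4ir/(y^2+r^2). *)
Lemma contour_inv_ge N r : (0 < N)%N -> 0 < r ->
  4 <= nrm (contour N GRing.inv (- r +i* - r)%C (2 * r)%:C%C).
Proof.
move=> N0 r0; apply: le_trans (Im_le_nrm _); apply: le_trans (ler_norm _).
rewrite /contour /edge -sumrB -big_split -sumrB Im_sum /=.
apply: (@le_trans _ _ (\sum_(j < N) (4 / N%:R))).
  by rewrite sumr_const card_ord -(mulr_natr (4 / _)) divfK // pnatr_eq0 -lt0n.
apply: ler_sum => j _.
have jN : (j%:R / N%:R : C) = (j%:R / N%:R : R)%:C%C by rewrite rmorphM fmorphV !rmorph_nat.
rewrite jN; set x : R := j%:R / N%:R.
have /andP[x0 x1] : 0 <= x <= 1.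
  rewrite divr_ge0 //= ler_pdivrMr ?ltr0n // mul1r ler_nat; exact/ltnW.
have -> : (2 * r)%:C%C / N%:R = (2 * r / N%:R)%:C%C :> C.
  by rewrite [RHS]rmorphM fmorphV rmorph_nat.
set y := 2 * r * x - r; set dl := 2 * r / N%:R.
have -> : 'i%C * (2 * r)%:C%C / N%:R = 'i%C * dl%:C%C :> C.
  by rewrite -mulrA; congr (_ * _); rewrite /dl [RHS]rmorphM fmorphV rmorph_nat.
have -> : (- r -i* r)%C + x%:C%C * (2 * r)%:C%C = (y +i* - r)%C.
  by apply/eqP; rewrite eq_complex /= /y; apply/andP; split; apply/eqP; ring.
have -> : (- r -i* r)%C + 'i%C * (2 * r)%:C%C + x%:C%C * (2 * r)%:C%C = (y +i* r)%C.
  by apply/eqP; rewrite eq_complex /= /y; apply/andP; split; apply/eqP; ring.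
have -> : (- r -i* r)%C + (2 * r)%:C%C + x%:C%C * ('i%C * (2 * r)%:C%C) = (r +i* y)%C.
  by apply/eqP; rewrite eq_complex /= /y; apply/andP; split; apply/eqP; ring.
have -> : (- r -i* r)%C + x%:C%C * ('i%C * (2 * r)%:C%C) = (- r +i* y)%C.
  by apply/eqP; rewrite eq_complex /= /y; apply/andP; split; apply/eqP; ring.
(* Hence $y^2 + r^2 \le 2r^2$, and the four terms together are at least [4 / N]. The total 4 is a
   crude substitute for $2\pi$. *)
have yr : y ^+ 2 <= r ^+ 2.
  have -> : r ^+ 2 = y ^+ 2 + (2 * r) ^+ 2 * (x * (1 - x)) by rewrite /y; ring.
  rewrite lerDl; apply: mulr_ge0; first exact: sqr_ge0.
  by apply: mulr_ge0 => //; rewrite subr_ge0.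
have s0 : 0 < y ^+ 2 + r ^+ 2 by rewrite ltr_wpDl ?sqr_ge0 // exprn_gt0.
have n0 : 0 < (N%:R : R) by rewrite ltr0n.
set s := y ^+ 2 + r ^+ 2.
have -> : complex.Im ((y -i* r)%C^-1 * dl%:C%C - (y +i* r)%C^-1 * dl%:C%C +
   (r +i* y)%C^-1 * ('i%C * dl%:C%C) - (- r +i* y)%C^-1 * ('i%C * dl%:C%C)) = 4 * r * dl / s.
  rewrite /= !sqrrN (addrC (r ^+ 2)) -/s; ring.
rewrite ler_pdivlMr // /dl.
have -> : 4 * r * (2 * r / N%:R) = 4 / N%:R * (2 * r ^+ 2) by ring.
by apply: ler_wpM2l; [rewrite divr_ge0 // ltW|rewrite /s; lra].
Qed.

Definition sq_boundary (r : R) : set C := [set z | `|complex.Re z| <= r /\ `|complex.Im z| <= r /\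
  (`|complex.Re z| = r \/ `|complex.Im z| = r)].

(** Cauchy's formula up to a constant: the quotient [(g z - g 0) / z] is bounded near 0, so its
    contour sums tend to 0. The sum for [g z / z] is at most [8 * B], the one for [1 / z] at least
    4, whence the factor 2. *)
Lemma max_modulus2 g (r B : R) : 0 < r -> 0 <= B ->
  (forall z, `|complex.Re z| <= r -> `|complex.Im z| <= r -> differentiable g z) ->
  (forall z, sq_boundary r z -> nrm (g z) <= B) -> nrm (g 0) <= 2 * B.
Proof.
move=> r0 B0 dg hB.
pose F z := (g z - g 0) * z^-1.
have dF z : `|complex.Re z| <= r -> `|complex.Im z| <= r -> z != 0 -> differentiable F z.
  move=> zr zi zn; apply: differentiableM.
    apply: differentiableB; [exact: dg|exact: differentiable_cst].
  exact: differentiable_Rinv.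
have [a /(_ 1 ltr01) [d d0 hd]] : exists a, forall e : R, 0 < e ->
   exists2 d : R, 0 < d & forall w, nrm (w - 0) < d ->
    nrm (g w - g 0 - a * (w - 0)) <= e * nrm (w - 0).
  by apply: diff_C; apply: dg; rewrite normr0 ltW.
pose M := nrm a + 1.
have M0 : 0 <= M by rewrite addr_ge0 ?nrm_ge0.
have FM z : nrm z < d -> nrm (F z) <= M.
  move=> zd; have [->|z0] := eqVneq z 0; first by rewrite /F subrr mul0r nrm0.
  rewrite /F nrmM nrmV ler_pdivrMr ?nrm_gt0 //.
  have := hd z; rewrite subr0 mul1r => /(_ zd) h.
  have -> : g z - g 0 = (g z - g 0 - a * z) + a * z by ring.
  by rewrite (le_trans (nrmD _ _)) // nrmM /M; lra.
pose p := (- r +i* - r)%C.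
have small e : 0 < e -> exists n0, forall n, (n0 <= n)%N ->
    nrm (contour (2 ^ n) F p (2 * r)%:C%C) <= e.
  move=> e0.
  have [k kr] : exists k, 2 * r < d * 2 ^+ k /\ 4 * M * (r / 2 ^+ k) <= e / 8.
    have [k kd] : exists k : nat, 2 * r / d + 4 * M * r / (e / 8) < k%:R.
      exists (Num.bound (2 * r / d + 4 * M * r / (e / 8))); apply: archi_boundP.
      by rewrite addr_ge0 // ?divr_ge0 ?mulr_ge0 ?divr_ge0 // ltW.
    exists k.
    have k2 : k%:R <= 2 ^+ k :> R by rewrite -natrX ler_nat; exact/ltnW/ltn_expl.
    have a1 : 0 <= 2 * r / d by rewrite divr_ge0 ?mulr_ge0 // ltW.
    have a2 : 0 <= 4 * M * r / (e / 8) by rewrite divr_ge0 ?mulr_ge0 // ?divr_ge0 // ltW.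
    split; first by rewrite (mulrC d) -ltr_pdivrMr //; lra.
    by rewrite mulrA ler_pdivrMr ?exprn_gt0 // (mulrC (e / 8)) -ler_pdivrMr ?divr_gt0 //; lra.
  have good (ab : bool * bool) : exists n0, forall n, (n0 <= n)%N ->
      nrm (contour (2 ^ n) F (corner ab.1 ab.2 r) r%:C%C) <= e / 8 + 4 * M * (r / 2 ^+ k).
    apply: (@contour_corner F ab.1 ab.2 M d); rewrite ?divr_gt0 //; first by case: kr.
    move=> z; case: z => x y; rewrite /square /corner /= => -[h1 h2]; apply: dF => /=; rewrite ler_norml.
      by move: h1 h2; case: ab => [[] []] /=; lra.
    by move: h1 h2; case: ab => [[] []] /=; lra.
  pose N ab := sval (cid (good ab)).
  exists (\max_ab N ab).+1 => -[//|n]; rewrite ltnS => nN.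
  rewrite contour_halve pair_bigA /=; apply: (le_trans (nrm_sum _ _ _)).
  apply: (@le_trans _ _ (\sum_(ab : bool * bool) (e / 4))); last first.
    by rewrite sumr_const card_prod card_bool -mulr_natr; lra.
  apply: ler_sum => ab _.
  (* The quarters of the centred square are the four squares of side [r] with vertex 0. *)
  have -> : p + (ab.1%:R * (2 * r / 2) +i* (ab.2%:R * (2 * r / 2)))%C = corner (~~ ab.1) (~~ ab.2) r.
    by apply/eqP; rewrite eq_complex /=; case: ab => [[] []] /=; apply/andP; split; apply/eqP; lra.
  have -> : 2 * r / 2 = r by lra.
  apply: (le_trans (svalP (cid (good (~~ ab.1, ~~ ab.2))) n _)).
    exact: leq_trans (leq_bigmax (~~ ab.1, ~~ ab.2)) nN.
  by case: kr => _; lra.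
apply/ler_addgt0Pr => e e0.
have [n0 h] := small _ (mulr_gt0 (ltr0n R 4) e0).
have N0 : (0 < 2 ^ n0)%N by rewrite expn_gt0.
have := h n0 (leqnn _).
have -> : contour (2 ^ n0) F p (2 * r)%:C%C = contour (2 ^ n0) (fun z => g z * z^-1) p (2 * r)%:C%C
    - g 0 * contour (2 ^ n0) GRing.inv p (2 * r)%:C%C.
  rewrite /F [X in contour _ X](_ : _ = fun z => g z * z^-1 - g 0 * z^-1); last by apply/funext => z; ring.
  rewrite contour_lin; congr (_ - _).
  rewrite /contour !(mulrBr, mulrDr) /edge !mulr_sumr.
  by congr (_ - _ + _ - _); apply: eq_bigr => j _; exact/esym/mulrA.
move=> hh.
have hb : nrm (contour (2 ^ n0) (fun z => g z * z^-1) p (2 * r)%:C%C) <= 4 * (B / r) * (2 * r).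
  apply: contour_bound => //; first by rewrite mulr_ge0 // ltW.
  move=> z [[z1 z2] z3].
  have zb : sq_boundary r z.
    rewrite /p /= in z1 z2 z3; split; first by rewrite ler_norml; lra.
    split; first by rewrite ler_norml; lra.
    by case: z3 => e1; [left|left|right|right]; rewrite e1 ?normrN ?gtr0_norm //; lra.
  rewrite nrmM nrmV ler_pM ?invr_ge0 ?nrm_ge0 //; first exact: hB.
  rewrite lef_pV2 ?posrE //.
    case: zb => _ [_ [<-|<-]]; [exact: Re_le_nrm|exact: Im_le_nrm].
  apply: (lt_le_trans r0).
  case: zb => _ [_ [<-|<-]]; [exact: Re_le_nrm|exact: Im_le_nrm].
have hi := contour_inv_ge N0 r0; rewrite -/p in hi.
have h4 : 4 * nrm (g 0) <= nrm (g 0 * contour (2 ^ n0) GRing.inv p (2 * r)%:C%C).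
  by rewrite nrmM mulrC ler_wpM2l // nrm_ge0.
have e8 : 4 * (B / r) * (2 * r) = 8 * B by field; rewrite gt_eqF.
move: hh hb h4; rewrite e8.
set u := contour _ _ _ _; set v := g 0 * _ => hh hb h4.
have := nrmD u (- (u - v)); rewrite nrmN opprB (addrC u) subrK.
lra.
Qed.

(** Applying [max_modulus2] to the powers of [g] gives $|g(0)|^m \le 2B^m$ for all $m$; Bernoulli's
    inequality then removes the factor 2. *)
Lemma max_modulus g (r B : R) : 0 < r -> 0 <= B ->
  (forall z, `|complex.Re z| <= r -> `|complex.Im z| <= r -> differentiable g z) ->
  (forall z, sq_boundary r z -> nrm (g z) <= B) -> nrm (g 0) <= B.
Proof.
move=> r0 B0 dg hB.
have P m : nrm (g 0) ^+ m <= 2 * B ^+ m.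
  rewrite -nrmX; apply: (@max_modulus2 (fun z => g z ^+ m) r) => //; first exact: exprn_ge0.
    move=> z z1 z2; elim: m => [|m IH].
      by under eq_fun do rewrite expr0; exact: differentiable_cst.
    under eq_fun do rewrite exprS.
    by apply: differentiableM => //; exact: dg.
  by move=> z zb; rewrite nrmX lerXn2r ?nnegrE ?nrm_ge0 //; exact: hB.
rewrite leNgt; apply/negP => Bg.
have [B00|Bp] := eqVneq B 0; first by have := P 1%N; rewrite !expr1 B00 mulr0 leNgt -B00 Bg.
have {}Bp : 0 < B by rewrite lt_def Bp.
pose x := nrm (g 0) / B - 1.
have x0 : 0 < x by rewrite subr_gt0 ltr_pdivlMr // mul1r.
have Q m : 1 + m%:R * x <= 2.
  apply: (@le_trans _ _ ((nrm (g 0) / B) ^+ m)).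
    have -> : nrm (g 0) / B = 1 + x by rewrite /x; ring.
    elim: m => [|m IH]; first by rewrite mul0r addr0.
    rewrite exprS -natr1; apply: (@le_trans _ _ ((1 + x) * (1 + m%:R * x))).
      have : 0 <= m%:R * x * x by rewrite !mulr_ge0 // ltW.
      by lra.
    by rewrite ler_wpM2l // addr_ge0 // ltW.
  by rewrite expr_div_n ler_pdivrMr ?exprn_gt0.
have := archi_boundP (ltW (ltr0n R 1)).
have xx : 0 <= 2 / x by rewrite divr_ge0 // ltW.
have := archi_boundP xx; rewrite ltr_pdivrMr //.
have := Q (Num.bound (2 / x)); lra.
Qed.

End Goursat.

(** * Real derivatives and second order Taylor bounds *)

Section RealSlices.
Variable R : realType.
Implicit Types (F G : R -> R) (t c e : R).

(** A derivative with explicit remainder and no division; [h = 0] is allowed. *)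
Definition deriv_at F t0 c := forall e, 0 < e -> exists2 d : R, 0 < d &
  forall h, `|h| < d -> `|F (t0 + h) - F t0 - c * h| <= e * `|h|.

Lemma derivable_deriv_at F t0 : derivable (F : R^o -> R^o) t0 1 -> deriv_at F t0 (derive1 F t0).
Proof.
move=> dF e e0; rewrite derive1E.
have dF' : (fun h : R => h^-1 * (F (t0 + h) - F t0)) @ 0^' --> 'D_1 (F : R^o -> R^o) t0.
  move: dF => /cvg_ex [l hl]; rewrite /derive (cvg_lim _ hl) //.
  apply: cvg_trans hl; apply: near_eq_cvg; near=> h.
  by rewrite /= [h *: 1]mulr1 (addrC h).
move/cvgrPdist_le : dF' => /(_ e e0); rewrite near_withinE => /nbhs_ballP[d /= d0 hd].
exists d => // h hh; have [->|h0] := eqVneq h 0.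
  by rewrite addr0 subrr mulr0 subr0 normr0 mulr0.
have := hd h; rewrite /ball /= sub0r normrN => /(_ hh h0).
move: (F (t0 + h) - F t0) ('D_1 (F : R^o -> R^o) t0) => D c H.
have -> : D - c * h = - (c - h^-1 * D) * h by field.
by rewrite normrM normrN ler_wpM2r.
Unshelve. all: by end_near. Qed.

Lemma deriv_atP F t0 c : deriv_at F t0 c -> is_derive t0 1 (F : R^o -> R^o) c.
Proof.
move=> h.
have H : (fun h : R => h^-1 *: (((F : R^o -> R^o) \o shift t0) (h *: 1) - F t0)) @ 0^' --> c.
  apply/cvgrPdist_le => e e0; have [d d0 hd] := h e e0.
  rewrite near_withinE; apply/nbhs_ballP; exists d => //= x; rewrite /ball /= sub0r normrN => xd x0.
  rewrite -(ler_pM2r (_ : 0 < `|x|)) ?normr_gt0 // -normrM.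
  have := hd x xd; rewrite distrC [x *: 1]mulr1 (addrC x) /=; congr (`|_| <= _).
  move: (F (t0 + x) - F t0) => D.
  by rewrite (_ : x^-1 *: D = x^-1 * D) //; field.
by split; [apply/cvg_ex; exists c|exact: cvg_lim H].
Qed.

Lemma deriv_at_derive1 F t0 c : deriv_at F t0 c -> derivable (F : R^o -> R^o) t0 1 /\ derive1 F t0 = c.
Proof. by move=> /deriv_atP h; rewrite derive1E; split; [exact: ex_derive|exact: derive_val]. Qed.

Lemma deriv_at_ext F G t0 c : (forall t, F t = G t) -> deriv_at F t0 c -> deriv_at G t0 c.
Proof. by move=> h; rewrite (_ : F = G) //; exact/funext. Qed.

Lemma deriv_atD F G t0 c d : deriv_at F t0 c -> deriv_at G t0 d ->
  deriv_at (fun t => F t + G t) t0 (c + d).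
Proof.
move=> hF hG e e0; have e2 : 0 < e / 2 by rewrite divr_gt0.
have [a a0 ha] := hF _ e2; have [b b0 hb] := hG _ e2.
exists (Num.min a b); first by rewrite lt_min a0.
move=> h; rewrite lt_min => /andP[/ha h1 /hb h2].
rewrite [X in `|X|](_ : _ = (F (t0 + h) - F t0 - c * h) + (G (t0 + h) - G t0 - d * h)); last ring.
apply: (le_trans (ler_normD _ _)); lra.
Qed.

Lemma deriv_atM k F t0 c : deriv_at F t0 c -> deriv_at (fun t => k * F t) t0 (k * c).
Proof.
move=> hF e e0; have ek : 0 < e / (`|k| + 1) by rewrite divr_gt0 // ltr_wpDl.
have [a a0 ha] := hF _ ek; exists a => // h /ha h1.
rewrite [X in `|X|](_ : _ = k * (F (t0 + h) - F t0 - c * h)); last ring.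
rewrite normrM; apply: (@le_trans _ _ (`|k| * (e / (`|k| + 1) * `|h|))); first exact: ler_wpM2l.
rewrite mulrA ler_wpM2r // mulrCA ger_pMr // ler_pdivrMr ?ltr_wpDl // mul1r lerDl //.
Qed.

Lemma deriv_at_lin a t0 : deriv_at (fun t => a * t) t0 a.
Proof.
move=> e e0; exists 1 => // h _.
have -> : a * (t0 + h) - a * t0 - a * h = 0 by ring.
by rewrite normr0 mulr_ge0 // ltW.
Qed.

Lemma deriv_at_sqr t0 : deriv_at (fun t => t ^+ 2 / 2) t0 t0.
Proof.
move=> e e0; exists e => // h he.
rewrite [X in `|X|](_ : _ = h / 2 * h); last by field.
by rewrite normrM ler_wpM2r // normrM [`|_^-1|]gtr0_norm ?invr_gt0 //; have := normr_ge0 h; lra.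
Qed.

Lemma mean_value_bound F dF s K : 0 <= K ->
  (forall t, `|t| <= `|s| -> deriv_at F t (dF t)) -> (forall t, `|t| <= `|s| -> `|dF t| <= K) ->
  `|F s - F 0| <= K * `|s|.
Proof.
move=> K0 hd hK.
have main a b : a <= b -> (forall t, a <= t <= b -> `|t| <= `|s|) -> `|F b - F a| <= K * (b - a).
  move=> ab hab.
  have hI x : x \in `]a, b[%R -> is_derive x 1 (F : R^o -> R^o) (dF x).
    by rewrite in_itv /= => /andP[/ltW ax /ltW xb]; apply: deriv_atP; apply: hd; apply: hab; rewrite ax.
  have hc : {within `[a, b], continuous (F : R^o -> R^o)}.
    apply: derivable_within_continuous => x; rewrite in_itv /= => /hab /hd /deriv_atP h.
    exact: (@ex_derive _ _ _ _ _ _ _ h).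
  have [c cab ->] := MVT_segment ab hI hc.
  rewrite normrM [`|b - a|]ger0_norm ?subr_ge0 // ler_wpM2r ?subr_ge0 //; apply: hK; apply: hab.
    by move: cab; rewrite in_itv.
have [s0|s0] := leP 0 s.
  rewrite (ger0_norm s0) -[X in K * X]subr0; apply: main => // t /andP[t0 ts]; by rewrite !ger0_norm.
rewrite distrC (ltr0_norm s0) -[X in K * X]sub0r; apply: main; first exact: ltW.
by move=> t /andP[t0 ts]; rewrite !ler0_norm ?lerN2 // ltW.
Qed.

(** The mean value bound is used twice, for [F1] minus its linear part and for [F] minus its
    quadratic polynomial. *)
Lemma taylor2_bound F F1 F2 s c e : 0 <= e ->
  (forall t, `|t| <= `|s| -> deriv_at F t (F1 t)) ->
  (forall t, `|t| <= `|s| -> deriv_at F1 t (F2 t)) ->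
  (forall t, `|t| <= `|s| -> `|F2 t - c| <= e) ->
  `|F s - F 0 - s * F1 0 - s ^+ 2 / 2 * c| <= e * s ^+ 2.
Proof.
move=> e0 h1 h2 h3.
pose G t := F t + ((- F1 0) * t + (- c) * (t ^+ 2 / 2)).
pose G1 t := F1 t + (- c) * t.
have -> : F s - F 0 - s * F1 0 - s ^+ 2 / 2 * c = G s - G 0 by rewrite /G expr0n /=; field.
have -> : s ^+ 2 = `|s| * `|s| by rewrite -expr2 real_normK // num_real.
rewrite mulrA; apply: (@mean_value_bound G (fun t => F1 t + (- F1 0 + - c * t))); first exact: mulr_ge0.
  move=> t ts; apply: deriv_atD; first exact: h1.
  by apply: deriv_atD; [exact: deriv_at_lin|apply/deriv_atM/deriv_at_sqr].
move=> t ts; rewrite [X in `|X|](_ : _ = G1 t - G1 0); last by rewrite /G1; ring.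
apply: (@le_trans _ _ (e * `|t|)); last exact: ler_wpM2l.
apply: (@mean_value_bound G1 (fun t => F2 t + - c)) => // x xt.
  by apply: deriv_atD; [apply: h2; exact: le_trans ts|exact: deriv_at_lin].
by apply: h3; exact: le_trans ts.
Qed.

End RealSlices.

Lemma triangle3 (R : realDomainType) (a b c d x y z : R) : d = a + b + c ->
  `|a| <= x -> `|b| <= y -> `|c| <= z -> `|d| <= x + y + z.
Proof.
move=> -> ax bx cx; apply: (le_trans (ler_normD _ _)); apply: lerD => //.
by apply: (le_trans (ler_normD _ _)); apply: lerD.
Qed.

(** * Iterated directional derivatives *)

Section RealCk.
Variables (R : realType) (n : nat).
Local Notation V := 'rV[R[i]]_n.
Implicit Types (g : V -> R) (z v w : V) (W : set V).

Definition rd v g z : R := derive1 (fun t : R => g (z + t%:C%C *: v)) 0.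

Fixpoint CkR (k : nat) W g : Prop :=
  (forall z, W z -> {for z, continuous g}) /\
  match k with
  | 0 => True
  | k'.+1 => forall v, (forall z, W z -> derivable ((fun t : R => g (z + t%:C%C *: v)) : R^o -> R^o) 0 1) /\
       CkR k' W (rd v g)
  end.

Lemma CkR_cont k W g z : CkR k W g -> W z -> forall e : R, 0 < e -> 
  exists2 d : R, 0 < d & forall y, vn (y - z) < d -> `|g y - g z| < e.
Proof.
move=> cg Wz e e0; have {}cg : {for z, continuous g} by case: k cg => [|k] [/(_ z Wz)].
have := cg [set x | `|x - g z| < e] ; case/(_ _)/nbhs_VP.
  by apply/nbhs_ballP; exists e => // x; rewrite /ball /= distrC.
by move=> d d0 hd; exists d.
Qed.

Lemma CkRS k W g v : CkR k.+1 W g -> CkR k W (rd v g).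
Proof. by move=> [_ /(_ v)[]]. Qed.

Lemma slice_shift z v (s t : R) : z + (s + t)%:C%C *: v = (z + s%:C%C *: v) + t%:C%C *: v.
Proof. by rewrite rmorphD /= scalerDl addrA. Qed.

Lemma CkR_deriv k W g z v t : CkR k.+1 W g -> W (z + t%:C%C *: v) ->
  deriv_at (fun s => g (z + s%:C%C *: v)) t (rd v g (z + t%:C%C *: v)).
Proof.
move=> [_ /(_ v)[h _]] Wt; have := derivable_deriv_at (h _ Wt).
move=> H e e0; have [d d0 hd] := H e e0; exists d => // s /hd.
by rewrite add0r slice_shift scale0r addr0.
Qed.

Lemma open_ball W z : open W -> W z -> exists2 r : R, 0 < r & forall y, vn (y - z) < r -> W y.
Proof. by move=> oW Wz; apply/nbhs_VP; exact: open_nbhs_nbhs. Qed.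

Lemma vn_slice z v w (s t r : R) : `|s| <= r -> `|t| <= r ->
  vn ((z + s%:C%C *: v + t%:C%C *: w) - z) <= r * (vn v + vn w).
Proof.
move=> sr tr; rewrite -[z + _ + _]addrA addrAC subrr add0r.
apply: (le_trans (vnD _ _)); rewrite !vnZ !nrm_real mulrDr.
by apply: lerD; apply: ler_wpM2r => //; exact: vn_ge0.
Qed.

(** Only iterated directional derivatives are available, so the expansion goes along [v] from
    [z + t w], then along [w] from [z], and finally [rd v g] is expanded along [w]. The mixed term
    appears in one order only, since symmetry is not yet known. *)
Lemma taylor2 W g z v w : open W -> W z -> CkR 2 W g -> forall e : R, 0 < e ->
  exists2 d : R, 0 < d & forall s t : R, `|s| < d -> `|t| < d ->
    `|g (z + s%:C%C *: v + t%:C%C *: w) -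
      (g z + s * rd v g z + t * rd w g z + s ^+ 2 / 2 * rd v (rd v g) z
       + t ^+ 2 / 2 * rd w (rd w g) z + s * t * rd w (rd v g) z)| <= e * (s ^+ 2 + t ^+ 2).
Proof.
move=> oW Wz cg e e0; have [r r0 hr] := open_ball oW Wz.
have e2 : 0 < e / 2 by rewrite divr_gt0.
have cv := CkRS v cg; have cw := CkRS w cg.
have [d1 d10 h1] := CkR_cont (CkRS v cv) Wz e2.
have [d2 d20 h2] := CkR_cont (CkRS w cw) Wz e2.
have [d3 d30 h3] := CkR_cont (CkRS w cv) Wz e2.
pose m := Num.min r (Num.min d1 (Num.min d2 d3)).
have m0 : 0 < m by rewrite !lt_min r0 d10 d20 d30.
pose K := vn v + vn w + 1.
have K0 : 0 < K by rewrite ltr_wpDl // addr_ge0 ?vn_ge0.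
exists (m / K); first by rewrite divr_gt0.
move=> s t sd td.
have near s' t' : `|s'| <= `|s| -> `|t'| <= `|t| -> vn ((z + s'%:C%C *: v + t'%:C%C *: w) - z) < m.
  move=> ss tt; have ms : Num.max `|s| `|t| < m / K by rewrite gt_max sd.
  apply: (@le_lt_trans _ _ (Num.max `|s| `|t| * (vn v + vn w))).
    by apply: vn_slice; rewrite le_max ?ss ?tt ?orbT.
  apply: (@le_lt_trans _ _ (Num.max `|s| `|t| * K)).
    by apply: ler_wpM2l; [rewrite le_max normr_ge0|rewrite lerDl].
  by rewrite -ltr_pdivlMr.
have nearr s' t' : `|s'| <= `|s| -> `|t'| <= `|t| -> W (z + s'%:C%C *: v + t'%:C%C *: w).
  by move=> ss tt; apply: hr; have := near _ _ ss tt; rewrite lt_min => /andP[].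
have n0 : `|0 : R| <= `|s| by rewrite normr0.
have A : `|g (z + s%:C%C *: v + t%:C%C *: w) - g (z + t%:C%C *: w) - s * rd v g (z + t%:C%C *: w)
    - s ^+ 2 / 2 * rd v (rd v g) z| <= e / 2 * s ^+ 2.
  pose y := z + t%:C%C *: w.
  have eqy s' : z + s'%:C%C *: v + t%:C%C *: w = y + s'%:C%C *: v by rewrite addrAC.
  rewrite eqy -/y.
  have := @taylor2_bound _ (fun s => g (y + s%:C%C *: v)) (fun s => rd v g (y + s%:C%C *: v))
    (fun s => rd v (rd v g) (y + s%:C%C *: v)) s (rd v (rd v g) z) (e / 2) (ltW e2).
  rewrite scale0r addr0; apply.
  - by move=> x xs; apply: (CkR_deriv cg); rewrite -eqy; exact: nearr.
  - by move=> x xs; apply: (CkR_deriv cv); rewrite -eqy; exact: nearr.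
  - move=> x xs; rewrite -eqy; apply/ltW/h1; have := near x t xs (lexx _).
    by rewrite !lt_min => /and4P[].
have B : `|g (z + t%:C%C *: w) - g z - t * rd w g z - t ^+ 2 / 2 * rd w (rd w g) z| <= e / 2 * t ^+ 2.
  have := @taylor2_bound _ (fun s => g (z + s%:C%C *: w)) (fun s => rd w g (z + s%:C%C *: w))
    (fun s => rd w (rd w g) (z + s%:C%C *: w)) t (rd w (rd w g) z) (e / 2) (ltW e2).
  have eqy s' : z + s'%:C%C *: w = z + 0%:C%C *: v + s'%:C%C *: w by rewrite scale0r addr0.
  rewrite scale0r addr0; apply.
  - by move=> x xs; apply: (CkR_deriv cg); rewrite eqy; exact: nearr.
  - by move=> x xs; apply: (CkR_deriv cw); rewrite eqy; exact: nearr.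
  - move=> x xs; rewrite eqy; apply/ltW/h2; have := near 0 x n0 xs.
    by rewrite !lt_min => /and4P[].
have D : `|rd v g (z + t%:C%C *: w) - rd v g z - t * rd w (rd v g) z| <= e / 2 * `|t|.
  pose G x := rd v g (z + x%:C%C *: w) + (- rd w (rd v g) z) * x.
  have -> : rd v g (z + t%:C%C *: w) - rd v g z - t * rd w (rd v g) z = G t - G 0.
    by rewrite /G scale0r addr0; ring.
  have eqy s' : z + s'%:C%C *: w = z + 0%:C%C *: v + s'%:C%C *: w by rewrite scale0r addr0.
  apply: (@mean_value_bound _ G (fun x => rd w (rd v g) (z + x%:C%C *: w) + - rd w (rd v g) z)); first exact: ltW.
  - move=> x xs; apply: deriv_atD; last exact: deriv_at_lin.
    by apply: (CkR_deriv cv); rewrite eqy; exact: nearr.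
  - move=> x xs; rewrite eqy; apply/ltW/h3; have := near 0 x n0 xs.
    by rewrite !lt_min => /and4P[].
have E : `|s * (rd v g (z + t%:C%C *: w) - rd v g z - t * rd w (rd v g) z)| <= e / 2 * (s ^+ 2 + t ^+ 2).
  rewrite normrM; apply: (@le_trans _ _ (`|s| * (e / 2 * `|t|))); first exact: ler_wpM2l.
  rewrite mulrCA; apply: ler_wpM2l; first exact: ltW.
  have -> : s ^+ 2 = `|s| ^+ 2 by rewrite real_normK // num_real.
  have -> : t ^+ 2 = `|t| ^+ 2 by rewrite real_normK // num_real.
  move: (`|s|) (`|t|) => x y; rewrite -subr_ge0.
  have -> : x ^+ 2 + y ^+ 2 - x * y = (x - y / 2) ^+ 2 + 3 / 4 * y ^+ 2 by field.
  by rewrite addr_ge0 ?sqr_ge0 // mulr_ge0 ?sqr_ge0 // divr_ge0.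
move: A B E {D}; move: (g (z + s%:C%C *: v + t%:C%C *: w)) (g (z + t%:C%C *: w)) (g z).
move: (rd v g (z + t%:C%C *: w)) (rd v g z) (rd w g z) (rd v (rd v g) z) (rd w (rd w g) z) (rd w (rd v g) z).
move=> a a' b' c1 c2 c3 X Y g0 A B E.
have -> : e * (s ^+ 2 + t ^+ 2) = e / 2 * s ^+ 2 + e / 2 * t ^+ 2 + e / 2 * (s ^+ 2 + t ^+ 2) by field.
apply: triangle3 A B E; ring.
Qed.

(** The expansions of [taylor2] in the orders [v, w] and [w, v] at [s = t] describe the same value
    and differ in the mixed term only. *)
Lemma rdC W g z v w : open W -> W z -> CkR 2 W g -> rd v (rd w g) z = rd w (rd v g) z.
Proof.
move=> oW Wz cg; apply/eqP; rewrite -subr_eq0 -normr_le0; apply/ler_addgt0Pr => e e0; rewrite add0r.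
have e4 : 0 < e / 4 by rewrite divr_gt0.
have [d1 d10 h1] := taylor2 v w oW Wz cg e4.
have [d2 d20 h2] := taylor2 w v oW Wz cg e4.
pose s := Num.min d1 d2 / 2.
have s0 : 0 < s by rewrite divr_gt0 // lt_min d10.
have sm : `|s| < Num.min d1 d2 by rewrite gtr0_norm // ltr_pdivrMr // mulr_natr mulr2n ltrDl lt_min d10.
move: sm; rewrite lt_min => /andP[sd1 sd2].
have := h1 s s sd1 sd1; have := h2 s s sd2 sd2; rewrite (addrAC z).
set X := g _; set a := rd v (rd w g) z; set b := rd w (rd v g) z => H2 H1.
have K : `|s * s * (a - b)| <= e * (s * s).
  move: H1 H2; rewrite -/X; move: X (g z) (rd v g z) (rd w g z) (rd v (rd v g) z) (rd w (rd w g) z) a b => {}X g0 x1 x2 x3 x4 a b H1 H2.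
  have -> : e * (s * s) = e / 4 * (s ^+ 2 + s ^+ 2) + e / 4 * (s ^+ 2 + s ^+ 2) + 0 by field.
  rewrite -normrN in H2; apply: (@triangle3 _ _ _ 0 _ _ _ _ _ H1 H2); last by rewrite normr0.
  ring.
have ss : 0 < s * s by rewrite mulr_gt0.
by move: K; rewrite normrM gtr0_norm // mulrC ler_pM2r.
Qed.

End RealCk.

(** * Wirtinger derivatives and the Levi form *)

Section Directional.
Variables (R : realType) (n : nat).
Local Notation V := 'rV[R[i]]_n.
Implicit Types (g : V -> R) (f : V -> R[i]) (z v w : V) (W : set V).

Lemma rdE g z v c : deriv_at (fun t => g (z + t%:C%C *: v)) 0 c -> rd v g z = c.
Proof. by move=> /deriv_at_derive1[]. Qed.

Lemma deriv_at_scale (F : R -> R) a c : deriv_at F 0 c -> deriv_at (fun t => F (a * t)) 0 (a * c).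
Proof.
move=> hF e e0; have ea : 0 < e / (`|a| + 1) by rewrite divr_gt0 // ltr_wpDl.
have [d d0 hd] := hF _ ea; exists (d / (`|a| + 1)); first by rewrite divr_gt0 // ltr_wpDl.
move=> h hh; have ah : `|a * h| < d.
  rewrite normrM; apply: (@le_lt_trans _ _ ((`|a| + 1) * `|h|)); first by rewrite ler_wpM2r // lerDl.
  by rewrite mulrC -ltr_pdivlMr // ltr_wpDl.
have := hd _ ah; rewrite !add0r mulr0 mulrA (mulrC c) => /le_trans; apply.
rewrite normrM mulrA ler_wpM2r // -mulrA ger_pMr // mulrC ler_pdivrMr ?ltr_wpDl // mul1r lerDl //.
Qed.

Lemma rdZ W g z v (a : R) : W z -> CkR 1 W g -> rd (a%:C%C *: v) g z = a * rd v g z.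
Proof.
move=> Wz cg; apply: rdE.
have H : deriv_at (fun s => g (z + s%:C%C *: v)) 0 (rd v g z).
  by have := @CkR_deriv _ _ 0 W g z v 0 cg; rewrite scale0r addr0; apply.
by apply: deriv_at_ext (deriv_at_scale a H) => t; rewrite scalerA -rmorphM (mulrC a).
Qed.

(** The step along [w] uses the derivative at [z]; the following step along [v] starts from a moving
    point, where continuity of [rd v g] is used. *)
Lemma rdD W g z v w : open W -> W z -> CkR 1 W g -> rd (v + w) g z = rd v g z + rd w g z.
Proof.
move=> oW Wz cg; apply: rdE => e e0; have [r r0 hr] := open_ball oW Wz.
have e2 : 0 < e / 2 by rewrite divr_gt0.
have [d1 d10 h1] := CkR_cont (CkRS v cg) Wz e2.
have H : deriv_at (fun s => g (z + s%:C%C *: w)) 0 (rd w g z).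
  by have := @CkR_deriv _ _ 0 W g z w 0 cg; rewrite scale0r addr0; apply.
have [d2 d20 h2] := H _ e2.
pose m := Num.min r d1; pose K := vn v + vn w + 1.
have m0 : 0 < m by rewrite lt_min r0.
have K0 : 0 < K by rewrite ltr_wpDl // addr_ge0 ?vn_ge0.
exists (Num.min d2 (m / K)); first by rewrite lt_min d20 divr_gt0.
move=> t; rewrite lt_min => /andP[td2 tm].
have near s : `|s| <= `|t| -> vn ((z + s%:C%C *: v + t%:C%C *: w) - z) < m.
  move=> st; apply: (@le_lt_trans _ _ (`|t| * (vn v + vn w))); first exact: vn_slice.
  apply: (@le_lt_trans _ _ (`|t| * K)); first by apply: ler_wpM2l => //; rewrite lerDl.
  by rewrite -ltr_pdivlMr.
have eqy s : z + s%:C%C *: v + t%:C%C *: w = z + t%:C%C *: w + s%:C%C *: v by rewrite addrAC.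
have A : `|g (z + t%:C%C *: w + t%:C%C *: v) - g (z + t%:C%C *: w) - t * rd v g z| <= e / 2 * `|t|.
  pose G x := g (z + t%:C%C *: w + x%:C%C *: v) + (- rd v g z) * x.
  rewrite [X in `|X|](_ : _ = G t - G 0); last by rewrite /G scale0r addr0; move: (g _) (g _) => ? ?; ring.
  apply: (@mean_value_bound _ G (fun x => rd v g (z + t%:C%C *: w + x%:C%C *: v) + - rd v g z)); first exact: ltW.
  - move=> x xs; apply: deriv_atD; last exact: deriv_at_lin.
    by apply: (CkR_deriv cg); rewrite -eqy; apply: hr; have := near x xs; rewrite lt_min => /andP[].
  - move=> x xs; rewrite -eqy; apply/ltW/h1; have := near x xs; by rewrite lt_min => /andP[].
have := h2 t td2; rewrite add0r scale0r addr0 => B.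
rewrite (scale0r (v + w)) addr0 scalerDr addrA eqy.
have -> : e * `|t| = e / 2 * `|t| + e / 2 * `|t| + 0 by field.
apply: (triangle3 (c := 0) _ A B); last by rewrite normr0.
by move: (g _) (g _) (g _) (rd v g z) (rd w g z) => ? ? ? ? ?; ring.
Qed.

Lemma Re_cont (z0 : R[i]) : {for z0, continuous (@complex.Re R : R[i] -> R)}.
Proof.
move=> P; case/nbhs_ballP => e /= e0 h; apply/nbhs_CP; exists e => // w hw.
by apply: h; rewrite /ball /= distrC -raddfB /=; apply: le_lt_trans hw; exact: Re_le_nrm.
Qed.
Lemma Im_cont (z0 : R[i]) : {for z0, continuous (@complex.Im R : R[i] -> R)}.
Proof.
move=> P; case/nbhs_ballP => e /= e0 h; apply/nbhs_CP; exists e => // w hw.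
by apply: h; rewrite /ball /= distrC -raddfB /=; apply: le_lt_trans hw; exact: Im_le_nrm.
Qed.

Lemma Ck_Re k W f : Ck k W f -> CkR k W (fun z => complex.Re (f z)).
Proof.
elim: k f => [|k IH] f [cf h]; split.
- by move=> z Wz; apply: continuous_comp; [exact: cf|exact: Re_cont].
- by [].
- by move=> z Wz; apply: continuous_comp; [exact: cf|exact: Re_cont].
- move=> v; have [h1 h2] := h v; split; first by move=> z /h1[].
  exact: (IH _ h2).
Qed.

Lemma Ck_Im k W f : Ck k W f -> CkR k W (fun z => complex.Im (f z)).
Proof.
elim: k f => [|k IH] f [cf h]; split.
- by move=> z Wz; apply: continuous_comp; [exact: cf|exact: Im_cont].
- by [].
- by move=> z Wz; apply: continuous_comp; [exact: cf|exact: Im_cont].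
- move=> v; have [h1 h2] := h v; split; first by move=> z /h1[].
  exact: (IH _ h2).
Qed.

Lemma Ck_S k W f v : Ck k.+1 W f -> Ck k W (rderive v f).
Proof. by move=> [_ /(_ v)[]]. Qed.

Lemma rderiveDdir W f z v w : open W -> W z -> Ck 1 W f ->
  rderive (v + w) f z = rderive v f z + rderive w f z.
Proof.
move=> oW Wz cf; apply/eqP; rewrite eq_complex; apply/andP; split; apply/eqP.
  exact: (rdD _ _ oW Wz (Ck_Re cf)).
exact: (rdD _ _ oW Wz (Ck_Im cf)).
Qed.

Lemma rderiveZdir W f z v (a : R) : W z -> Ck 1 W f ->
  rderive (a%:C%C *: v) f z = a%:C%C * rderive v f z.
Proof.
move=> Wz cf; apply/eqP; rewrite eq_complex /= !mul0r subr0 addr0; apply/andP; split; apply/eqP.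
  exact: (rdZ _ _ Wz (Ck_Re cf)).
exact: (rdZ _ _ Wz (Ck_Im cf)).
Qed.

Lemma rderiveC W f z v w : open W -> W z -> Ck 2 W f ->
  rderive v (rderive w f) z = rderive w (rderive v f) z.
Proof.
move=> oW Wz cf; apply/eqP; rewrite eq_complex; apply/andP; split; apply/eqP.
  exact: (rdC _ _ oW Wz (Ck_Re cf)).
exact: (rdC _ _ oW Wz (Ck_Im cf)).
Qed.

Local Notation ee p := (delta_mx 0 p : V).

Lemma rderive_coord W f z v : open W -> W z -> Ck 1 W f ->
  rderive v f z = \sum_p ((complex.Re (v 0 p))%:C%C * rderive (ee p) f z
                       + (complex.Im (v 0 p))%:C%C * rderive ('i%C *: ee p) f z).
Proof.
move=> oW Wz cf; rewrite [in LHS](row_sum_delta v).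
have D0 : rderive 0 f z = 0.
  by have := rderiveZdir (0 : V) 0 Wz cf; rewrite scale0r mul0r.
rewrite (big_morph (fun v => rderive v f z) (fun v w => rderiveDdir v w oW Wz cf) D0).
apply: eq_bigr => p _; rewrite [v 0 p in LHS]complexE scalerDl (mulrC 'i%C) -scalerA.
by rewrite (rderiveDdir _ _ oW Wz cf) !(rderiveZdir _ _ Wz cf).
Qed.

Lemma Re_iM (x : R[i]) : complex.Re ('i%C * x) = - complex.Im x.
Proof. by rewrite mulrC ReiNIm. Qed.
Lemma Im_iM (x : R[i]) : complex.Im ('i%C * x) = complex.Re x.
Proof. by rewrite mulrC ImiRe. Qed.

Lemma wirtinger_sum (F : fieldType) (i x y a b : F) : i ^+ 2 = -1 -> (2 : F) != 0 ->
  (x + i * y) * (2^-1 * (a - i * b)) = 2^-1 * (x * a + y * b - i * (- y * a + x * b)).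
Proof. by move=> i2 t0; field: i2. Qed.

Lemma wirtinger_sumbar (F : fieldType) (i x y a b : F) : i ^+ 2 = -1 -> (2 : F) != 0 ->
  (x - i * y) * (2^-1 * (a + i * b)) = 2^-1 * (x * a + y * b + i * (- y * a + x * b)).
Proof. by move=> i2 t0; field: i2. Qed.

Let i2 : ('i%C : R[i]) ^+ 2 = -1. Proof. exact: sqr_i. Qed.

Lemma conjcE (x : R[i]) : x^* = (complex.Re x)%:C%C - 'i%C * (complex.Im x)%:C%C.
Proof. by apply/eqP; case: x => a b; rewrite eq_complex /=; apply/andP; split; apply/eqP; ring. Qed.

(** The right-hand side is the C-linear part of the real differential at [v]; the next lemma gives
    the antilinear part. *)
Lemma dz_sum W f z v : open W -> W z -> Ck 1 W f ->
  \sum_p v 0 p * dz p f z = 2^-1 * (rderive v f z - 'i%C * rderive ('i%C *: v) f z).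
Proof.
move=> oW Wz cf; rewrite !(rderive_coord _ oW Wz cf) mulr_sumr -sumrB mulr_sumr; apply: eq_bigr => p _.
rewrite /dz mxE Re_iM Im_iM {1}[v 0 p]complexE rmorphN.
exact: wirtinger_sum.
Qed.

Lemma dzbar_sum W f z v : open W -> W z -> Ck 1 W f ->
  \sum_p (v 0 p)^* * dzbar p f z = 2^-1 * (rderive v f z + 'i%C * rderive ('i%C *: v) f z).
Proof.
move=> oW Wz cf; rewrite !(rderive_coord _ oW Wz cf) mulr_sumr -big_split mulr_sumr; apply: eq_bigr => p _.
rewrite /dzbar mxE Re_iM Im_iM conjcE rmorphN.
exact: wirtinger_sumbar.
Qed.

Lemma ReM (x y : R[i]) : complex.Re (x * y) = complex.Re x * complex.Re y - complex.Im x * complex.Im y.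
Proof. by case: x y => [a b] [c d]. Qed.
Lemma ImM (x y : R[i]) : complex.Im (x * y) = complex.Re x * complex.Im y + complex.Im x * complex.Re y.
Proof. by case: x y => [a b] [c d]. Qed.

Definition cderiv (F : R -> R[i]) t (c : R[i]) :=
  deriv_at (fun t => complex.Re (F t)) t (complex.Re c) /\
  deriv_at (fun t => complex.Im (F t)) t (complex.Im c).

Lemma cderivD F G t c d : cderiv F t c -> cderiv G t d -> cderiv (fun t => F t + G t) t (c + d).
Proof.
move=> [h1 h2] [h3 h4]; split.
  by rewrite raddfD; apply: deriv_at_ext (deriv_atD h1 h3) => x; rewrite raddfD.
by rewrite raddfD; apply: deriv_at_ext (deriv_atD h2 h4) => x; rewrite raddfD.
Qed.

Lemma cderivM F t c a : cderiv F t c -> cderiv (fun t => a * F t) t (a * c).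
Proof.
move=> [h1 h2]; split.
  rewrite ReM -mulNr; apply: deriv_at_ext (deriv_atD (deriv_atM (complex.Re a) h1) (deriv_atM (- complex.Im a) h2)) => x.
  by rewrite ReM mulNr.
rewrite ImM; apply: deriv_at_ext (deriv_atD (deriv_atM (complex.Re a) h2) (deriv_atM (complex.Im a) h1)) => x.
by rewrite ImM.
Qed.

Lemma cderivE f z v c : cderiv (real_slice f z v) 0 c -> rderive v f z = c.
Proof.
move=> [/deriv_at_derive1[_ h1] /deriv_at_derive1[_ h2]].
by apply/eqP; rewrite eq_complex /= h1 h2 !eqxx.
Qed.

Lemma rderivable_cderiv f z v : rderivable f z v -> cderiv (real_slice f z v) 0 (rderive v f z).
Proof. by move=> [/derivable_deriv_at r1 /derivable_deriv_at m1]. Qed.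

Lemma rderive_lin f1 f2 z v (a b : R[i]) : rderivable f1 z v -> rderivable f2 z v ->
  rderive v (fun z => a * (f1 z + b * f2 z)) z = a * (rderive v f1 z + b * rderive v f2 z).
Proof.
move=> /rderivable_cderiv h1 /rderivable_cderiv h2; apply: cderivE.
exact: (cderivM a (cderivD h1 (cderivM b h2))).
Qed.

Lemma Ck2_rderivable W f z u v : W z -> Ck 2 W f -> rderivable (rderive u f) z v.
Proof. by move=> Wz [_ /(_ u)[_ [_ /(_ v)[/(_ z Wz)]]]]. Qed.

Lemma comb_eq (x x' y y' a b : R[i]) : x = x' -> y = y' -> a * x + b * y = a * x' + b * y'.
Proof. by move=> -> ->. Qed.

Lemma rderive2_coordr W f z u w : open W -> W z -> Ck 2 W f ->
  rderive u (rderive w f) z = \sum_q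
    ((complex.Re (w 0 q))%:C%C * rderive u (rderive (ee q) f) z
   + (complex.Im (w 0 q))%:C%C * rderive u (rderive ('i%C *: ee q) f) z).
Proof.
move=> oW Wz cf; apply: (etrans (rderiveC u w oW Wz cf)).
apply: (etrans (rderive_coord w oW Wz (Ck_S u cf))); apply: eq_bigr => q _.
exact: comb_eq (rderiveC (ee q) u oW Wz cf) (rderiveC ('i%C *: ee q) u oW Wz cf).
Qed.

Lemma sum_comb2 (F G : 'I_n -> R[i]) (X Y a b : R[i]) : X = \sum_q F q -> Y = \sum_q G q ->
  a * X + b * Y = \sum_q (a * F q + b * G q).
Proof. by move=> -> ->; rewrite big_split !mulr_sumr. Qed.

Lemma distr4 (a b c d x y z t : R[i]) :
  a * (b * x + c * y) + d * (b * z + c * t) = a * b * x + a * c * y + d * b * z + d * c * t.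
Proof. by rewrite !mulrDr !mulrA !addrA. Qed.

Lemma rderive2_coord W f z v w : open W -> W z -> Ck 2 W f ->
  rderive v (rderive w f) z = \sum_p \sum_q
    ((complex.Re (v 0 p))%:C%C * (complex.Re (w 0 q))%:C%C * rderive (ee p) (rderive (ee q) f) z
   + (complex.Re (v 0 p))%:C%C * (complex.Im (w 0 q))%:C%C * rderive (ee p) (rderive ('i%C *: ee q) f) z
   + (complex.Im (v 0 p))%:C%C * (complex.Re (w 0 q))%:C%C * rderive ('i%C *: ee p) (rderive (ee q) f) z
   + (complex.Im (v 0 p))%:C%C * (complex.Im (w 0 q))%:C%C * rderive ('i%C *: ee p) (rderive ('i%C *: ee q) f) z).
Proof.
move=> oW Wz cf; apply: (etrans (rderive_coord v oW Wz (Ck_S w cf))); apply: eq_bigr => p _.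
apply: (etrans (sum_comb2 _ _ (rderive2_coordr _ w oW Wz cf) (rderive2_coordr _ w oW Wz cf))).
by apply: eq_bigr => q _; exact: distr4.
Qed.

Lemma dz_dzbarE W f z p q : open W -> W z -> Ck 2 W f -> dz p (dzbar q f) z =
  2^-1 * (2^-1 * (rderive (ee p) (rderive (ee q) f) z + 'i%C * rderive (ee p) (rderive ('i%C *: ee q) f) z)
   - 'i%C * (2^-1 * (rderive ('i%C *: ee p) (rderive (ee q) f) z + 'i%C * rderive ('i%C *: ee p) (rderive ('i%C *: ee q) f) z))).
Proof.
move=> oW Wz cf; rewrite /dz /dzbar.
congr (_ * (_ - _ * _)); apply: rderive_lin; exact: Ck2_rderivable cf.
Qed.

Lemma levi_ring (F : fieldType) (i x y x' y' b1 b2 b3 b4 : F) : i ^+ 2 = -1 -> (2 : F) != 0 ->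
  (x + i * y) * (x' - i * y') * (2^-1 * ((2^-1 * (b1 + i * b2)) - i * (2^-1 * (b3 + i * b4)))) =
  4^-1 * ((x * x' * b1 + x * y' * b2 + y * x' * b3 + y * y' * b4)
   + (y * y' * b1 - y * x' * b2 - x * y' * b3 + x * x' * b4)
   + i * (- x * y' * b1 + x * x' * b2 - y * y' * b3 + y * x' * b4)
   - i * (- y * x' * b1 - y * y' * b2 + x * x' * b3 + x * y' * b4)).
Proof.
move=> i2' t0; have t4 : (4 : F) != 0 by rewrite (natrM _ 2 2) mulf_neq0.
by field: i2'; rewrite ?t4 ?t0.
Qed.

(** Here [a'] and [c'] are coordinates of [i v]; the four groups on the right are the second
    derivatives along the pairs formed from [v] and [i v]. *)
Lemma levi_term (a c a' c' b1 b2 b3 b4 : R[i]) : a' = 'i%C * a -> c' = 'i%C * c ->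
  a * c^* * (2^-1 * (2^-1 * (b1 + 'i%C * b2) - 'i%C * (2^-1 * (b3 + 'i%C * b4)))) =
  4^-1 * (((complex.Re a)%:C%C * (complex.Re c)%:C%C * b1 + (complex.Re a)%:C%C * (complex.Im c)%:C%C * b2
     + (complex.Im a)%:C%C * (complex.Re c)%:C%C * b3 + (complex.Im a)%:C%C * (complex.Im c)%:C%C * b4)
   + ((complex.Re a')%:C%C * (complex.Re c')%:C%C * b1 + (complex.Re a')%:C%C * (complex.Im c')%:C%C * b2
     + (complex.Im a')%:C%C * (complex.Re c')%:C%C * b3 + (complex.Im a')%:C%C * (complex.Im c')%:C%C * b4)
   + 'i%C * ((complex.Re a)%:C%C * (complex.Re c')%:C%C * b1 + (complex.Re a)%:C%C * (complex.Im c')%:C%C * b2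
     + (complex.Im a)%:C%C * (complex.Re c')%:C%C * b3 + (complex.Im a)%:C%C * (complex.Im c')%:C%C * b4)
   - 'i%C * ((complex.Re a')%:C%C * (complex.Re c)%:C%C * b1 + (complex.Re a')%:C%C * (complex.Im c)%:C%C * b2
     + (complex.Im a')%:C%C * (complex.Re c)%:C%C * b3 + (complex.Im a')%:C%C * (complex.Im c)%:C%C * b4)).
Proof.
move=> -> ->; rewrite !Re_iM !Im_iM !rmorphN conjcE {1}[a]complexE levi_ring //; congr (_ * _).
by rewrite !(mulNr, mulrN) !opprK.
Qed.

Lemma sum_comb (F1 F2 F3 F4 : 'I_n -> R[i]) (X1 X2 X3 X4 c i : R[i]) :
  X1 = \sum_p F1 p -> X2 = \sum_p F2 p -> X3 = \sum_p F3 p -> X4 = \sum_p F4 p ->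
  c * (X1 + X2 + i * X3 - i * X4) = \sum_p c * (F1 p + F2 p + i * F3 p - i * F4 p).
Proof. by move=> -> -> -> ->; rewrite -mulr_sumr sumrB !big_split /= !mulr_sumr. Qed.

(** The Levi form at [v] is a quarter of the Laplacian of [f] on the complex line through [z] in
    direction [v]. *)
Lemma levi_sum W f z v : open W -> W z -> Ck 2 W f ->
  \sum_p \sum_q v 0 p * (v 0 q)^* * dz p (dzbar q f) z =
  4^-1 * (rderive v (rderive v f) z + rderive ('i%C *: v) (rderive ('i%C *: v) f) z).
Proof.
move=> oW Wz cf; set vv := rderive v (rderive v f) z; set ww := rderive ('i%C *: v) _ z.
(* The two mixed derivatives, which cancel by symmetry, are restored so that the sum matches the
   product of two Wirtinger operators. *)
transitivity (4^-1 * (vv + ww + 'i%C * rderive v (rderive ('i%C *: v) f) z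
     - 'i%C * rderive ('i%C *: v) (rderive v f) z)); last first.
  by rewrite (rderiveC v ('i%C *: v) oW Wz cf) addrK.
apply/esym; apply: (etrans (sum_comb _ _ (rderive2_coord _ _ oW Wz cf) (rderive2_coord _ _ oW Wz cf)
  (rderive2_coord _ _ oW Wz cf) (rderive2_coord _ _ oW Wz cf))).
apply: eq_bigr => p _; apply: (etrans (sum_comb _ _ erefl erefl erefl erefl)); apply: eq_bigr => q _.
by rewrite (dz_dzbarE p q oW Wz cf); apply/esym; apply: levi_term; rewrite mxE.
Qed.

End Directional.

(** * Second order jets in one complex variable *)

Section Jets.
Variable R : realType.
Local Notation C := R[i].
Implicit Types (F G l q : C -> C) (c : C).

Lemma nrm_triangle3 (a b c d : C) (x y z : R) : d = a + b + c ->
  nrm a <= x -> nrm b <= y -> nrm c <= z -> nrm d <= x + y + z.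
Proof.
move=> -> ax bx cx; apply: (le_trans (nrmD _ _)); apply: lerD => //.
by apply: (le_trans (nrmD _ _)); apply: lerD.
Qed.

(** The expansion of [F] at 0 with constant part [c], linear part [l], quadratic part [q]. The parts
    are restricted only by growth, as polynomials in [z] and its conjugate have to be allowed. *)
Definition jet2 F c l q :=
  (exists2 M : R, 0 <= M & forall z, nrm (l z) <= M * nrm z /\ nrm (q z) <= M * nrm z ^+ 2) /\
  forall e : R, 0 < e -> exists2 d : R, 0 < d & forall z, nrm z < d ->
    nrm (F z - (c + l z + q z)) <= e * nrm z ^+ 2.

Lemma jet2_ext F c l q F' c' l' q' : jet2 F c l q -> F =1 F' -> c = c' -> l =1 l' -> q =1 q' ->
  jet2 F' c' l' q'.
Proof. by move=> h /funext <- <- /funext <- /funext <-. Qed.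

Lemma jet2D F c l q F' c' l' q' : jet2 F c l q -> jet2 F' c' l' q' ->
  jet2 (fun z => F z + F' z) (c + c') (fun z => l z + l' z) (fun z => q z + q' z).
Proof.
move=> [[M M0 hM] h] [[M' M'0 hM'] h']; split.
  exists (M + M'); first exact: addr_ge0.
  move=> z; have [a1 a2] := hM z; have [b1 b2] := hM' z; rewrite !mulrDl.
  by split; apply: (le_trans (nrmD _ _)); apply: lerD.
move=> e e0; have e2 : 0 < e / 2 by rewrite divr_gt0.
have [d d0 hd] := h _ e2; have [d' d'0 hd'] := h' _ e2.
exists (Num.min d d'); first by rewrite lt_min d0.
move=> z; rewrite lt_min => /andP[/hd h1 /hd' h2].
have -> : e * nrm z ^+ 2 = e / 2 * nrm z ^+ 2 + e / 2 * nrm z ^+ 2 + 0 by field.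
apply: (nrm_triangle3 (c := 0) _ h1 h2); last by rewrite nrm0.
ring.
Qed.

Lemma jet2_cst c : jet2 (fun=> c) c (fun=> 0) (fun=> 0).
Proof.
split; first by exists 0 => // z; rewrite nrm0 !mul0r.
by move=> e e0; exists 1 => // z _; rewrite !addr0 subrr nrm0 mulr_ge0 ?exprn_ge0 ?nrm_ge0 // ltW.
Qed.

Lemma jet2_sum (I : Type) (s : seq I) (F : I -> C -> C) (c : I -> C) (l q : I -> C -> C) :
  (forall i, jet2 (F i) (c i) (l i) (q i)) ->
  jet2 (fun z => \sum_(i <- s) F i z) (\sum_(i <- s) c i) (fun z => \sum_(i <- s) l i z) (fun z => \sum_(i <- s) q i z).
Proof.
move=> h; elim: s => [|i s IH].
  by apply: (jet2_ext (jet2_cst 0)) => [z||z|z]; rewrite big_nil.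
by apply: (jet2_ext (jet2D (h i) IH)) => [z||z|z]; rewrite big_cons.
Qed.

(** With errors [E] and [E'], the remainder is [F E'] plus [E] times the second jet, plus the
    products of total order at least 3; each receives a third of [e]. *)
Lemma jet2M F c l q F' c' l' q' : jet2 F c l q -> jet2 F' c' l' q' ->
  jet2 (fun z => F z * F' z) (c * c') (fun z => c * l' z + c' * l z)
       (fun z => c * q' z + l z * l' z + q z * c').
Proof.
move=> [[M M0 hM] h] [[M' M'0 hM'] h']; split.
  exists (nrm c * M' + nrm c' * M + M * M'); first by rewrite !addr_ge0 ?mulr_ge0 ?nrm_ge0.
  move=> z; have [a1 a2] := hM z; have [b1 b2] := hM' z; split.
    have -> : (nrm c * M' + nrm c' * M + M * M') * nrm z =
      nrm c * (M' * nrm z) + nrm c' * (M * nrm z) + M * M' * nrm z by ring.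
    apply: (nrm_triangle3 (c := 0)); first by rewrite addr0.
    - by rewrite nrmM ler_wpM2l // nrm_ge0.
    - by rewrite nrmM ler_wpM2l // nrm_ge0.
    - by rewrite nrm0 !mulr_ge0 ?nrm_ge0.
  have -> : (nrm c * M' + nrm c' * M + M * M') * nrm z ^+ 2 =
      nrm c * (M' * nrm z ^+ 2) + (M * nrm z) * (M' * nrm z) + M * nrm z ^+ 2 * nrm c' by ring.
  apply: (nrm_triangle3 erefl); rewrite nrmM.
  - by rewrite ler_wpM2l // nrm_ge0.
  - by apply: ler_pM; rewrite ?nrm_ge0.
  - by rewrite ler_wpM2r // nrm_ge0.
move=> e e0.
pose K := nrm c + M + M + 1; pose K' := nrm c' + M' + M' + 1.
have K0 : 0 < K by rewrite ltr_wpDl // !addr_ge0 ?nrm_ge0.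
have K'0 : 0 < K' by rewrite ltr_wpDl // !addr_ge0 ?nrm_ge0.
have ea : 0 < Num.min 1 (e / 3 / K') by rewrite lt_min ltr01 !divr_gt0.
have eb : 0 < e / 3 / K by rewrite !divr_gt0.
have [d d0 hd] := h _ ea; have [d' d'0 hd'] := h' _ eb.
pose L := 3 * (M * M') + 1.
have L0 : 0 < L by rewrite ltr_wpDl // !mulr_ge0.
exists (Num.min 1 (Num.min (e / 3 / L) (Num.min d d'))).
  by rewrite !lt_min ltr01 d0 d'0 !divr_gt0.
move=> z; rewrite !lt_min => /and4P[z1 zL zd zd'].
have [a1 a2] := hM z; have [b1 b2] := hM' z.
have := hd z zd; have := hd' z zd'.
have x0 := nrm_ge0 z; set x := nrm z in a1 a2 b1 b2 z1 zL x0 *.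
have xx : x ^+ 2 <= x by rewrite expr2 ler_piMl // ltW.
have xx0 : 0 <= x ^+ 2 by rewrite exprn_ge0.
set E' := F' z - _; set E := F z - _ => hE' hE.
have PM : nrm (c + l z + q z) <= K - 1.
  rewrite /K addrK; apply: (nrm_triangle3 erefl) => //.
    by apply: (le_trans a1); rewrite ler_piMr // ltW.
  by apply: (le_trans a2); rewrite ler_piMr // (le_trans xx) // ltW.
have PM' : nrm (c' + l' z + q' z) <= K' - 1.
  rewrite /K' addrK; apply: (nrm_triangle3 erefl) => //.
    by apply: (le_trans b1); rewrite ler_piMr // ltW.
  by apply: (le_trans b2); rewrite ler_piMr // (le_trans xx) // ltW.
have FK : nrm (F z) <= K.
  have -> : F z = E + (c + l z + q z) by rewrite subrK.
  apply: (le_trans (nrmD _ _)); rewrite -[K](subrK 1) [leRHS]addrC; apply: lerD => //.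
  apply: (le_trans hE); apply: (@le_trans _ _ (1 * x ^+ 2)); first by rewrite ler_wpM2r // ge_min lexx.
  by rewrite mul1r (le_trans xx) // ltW.
have -> : e * x ^+ 2 = e / 3 * x ^+ 2 + e / 3 * x ^+ 2 + e / 3 * x ^+ 2 by field.
apply: (nrm_triangle3 (a := F z * E') (b := E * (c' + l' z + q' z))
   (c := l z * q' z + q z * l' z + q z * q' z)).
- by rewrite /E' /E; ring.
- rewrite nrmM; apply: (@le_trans _ _ (K * (e / 3 / K * x ^+ 2))).
    by apply: ler_pM => //; rewrite nrm_ge0.
  by rewrite mulrA (mulrC K) divfK // gt_eqF.
- rewrite nrmM; apply: (@le_trans _ _ ((e / 3 / K' * x ^+ 2) * K')).
    apply: ler_pM; rewrite ?nrm_ge0 //.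
      by apply: (le_trans hE); rewrite ler_wpM2r // ge_min lexx orbT.
    by apply: (le_trans PM'); rewrite gerBl.
  by rewrite mulrAC divfK // gt_eqF.
- have x3 : x * x ^+ 2 <= e / 3 / L * x ^+ 2 by rewrite ler_wpM2r // ltW.
  have MM : 0 <= M * M' by rewrite mulr_ge0.
  apply: (@le_trans _ _ (M * M' * (x * x ^+ 2) + M * M' * (x * x ^+ 2) + M * M' * (x * x ^+ 2))).
    apply: (nrm_triangle3 erefl); rewrite nrmM.
    - rewrite (_ : M * M' * _ = (M * x) * (M' * x ^+ 2)); last ring.
      by apply: ler_pM; rewrite ?nrm_ge0.
    - rewrite (_ : M * M' * _ = (M * x ^+ 2) * (M' * x)); last ring.
      by apply: ler_pM; rewrite ?nrm_ge0.
    - apply: (@le_trans _ _ (M * x ^+ 2 * (M' * x ^+ 2))); first by apply: ler_pM; rewrite ?nrm_ge0.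
      rewrite (_ : _ * _ = M * M' * (x ^+ 2 * x ^+ 2)); last ring.
      by rewrite ler_wpM2l // ler_wpM2r.
  rewrite (_ : _ + _ + _ = (L - 1) * (x * x ^+ 2)); last by rewrite /L; ring.
  apply: (@le_trans _ _ (L * (x * x ^+ 2))); first by rewrite ler_wpM2r ?gerBl // mulr_ge0.
  by rewrite mulrC -ler_pdivlMr // mulrAC.
Qed.

Lemma jet2_poly (u b d : C) : jet2 (fun z => u + z * b + z ^+ 2 * d) u (fun z => z * b) (fun z => z ^+ 2 * d).
Proof.
split.
  exists (nrm b + nrm d); first by rewrite addr_ge0 ?nrm_ge0.
  move=> z; split; rewrite nrmM ?nrmX mulrC ler_wpM2r ?exprn_ge0 ?nrm_ge0 //.
    by rewrite lerDl nrm_ge0.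
  by rewrite lerDr nrm_ge0.
by move=> e e0; exists 1 => // z _; rewrite subrr nrm0 mulr_ge0 ?exprn_ge0 ?nrm_ge0 // ltW.
Qed.

Lemma jet2_conj F c l q : jet2 F c l q ->
  jet2 (fun z => (F z)^*) c^* (fun z => (l z)^*) (fun z => (q z)^*).
Proof.
move=> [[M M0 hM] h]; split; first by exists M => // z; rewrite !nrmJ.
move=> e e0; have [d d0 hd] := h _ e0; exists d => // z /hd.
by rewrite -nrmJ rmorphB !rmorphD.
Qed.

End Jets.

Section TaylorC.
Variables (R : realType) (n : nat).
Local Notation V := 'rV[R[i]]_n.
Implicit Types (f : V -> R[i]) (z v w : V) (W : set V).

Lemma taylor_ring (F : fieldType) (i s t f0 d1 d2 d11 d22 d21 : F) : i ^+ 2 = -1 ->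
  (2 : F) != 0 ->
  f0 + s * d1 + t * d2 + s ^+ 2 / 2 * d11 + t ^+ 2 / 2 * d22 + s * t * d21 =
  f0 + ((s + i * t) * (2^-1 * (d1 - i * d2)) + (s - i * t) * (2^-1 * (d1 + i * d2)))
  + ((s + i * t) ^+ 2 * (8^-1 * (d11 - d22) - i * 4^-1 * d21)
    + (s + i * t) * (s - i * t) * (4^-1 * (d11 + d22))
    + (s - i * t) ^+ 2 * (8^-1 * (d11 - d22) + i * 4^-1 * d21)).
Proof.
move=> i2 t0; have t4 : (4 : F) != 0 by rewrite (natrM _ 2 2) mulf_neq0.
have t8 : (8 : F) != 0 by rewrite (natrM _ 2 4) mulf_neq0.
by field: i2; rewrite ?t8 ?t4 ?t0.
Qed.

Lemma ReD (a b : R[i]) : complex.Re (a + b) = complex.Re a + complex.Re b.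
Proof. by case: a b => [? ?] [? ?]. Qed.
Lemma ImD (a b : R[i]) : complex.Im (a + b) = complex.Im a + complex.Im b.
Proof. by case: a b => [? ?] [? ?]. Qed.
Lemma ReB (a b : R[i]) : complex.Re (a - b) = complex.Re a - complex.Re b.
Proof. by case: a b => [? ?] [? ?]. Qed.
Lemma ImB (a b : R[i]) : complex.Im (a - b) = complex.Im a - complex.Im b.
Proof. by case: a b => [? ?] [? ?]. Qed.
Lemma Re_realM (k : R) (w : R[i]) : complex.Re (k%:C%C * w) = k * complex.Re w.
Proof. by rewrite ReM mul0r subr0. Qed.
Lemma Im_realM (k : R) (w : R[i]) : complex.Im (k%:C%C * w) = k * complex.Im w.
Proof. by rewrite ImM mul0r addr0. Qed.

Lemma half_sqr_real (k : R) : k%:C%C ^+ 2 / 2 = (k ^+ 2 / 2)%:C%C :> R[i].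
Proof. by rewrite rmorphM rmorphXn fmorphV rmorph_nat. Qed.

Lemma Re_quad (a0 a1 a2 a3 a4 a5 : R[i]) (x y : R) :
  complex.Re (a0 + x%:C%C * a1 + y%:C%C * a2 + x%:C%C ^+ 2 / 2 * a3 + y%:C%C ^+ 2 / 2 * a4 + x%:C%C * y%:C%C * a5) =
  complex.Re a0 + x * complex.Re a1 + y * complex.Re a2 + x ^+ 2 / 2 * complex.Re a3
  + y ^+ 2 / 2 * complex.Re a4 + x * y * complex.Re a5.
Proof. by rewrite !half_sqr_real -rmorphM !ReD !Re_realM. Qed.

Lemma Im_quad (a0 a1 a2 a3 a4 a5 : R[i]) (x y : R) :
  complex.Im (a0 + x%:C%C * a1 + y%:C%C * a2 + x%:C%C ^+ 2 / 2 * a3 + y%:C%C ^+ 2 / 2 * a4 + x%:C%C * y%:C%C * a5) =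
  complex.Im a0 + x * complex.Im a1 + y * complex.Im a2 + x ^+ 2 / 2 * complex.Im a3
  + y ^+ 2 / 2 * complex.Im a4 + x * y * complex.Im a5.
Proof. by rewrite !half_sqr_real -rmorphM !ImD !Im_realM. Qed.

Lemma jet_bound (A B a b c : R[i]) : exists2 M : R, 0 <= M & forall t : R[i],
  nrm (t * A + t^* * B) <= M * nrm t /\
  nrm (t ^+ 2 * a + t * t^* * b + t^* ^+ 2 * c) <= M * nrm t ^+ 2.
Proof.
exists (nrm A + nrm B + nrm a + nrm b + nrm c); first by rewrite !addr_ge0 ?nrm_ge0.
move=> t; have t0 := nrm_ge0 t; split.
  rewrite (le_trans (nrmD _ _)) // !nrmM nrmJ -mulrDr mulrC ler_wpM2r //.
  by rewrite -!addrA lerD2l lerDl !addr_ge0 ?nrm_ge0.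
have -> : (nrm A + nrm B + nrm a + nrm b + nrm c) * nrm t ^+ 2 =
    nrm a * nrm t ^+ 2 + nrm b * nrm t ^+ 2 + (nrm c * nrm t ^+ 2 + (nrm A + nrm B) * nrm t ^+ 2) by ring.
apply: (nrm_triangle3 erefl).
- by rewrite nrmM nrmX mulrC.
- by rewrite !nrmM nrmJ -expr2 mulrC.
- by rewrite nrmM nrmX nrmJ mulrC lerDl mulr_ge0 ?exprn_ge0 ?addr_ge0 ?nrm_ge0.
Qed.

(** This is [taylor2] in the real directions [v] and [i v], sorted by powers of [t] and its
    conjugate. [A] and [B] are the (1,0) and (0,1) derivatives along [v]; the coefficient of $t\bar
    t$ is the Levi form of [levi_sum]. *)
Lemma taylor2_jet W f z v : open W -> W z -> Ck 2 W f ->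
  let A := 2^-1 * (rderive v f z - 'i%C * rderive ('i%C *: v) f z) in
  let B := 2^-1 * (rderive v f z + 'i%C * rderive ('i%C *: v) f z) in
  let d11 := rderive v (rderive v f) z in
  let d22 := rderive ('i%C *: v) (rderive ('i%C *: v) f) z in
  let d21 := rderive ('i%C *: v) (rderive v f) z in
  jet2 (fun t => f (z + t *: v)) (f z) (fun t => t * A + t^* * B)
    (fun t => t ^+ 2 * (8^-1 * (d11 - d22) - 'i%C * 4^-1 * d21) + t * t^* * (4^-1 * (d11 + d22))
            + (t^*) ^+ 2 * (8^-1 * (d11 - d22) + 'i%C * 4^-1 * d21)).
Proof.
move=> oW Wz cf A B d11 d22 d21.
set a := 8^-1 * (d11 - d22) - 'i%C * 4^-1 * d21.
set c := 8^-1 * (d11 - d22) + 'i%C * 4^-1 * d21.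
set b := 4^-1 * (d11 + d22).
split.
  exact: jet_bound.
move=> e e0; have e2 : 0 < e / 2 by rewrite divr_gt0.
have [d1 d10 h1] := taylor2 v ('i%C *: v) oW Wz (Ck_Re cf) e2.
have [d2 d20 h2] := taylor2 v ('i%C *: v) oW Wz (Ck_Im cf) e2.
exists (Num.min d1 d2); first by rewrite lt_min d10.
move=> t; rewrite lt_min => /andP[td1 td2].
pose x := complex.Re t; pose y := complex.Im t.
have xt : `|x| <= nrm t by exact: Re_le_nrm.
have yt : `|y| <= nrm t by exact: Im_le_nrm.
have := h1 x y (le_lt_trans xt td1) (le_lt_trans yt td1).
have := h2 x y (le_lt_trans xt td2) (le_lt_trans yt td2).
have -> : z + x%:C%C *: v + y%:C%C *: ('i%C *: v) = z + t *: v.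
  by rewrite -addrA scalerA -scalerDl [t in RHS]complexE (mulrC y%:C%C).
have -> : x ^+ 2 + y ^+ 2 = nrm t ^+ 2 by rewrite nrm_sqr.
set T := f (z + t *: v).
set P := f z + x%:C%C * rderive v f z + y%:C%C * rderive ('i%C *: v) f z
  + x%:C%C ^+ 2 / 2 * d11 + y%:C%C ^+ 2 / 2 * d22 + x%:C%C * y%:C%C * d21.
have -> : f z + (t * A + t^* * B) + (t ^+ 2 * a + t * t^* * b + t^* ^+ 2 * c) = P.
  rewrite /P (taylor_ring _ _ _ _ _ _ _ _ (sqr_i R)) ?pnatr_eq0 //.
  by rewrite -(conjcE t) -(complexE t).
move=> hi hr.
have RP : complex.Re P = complex.Re (f z) + x * rd v (fun z => complex.Re (f z)) z
  + y * rd ('i%C *: v) (fun z => complex.Re (f z)) z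
  + x ^+ 2 / 2 * rd v (rd v (fun z => complex.Re (f z))) z
  + y ^+ 2 / 2 * rd ('i%C *: v) (rd ('i%C *: v) (fun z => complex.Re (f z))) z
  + x * y * rd ('i%C *: v) (rd v (fun z => complex.Re (f z))) z.
  exact: Re_quad.
have IP : complex.Im P = complex.Im (f z) + x * rd v (fun z => complex.Im (f z)) z
  + y * rd ('i%C *: v) (fun z => complex.Im (f z)) z
  + x ^+ 2 / 2 * rd v (rd v (fun z => complex.Im (f z))) z
  + y ^+ 2 / 2 * rd ('i%C *: v) (rd ('i%C *: v) (fun z => complex.Im (f z))) z
  + x * y * rd ('i%C *: v) (rd v (fun z => complex.Im (f z))) z.
  exact: Im_quad.
rewrite -RP -ReB in hr; rewrite -IP -ImB in hi.
apply: (le_trans (nrm_le_ReIm _)); apply: (le_trans (lerD hr hi)).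
by rewrite -mulrDl -splitr.
Qed.

End TaylorC.

(** * Discs produced by RC-positivity *)

Section Conj.
Variable R : realType.
Implicit Types x y : R[i].
Lemma cjM x y : (x * y)^* = x^* * y^*. Proof. exact: rmorphM. Qed.
Lemma cjD x y : (x + y)^* = x^* + y^*. Proof. exact: rmorphD. Qed.
Lemma cjN x : (- x)^* = - x^*. Proof. exact: rmorphN. Qed.
Lemma mulcJ x : x * x^* = (nrm x ^+ 2)%:C%C.
Proof.
by rewrite nrm_sqr; case: x => a b; apply/eqP; rewrite eq_complex /=; apply/andP; split; apply/eqP; ring.
Qed.
Lemma cj0 : (0 : R[i])^* = 0. Proof. exact: rmorph0. Qed.
Lemma cjK x : x^*^* = x. Proof. exact: conjcK. Qed.
Lemma cj_sum (I : Type) (s : seq I) (P : pred I) (F : I -> R[i]) :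
  (\sum_(i <- s | P i) F i)^* = \sum_(i <- s | P i) (F i)^*.
Proof. exact: rmorph_sum. Qed.
End Conj.

Lemma Ck_weaken (R : realType) n k (W : set 'rV[R[i]]_n) f : Ck k.+1 W f -> Ck k W f.
Proof.
elim: k f => [|k IH] f [cf h]; first by split.
by split=> // v; have [h1 h2] := h v; split => //; exact: IH.
Qed.

Section LocalDisc.
Variables (R : realType) (n r : nat).
Local Notation C := R[i].
Local Notation V := 'rV[R[i]]_n.
Implicit Types (X Y : 'I_r -> 'I_r -> C) (x y u : 'I_r -> C).

Definition sesq X x y : C := \sum_a \sum_b X a b * x a * (y b)^*.

Lemma sesqZl X x y c : sesq X (fun a => c * x a) y = c * sesq X x y.
Proof. by rewrite mulr_sumr; apply: eq_bigr => a _; rewrite mulr_sumr; apply: eq_bigr => b _; rewrite !mulrA (mulrC c). Qed.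
Lemma sesqZr X x y c : sesq X x (fun a => c * y a) = c^* * sesq X x y.
Proof. by rewrite mulr_sumr; apply: eq_bigr => a _; rewrite mulr_sumr; apply: eq_bigr => b _; rewrite cjM mulrCA. Qed.

Lemma conj_sesq X Y x y : (forall a b, Y b a = (X a b)^*) -> (sesq X x y)^* = sesq Y y x.
Proof.
move=> h; transitivity (\sum_a \sum_b (X a b * x a * (y b)^*)^*).
  by rewrite /sesq cj_sum; apply: eq_bigr => a _; rewrite cj_sum.
rewrite exchange_big; apply: eq_bigr => b _; apply: eq_bigr => a _.
by rewrite !cjM cjK h mulrAC.
Qed.

(** The left-hand sides here and in the next lemma are the first and second order parts that [jet2M]
    yields for the squared length of the lifted vector. *)
Lemma sesq_jet_lin H A B u b (t : C) :
  \sum_x \sum_y (H x y * u x * (t * b y)^* + (u y)^* * (H x y * (t * b x) + u x * (t * A x y + t^* * B x y))) =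
  t * (sesq H b u + sesq A u u) + t^* * (sesq H u b + sesq B u u).
Proof.
rewrite /sesq !mulrDr !mulr_sumr -!big_split; apply: eq_bigr => x _ /=.
rewrite !mulr_sumr -!big_split; apply: eq_bigr => y _ /=.
rewrite cjM; ring.
Qed.

Lemma sesq_jet_quad H A B al be ga u b d (t : C) :
  \sum_x \sum_y (H x y * u x * (t ^+ 2 * d y)^*
    + (H x y * (t * b x) + u x * (t * A x y + t^* * B x y)) * (t * b y)^*
    + (H x y * (t ^+ 2 * d x) + (t * A x y + t^* * B x y) * (t * b x)
       + (t ^+ 2 * al x y + t * t^* * be x y + t^* ^+ 2 * ga x y) * u x) * (u y)^*) =
  t ^+ 2 * (sesq H d u + sesq A b u + sesq al u u)
  + t^* ^+ 2 * (sesq H u d + sesq B u b + sesq ga u u)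
  + t * t^* * (sesq H b b + sesq A u b + sesq B b u + sesq be u u).
Proof.
rewrite /sesq !mulrDr !mulr_sumr -!big_split; apply: eq_bigr => x _ /=.
rewrite !mulr_sumr -!big_split; apply: eq_bigr => y _ /=.
rewrite !cjM; ring.
Qed.

Lemma sum4_prod (I J : finType) (c : C) (X Y : I -> J -> C) :
  \sum_p \sum_q \sum_a \sum_b c * X p a * Y q b = c * (\sum_a \sum_p X p a) * (\sum_b \sum_q Y q b).
Proof.
transitivity (c * (\sum_p \sum_a X p a) * (\sum_q \sum_b Y q b)); last first.
  by congr (c * _ * _); exact: exchange_big.
rewrite -mulrA mulr_suml mulr_sumr; apply: eq_bigr => p _.
rewrite !mulr_sumr; apply: eq_bigr => q _.
rewrite mulr_suml mulr_sumr; apply: eq_bigr => a _.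
by rewrite !mulr_sumr; apply: eq_bigr => b _; rewrite mulrA.
Qed.

(** Contracting with [v] first replaces coordinate derivatives of the metric by derivatives along
    [v], the form in which [disc_algebra] recognizes the curvature. *)
Lemma chern_sum (m : nat) (L : 'I_m -> 'I_m -> 'I_r -> 'I_r -> C) (J : 'I_r -> 'I_r -> C)
    (P Q : 'I_m -> 'I_r -> 'I_r -> C) (v : 'I_m -> C) u :
  \sum_p \sum_q \sum_a \sum_b (- L p q a b + \sum_g \sum_d J d g * P p a d * Q q g b)
    * v p * (v q)^* * u a * (u b)^* =
  - sesq (fun a b => \sum_p \sum_q v p * (v q)^* * L p q a b) u u
  + \sum_g \sum_d J d g * (\sum_a (\sum_p v p * P p a d) * u a)
       * (\sum_b (\sum_q (v q)^* * Q q g b) * (u b)^*).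
Proof.
transitivity (\sum_p \sum_q \sum_a \sum_b (- (v p * (v q)^* * L p q a b * u a * (u b)^*))
  + \sum_p \sum_q \sum_a \sum_b \sum_g \sum_d J d g * (v p * P p a d * u a) * ((v q)^* * Q q g b * (u b)^*)).
  rewrite -big_split; apply: eq_bigr => p _; rewrite -big_split; apply: eq_bigr => q _.
  rewrite -big_split; apply: eq_bigr => a _; rewrite -big_split; apply: eq_bigr => b _ /=.
  rewrite !mulrDl; congr (_ + _); first by ring.
  rewrite !mulr_suml; apply: eq_bigr => g _; rewrite !mulr_suml; apply: eq_bigr => d _; ring.
congr (_ + _).
  rewrite /sesq -sumrN.
  rewrite (eq_bigr (fun p => \sum_a \sum_b \sum_q - (v p * (v q)^* * L p q a b * u a * (u b)^*))); last first.
    by move=> p _; rewrite exchange_big; apply: eq_bigr => a _; rewrite exchange_big.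
  rewrite exchange_big; apply: eq_bigr => a _; rewrite exchange_big -sumrN; apply: eq_bigr => b _.
  rewrite !mulr_suml -sumrN; apply: eq_bigr => p _; rewrite !mulr_suml -sumrN; apply: eq_bigr => q _ //.
transitivity (\sum_g \sum_d \sum_p \sum_q \sum_a \sum_b J d g * (v p * P p a d * u a) * ((v q)^* * Q q g b * (u b)^*)).
  rewrite (eq_bigr (fun p => \sum_g \sum_d \sum_q \sum_a \sum_b J d g * (v p * P p a d * u a) * ((v q)^* * Q q g b * (u b)^*))); last first.
    move=> p _; rewrite (eq_bigr (fun q => \sum_g \sum_d \sum_a \sum_b J d g * (v p * P p a d * u a) * ((v q)^* * Q q g b * (u b)^*))); last first.
      move=> q _; rewrite (eq_bigr (fun a => \sum_g \sum_d \sum_b J d g * (v p * P p a d * u a) * ((v q)^* * Q q g b * (u b)^*))); last first.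
        by move=> a _; rewrite exchange_big; apply: eq_bigr => g _; rewrite exchange_big.
      by rewrite exchange_big; apply: eq_bigr => g _; rewrite exchange_big.
    by rewrite exchange_big; apply: eq_bigr => g _; rewrite exchange_big.
  by rewrite exchange_big; apply: eq_bigr => g _; rewrite exchange_big.
apply: eq_bigr => g _; apply: eq_bigr => d _.
rewrite (sum4_prod (J d g) (fun p a => v p * P p a d * u a) (fun q b => (v q)^* * Q q g b * (u b)^*)).
congr (_ * _ * _).
  by apply: eq_bigr => a _; rewrite mulr_suml.
by apply: eq_bigr => a _; rewrite mulr_suml.
Qed.

Lemma pos_form_unitmx X : (forall x, (exists a, x a != 0) -> 0 < sesq X x x) ->
  (\matrix_(a, b) X a b) \in unitmx.
Proof.
move=> hpos; rewrite unitmxE unitfE; apply/negP => /det0P [w w0 wX].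
have /rV0Pn[a wa] := w0.
have := hpos (fun a => w 0 a) (ex_intro _ a wa).
rewrite /sesq exchange_big big1 ?ltxx // => b _.
rewrite -mulr_suml; have := congr1 (fun M : 'rV_r => M 0 b) wX; rewrite !mxE => h.
have -> : \sum_i X i b * w 0 i = 0 by rewrite -[RHS]h; apply: eq_bigr => i _; rewrite mxE mulrC.
by rewrite mul0r.
Qed.

(** The four equations kill the coefficients of $t$, $\bar t$, $t^2$ and $\bar t^2$ in the squared
    length. What remains, the coefficient of $t\bar t$, is minus the curvature. *)
Lemma disc_algebra (H A B al ga : 'I_r -> 'I_r -> C) u :
  (forall a b, H b a = (H a b)^*) -> (forall a b, B b a = (A a b)^*) -> (forall a b, ga b a = (al a b)^*) ->
  (forall x, (exists a, x a != 0) -> 0 < sesq H x x) -> (exists a, u a != 0) ->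
  exists b d, [/\ sesq H b u + sesq A u u = 0, sesq H u b + sesq B u u = 0,
    sesq H d u + sesq A b u + sesq al u u = 0,
    sesq H u d + sesq B u b + sesq ga u u = 0 &
    forall be, sesq H b b + sesq A u b + sesq B b u + sesq be u u =
      - (- sesq be u u + \sum_g \sum_d invmx (\matrix_(x, y) H x y) d g * (\sum_x A x d * u x)
       * (\sum_y B g y * (u y)^*))].
Proof.
move=> hH hB hga hpos u0; set M := \matrix_(x, y) H x y.
have uM : M \in unitmx by exact: pos_form_unitmx.
pose w d := \sum_x A x d * u x.
(* The solution of [H(b, y) = - A(u, y)] for all [y]: minus the Chern connection form along [v]
   applied to [u]. *)
pose b g := - \sum_d invmx M d g * w d.
have hb c : \sum_g H g c * b g = - w c.
  under eq_bigr do rewrite /b mulrN mulr_sumr.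
  rewrite sumrN exchange_big /=; congr (- _).
  rewrite (eq_bigr (fun d => (invmx M *m M) d c * w d)); last first.
    by move=> d _; rewrite mxE mulr_suml; apply: eq_bigr => g _; rewrite mxE mulrA (mulrC (H g c)).
  rewrite mulVmx // (bigD1 c) //= mxE eqxx mul1r big1 ?addr0 // => d dc.
  by rewrite mxE (negbTE dc) mul0r.
have Hb y : sesq H b y = - sesq A u y.
  rewrite /sesq exchange_big [in RHS]exchange_big /= -sumrN; apply: eq_bigr => c _.
  by rewrite -!mulr_suml hb /w mulNr.
have Hb' y : sesq H y b = - sesq B y u.
  by rewrite -(conj_sesq b y hH) Hb cjN (conj_sesq u y hB).
have huu : sesq H u u != 0 by rewrite gt_eqF // hpos.
(* Only the value [H(d, u)] matters, so a multiple of [u] suffices for [d]. *)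
pose tau := - (sesq A b u + sesq al u u) / sesq H u u.
exists b, (fun a => tau * u a).
have d0 : sesq H (fun a => tau * u a) u + sesq A b u + sesq al u u = 0.
  by rewrite sesqZl /tau divfK // -addrA addNr.
split => //.
- by rewrite Hb addNr.
- by rewrite Hb' addNr.
- by rewrite -(conj_sesq _ _ hH) -(conj_sesq _ _ hB) -(conj_sesq _ _ hga) -!cjD d0 cj0.
(* The quadratic term of the curvature is [H(b, b)]. Each mixed term equals [- H(b, b)], so the
   coefficient is [be(u, u) - H(b, b)]. *)
move=> be; have -> : \sum_g \sum_d invmx M d g * (\sum_x A x d * u x) * (\sum_y B g y * (u y)^*) = sesq H b b.
  rewrite Hb' /sesq -sumrN; apply: eq_bigr => g _.
  rewrite -mulr_suml (_ : \sum_i _ = - b g); last by rewrite /b opprK.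
  by rewrite mulNr mulr_sumr; congr (- _); apply: eq_bigr => y _; rewrite mulrCA mulrA.
rewrite [sesq A u b](_ : _ = - sesq H b b); last by rewrite Hb opprK.
rewrite [sesq B b u](_ : _ = - sesq H b b); last by rewrite Hb' opprK.
ring.
Qed.

Lemma deriv_at_near (F G : R -> R) t c d : 0 < d -> (forall h, `|h| < d -> F (t + h) = G (t + h)) ->
  deriv_at F t c -> deriv_at G t c.
Proof.
move=> d0 FG hF e e0; have [d' d'0 hd'] := hF e e0.
exists (Num.min d d'); first by rewrite lt_min d0.
move=> h; rewrite lt_min => /andP[h1 h2]; have := FG 0; rewrite normr0 addr0 => /(_ d0) <-.
by rewrite -FG //; exact: hd'.
Qed.

(** Passes Hermitian symmetry from the metric to its derivatives, as [disc_algebra] requires. *)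
Lemma rderive_conj W (f g : V -> C) (z w : V) : open W -> W z -> Ck 1 W f ->
  (forall y : V, W y -> g y = (f y)^*) -> rderive w g z = (rderive w f z)^*.
Proof.
move=> oW Wz cf fg; have [e e0 he] := open_ball oW Wz.
have dd : 0 < e / (vn w + 1) by rewrite divr_gt0 // ltr_wpDl // vn_ge0.
have near h : `|h| < e / (vn w + 1) -> g (z + (0 + h)%:C%C *: w) = (f (z + (0 + h)%:C%C *: w))^*.
  move=> hh; apply: fg; apply: he; rewrite add0r addrAC subrr add0r vnZ nrm_real.
  apply: (@le_lt_trans _ _ (`|h| * (vn w + 1))); first by rewrite ler_wpM2l // lerDl.
  by rewrite -ltr_pdivlMr // ltr_wpDl // vn_ge0.
have rf : rderivable f z w by case: cf => _ /(_ w)[/(_ z Wz)].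
have [h1 h2] := rderivable_cderiv rf.
have conjRe (x : C) : complex.Re x^* = complex.Re x by case: x.
have conjIm (x : C) : complex.Im x^* = - complex.Im x by case: x.
apply: cderivE; split.
  rewrite conjRe; apply: (deriv_at_near dd _ h1) => h hh.
  by rewrite /real_slice near // conjRe.
rewrite conjIm -mulN1r; apply: (deriv_at_near dd _ (deriv_atM (-1) h2)) => h hh.
by rewrite /real_slice near // conjIm mulN1r.
Qed.

Let cj_i : ('i%C : C)^* = - 'i%C.
Proof. by apply/eqP; rewrite eq_complex /= oppr0 !eqxx. Qed.
Let cj_inv n0 : ((n0%:R : C)^-1)^* = (n0%:R : C)^-1.
Proof. by rewrite fmorphV rmorph_nat. Qed.

Lemma conj_half (x y x' y' : C) : x' = x^* -> y' = y^* ->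
  2^-1 * (x' + 'i%C * y') = (2^-1 * (x - 'i%C * y))^*.
Proof. by move=> -> ->; rewrite cjM cj_inv cjD cjN cjM cj_i mulNr opprK. Qed.

Lemma conj_eighth (x y w x' y' w' : C) : x' = x^* -> y' = y^* -> w' = w^* ->
  8^-1 * (x' - y') + 'i%C * 4^-1 * w' = (8^-1 * (x - y) - 'i%C * 4^-1 * w)^*.
Proof. by move=> -> -> ->; rewrite cjD cjN !cjM cjD cjN !cj_inv cj_i !mulNr opprK. Qed.

(** A disc at one point for one vector: the jets of the metric and of the lift are multiplied and
    [disc_algebra] is inserted. *)
Lemma local_disc W (z : V) (H : 'I_r -> 'I_r -> V -> C) (v : V) u : open W -> W z ->
  (forall a b, Ck 2 W (H a b)) -> (forall (y : V) a b, W y -> H b a y = (H a b y)^*) ->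
  (forall x, (exists a, x a != 0) -> 0 < sesq (fun a b => H a b z) x x) -> (exists a, u a != 0) ->
  0 < \sum_p \sum_q \sum_a \sum_b (- dz p (dzbar q (H a b)) z
    + \sum_g \sum_d invmx (\matrix_(x, y) H x y z) d g * dz p (H a d) z * dzbar q (H g b) z)
    * v 0 p * (v 0 q)^* * u a * (u b)^* ->
  exists b d, exists2 k : R, 0 < k & exists2 dl : R, 0 < dl & forall t, nrm t < dl ->
    let phi a := u a + t * b a + t ^+ 2 * d a in
    complex.Re (sesq (fun a b => H a b (z + t *: v)) phi phi) <=
    complex.Re (sesq (fun a b => H a b z) u u) - k * nrm t ^+ 2.
Proof.
move=> oW Wz cH hH hpos u0 hc.
pose D a b := rderive v (H a b) z; pose E a b := rderive ('i%C *: v) (H a b) z.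
pose d11 a b := rderive v (rderive v (H a b)) z.
pose d22 a b := rderive ('i%C *: v) (rderive ('i%C *: v) (H a b)) z.
pose d21 a b := rderive ('i%C *: v) (rderive v (H a b)) z.
have c1 a b : Ck 1 W (H a b) by apply: Ck_weaken; exact: cH.
have hD w a b : rderive w (H b a) z = (rderive w (H a b) z)^*.
  by apply: (rderive_conj w oW Wz (c1 a b)) => y Wy; exact: hH.
have hDD w w' a b : rderive w' (rderive w (H b a)) z = (rderive w' (rderive w (H a b)) z)^*.
  apply: (rderive_conj w' oW Wz (Ck_S w (cH a b))) => y Wy.
  by apply: (rderive_conj w oW Wy (c1 a b)) => y' Wy'; exact: hH.
pose A a b := 2^-1 * (D a b - 'i%C * E a b); pose B a b := 2^-1 * (D a b + 'i%C * E a b).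
pose al a b := 8^-1 * (d11 a b - d22 a b) - 'i%C * 4^-1 * d21 a b.
pose be a b := 4^-1 * (d11 a b + d22 a b).
pose ga a b := 8^-1 * (d11 a b - d22 a b) + 'i%C * 4^-1 * d21 a b.
pose H0 a b := H a b z.
have hB a b : B b a = (A a b)^*.
  exact: conj_half (hD v a b) (hD _ a b).
have hga a b : ga b a = (al a b)^*.
  exact: conj_eighth (hDD _ _ a b) (hDD _ _ a b) (hDD _ _ a b).
have [b [d [l1 l2 q1 q2 q3]]] := disc_algebra (fun a b => hH z a b Wz) hB hga hpos u0.
exists b, d.
have J (x y : 'I_r) := jet2M (jet2M (taylor2_jet v oW Wz (cH x y)) (jet2_poly (u x) (b x) (d x)))
   (jet2_conj (jet2_poly (u y) (b y) (d y))).
have JJ := jet2_sum (index_enum 'I_r) (fun x : 'I_r => jet2_sum (index_enum 'I_r) (J x)).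
set K := \sum_p _ in hc.
have KE : K = - sesq be u u + \sum_g \sum_d invmx (\matrix_(x, y) H x y z) d g * (\sum_x A x d * u x)
       * (\sum_y B g y * (u y)^*).
  rewrite /K (chern_sum (fun p q a b => dz p (dzbar q (H a b)) z) (invmx (\matrix_(x, y) H x y z))
    (fun p a d => dz p (H a d) z) (fun q g b => dzbar q (H g b) z) (v 0) u).
  congr (- _ + _).
    apply: eq_bigr => x _; apply: eq_bigr => y _; congr (_ * _ * _).
    exact: (levi_sum v oW Wz (cH x y)).
  apply: eq_bigr => g _; apply: eq_bigr => e _; congr (_ * _ * _).
    by apply: eq_bigr => x _; congr (_ * _); exact: (dz_sum v oW Wz (c1 x e)).
  by apply: eq_bigr => y _; congr (_ * _); exact: (dzbar_sum v oW Wz (c1 g y)).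
pose k := complex.Re K.
have K0 : K = k%:C%C by move: hc; rewrite ltcE /= => /andP[/eqP i0 _]; rewrite [LHS]complexE i0 mulr0 addr0.
have k0 : 0 < k by move: hc; rewrite K0 ltcR.
(* Half of the curvature absorbs the remainder, the other half is the guaranteed drop. *)
have [_ /(_ (k / 2))] := JJ; rewrite divr_gt0 // => /(_ isT)[dl dl0 hdl].
exists (k / 2); first by rewrite divr_gt0.
exists dl => // t td; cbv zeta.
pose phi a := u a + t * b a + t ^+ 2 * d a.
have := hdl t td.
rewrite (sesq_jet_lin H0 A B u b t) (sesq_jet_quad H0 A B al be ga u b d t).
rewrite l1 l2 q1 q2 q3 -KE K0 !mulr0 !add0r addr0.
pose S := sesq (fun a b => H a b (z + t *: v)) phi phi; pose T := sesq (fun a b => H a b z) u u.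
have -> : t * t^* * - k%:C%C = - (k * nrm t ^+ 2)%:C%C.
  by rewrite mulrN mulcJ -rmorphM mulrC.
set X := \sum_(i <- _) _; set Y := \sum_(i <- _) _.
have -> : X = S by [].
have -> : Y = T by [].
move=> /(le_trans (Re_le_nrm _)) /(le_trans (ler_norm _)).
rewrite -/S -/T ReB ReD -rmorphN /=; lra.
Qed.

End LocalDisc.

(** * Compact squares, balls and spheres *)

Section Compactness.
Variable R : realType.
Local Notation C := R[i].

Definition csquare (r : R) : set C := [set z | `|complex.Re z| <= r /\ `|complex.Im z| <= r].

Lemma continuous_mkcomplex : continuous (fun p : R^o * R^o => (Complex p.1 p.2 : C)).
Proof.
move=> p; apply/cvg_CP => e e0; have e2 : 0 < e / 2 by rewrite divr_gt0.
have c1 : {for p, continuous (fst : R^o * R^o -> R^o)} by exact: cvg_fst.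
have c2 : {for p, continuous (snd : R^o * R^o -> R^o)} by exact: cvg_snd.
have n1 : \forall q \near p, `|q.1 - p.1| < e / 2.
  by apply: (c1 [set x | `|x - p.1| < e / 2]); apply/nbhs_ballP; exists (e / 2) => // x; rewrite /ball /= distrC.
have n2 : \forall q \near p, `|q.2 - p.2| < e / 2.
  by apply: (c2 [set x | `|x - p.2| < e / 2]); apply/nbhs_ballP; exists (e / 2) => // x; rewrite /ball /= distrC.
apply: filterS2 n1 n2 => q h1 h2.
by apply: (le_lt_trans (nrm_le_ReIm _)) => /=; rewrite [ltRHS]splitr; apply: ltrD.
Qed.

Lemma compact_csquare r : compact (csquare r).
Proof.
have -> : csquare r = (fun p : R^o * R^o => (Complex p.1 p.2 : C)) @` ((`[- r, r] : set R^o) `*` (`[- r, r] : set R^o)).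
  apply/seteqP; split => [[a b] /= [ha hb]|z [[a b] /= [ha hb] <-]] /=.
    by exists (a, b) => //=; rewrite !in_itv /= -!ler_norml.
  by move: ha hb; rewrite !in_itv /= -!ler_norml.
apply: continuous_compact; first by apply: continuous_subspaceT; exact: continuous_mkcomplex.
by apply: compact_setX; exact: segment_compact.
Qed.

Lemma nrm_csquare r z : csquare r z -> nrm z <= 2 * r.
Proof. by move=> [h1 h2]; rewrite (le_trans (nrm_le_ReIm _)) // mulrDl mul1r lerD. Qed.

Lemma sq_boundary_nrm r (z : C) : sq_boundary r z -> r <= nrm z.
Proof. by move=> [_ [_ [<-|<-]]]; [exact: Re_le_nrm|exact: Im_le_nrm]. Qed.

Lemma sq_boundary_csquare r (z : C) : sq_boundary r z -> csquare r z.
Proof. by move=> [? []]. Qed.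

Variable n : nat.
Local Notation V := 'rV[R[i]]_n.
Definition cball (z : V) (r : R) : set V := [set y | vn (y - z) <= r].

Lemma closed_cball z r : closed (cball z r).
Proof.
rewrite closedE => y; apply: contra_notP => /negP; rewrite -ltNge => h.
apply/nbhs_VP; exists (vn (y - z) - r); first by rewrite subr_gt0.
move=> y' h'; apply/negP; rewrite -ltNge.
have := vnD (y - y') (y' - z); rewrite addrA subrK (vnB y y'); lra.
Qed.

Lemma compact_cball z r : compact (cball z r).
Proof.
have hB : compact [set y : V | forall j, [set w | csquare r (w - z 0 j)] (y ord0 j)].
  apply: (@rV_compact _ _ (fun j => [set w : C | csquare r (w - z 0 j)])) => j.
  have -> : [set w | csquare r (w - z 0 j)] = (fun w => w + z 0 j) @` csquare r.
    apply/seteqP; split => [w /= h|_ [w h <-]] /=; last by rewrite addrK.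
    by exists (w - z 0 j) => //; rewrite subrK.
  apply: continuous_compact; last exact: compact_csquare.
  apply: continuous_subspaceT => w; apply: continuousD; first exact: cvg_id.
  exact: cst_continuous.
apply: (subclosed_compact (@closed_cball z r) hB).
move=> y h j; have := le_trans (vn_coord (y - z) j) h; rewrite !mxE => hj.
by split; apply: le_trans hj; [exact: Re_le_nrm|exact: Im_le_nrm].
Qed.

Lemma compact_sphere : compact [set u : V | vn u = 1].
Proof.
apply: (@subclosed_compact _ _ (cball 0 1)); last by move=> u /= h; rewrite /cball /= subr0 h.
  rewrite closedE => u; apply: contra_notP => h.
  have h1 : 0 < `|vn u - 1| by rewrite normr_gt0 subr_eq0; apply/eqP.
  apply/nbhs_VP; exists `|vn u - 1| => // u' hu /= e; move: hu; apply/negP; rewrite -leNgt -e.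
  rewrite ler_norml; have := vnD (u' - u) u; have := vnD (u - u') u'; rewrite !subrK (vnB u); lra.
exact: compact_cball.
Qed.

End Compactness.

(** * Discs with a common contraction factor *)

Section UniformDisc.
Variables (R : realType) (n r : nat).
Local Notation C := R[i].
Local Notation V := 'rV[R[i]]_n.
Local Notation U := 'rV[R[i]]_r.

Lemma continuous_sum (T : topologicalType) (I : Type) (s : seq I) (F : I -> T -> C) (x : T) :
  (forall i, {for x, continuous (F i)}) -> {for x, continuous (fun y => \sum_(i <- s) F i y)}.
Proof.
move=> h; elim: s => [|i s IH].
  rewrite (_ : (fun y => _) = fun=> 0); last by apply/funext => y; rewrite big_nil.
  exact: cst_continuous.
rewrite (_ : (fun y => _) = F i + (fun y => \sum_(i <- s) F i y)); first exact: (continuousD (h i) IH).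
by apply/funext => y; rewrite big_cons.
Qed.

Lemma continuous_cj (T : topologicalType) (F : T -> C) (x : T) :
  {for x, continuous F} -> {for x, continuous (fun y => (F y)^*)}.
Proof.
move=> /cvg_CP h; apply/cvg_CP => e /h; apply: filterS => y.
by rewrite -cjN -cjD nrmJ.
Qed.

Lemma continuous_sesq (T : topologicalType) (X : 'I_r -> 'I_r -> T -> C) (x y : 'I_r -> T -> C) (p : T) :
  (forall a b, {for p, continuous (X a b)}) -> (forall a, {for p, continuous (x a)}) ->
  (forall a, {for p, continuous (y a)}) ->
  {for p, continuous (fun q => sesq (fun a b => X a b q) (fun a => x a q) (fun a => y a q))}.
Proof.
move=> hX hx hy; apply: continuous_sum => a; apply: continuous_sum => b.
by apply: continuousM; [apply: continuousM|apply: continuous_cj].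
Qed.

Lemma continuous_Re (T : topologicalType) (F : T -> C) (x : T) :
  {for x, continuous F} -> forall e : R, 0 < e -> \forall y \near x, `|complex.Re (F y) - complex.Re (F x)| < e.
Proof.
move=> /cvg_CP h e /h; apply: filterS => y; apply: le_lt_trans.
by rewrite -ReB; exact: Re_le_nrm.
Qed.

(* A disc z + t v with a lift u + t b + t^2 d along whose boundary the form H
   has dropped by the factor q; this is what RC-positivity provides. *)
Definition disc_at (H : 'I_r -> 'I_r -> V -> C) (z0 : V) (R0 q : R) (z : V) (u : 'I_r -> C) :=
  exists (v : V) (b d : 'I_r -> C), exists2 s : R, 0 < s &
   (forall t, csquare s t -> cball z0 R0 (z + t *: v)) /\
   forall t, sq_boundary s t -> let phi a := u a + t * b a + t ^+ 2 * d a in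
     complex.Re (sesq (fun a b => H a b (z + t *: v)) phi phi) <= q * complex.Re (sesq (fun a b => H a b z) u u).

(** Homogeneity in the fibre reduces the search for discs to unit vectors. *)
Lemma disc_atZ H z0 R0 q z u c : disc_at H z0 R0 q z u -> disc_at H z0 R0 q z (fun a => c * u a).
Proof.
move=> [v [b [d [s s0 [h1 h2]]]]]; exists v, (fun a => c * b a), (fun a => c * d a), s => //; split => // t /h2 /=.
have E X (w : 'I_r -> C) : complex.Re (sesq X (fun a => c * w a) (fun a => c * w a)) = nrm c ^+ 2 * complex.Re (sesq X w w).
  by rewrite sesqZl sesqZr mulrA mulcJ Re_realM.
rewrite E => h.
rewrite (_ : (fun a => _) = (fun a => c * (u a + t * b a + t ^+ 2 * d a))) ?E; last by apply/funext => a; ring.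
by rewrite mulrCA ler_wpM2l // exprn_ge0 // nrm_ge0.
Qed.

(** For a fixed unit vector the data [v], [b], [d], [s] of [local_disc] still work after a small
    change of the starting point and vector, with a slightly weaker drop; compactness of the sphere
    makes the factor uniform. *)
Lemma uniform_disc W (z0 : V) (H : 'I_r -> 'I_r -> V -> C) (R0 : R) : open W -> 0 < R0 -> cball z0 R0 `<=` W ->
  (forall a b, Ck 2 W (H a b)) -> (forall (y : V) a b, W y -> H b a y = (H a b y)^*) ->
  (forall x : 'I_r -> C, (exists a, x a != 0) -> 0 < sesq (fun a b => H a b z0) x x) ->
  (forall u : 'I_r -> C, (exists a, u a != 0) -> exists v : V,
    0 < \sum_p \sum_q \sum_a \sum_b (- dz p (dzbar q (H a b)) z0
    + \sum_g \sum_d invmx (\matrix_(x, y) H x y z0) d g * dz p (H a d) z0 * dzbar q (H g b) z0)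
    * v 0 p * (v 0 q)^* * u a * (u b)^*) ->
  exists2 e : R, 0 < e & exists2 q : R, 0 < q < 1 & forall z, vn (z - z0) < e ->
    forall u : 'I_r -> C, (exists a, u a != 0) -> disc_at H z0 R0 q z u.
Proof.
move=> oW R00 BW cH hH hpos hRC.
have Wz : W z0 by apply: BW; rewrite /cball /= subrr vn0 ltW.
(* One index governs radius and factor: both requirements weaken as [m] grows, so compactness can be
   used along the filter of large [m]. The shift by 2 keeps the factor positive at [m = 0]. *)
pose P (m : nat) (u : U) := forall z, vn (z - z0) < m.+1%:R^-1 -> disc_at H z0 R0 (1 - m.+2%:R^-1) z (u 0).
suff : \forall m \near \oo, [set u : U | vn u = 1] `<=` P m.
  move=> [m _ /(_ m (leqnn m)) hm]; exists m.+1%:R^-1; first by rewrite invr_gt0.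
  exists (1 - m.+2%:R^-1).
    by rewrite subr_gt0 invf_lt1 // ltr1n /= gtrBl invr_gt0.
  move=> z zz u [a ua]; pose w : U := \row_a u a.
  have w0 : vn w != 0.
    rewrite vn_eq0; apply: contraNneq ua => /(congr1 (fun w : U => w 0 a)).
    by rewrite !mxE => ->.
  have := hm (((vn w)^-1)%:C%C *: w); rewrite /= vnZ nrm_real ger0_norm ?invr_ge0 ?vn_ge0 // mulVf //.
  move=> /(_ erefl z zz) /(disc_atZ (vn w)%:C%C).
  rewrite (_ : (fun a => _) = u) //; apply/funext => b.
  by rewrite !mxE mulrA -rmorphM divff // mul1r.
apply: (compact_near_coveringP _).1; first exact: compact_sphere.
move=> u0 /= u01; have u0n : exists a, u0 0 a != 0.
  apply/existsP; move: u01; apply: contra_eqT; rewrite negb_exists => /forallP h.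
  rewrite (_ : u0 = 0) ?vn0 1?eq_sym ?oner_eq0 //; apply/rowP => a; rewrite mxE.
  by apply/eqP; have := h a; rewrite negbK.
have [v hv] := hRC _ u0n.
have [b [d [k k0 [dl dl0 hdl]]]] := local_disc oW Wz cH hH hpos u0n hv.
(* The first bound keeps the square inside the disc of radius [dl]; the second moves a point by at
   most [R0 / 4], which fits starting points within [R0 / 2] of [z0]. *)
pose s := Num.min (dl / 4) (R0 / (8 * (vn v + 1))).
have vp : 0 < vn v + 1 by rewrite ltr_wpDl // vn_ge0.
have s0 : 0 < s by rewrite lt_min !divr_gt0 // mulr_gt0.
have s1 : 2 * s < dl.
  apply: (@le_lt_trans _ _ (2 * (dl / 4))); first by rewrite ler_wpM2l // ge_min lexx.
  by rewrite mulrCA gtr_pMr //; lra.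
have s2 : 2 * s * vn v <= R0 / 4.
  apply: (@le_trans _ _ (2 * (R0 / (8 * (vn v + 1))) * (vn v + 1))).
    apply: ler_pM; [by rewrite mulr_ge0 // ltW|exact: vn_ge0| |by rewrite lerDl].
    by rewrite ler_wpM2l // ge_min lexx orbT.
  by rewrite le_eqVlt; apply/orP; left; apply/eqP; field; rewrite gt_eqF.
pose h0 := complex.Re (sesq (fun a b => H a b z0) (u0 0) (u0 0)).
have h00 : 0 < h0 by have := hpos _ u0n; rewrite ltcE => /andP[].
(* Boundary points of the square satisfy [s <= nrm t], so the length drops there by at least
   [eta]. *)
pose eta := k * s ^+ 2.
have eta0 : 0 < eta by rewrite mulr_gt0 // exprn_gt0.
pose F (x : C * (V * U)) := sesq (fun a b => H a b (x.2.1 + x.1 *: v))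
  (fun a => x.2.2 0 a + x.1 * b a + x.1 ^+ 2 * d a) (fun a => x.2.2 0 a + x.1 * b a + x.1 ^+ 2 * d a).
have contF t : csquare s t -> {for (t, (z0, u0)), continuous F}.
  move=> st; apply: continuous_sesq => [a c|a|a].
  - have Wt : W (z0 + t *: v).
      apply: BW; rewrite /cball /= addrAC subrr add0r vnZ.
      apply: (@le_trans _ _ (2 * s * vn v)); first by rewrite ler_wpM2r ?vn_ge0 // nrm_csquare.
      by apply: (le_trans s2); rewrite ler_pdivrMr // ler_pMr // ler1n.
    have cHt : {for z0 + t *: v, continuous (H a c)} by have [h _] := cH a c; exact: h.
    apply: (@continuous_comp _ _ _ (fun x : C * (V * U) => x.2.1 + x.1 *: v) (H a c)) => //.
    apply: continuousD.
      by apply: continuous_comp; [exact: cvg_snd|exact: cvg_fst].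
    by apply: cvgZr_tmp; exact: cvg_fst.
  - apply: continuousD; first apply: continuousD.
    + apply: (@continuous_comp _ _ _ (fun x : C * (V * U) => x.2.2) (fun u : U => u 0 a)).
        by apply: continuous_comp; [exact: cvg_snd|exact: cvg_snd].
      exact: coord_continuous.
    + by apply: continuousM; [exact: cvg_fst|exact: cst_continuous].
    + by apply: continuousM; [apply: continuousM; exact: cvg_fst|exact: cst_continuous].
  - apply: continuousD; first apply: continuousD.
    + apply: (@continuous_comp _ _ _ (fun x : C * (V * U) => x.2.2) (fun u : U => u 0 a)).
        by apply: continuous_comp; [exact: cvg_snd|exact: cvg_snd].
      exact: coord_continuous.
    + by apply: continuousM; [exact: cvg_fst|exact: cst_continuous].
    + by apply: continuousM; [apply: continuousM; exact: cvg_fst|exact: cst_continuous].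
have Fe t (x : V * U) : F (t, x) = sesq (fun a b => H a b (x.1 + t *: v))
  (fun a => x.2 0 a + t * b a + t ^+ 2 * d a) (fun a => x.2 0 a + t * b a + t ^+ 2 * d a) by [].
have e4 : 0 < eta / 4 by rewrite divr_gt0.
(* on the boundary of the square the inequality is strict, hence stable *)
have near_bd : \forall x \near (z0, u0), csquare s `<=`
    [set t | sq_boundary s t -> complex.Re (F (t, x)) < h0 - eta / 2].
  apply: ((compact_near_coveringP _).1 (@compact_csquare R s) (V * U)%type (nbhs (z0, u0))
    (fun x t => sq_boundary s t -> complex.Re (F (t, x)) < h0 - eta / 2)) => t st.
  have [bt|nbt] := pselect (sq_boundary s t).
    have tdl : nrm t < dl by apply: le_lt_trans s1; exact: nrm_csquare.
    have := hdl t tdl; cbv zeta; rewrite -/h0 => ht.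
    have ht2 : complex.Re (F (t, (z0, u0))) <= h0 - eta.
      apply: (le_trans ht); rewrite lerD2l lerN2 /eta; apply: ler_wpM2l; first exact: ltW.
      have st' := sq_boundary_nrm bt.
      by rewrite lerXn2r ?nnegrE //; [exact: ltW|exact: (le_trans (ltW s0))].
    have cF := continuous_Re (contF t st) e4.
    apply: (@filterS _ (nbhs (t, (z0, u0))) _ _ _ _ cF) => -[t' x'] /= h _.
    by move: h; rewrite ltr_norml => /andP[_]; lra.
  (* Compactness is applied to the whole square; near an interior point the condition on boundary
     points is void. *)
  have : \forall t' \near t, ~ sq_boundary s t'.
    have ho : `|complex.Re t| < s /\ `|complex.Im t| < s.
      case: st => t1 t2; rewrite !lt_def t1 t2 !andbT; split; apply/eqP => h; apply: nbt; split => //; split => //; [left|right]; exact/esym.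
    apply/nbhs_CP; exists (Num.min (s - `|complex.Re t|) (s - `|complex.Im t|)).
      by case: ho => ho1 ho2; rewrite lt_min !subr_gt0 ho1 ho2.
    move=> t'; rewrite lt_min => /andP[h1 h2] [_ [_ hb]].
    have k1 := le_lt_trans (Re_le_nrm (t' - t)) h1; have k2 := le_lt_trans (Im_le_nrm (t' - t)) h2.
    rewrite ReB in k1; rewrite ImB in k2.
    have j1 := ler_normD (complex.Re t' - complex.Re t) (complex.Re t).
    have j2 := ler_normD (complex.Im t' - complex.Im t) (complex.Im t).
    by rewrite !subrK in j1 j2; case: hb => hb; lra.
  move=> nt; exists ([set t' | ~ sq_boundary s t'], setT) => /=; first by split => //; exact: filterT.
  by move=> [t' x'] /= [h _] /h.
have near_h : \forall x \near (z0, u0), h0 - eta / 4 < complex.Re (F (0, x)).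
  have s00 : csquare s 0 by split; rewrite /= normr0 ltW.
  have c0 := continuous_Re (contF 0 s00) e4.
  have F0 : complex.Re (F (0, (z0, u0))) = h0.
    rewrite /F /h0 /= scale0r addr0; congr (complex.Re (sesq _ _ _)); apply/funext => a; rewrite expr0n /= !mul0r !addr0 //.
  move: c0 => [[A B] /= [hA hB] AB]; apply: filterS hB => x Bx.
  have := AB (0, x) (conj (nbhs_singleton hA) Bx) => /=.
  rewrite F0 ltr_norml => /andP[+ _]; lra.
have near_z : \forall x \near (z0, u0), vn (x.1 - z0) < R0 / 2.
  have c1 : {for (z0, u0), continuous (fst : V * U -> V)} by exact: cvg_fst.
  by apply: (c1 [set y | vn (y - z0) < R0 / 2]); apply/nbhs_VP; exists (R0 / 2) => //; rewrite divr_gt0.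
(* A half of [eta] survives on the boundary and a quarter may be lost at the centre; the gap turns
   the additive drop into a factor below 1. *)
have [M hM] : exists M : nat, forall m, (M <= m)%N -> h0 - eta / 2 <= (1 - m.+2%:R^-1) * (h0 - eta / 4).
  exists (Num.bound (4 * `|h0 - eta / 4| / eta)) => m Mm.
  have b0 : 0 <= 4 * `|h0 - eta / 4| / eta by rewrite divr_ge0 ?mulr_ge0 // ltW.
  have mp : 0 < (m.+2%:R : R) by rewrite ltr0n.
  have hb : 4 * `|h0 - eta / 4| / eta <= m.+2%:R.
    apply: (le_trans (ltW (archi_boundP b0))); rewrite ler_nat; apply: (leq_trans Mm).
    by rewrite -addn2 leq_addr.
  have : m.+2%:R^-1 * `|h0 - eta / 4| <= eta / 4.
    by rewrite mulrC ler_pdivrMr //; rewrite ler_pdivrMr // in hb; lra.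
  have := ler_norm (h0 - eta / 4); have : 0 <= m.+2%:R^-1 :> R by rewrite invr_ge0 ltW.
  move=> i0 hn hh; have : m.+2%:R^-1 * (h0 - eta / 4) <= m.+2%:R^-1 * `|h0 - eta / 4| by rewrite ler_wpM2l.
  rewrite mulrBl mul1r => h3; move: (le_trans h3 hh) eta0; move: (m.+2%:R^-1 * _) => x; lra.
have : nbhs (z0, u0) [set x : V * U | forall m, (M <= m)%N -> disc_at H z0 R0 (1 - m.+2%:R^-1) x.1 (fun a => x.2 0 a)].
  apply: filterS3 near_bd near_h near_z => x hb hh hz m Mm.
  exists v, b, d, s => //; split.
    move=> t st; rewrite /cball /= addrAC; apply: (le_trans (vnD _ _)); rewrite vnZ.
    have : nrm t * vn v <= 2 * s * vn v by rewrite ler_wpM2r ?vn_ge0 // nrm_csquare.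
    by move: hz s2; lra.
  move=> t bt; cbv zeta; rewrite -(Fe t x).
  apply: (le_trans (ltW (hb t (sq_boundary_csquare bt) bt))); apply: (le_trans (hM m Mm)).
  apply: ler_wpM2l; first by rewrite subr_ge0 invf_le1 // ler1n.
  apply: (le_trans (ltW hh)); rewrite (Fe 0 x) scale0r addr0 le_eqVlt; apply/orP; left; apply/eqP.
  congr (complex.Re (sesq _ _ _)); apply/funext => a; rewrite expr0n /= !mul0r !addr0 //.
move=> [[A B] /= [/nbhs_VP[e e0 hA] hB] AB].
have [M' hM'] : exists M' : nat, forall m, (M' <= m)%N -> (m.+1%:R^-1 : R) <= e.
  exists (Num.bound e^-1) => m hm; rewrite invf_ple ?posrE ?ltr0n //.
  apply: (le_trans (ltW (archi_boundP _))); first by rewrite invr_ge0 ltW.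
  by rewrite ler_nat; apply: (leq_trans hm).
exists (B, [set m | (maxn M M' <= m)%N]) => /=; first by split => //; exists (maxn M M').
move=> [u m] /= [Bu]; rewrite geq_max => /andP[m1 m2] z hz.
by apply: (AB (z, u)) => //; split => //=; apply: hA; apply: lt_le_trans hz _; exact: hM'.
Qed.

End UniformDisc.

(** * Symmetric powers as polynomials *)

Section SymEval.
Variables (K : comNzRingType) (r l : nat).
Implicit Types (u : 'I_r -> K).

Lemma sort_leq_ord (t : seq 'I_r) : sorted leq (map val (sort (fun a b : 'I_r => (a <= b)%N) t)).
Proof. by rewrite sorted_map; apply: sort_sorted => a b; exact: leq_total. Qed.

Lemma sorted_leq_inj (t u : seq 'I_r) :
  sorted leq (map val t) -> sorted leq (map val u) -> perm_eq t u -> t = u.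
Proof.
rewrite !sorted_map; apply: sorted_eq.
- by move=> a b c; exact: leq_trans.
- by move=> a b /anti_leq /val_inj.
Qed.

Lemma sym_mono_sorted (M : 'I_#|sym_basis r l|) : sorted leq (map val (sym_mono M)).
Proof. by have := enum_valP M; rewrite inE. Qed.

Lemma sym_mono_ex (p : l.-tuple 'I_r) : exists P : 'I_#|sym_basis r l|, perm_eq p (sym_mono P).
Proof.
have sp : [tuple of sort (fun a b : 'I_r => (a <= b)%N) p] \in sym_basis r l by rewrite inE sort_leq_ord.
exists (enum_rank_in sp [tuple of sort (fun a b : 'I_r => (a <= b)%N) p]).
by rewrite /sym_mono enum_rankK_in // perm_sym perm_sort.
Qed.

Lemma sym_mono_uniq (P Q : 'I_#|sym_basis r l|) : perm_eq (sym_mono P) (sym_mono Q) -> P = Q.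
Proof.
by move=> h; apply: enum_val_inj; apply: val_inj; apply: sorted_leq_inj => //; exact: sym_mono_sorted.
Qed.

(** Each tuple is a rearrangement of exactly one nondecreasing tuple. *)
Lemma sum_sym_mono (F : l.-tuple 'I_r -> K) :
  \sum_(M : 'I_#|sym_basis r l|) \sum_(t : l.-tuple 'I_r | perm_eq t (sym_mono M)) F t = \sum_t F t.
Proof.
rewrite (exchange_big_dep predT) //=; apply: eq_bigr => t _.
have [P tP] := sym_mono_ex t; rewrite (bigD1 P) //= big1 ?addr0 // => Q /andP[tQ].
rewrite (@sym_mono_uniq Q P) ?eqxx //; apply: perm_trans tP; by rewrite perm_sym.
Qed.

(** The homogeneous polynomial of degree [l] with coefficients [w]: an element of the symmetric
    power of the dual evaluated on the power of a vector. *)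
Definition symeval (w : 'I_#|sym_basis r l| -> K) u : K :=
  \sum_M w M * \prod_(k < l) u (tnth (sym_mono M) k).

(** The action of [symmx] on coefficients is linear substitution with the transpose on vectors, as
    expected of a dual. *)
Lemma symeval_trans (g : 'M[K]_r) w u :
  symeval (fun M => \sum_N symmx l g M N * w N) u = symeval w (fun a => \sum_b g b a * u b).
Proof.
rewrite /symeval.
transitivity (\sum_(N : 'I_#|sym_basis r l|) \sum_(M : 'I_#|sym_basis r l|) \sum_(t : l.-tuple 'I_r | perm_eq t (sym_mono M))
   w N * \prod_(k < l) (g (tnth t k) (tnth (sym_mono N) k) * u (tnth t k))).
  rewrite exchange_big; apply: eq_bigr => M _; rewrite mulr_suml; apply: eq_bigr => N _.
  rewrite mxE !mulr_suml; apply: eq_bigr => t tM.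
  have E (v : l.-tuple 'I_r) : \prod_(k < l) u (tnth v k) = \prod_(x <- v) u x by rewrite big_tuple.
  by rewrite big_split /= !E (perm_big _ tM) /= [in RHS]mulrCA mulrA.
apply: eq_bigr => N _; rewrite sum_sym_mono -mulr_sumr; congr (_ * _).
rewrite bigA_distr_bigA /=.
rewrite (reindex (fun p : l.-tuple 'I_r => [ffun k => tnth p k])) /=; last first.
  exists (fun f : {ffun 'I_l -> 'I_r} => [tuple f i | i < l]) => [p _|f _].
    by apply: eq_from_tnth => i; rewrite tnth_mktuple ffunE.
  by apply/ffunP => i; rewrite ffunE tnth_mktuple.
by apply: eq_bigr => p _; apply: eq_bigr => k _; rewrite ffunE.
Qed.

End SymEval.

Lemma digits_inj (b : nat) (s : nat) (f g : nat -> nat) : (forall a, f a < b)%N -> (forall a, g a < b)%N ->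
  (\sum_(a < s) f a * b ^ a = \sum_(a < s) g a * b ^ a)%N -> forall a, (a < s)%N -> f a = g a.
Proof.
elim: s f g => [//|s IH] f g hf hg; rewrite !big_ord_recl /= !expn0 !muln1.
have E (h : nat -> nat) : (\sum_(i < s) h (bump 0 i) * b ^ bump 0 i = b * \sum_(i < s) h i.+1 * b ^ i)%N.
  by rewrite big_distrr; apply: eq_bigr => i _; rewrite /bump add1n expnS mulnCA.
rewrite !E => h; have h0 : f 0%N = g 0%N.
  have := congr1 (fun x => x %% b)%N h; rewrite ![(_ + b * _)%N]addnC ![(b * _)%N]mulnC !modnMDl.
  by rewrite !modn_small.
case=> [_|a]; first exact: h0.
rewrite ltnS => ra; apply: (IH (fun a => f a.+1) (fun a => g a.+1)) => //.
have b0 : (0 < b)%N by exact: leq_ltn_trans (hf 0%N).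
by apply/eqP; rewrite -(eqn_pmul2l b0); apply/eqP; move: h; rewrite h0 => /addnI.
Qed.

Lemma sum_count (r b : nat) (s : seq 'I_r) :
  (\sum_(x <- s) b ^ x = \sum_(a < r) count (fun x : 'I_r => val x == a) s * b ^ a)%N.
Proof.
elim: s => [|x s IH]; first by rewrite big_nil big1.
rewrite big_cons IH [in LHS](bigD1 x) //= [in RHS](bigD1 x) //= eqxx mulnDl mul1n -!addnA.
congr (_ + (_ + _))%N; apply: eq_bigr => a ax; rewrite (_ : (val x == a) = false) //.
by apply/negbTE; rewrite eq_sym.
Qed.

(** Kronecker's substitution $u_a = x^{b^a}$ with $b = l+1$: the multiplicities of a monomial are at
    most $l$, hence digits of its exponent in base $b$, so different monomials stay different. The
    resulting polynomial in one variable vanishes at all natural numbers. *)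
Lemma symeval_inj (K : numFieldType) (r l : nat) (w : 'I_#|sym_basis r l| -> K) :
  (forall u, symeval w u = 0) -> forall M, w M = 0.
Proof.
move=> h M0; pose b := l.+1.
pose e (M : 'I_#|sym_basis r l|) := (\sum_(k < l) b ^ tnth (sym_mono M) k)%N.
have e_inj M M' : e M = e M' -> M = M'.
  have E (t : l.-tuple 'I_r) : (\sum_(k < l) b ^ tnth t k = \sum_(x <- t) b ^ x)%N by rewrite big_tuple.
  rewrite /e !E !sum_count => eM; apply: sym_mono_uniq; apply/allP => x _ /=.
  have lt (t : 'I_#|sym_basis r l|) : forall a, (count (fun x : 'I_r => val x == a) (sym_mono t) < b)%N.
    by move=> a; rewrite /b ltnS (leq_trans (count_size _ _)) // size_tuple.
  have := digits_inj (lt M) (lt M') eM (ltn_ord x).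
  by rewrite (eq_count (a2 := pred1 x)) // => ->; rewrite (eq_count (a2 := pred1 x)).
pose p : {poly K} := \sum_M w M *: 'X^(e M).
have p0 : p = 0.
  apply: (@roots_geq_poly_eq0 _ p [seq n%:R | n <- iota 0 (size p)]).
  - apply/allP => _ /mapP[n _ ->]; apply/rootP.
    rewrite horner_sum -[RHS](h (fun a => n%:R ^+ (b ^ a))); apply: eq_bigr => M _.
    rewrite hornerZ hornerXn; congr (_ * _); by rewrite -prodrXr /e.
  - by rewrite map_inj_uniq ?iota_uniq // => m n /eqP; rewrite eqr_nat => /eqP.
  - by rewrite size_map size_iota.
have := congr1 (fun q : {poly K} => q`_(e M0)) p0.
rewrite coef0 coef_sum (bigD1 M0) //= coefZ coefXn eqxx mulr1 big1 ?addr0 // => M MM.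
rewrite coefZ coefXn; case: eqP => [/e_inj eM|_]; last by rewrite mulr0.
by rewrite eM eqxx in MM.
Qed.

(** * Charts and patches *)

Section Charts.
Variables (R : realType) (X : complex_manifold R).
Local Notation n := (mfd_dim X).
Local Notation V := 'rV[R[i]]_n.
Implicit Types (c : chart R X n) (O : set X).

Lemma chart_inv_continuous c z : (chart_fun c @` chart_dom c) z -> {for z, continuous (chart_inv c)}.
Proof.
move=> hz; have := chart_inv_cont (c := c).
rewrite (continuous_open_subspace _ (@chart_img_open _ _ _ c)) // => /(_ z); apply.
by rewrite inE.
Qed.

Lemma chart_fun_continuous c x : chart_dom c x -> {for x, continuous (chart_fun c)}.
Proof.
move=> hx; have := chart_fun_cont (c := c).
rewrite (continuous_open_subspace _ (@chart_dom_open _ _ _ c)) // => /(_ x); apply.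
by rewrite inE.
Qed.

Lemma chart_img_open_sub c O : open O -> open (chart_fun c @` (O `&` chart_dom c)).
Proof.
move=> oO; rewrite openE => _ [x [Ox dx] <-]; rewrite /interior.
have iz : (chart_fun c @` chart_dom c) (chart_fun c x) by exists x.
have n1 : nbhs (chart_fun c x) (chart_inv c @^-1` O).
  apply: (chart_inv_continuous iz); rewrite chart_funK //; exact: open_nbhs_nbhs.
have n2 : nbhs (chart_fun c x) (chart_fun c @` chart_dom c).
  by apply: open_nbhs_nbhs; split => //; exact: chart_img_open.
apply: filterS (filterI n1 n2) => w /= [h [y dy yw]]; exists y => //; split => //.
by rewrite -yw chart_funK in h.
Qed.

Lemma chart_ball c O x : open O -> O x -> chart_dom c x -> exists2 e : R, 0 < e &
  cball (chart_fun c x) e `<=` chart_fun c @` (O `&` chart_dom c).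
Proof.
move=> oO Ox dx; have [|e e0 he] := open_ball (@chart_img_open_sub c O oO) (z := chart_fun c x).
  by exists x.
exists (e / 2); first by rewrite divr_gt0.
by move=> y hy; apply: he; apply: (le_lt_trans hy); lra.
Qed.

Lemma img_inv c O z : (chart_fun c @` (O `&` chart_dom c)) z ->
  [/\ O (chart_inv c z), chart_dom c (chart_inv c z) & chart_fun c (chart_inv c z) = z].
Proof. by move=> [x [Ox dx] <-]; rewrite !chart_funK. Qed.

Lemma chart_nbhs c x (P : set V) : chart_dom c x -> nbhs (chart_fun c x) P ->
  nbhs x [set y | chart_dom c y /\ P (chart_fun c y)].
Proof.
move=> dx nP; have n1 := chart_fun_continuous dx nP.
have n2 : nbhs x (chart_dom c) by apply: open_nbhs_nbhs; split => //; exact: chart_dom_open.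
by apply: filterS (filterI n2 n1).
Qed.

Lemma cball_sub (z : V) (r s : R) : r <= s -> cball z r `<=` cball z s.
Proof. by move=> rs y; rewrite /cball /= => /le_trans; apply. Qed.

End Charts.

(** * Finite covers and uniform constants *)

Section Compactness.
Variable R : realType.

(** The filter form of compactness along the filter of large reals. Conditions of the form
    sufficiently small are fed to it through their inverses. *)
Lemma compact_exists_bound (T : topologicalType) (K : set T) (P : T -> R -> Prop) : compact K ->
  (forall y m m', m <= m' -> P y m -> P y m') ->
  (forall x, K x -> exists m, \forall y \near x, P y m) -> exists2 m, 0 <= m & forall x, K x -> P x m.
Proof.
move=> cK mono hP.
have : \forall m \near +oo, K `<=` P^~ m.
  apply: ((compact_near_coveringP _).1 cK R +oo (fun m x => P x m)) => x Kx.
  have [m hm] := hP x Kx.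
  exists ([set y | P y m], [set m' | m <= m']) => /=; last by move=> [y m'] [/= h1 h2]; apply: mono h2 h1.
  by split => //; exists m; split; [exact: num_real|move=> y /ltW].
move=> [m [_ hm]]; exists (`|m| + 1); first by rewrite addr_ge0.
by move=> x Kx; apply: (hm (`|m| + 1)) => //; rewrite (le_lt_trans (ler_norm m)) // ltrDl.
Qed.

(** The filter form of compactness, along the filter of finite lists directed by inclusion; the
    cover is indexed by points. *)
Lemma finite_cover (T : topologicalType) (N : T -> set T) : compact [set: T] -> (forall x, nbhs x (N x)) ->
  exists s : seq T, forall y, exists2 x, x \in s & N x y.
Proof.
move=> cT hN.
pose F : set_system (seq T) := [set P | exists s0 : seq T, forall s : seq T, {subset s0 <= s} -> P s].
have FF : Filter F.
  split; first by exists [::].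
  - move=> P Q [s hs] [t ht]; exists (s ++ t) => w sw; split; [apply: hs|apply: ht] => x xs; apply: sw;
      by rewrite mem_cat xs ?orbT.
  - by move=> P Q PQ [s hs]; exists s => w /hs /PQ.
have : \forall s \near F, [set: T] `<=` (fun y => exists2 x, x \in s & N x y).
  apply: ((compact_near_coveringP _).1 cT _ F (fun (s : seq T) y => exists2 x, x \in s & N x y)) => x _.
  exists (N x, [set s : seq T | x \in s]) => /=; last by move=> [y s] [/= h1 h2]; exists x.
  by split => //; exists [:: x] => s; apply; rewrite inE.
move=> [s hs]; exists s => y; exact: (hs s (fun _ => id)).
Qed.

(** The lower bound 1 makes powers of the constant monotone and at least 1. *)
Lemma finite_bound (I : eqType) (s : seq I) (f : I -> R) : exists2 m, 1 <= m & forall i, i \in s -> f i <= m.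
Proof.
elim: s => [|i s [m m1 hm]]; first by exists 1.
exists (Num.max m (f i)); first by rewrite le_max m1.
by move=> j; rewrite inE le_max => /orP[/eqP ->|/hm ->]; rewrite ?lexx ?orbT.
Qed.

Lemma finite_bound_lt1 (I : eqType) (s : seq I) (f : I -> R) : (forall i, 0 < f i < 1) ->
  exists2 q, 0 < q < 1 & forall i, i \in s -> f i <= q.
Proof.
move=> hf; elim: s => [|i s [q /andP[q0 q1] hq]]; first by exists (1/2) => //; apply/andP; split; lra.
have /andP[f0 f1] := hf i.
exists (Num.max q (f i)); first by rewrite lt_max q0 gt_max q1 f1.
by move=> j; rewrite inE le_max => /orP[/eqP ->|/hq ->]; rewrite ?lexx ?orbT.
Qed.

Lemma pow_small (q K : R) : 0 < q < 1 -> exists c : nat, (0 < c)%N /\ K * q ^+ c <= 1/2.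
Proof.
move=> /andP[q0 q1]; pose e := (1/2) / (`|K| + 1).
have K0 : 0 < `|K| + 1 by rewrite ltr_wpDl.
have e0 : 0 < e by rewrite divr_gt0 //; lra.
have /cvgrPdist_lt /(_ e e0) [N _ hN] : GRing.exp q @ \oo --> (0 : R) by apply: cvg_expr; rewrite ger0_norm // ltW.
exists N.+1; split; first by [].
have := hN N.+1 (leqnSn _); rewrite /= sub0r normrN ger0_norm ?exprn_ge0 //; [move=> h|exact: ltW].
apply: (@le_trans _ _ ((`|K| + 1) * q ^+ N.+1)).
  by apply: ler_wpM2r; [apply: exprn_ge0; exact: ltW|rewrite (le_trans (ler_norm K)) // lerDl].
by rewrite mulrC -ler_pdivlMr // ltW.
Qed.

End Compactness.

Lemma Ck_subset (R : realType) n k (W W' : set 'rV[R[i]]_n) f : W' `<=` W -> Ck k W f -> Ck k W' f.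
Proof.
move=> sub; elim: k f => [|k IH] f [h1 h2]; split; try by move=> z /sub /h1.
  by [].
move=> v; have [h3 h4] := h2 v; split; [by move=> z /sub /h3|exact: IH].
Qed.

(** * Coordinate patches adapted to the discs *)

Section Patches.
Variables (R : realType) (X : complex_manifold R) (E : hol_bundle X) (h : hermitian_metric E).
Local Notation n := (mfd_dim X).
Local Notation r := (rank E).
Local Notation V := 'rV[R[i]]_n.
Local Notation C := R[i].
Implicit Types (c : chart R X n) (O : set X).

Definition hform i (x : X) (u : 'I_r -> C) : R := complex.Re (sesq (hmat h i x) u u).

Lemma hform_gt0 i x u : triv_dom i x -> (exists a, u a != 0) -> 0 < hform i x u.
Proof. by move=> dx hu; have := hmat_pos h dx hu; rewrite ltcE => /andP[]. Qed.

Lemma hform0 i x : hform i x (fun=> 0) = 0.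
Proof. by rewrite /hform /sesq big1 // => a _; rewrite big1 // => b _; rewrite mulr0 mul0r. Qed.

Lemma hform_ge0 i x u : triv_dom i x -> 0 <= hform i x u.
Proof.
move=> dx; have [hu|hu] := pselect (exists a, u a != 0); first exact/ltW/hform_gt0.
rewrite (_ : u = fun=> 0) ?hform0 //; apply/funext => a; apply/eqP/negP => ua; apply: hu; exists a; exact/negP.
Qed.

Lemma hform_trans i j x (u : 'I_r -> C) : triv_dom i x -> triv_dom j x ->
  hform j x u = hform i x (fun a => \sum_b trans i j x a b * u b).
Proof.
move=> di dj; rewrite /hform (hmat_trans h di dj); congr (complex.Re _).
move: (trans i j x) (hmat h i x) => G H; rewrite /sesq.
transitivity (\sum_a \sum_b \sum_p \sum_k G p a * H p k * (G k b)^* * u a * (u b)^*).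
  apply: eq_bigr => a _; apply: eq_bigr => b _; rewrite mxE !mulr_suml exchange_big.
  apply: eq_bigr => p _; rewrite !mxE !mulr_suml; apply: eq_bigr => k _; by rewrite !mxE.
transitivity (\sum_p \sum_k \sum_a \sum_b G p a * H p k * (G k b)^* * u a * (u b)^*).
  rewrite (eq_bigr (fun a => \sum_p \sum_b \sum_k G p a * H p k * (G k b)^* * u a * (u b)^*)); last first.
    by move=> a _; rewrite exchange_big.
  rewrite exchange_big; apply: eq_bigr => p _.
  rewrite (eq_bigr (fun a => \sum_k \sum_b G p a * H p k * (G k b)^* * u a * (u b)^*)); last first.
    by move=> a _; rewrite exchange_big.
  by rewrite exchange_big.
apply: eq_bigr => p _; apply: eq_bigr => k _.
rewrite cj_sum mulr_sumr mulr_suml; apply: eq_bigr => a _.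
rewrite mulr_sumr; apply: eq_bigr => b _; rewrite cjM; ring.
Qed.

Definition hmat_chart i c (a b : 'I_r) (z : V) : C := hmat h i (chart_inv c z) a b.

(** Every disc that starts within [pe] of the centre stays in the closed ball of radius [pR], which
    lies in one chart, one trivialization and [O]. The contraction factor [pq] serves the whole
    patch. *)
Record patch O x0 := Patch {
  pc : chart R X n; pi : bidx E; pR : R; pe : R; pq : R;
  p_atlas : atlas pc; p_dom : chart_dom pc x0;
  p_sub : cball (chart_fun pc x0) pR `<=` chart_fun pc @` ((O `&` triv_dom pi) `&` chart_dom pc);
  p_e : 0 < pe; p_eR : pe <= pR; p_q : 0 < pq < 1;
  p_disc : forall z, vn (z - chart_fun pc x0) < pe -> forall u, (exists a, u a != 0) ->
    disc_at (hmat_chart pi pc) (chart_fun pc x0) pR pq z u }.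

Lemma patch_ex O x0 : RC_positive_metric h -> open O -> O x0 -> inhabited (patch O x0).
Proof.
move=> hRC oO Ox.
have [c ac cx] := atlas_cover x0; have [i ix] := triv_cover E x0.
have oOi : open (O `&` triv_dom i) by apply: openI => //; exact: triv_open.
have [R0 R00 hR0] := chart_ball oOi (conj Ox ix) cx.
have oW := @chart_img_open_sub _ _ c _ oOi.
have [||||e e0 [q q01 hq]] := @uniform_disc R n r _ (chart_fun c x0) (hmat_chart i c) R0 oW R00 hR0.
- move=> a b; have := @hmat_smooth _ _ _ h i a b c ac 2.
  by apply: Ck_subset => _ [x [[_ ix'] cx'] <-]; exists x.
- move=> y a b /img_inv [[_ iy] _ _]; rewrite /hmat_chart; exact: hmat_herm.
- move=> u hu; rewrite /hmat_chart chart_funK //; exact: hmat_pos.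
- move=> u hu; have [|v hv] := hRC x0 c i ac cx ix (\col_a u a).
    case: hu => a ua; apply/eqP => /matrixP /(_ a 0); rewrite !mxE => u0; by rewrite u0 eqxx in ua.
  exists v; move: hv; rewrite /chern_form /chern_curvature /=.
  rewrite (_ : \matrix_(x, y) hmat_chart i c x y (chart_fun c x0) = hmat h i x0); last first.
    by apply/matrixP => a b; rewrite mxE /hmat_chart chart_funK.
  congr (0 < _); apply: eq_bigr => p _; apply: eq_bigr => k _; apply: eq_bigr => a _; apply: eq_bigr => b _.
  by rewrite !mxE.
(* The inner radius is capped by [R0] so that starting points lie in the closed ball. *)
split; apply: (@Patch O x0 c i R0 (Num.min e R0) q) => //.
- by rewrite lt_min e0.
- by rewrite ge_min lexx orbT.
- by move=> z; rewrite lt_min => /andP[ze _]; exact: hq.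
Qed.

End Patches.

Section Holo.
Variables (R : realType) (X : complex_manifold R).
Local Notation n := (mfd_dim X).
Local Notation V := 'rV[R[i]]_n.
Local Notation C := R[i].
Implicit Types (c : chart R X n) (O : set X).

Lemma chart_continuous c x (f : X -> C) : chart_dom c x ->
  {for chart_fun c x, continuous (f \o chart_inv c)} -> {for x, continuous f}.
Proof.
move=> dx hf.
have h : (f \o chart_inv c \o chart_fun c) @ x --> f x.
  rewrite -{2}(chart_funK dx); apply: continuous_comp; first exact: chart_fun_continuous.
  exact: hf.
apply: cvg_trans h; apply: near_eq_cvg.
have d : nbhs x (chart_dom c) by apply: open_nbhs_nbhs; split => //; exact: chart_dom_open.
by apply: filterS d => y dy /=; rewrite chart_funK.
Qed.

Lemma holo_continuous (U : set X) (f : X -> C) x : U x -> holo_on U f -> {for x, continuous f}.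
Proof.
move=> Ux hf; have [c ac cx] := atlas_cover x.
by apply: (chart_continuous cx); apply: differentiable_continuous; exact: hf.
Qed.

Lemma smooth_continuous (U : set X) (f : X -> C) x : U x -> mfd_smooth_on U f -> {for x, continuous f}.
Proof.
move=> Ux hf; have [c ac cx] := atlas_cover x.
apply: (chart_continuous cx); have [+ _] := hf c ac 0%N; apply; by exists x.
Qed.

Lemma differentiable_sumC (W : normedModType C) (I : Type) (s : seq I) (F : I -> W -> C) t :
  (forall i, differentiable (F i) t) -> differentiable (fun x => \sum_(i <- s) F i x) t.
Proof.
move=> hF; elim: s => [|i s IH].
  by rewrite (_ : (fun x => _) = fun=> 0); [exact: differentiable_cst|apply/funext => x; rewrite big_nil].
rewrite (_ : (fun x => _) = F i + (fun x => \sum_(j <- s) F j x)); first exact: differentiableD.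
by apply/funext => x; rewrite big_cons.
Qed.

Lemma differentiable_prodC (W : normedModType C) (I : Type) (s : seq I) (F : I -> W -> C) t :
  (forall i, differentiable (F i) t) -> differentiable (fun x => \prod_(i <- s) F i x) t.
Proof.
move=> hF; elim: s => [|i s IH].
  by rewrite (_ : (fun x => _) = fun=> 1); [exact: differentiable_cst|apply/funext => x; rewrite big_nil].
rewrite (_ : (fun x => _) = F i * (fun x => \prod_(j <- s) F j x)); first exact: differentiableM.
by apply/funext => x; rewrite big_cons.
Qed.

Lemma symeval_diff (W : normedModType C) r l (w : 'I_#|sym_basis r l| -> W -> C) (u : 'I_r -> W -> C) t :
  (forall M, differentiable (w M) t) -> (forall a, differentiable (u a) t) ->
  differentiable (fun t => symeval (w^~ t) (u^~ t)) t.
Proof.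
move=> hw hu; rewrite /symeval; apply: differentiable_sumC => M.
apply: (@differentiableM _ _ (w M)) => //.
by apply: differentiable_prodC => k; exact: hu.
Qed.

Lemma disc_diff (U : set X) (f : X -> C) c z v (t : C) : atlas c -> holo_on U f ->
  (chart_fun c @` (U `&` chart_dom c)) (z + t *: v) ->
  differentiable (fun t : C => f (chart_inv c (z + t *: v))) t.
Proof.
move=> ac hf /img_inv [Uy dy yz].
apply: (@differentiable_comp _ _ _ _ (fun t : C => z + t *: v) (f \o chart_inv c)); last first.
  by have := hf c _ ac Uy dy; rewrite yz.
apply: differentiableD; first exact: differentiable_cst.
exact: differentiableZl.
Qed.

Lemma phi_diff (a b d t : C) : differentiable (fun t : C => a + t * b + t ^+ 2 * d) t.
Proof.
have did : differentiable (id : C -> C) t by apply/derivable1_diffP; exact: derivable_id.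
apply: (@differentiableD _ _ _ (fun t : C => a + t * b) (fun t : C => t ^+ 2 * d)); last first.
  apply: (@differentiableM _ _ (fun t : C => t * t) (fun=> d)); last exact: differentiable_cst.
  exact: (differentiableM did did).
apply: (@differentiableD _ _ _ (fun=> a) (fun t : C => t * b)); first exact: differentiable_cst.
by apply: (differentiableM did); exact: differentiable_cst.
Qed.

End Holo.

Section PatchSet.
Variables (R : realType) (X : complex_manifold R) (E : hol_bundle X) (h : hermitian_metric E).
Variables (O : set X) (x : X) (p : patch h O x).

(** The compact set on which bounds are stated; discs from the smaller ball remain in it, so bounds
    on it can be iterated. *)
Definition patch_set : set X := chart_inv (pc p) @` cball (chart_fun (pc p) x) (pR p).

Lemma patch_set_compact : compact patch_set.
Proof.
apply: continuous_compact; last exact: compact_cball.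
apply: continuous_in_subspaceT => z /set_mem zB; apply: chart_inv_continuous.
by have [y [_ cy] <-] := p_sub zB; exists y.
Qed.

Lemma patch_set_dom y : patch_set y -> O y /\ triv_dom (pi p) y /\ chart_dom (pc p) y.
Proof. by move=> [z /p_sub/img_inv [[? ?] ? _] <-]. Qed.

Lemma patch_set_mem y : chart_dom (pc p) y -> vn (chart_fun (pc p) y - chart_fun (pc p) x) < pe p -> patch_set y.
Proof.
move=> dy hy; exists (chart_fun (pc p) y); last by rewrite chart_funK.
by apply/ltW/(lt_le_trans hy); exact: p_eR.
Qed.

Lemma continuous_hform i y (u : 'rV[R[i]]_(rank E)) : triv_dom i y ->
  {for (y, u), continuous (fun q : X * 'rV[R[i]]_(rank E) => sesq (hmat h i q.1) (q.2 0) (q.2 0))}.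
Proof.
move=> iy.
have cu a : {for (y, u), continuous (fun q : X * 'rV[R[i]]_(rank E) => q.2 0 a)}.
  by apply: (continuous_comp (g := fun v : 'rV_(rank E) => v 0 a)); [exact: cvg_snd|exact: coord_continuous].
have cm a b : {for (y, u), continuous (fun q : X * 'rV[R[i]]_(rank E) => hmat h i q.1 a b)}.
  apply: (continuous_comp (f := fst) (g := fun y => hmat h i y a b)); first exact: cvg_fst.
  exact: (smooth_continuous iy (@hmat_smooth _ _ _ h i a b)).
exact: (@continuous_sesq _ _ _ (fun a b (q : X * 'rV[R[i]]_(rank E)) => hmat h i q.1 a b)
  (fun a (q : X * 'rV[R[i]]_(rank E)) => q.2 0 a) (fun a (q : X * 'rV[R[i]]_(rank E)) => q.2 0 a) (y, u) cm cu cu).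
Qed.

End PatchSet.

(** * Vanishing of sections *)

Section Coordinates.
Variables (R : realType) (X : complex_manifold R) (E A : hol_bundle X).
Local Notation C := R[i].
Local Notation r := (rank E).

(** The tensor power is trivialized by one and the same frame of [A] in all factors, so that changes
    of frame are bounded by powers. *)
Fixpoint diag_idx k (j : bidx A) : bidx (tensor_power A k) :=
  match k return bidx (tensor_power A k) with
  | 0%N => tt
  | k'.+1 => (j, diag_idx k' j)
  end.

Lemma diag_dom k (j : bidx A) x : triv_dom j x -> triv_dom (diag_idx k j) x.
Proof. by move=> jx; elim: k => [//|k IH]; split. Qed.

Lemma sum_mxtens m p (F : 'I_(m * p) -> R) : \sum_a F a = \sum_b \sum_c F (mxtens_index (b, c)).
Proof.
rewrite pair_big /= (reindex (@mxtens_index m p)) /=; first by apply: eq_bigr => -[].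
by exists (@mxtens_unindex m p) => a _; rewrite ?mxtens_indexK ?mxtens_unindexK.
Qed.

Lemma sum_mxtensC m p (F : 'I_(m * p) -> C) : \sum_a F a = \sum_b \sum_c F (mxtens_index (b, c)).
Proof.
rewrite pair_big /= (reindex (@mxtens_index m p)) /=; first by apply: eq_bigr => -[].
by exists (@mxtens_unindex m p) => a _; rewrite ?mxtens_indexK ?mxtens_unindexK.
Qed.

(** The maximal absolute row sum is submultiplicative under Kronecker products; this is the origin
    of the exponent [k] in the cost of a change of frame. *)
Lemma diag_rowsum k (j j' : bidx A) x (K : R) : 0 <= K ->
  (forall b, \sum_c nrm (trans j j' x b c) <= K) ->
  forall b, \sum_c nrm (trans (diag_idx k j) (diag_idx k j') x b c) <= K ^+ k.
Proof.
move=> K0 hK; elim: k => [|k IH] b /=.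
  by rewrite (big_ord_recl 0) big_ord0 addr0 mxE (ord1 b) eqxx nrm1.
case: (mxtens_indexP b) => b1 b2; rewrite sum_mxtens exprS.
apply: (@le_trans _ _ ((\sum_c nrm (trans j j' x b1 c)) * K ^+ k)); last first.
  by apply: ler_wpM2r; [exact: exprn_ge0|exact: hK].
rewrite mulr_suml; apply: ler_sum => c _.
under eq_bigr do rewrite tensmxE nrmM.
by rewrite -mulr_sumr; apply: ler_wpM2l; [exact: nrm_ge0|exact: IH].
Qed.

Variables (l k : nat).
Local Notation B := (tensor (sym_power l (dual E)) (tensor_power A k)).
Variable s : presection B.

Definition coord (i : bidx E) (J : bidx (tensor_power A k)) (y : X) (M : 'I_#|sym_basis r l|)
  (b : 'I_(rank (tensor_power A k))) : C := s ((i, J) : bidx B) y (mxtens_index (M, b)) 0.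

(** The component [b] of the section, read as a form of degree [l] on the fibre of [E]. *)
Definition spoly i J y b (u : 'I_r -> C) : C := symeval (fun M => coord i J y M b) u.

(** The symmetric factor disappears into the change of frame of [u], so only the transitions of the
    power of [A] cost anything. *)
Lemma spoly_trans i0 i1 J0 J1 y b u : is_section setT s ->
  triv_dom i0 y -> triv_dom J0 y -> triv_dom i1 y -> triv_dom J1 y ->
  spoly i0 J0 y b u =
  \sum_c trans J0 J1 y b c * spoly i1 J1 y c (fun a => \sum_b trans i1 i0 y a b * u b).
Proof.
move=> [_ hs] h0 H0 h1 H1.
have E1 M : coord i0 J0 y M b = \sum_c trans J0 J1 y b c * \sum_N symmx l (trans i1 i0 y)^T M N * coord i1 J1 y N c.
  rewrite /coord (hs (i0, J0) (i1, J1) y) //= mxE sum_mxtensC exchange_big; apply: eq_bigr => c _.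
  by rewrite mulr_sumr; apply: eq_bigr => N _; rewrite tensmxE; ring.
rewrite {1}/spoly (funext E1).
rewrite {1}/symeval; under eq_bigr do rewrite mulr_suml.
rewrite exchange_big; apply: eq_bigr => c _.
have := symeval_trans (trans i1 i0 y)^T (fun N => coord i1 J1 y N c) u.
rewrite [X in _ = symeval _ X](_ : _ = fun a => \sum_b trans i1 i0 y a b * u b); last first.
  by apply/funext => a; apply: eq_bigr => d _; rewrite mxE.
by rewrite /spoly => <-; rewrite /symeval mulr_sumr; apply: eq_bigr => M _; rewrite mulrA.
Qed.

Lemma symeval0 (K : comNzRingType) (w : 'I_#|sym_basis r l| -> K) : (0 < l)%N -> symeval w (fun=> 0) = 0.
Proof.
move=> l0; rewrite /symeval big1 // => M _.
by rewrite (bigD1 (Ordinal l0)) //= mul0r mulr0.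
Qed.

Lemma symevalZ (K : comNzRingType) (w : 'I_#|sym_basis r l| -> K) c u :
  symeval w (fun a => c * u a) = c ^+ l * symeval w u.
Proof.
rewrite /symeval mulr_sumr; apply: eq_bigr => M _.
by rewrite big_split /= prodr_const card_ord mulrCA.
Qed.

Lemma coord_holo i J M b : is_section setT s ->
  holo_on (triv_dom i `&` triv_dom J) (fun y => coord i J y M b).
Proof.
move=> [hs _]; have := hs ((i, J) : bidx B) (mxtens_index (M, b)); by rewrite setTI.
Qed.

End Coordinates.

Lemma continuous_prodC (R : realType) (T : topologicalType) (I : Type) (s : seq I) (F : I -> T -> R[i]) (x : T) :
  (forall i, {for x, continuous (F i)}) -> {for x, continuous (fun y => \prod_(i <- s) F i y)}.
Proof.
move=> h; elim: s => [|i s IH].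
  rewrite (_ : (fun y => _) = fun=> 1); last by apply/funext => y; rewrite big_nil.
  exact: cst_continuous.
rewrite (_ : (fun y => _) = F i * (fun y => \prod_(i <- s) F i y)); first exact: (continuousM (h i) IH).
by apply/funext => y; rewrite big_cons.
Qed.

Section Vanishing.
Variables (R : realType) (X : complex_manifold R) (E A : hol_bundle X) (h : hermitian_metric E).
Local Notation C := R[i].
Local Notation r := (rank E).
Local Notation n := (mfd_dim X).
Local Notation V := 'rV[R[i]]_n.

Variable j : X -> bidx A.
Variable pt : forall x, patch h (triv_dom (j x)) x.
Let c x := pc (pt x).
Let i x := pi (pt x).
Let K x : set X := patch_set (pt x).

(** Transition matrices are continuous on the compact intersection of two patch sets; the bound
    refers to [A] alone and is therefore independent of [l] and [k]. *)
Lemma trans_bound x x' : exists2 m, 0 <= m & forall y, K x y -> K x' y ->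
  forall b, \sum_c nrm (trans (j x) (j x') y b c) <= m.
Proof.
have cK : compact (K x `&` K x').
  apply: compact_closedI; first exact: patch_set_compact.
  by apply: compact_closed; [exact: mfd_hausdorff|exact: patch_set_compact].
pose P y m := forall b, \sum_c nrm (trans (j x) (j x') y b c) <= m.
have [||m m0 hm] := compact_exists_bound (P := P) cK.
- by move=> y m m' mm hy b; apply: le_trans mm.
- move=> y [/patch_set_dom [jy _] /patch_set_dom [jy' _]].
  have [m [m0 hm]] : exists m, 0 <= m /\ forall b c, nrm (trans (j x) (j x') y b c) <= m.
    have [m m1 hm] := finite_bound (index_enum ('I_(rank A) * 'I_(rank A))%type) (fun p => nrm (trans (j x) (j x') y p.1 p.2)).
    by exists m; split; [apply: le_trans m1|move=> b d; apply: (hm (b, d)); rewrite mem_index_enum].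
  exists (\sum_(c < rank A) (m + 1)).
  have : \forall z \near y, forall p : 'I_(rank A) * 'I_(rank A), nrm (trans (j x) (j x') z p.1 p.2) < m + 1.
    apply: filter_forall => -[b d] /=.
    have /cvg_CP H := holo_continuous (conj jy jy') (@trans_holo _ _ A (j x) (j x') b d).
    have := H _ ltr01; apply: filterS => z hz.
    rewrite -(subrK (trans (j x) (j x') y b d) (trans _ _ z b d)).
    by apply: le_lt_trans (nrmD _ _) _; rewrite addrC ler_ltD.
  by apply: filterS => z hz b; apply: ler_sum => d _; exact/ltW/(hz (b, d)).
- by exists m => // y h1 h2; apply: hm.
Qed.

Variables (l k : nat).
Local Notation L := (tensor (sym_power l (dual E)) (tensor_power A k)).
Variable s : presection L.
Hypothesis hs : is_section setT s.
Let P x y b u := spoly s (i x) (diag_idx k (j x)) y b u.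

Let bdd (M : R) x := forall y, K x y -> forall b u, nrm (P x y b u) ^+ 2 <= M * hform h (i x) y u ^+ l.

(** Numerator and denominator are continuous on the product of the patch set with the unit sphere,
    where the metric is positive; both sides are homogeneous of the same degree in [u]. *)
Lemma bdd_ex x : (0 < l)%N -> exists2 M, 0 <= M & bdd M x.
Proof.
move=> l0; pose U := 'rV[C]_r.
have cS := @compact_sphere R r.
pose Q (p : X * U) (m : R) := 0 <= m /\ 0 <= hform h (i x) p.1 (p.2 0) /\ forall b, nrm (P x p.1 b (p.2 0)) ^+ 2 <= m * hform h (i x) p.1 (p.2 0) ^+ l.
have [||M M0 hM] := compact_exists_bound (P := Q) (compact_setX (patch_set_compact (p := pt x)) cS).
- move=> p m m' mm [m0 [h0 hp]]; split; first exact: le_trans mm.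
  by split => // b; apply: (le_trans (hp b)); apply: ler_wpM2r => //; exact: exprn_ge0.
- move=> [y u] [/= /patch_set_dom [jy [iy cy]] hu].
  have nu : exists a, u 0 a != 0.
    apply: contrapT => nu; have : u = 0.
      by apply/rowP => a; rewrite mxE; apply/eqP/negP => ua; apply: nu; exists a; exact/negP.
    by move=> u0; move: hu; rewrite u0 vn0 => /eqP; rewrite eq_sym oner_eq0.
  have cu a : {for (y, u), continuous (fun p : X * U => p.2 0 a)}.
    apply: (continuous_comp (g := fun v : U => v 0 a)); first exact: cvg_snd.
    exact: coord_continuous.
  have cP b : {for (y, u), continuous (fun p : X * U => P x p.1 b (p.2 0))}.
    apply: (@continuous_sum _ _ _ _ (fun M (p : X * U) => coord s (i x) (diag_idx k (j x)) p.1 M b * \prod_(k < l) p.2 0 (tnth (sym_mono M) k))) => M.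
    apply: (@continuousM _ _ (fun p : X * U => coord s (i x) (diag_idx k (j x)) p.1 M b) (fun p : X * U => \prod_(k < l) p.2 0 (tnth (sym_mono M) k))).
      apply: (continuous_comp (f := fst) (g := fun y => coord s (i x) (diag_idx k (j x)) y M b)); first exact: cvg_fst.
      by apply: (@holo_continuous _ _ _ _ _ _ (@coord_holo _ _ E A l k s (i x) (diag_idx k (j x)) M b hs)); split => //; exact: diag_dom.
    exact: (@continuous_prodC _ _ _ _ (fun k (p : X * U) => p.2 0 (tnth (sym_mono M) k))).
  have h0 := hform_gt0 h iy nu.
  have [m1 m11 hm1] := finite_bound (index_enum 'I_(rank (tensor_power A k))) (fun b => nrm (P x y b (u 0))).
  have N1 : nbhs ((y, u) : X * U) (fun p : X * U => hform h (i x) y (u 0) / 2 < hform h (i x) p.1 (p.2 0)).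
    have := continuous_Re (continuous_hform (h := h) (u := u) iy) (divr_gt0 h0 (ltr0Sn _ 1)); apply: filterS => p; rewrite /hform.
    by rewrite ltr_norml => /andP[+ _]; move: (complex.Re _) (complex.Re _) => a' b'; lra.
  have N2 : nbhs ((y, u) : X * U) (fun p : X * U => forall b, nrm (P x p.1 b (p.2 0)) < m1 + 1).
    apply: (@filter_forall _ _ (fun b (p : X * U) => nrm (P x p.1 b (p.2 0)) < m1 + 1) _ (nbhs_filter ((y, u) : X * U))) => b.
    have /cvg_CP /(_ _ ltr01) := cP b; apply: filterS => p hp.
    rewrite -(subrK (P x y b (u 0)) (P x p.1 b (p.2 0))).
    apply: le_lt_trans (nrmD _ _) _; rewrite addrC; apply: ler_ltD => //; apply: hm1; exact: mem_index_enum.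
  have h2 : 0 < (hform h (i x) y (u 0) / 2) ^+ l by rewrite exprn_gt0 // divr_gt0.
  exists ((m1 + 1) ^+ 2 / (hform h (i x) y (u 0) / 2) ^+ l).
  apply: filterS (filterI N1 N2) => p [p1 p2].
  have hp0 : 0 <= hform h (i x) p.1 (p.2 0) by apply: le_trans (ltW p1); rewrite divr_ge0 // ltW.
  split; first by rewrite divr_ge0 ?sqr_ge0 // ltW.
  split => // b.
  apply: (@le_trans _ _ ((m1 + 1) ^+ 2)).
    by apply: lerXn2r; rewrite ?nnegrE ?nrm_ge0 //; [apply: le_trans (ltW (p2 b)); exact: nrm_ge0|exact/ltW/p2].
  rewrite mulrAC ler_pdivlMr //; apply: ler_wpM2l; first exact: sqr_ge0.
  apply: lerXn2r; rewrite ?nnegrE //; [by rewrite divr_ge0 // ltW|exact: ltW].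
exists M => // y Ky b u.
have [u0|u0] := eqVneq (\row_a u a : U) 0.
  have -> : u = fun=> 0 by apply/funext => a; have := congr1 (fun v : U => v 0 a) u0; rewrite !mxE.
  by rewrite /P /spoly symeval0 // nrm0 expr0n hform0 expr0n (gtn_eqF l0) mulr0.
pose v := vn (\row_a u a : U); have v0 : 0 < v by rewrite vn_gt0.
pose u' := (v^-1)%:C%C *: (\row_a u a : U).
have v1 : vn u' = 1 by rewrite vnZ nrm_real ger0_norm ?invr_ge0 1?ltW // mulVf // gt_eqF.
have uE : u = fun a => v%:C%C * u' 0 a.
  by apply/funext => a; rewrite !mxE mulrA -rmorphM divff ?gt_eqF // rmorph1 mul1r.
have [_ [_ /(_ b)]] := hM (y, u') (conj Ky v1).
rewrite /= uE /P /spoly symevalZ /hform sesqZl sesqZr mulrA mulcJ Re_realM exprMn nrmM nrmX nrm_real (ger0_norm (ltW v0)).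
move: (symeval _ _) (sesq _ _ _) => a1 a2 hh.
rewrite [in leLHS]exprMn [in leRHS]mulrCA [v ^+ 2 ^+ l]exprAC ler_wpM2l //.
by rewrite sqr_ge0.
Qed.

(** A point is moved to a patch in whose inner ball it lies, at the cost [T ^+ k], squared for
    squared norms. The maximum principle on the disc there gains [q ^+ l], because the form has
    degree [l] in the lifted vector. *)
Lemma bdd_step (s0 : seq X) (q T M : R) : (0 < l)%N -> 0 <= M -> 0 <= T -> 0 <= q ->
  (forall y, exists2 x, x \in s0 & chart_dom (c x) y /\ vn (chart_fun (c x) y - chart_fun (c x) x) < pe (pt x)) ->
  (forall x, x \in s0 -> pq (pt x) <= q) ->
  (forall x x', x \in s0 -> x' \in s0 -> forall y, K x y -> K x' y -> forall b, \sum_c nrm (trans (j x) (j x') y b c) <= T) ->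
  (forall x, x \in s0 -> bdd M x) -> forall x, x \in s0 -> bdd (T ^+ k ^+ 2 * (M * q ^+ l)) x.
Proof.
move=> l0 M0 T0 q0 hcov hq hT hM x xs y Ky b u.
have [jy [iy cy]] := patch_set_dom Ky.
have [hu|hu] := pselect (exists a, u a != 0); last first.
  have -> : u = fun=> 0.
    by apply/funext => a; apply/eqP/negP => ua; apply: hu; exists a; exact/negP.
  by rewrite /P /spoly symeval0 // nrm0 expr0n hform0 expr0n (gtn_eqF l0) mulr0.
have [x' xs' [cy' ey']] := hcov y.
have Ky' : K x' y by exact: patch_set_mem.
have [jy' [iy' _]] := patch_set_dom Ky'.
rewrite /P (spoly_trans (i1 := i x') (J1 := diag_idx k (j x')) _ _ hs) //; try exact: diag_dom.
rewrite (hform_trans h u iy' iy).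
pose u' a := \sum_b trans (i x') (i x) y a b * u b.
rewrite -/u'.
have hu' : exists a, u' a != 0.
  apply: contrapT => nu'; have u0 : u' = fun=> 0.
    by apply/funext => a; apply/eqP/negP => ua; apply: nu'; exists a; exact/negP.
  have := hform_gt0 h iy hu; by rewrite (hform_trans h u iy' iy) -/u' u0 hform0 ltxx.
(* Along the disc the form, evaluated on the quadratic lift, is a holomorphic function of [t]. On
   the boundary it obeys the old bound with the length already reduced by [q]. *)
have key g : nrm (spoly s (i x') (diag_idx k (j x')) y g u') ^+ 2 <= M * q ^+ l * hform h (i x') y u' ^+ l.
  have [v [bb [d [sg sg0 [hd1 hd2]]]]] := p_disc ey' hu'.
  pose z := chart_fun (c x') y.
  pose phi t a := u' a + t * bb a + t ^+ 2 * d a.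
  pose G t := spoly s (i x') (diag_idx k (j x')) (chart_inv (c x') (z + t *: v)) g (phi t).
  have G0 : G 0 = spoly s (i x') (diag_idx k (j x')) y g u'.
    rewrite /G scale0r addr0 chart_funK //; congr (spoly _ _ _ _ _ _).
    by apply/funext => a; rewrite /phi expr2 !mul0r !addr0.
  pose Bd := M * q ^+ l * hform h (i x') y u' ^+ l.
  have Bd0 : 0 <= Bd by rewrite !mulr_ge0 ?exprn_ge0 ?hform_ge0.
  rewrite -G0 -/Bd -(sqr_sqrtr Bd0) ler_sqr ?nnegrE ?nrm_ge0 ?sqrtr_ge0 //.
  apply: (@max_modulus R G sg) => //.
  - move=> t t1 t2; have hy := p_sub (p := pt x') (hd1 t (conj t1 t2)).
    apply: (@symeval_diff R _ r l (fun M (t : C) => coord s (i x') (diag_idx k (j x')) (chart_inv (c x') (z + t *: v)) M g) (fun a (t : C) => phi t a) t).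
      move=> N; apply: (@disc_diff _ _ _ (fun y => coord s (i x') (diag_idx k (j x')) y N g) _ z v t (p_atlas (pt x')) (@coord_holo _ _ E A l k s (i x') (diag_idx k (j x')) N g hs)).
      by case: hy => w [[wj wi] wc] wE; exists w => //; split => //; split => //; exact: diag_dom.
    by move=> a; exact: phi_diff.
  - move=> t ht; rewrite -[leLHS]ger0_norm ?nrm_ge0 // -sqrtr_sqr ler_wsqrtr //.
    have Kt : K x' (chart_inv (c x') (z + t *: v)).
      by exists (z + t *: v) => //; apply: hd1; exact: sq_boundary_csquare.
    have [_ [it _]] := patch_set_dom Kt.
    apply: (le_trans (hM x' xs' _ Kt g (phi t))); rewrite /Bd -!mulrA -exprMn; apply: ler_wpM2l => //.
    apply: lerXn2r; rewrite ?nnegrE ?mulr_ge0 ?hform_ge0 //.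
    have := hd2 t ht; rewrite -/z /= /hmat_chart -/(i x') -/(c x') => /le_trans; apply.
    rewrite chart_funK // -/(hform h (i x') y u'); apply: ler_wpM2r; [exact: hform_ge0|exact: hq].
set F := hform h (i x') y u' ^+ l.
have F0 : 0 <= F by rewrite exprn_ge0 // hform_ge0.
have Bd0 : 0 <= M * q ^+ l * F by apply: mulr_ge0 => //; apply: mulr_ge0 => //; exact: exprn_ge0.
rewrite -/F in key; move: F F0 Bd0 key => F F0 Bd0 key.
have : nrm (\sum_c0 trans (diag_idx k (j x)) (diag_idx k (j x')) y b c0 * spoly s (i x') (diag_idx k (j x')) y c0 u')
  <= T ^+ k * Num.sqrt (M * q ^+ l * F).
  apply: (le_trans (nrm_sum _ _ _)).
  apply: (@le_trans _ _ ((\sum_c0 nrm (trans (diag_idx k (j x)) (diag_idx k (j x')) y b c0)) * Num.sqrt (M * q ^+ l * F))).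
    rewrite mulr_suml; apply: ler_sum => g _; rewrite nrmM; apply: ler_wpM2l; first exact: nrm_ge0.
    by rewrite -[leLHS]ger0_norm ?nrm_ge0 // -sqrtr_sqr ler_wsqrtr // key.
  by apply: ler_wpM2r; [exact: sqrtr_ge0|apply: diag_rowsum => //; exact: hT].
rewrite -ler_sqr ?nnegrE ?nrm_ge0 ?mulr_ge0 ?exprn_ge0 ?sqrtr_ge0 // exprMn sqr_sqrtr //.
by rewrite !mulrA.
Qed.

(** Vanishing as a function of [u] becomes vanishing of coefficients by [symeval_inj], first in the
    patch frame and then in any other. *)
Lemma section_zero (s0 : seq X) : (forall x, x \in s0 -> bdd 0 x) ->
  (forall y, exists2 x, x \in s0 & K x y) -> (0 < l)%N -> eq_section setT s (zero_section L).
Proof.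
move=> hb hcov l0 [i0 J0] y _ [iy Jy].
have [x xs Ky] := hcov y; have [jy [ixy _]] := patch_set_dom Ky.
have z b u : P x y b u = 0.
  apply/eqP; rewrite -nrm_eq0 -sqrf_eq0 eq_le sqr_ge0 andbT.
  by apply: (le_trans (hb x xs y Ky b u)); rewrite mul0r.
have z' M b : coord s (i x) (diag_idx k (j x)) y M b = 0.
  exact: (symeval_inj (z b)).
case: hs => _ /(_ (i0, J0) (i x, diag_idx k (j x)) y) -> //; last by split => //; exact: diag_dom.
rewrite /zero_section (_ : s _ y = 0) ?mulmx0 //.
apply/matrixP => a b; rewrite (ord1 b) mxE; case: (mxtens_indexP a) => M g; exact: z'.
Qed.

End Vanishing.

Theorem sym_tensor_vanishing (R : realType) (X : complex_manifold R) (E A : hol_bundle X) :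
  compact [set: X] -> RC_positive E -> exists cA : nat, (0 < cA)%N /\
     forall l k : nat, (cA * (k + 1) <= l)%N ->
       H0_vanishes (tensor (sym_power l (dual E)) (tensor_power A k)).
Proof.
move=> cX [h hRC].
have /choice [j hj] := triv_cover A.
have pt x : patch h (triv_dom (j x)) x.
  have /cid[] // : exists p : patch h (triv_dom (j x)) x, True.
  by have [p] := patch_ex hRC (triv_open (j x)) (hj x); exists p.
have [s0 hs0] := finite_cover cX (N := fun x => [set y | chart_dom (pc (pt x)) y /\
   vn (chart_fun (pc (pt x)) y - chart_fun (pc (pt x)) x) < pe (pt x)]) (fun x =>
   chart_nbhs (p_dom (pt x)) ((nbhs_VP _ _).2 (ex_intro2 _ _ (pe (pt x)) (p_e (pt x)) (fun y hy => hy)))).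
have [q /andP[q0 q1] hq] := finite_bound_lt1 s0 (fun x => p_q (pt x)).
have /choice [T hT] : forall p : X * X, exists m, 0 <= m /\ forall y, 
    patch_set (pt p.1) y ->
    patch_set (pt p.2) y ->
    forall b, \sum_c nrm (trans (j p.1) (j p.2) y b c) <= m.
  by move=> p; have [m m0 hm] := trans_bound pt p.1 p.2; exists m.
have [K K1 hK] := finite_bound [seq (x, x') | x <- s0, x' <- s0] T.
(* The constant depends on the patches and on the transitions of [A] over them, but is fixed before
   [l], [k] and the section. *)
have [cA [cA0 hcA]] := pow_small (K ^+ 2) (introT andP (conj q0 q1)).
exists cA; split => // l k lk s hs.
have l0 : (0 < l)%N by apply: leq_trans lk; rewrite muln_gt0 cA0 addn1.
have hT' x x' : x \in s0 -> x' \in s0 -> forall y, 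
   patch_set (pt x) y ->
   patch_set (pt x') y ->
   forall b, \sum_c nrm (trans (j x) (j x') y b c) <= K.
  move=> xs xs' y Ky Ky' b; apply: (le_trans ((hT (x, x')).2 y Ky Ky' b)).
  by apply: hK; apply/allpairsP; exists (x, x').
have /choice [M0 hM0] x : exists M, 0 <= M /\ forall y,
   patch_set (pt x) y -> forall b u,
   nrm (spoly s (pi (pt x)) (diag_idx k (j x)) y b u) ^+ 2 <= M * hform h (pi (pt x)) y u ^+ l.
  by have [M ? ?] := bdd_ex pt hs x l0; exists M.
have [M M1 hM] := finite_bound s0 M0.
have K0 : 0 <= K by exact: le_trans K1.
(* At [l = cA * (k + 1)] the product is $(K^2 q^{c_A})^k q^{c_A}$. The first factor is at most 1;
   the last is at most 1/2 because [1 <= K], and it handles [k = 0]. *)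
have small : K ^+ k ^+ 2 * q ^+ l <= 1/2.
  have Kq0 : 0 <= K ^+ 2 * q ^+ cA by rewrite mulr_ge0 // exprn_ge0 // ltW.
  have qcA0 : 0 <= q ^+ cA by rewrite exprn_ge0 // ltW.
  have qcA : q ^+ cA <= 1/2.
    by apply: le_trans hcA; rewrite ler_peMl // exprn_ege1.
  apply: (@le_trans _ _ (K ^+ k ^+ 2 * q ^+ (cA * (k + 1)))).
    apply: ler_wpM2l; first by rewrite exprn_ge0 // exprn_ge0.
    by apply: ler_wiXn2l => //; exact: ltW.
  have -> : K ^+ k ^+ 2 * q ^+ (cA * (k + 1)) = (K ^+ 2 * q ^+ cA) ^+ k * q ^+ cA.
    by rewrite addn1 mulnS exprD exprM exprMn -!exprM mulnC; ring.
  apply: le_trans qcA; rewrite ler_piMl //.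
  by apply: exprn_ile1 => //; apply: (le_trans hcA); lra.
have it m : forall x, x \in s0 -> forall y,
   patch_set (pt x) y -> forall b u,
   nrm (spoly s (pi (pt x)) (diag_idx k (j x)) y b u) ^+ 2 <= M / 2 ^+ m * hform h (pi (pt x)) y u ^+ l.
  elim: m => [|m IH] x xs y Ky b u; have [_ [iy _]] := patch_set_dom Ky.
    rewrite expr0 divr1; apply: (le_trans ((hM0 x).2 y Ky b u)); apply: ler_wpM2r; last exact: hM.
    by rewrite exprn_ge0 // hform_ge0.
  have M2 : 0 <= M / 2 ^+ m by rewrite divr_ge0 ?exprn_ge0 // (le_trans _ M1).
  apply: (le_trans (bdd_step hs l0 M2 K0 (ltW q0) hs0 hq hT' IH xs Ky b u)).
  apply: ler_wpM2r; first by rewrite exprn_ge0 // hform_ge0.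
  have -> : M / 2 ^+ m.+1 = M / 2 ^+ m * (1 / 2) by rewrite exprSr invfM mulrA div1r.
  by rewrite mulrCA; apply: ler_wpM2l.
refine (section_zero (pt := pt) hs (s0 := s0) _ _ l0); last first.
  by move=> y; have [x xs [cy ey]] := hs0 y; exists x => //; exact: patch_set_mem.
move=> x xs y Ky b u; rewrite mul0r.
have [_ [iy _]] := patch_set_dom Ky.
set F := hform h (pi (pt x)) y u ^+ l; have F0 : 0 <= F by rewrite exprn_ge0 // hform_ge0.
rewrite leNgt; apply/negP => lt0; set Q := nrm _ ^+ 2 in lt0.
have MF : 0 <= M * F by rewrite mulr_ge0 // (le_trans _ M1).
have h12 : 0 < (1 / 2 : R) < 1 by apply/andP; split; lra.
(* The 1 added to [M * F] turns the weak inequality into a strict contradiction. *)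
have [m [_ hm]] := pow_small ((M * F + 1) / Q) h12.
have := it m x xs y Ky b u; rewrite -/Q -/F => h1; move: hm.
rewrite mulrAC ler_pdivrMr // expr_div_n expr1n => h2.
have e : M / 2 ^+ m * F = M * F * (1 / 2 ^+ m) by rewrite div1r mulrAC.
have p0 : 0 < 1 / 2 ^+ m :> R by rewrite divr_gt0 // exprn_gt0.
by move: h1 h2; rewrite e mulrDl mul1r; move: p0; move: (1 / 2 ^+ m) (M * F * _) => a b'; lra.
Qed.

(** * The maximum principle for log-subharmonic functions *)

Section JetMaximum.
Variable R : realType.
Local Notation C := R[i].

Lemma cvg_RP (T : topologicalType) (f : T -> R) (x : T) : {for x, continuous f} <->
  forall e : R, 0 < e -> \forall y \near x, `|f y - f x| < e.
Proof.
split => [cf e e0|h].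
  by have /cvgrPdist_lt /(_ e e0) := cf; apply: filterS => y; rewrite distrC.
by apply/cvgrPdist_lt => e /h; apply: filterS => y; rewrite distrC.
Qed.

Lemma nrm_sqrD (x y : C) : nrm (x + y) ^+ 2 = nrm x ^+ 2 + 2 * complex.Re (x^* * y) + nrm y ^+ 2.
Proof.
rewrite !nrm_sqr; case: x => a b; case: y => c d; rewrite /=; ring.
Qed.

(* One-sided substitute for |exp w|^2 = exp (2 Re w) *)
Lemma nrm_pow_exp (w : C) m : (0 < m)%N ->
  (nrm (1 + (m%:R^-1)%:C%C * w) ^+ m) ^+ 2 <= expR (2 * complex.Re w + nrm w ^+ 2 / m%:R).
Proof.
move=> m0; have mr : 0 < m%:R :> R by rewrite ltr0n.
rewrite -exprM mulnC exprM.
have -> : 2 * complex.Re w + nrm w ^+ 2 / m%:R = m%:R * (2 * (m%:R^-1 * complex.Re w) + (m%:R^-1 * nrm w) ^+ 2).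
  by field; rewrite gt_eqF.
rewrite expRM_natl; apply: lerXn2r; rewrite ?nnegrE ?sqr_ge0 ?expR_ge0 //.
apply: le_trans (expR_ge1Dx _).
rewrite nrm_sqrD nrm1 expr1n nrmM nrm_real ger0_norm; last by rewrite invr_ge0 ltW.
have -> : (1 : C)^* = 1 by rewrite rmorph1.
by rewrite mul1r Re_realM addrA.
Qed.

(** At an interior maximum, multiply [g] by an approximate exponential that cancels the first order
    part of the exponent and the real part of its holomorphic second order part. The strictly
    subharmonic term [d * nrm t ^+ 2] then forces the product below [g z] on a small square, against
    [max_modulus]. *)
Lemma no_interior_max (u : C -> R) (g : C -> C) (s d K : R) (z a b : C) : 0 < d -> 0 <= K ->
  (forall z, csquare s z -> differentiable g z) -> `|complex.Re z| < s -> `|complex.Im z| < s -> g z != 0 ->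
  (forall t, nrm t <= 1 -> u z + 2 * complex.Re (a * t + b * t ^+ 2) - K * nrm t ^+ 3 <= u (z + t)) ->
  ~ forall t, csquare s t -> nrm (g t) ^+ 2 * expR (u t + d * nrm t ^+ 2) <= nrm (g z) ^+ 2 * expR (u z + d * nrm z ^+ 2).
Proof.
move=> d0 K0 dg zr zi gz hu hmax.
(* Besides staying in the square, [r] makes the cubic error at most [d / 4 * r ^+ 2]. *)
pose r := Num.min (Num.min (s - `|complex.Re z|) (s - `|complex.Im z|)) (Num.min (1/2) (d / (32 * (K + 1)))).
have r0 : 0 < r.
  rewrite !lt_min !subr_gt0 zr zi divr_gt0 //=; first by rewrite divr_gt0 // mulr_gt0 // ltr_wpDl.
have [r1 r2 r3 r4] : [/\ r <= s - `|complex.Re z|, r <= s - `|complex.Im z|, r <= 1/2 & r <= d / (32 * (K + 1))].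
  by split; rewrite !ge_min lexx ?orbT.
have r5 : 8 * K * r <= d / 4.
  have : r * (32 * (K + 1)) <= d by rewrite -ler_pdivlMr // mulr_gt0 // ltr_wpDl.
  have : 0 <= r * K by rewrite mulr_ge0 // ltW.
  have -> : 8 * K * r = 8 * (r * K) by ring.
  have -> : r * (32 * (K + 1)) = 32 * (r * K) + 32 * r by ring.
  by move: (r * K) => rK; lra.
pose L := nrm a + nrm b + nrm (d%:C%C * z^*).
have L0 : 0 <= L by rewrite !addr_ge0 ?nrm_ge0.
have [m m0 hm] : exists2 m, (0 < m)%N & 4 * L ^+ 2 / m%:R <= d / 4.
  pose x := 16 * L ^+ 2 / d; have := archi_boundP (x := x); set m := Num.bound x => hm.
  have x0 : 0 <= x by rewrite divr_ge0 ?mulr_ge0 ?sqr_ge0 // ltW.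
  exists m.+1 => //; rewrite ler_pdivrMr ?ltr0n //.
  have : x < m.+1%:R by apply: (lt_trans (hm x0)); rewrite ltr_nat.
  rewrite /x ltr_pdivrMr //; nra.
(* The last term cancels the linear part of [d * nrm (z + t) ^+ 2]. The power [m] replaces the
   exponential, at a cost of at most [d / 4 * r ^+ 2]. *)
pose w t := a * t + b * t ^+ 2 + d%:C%C * z^* * t.
pose G t := g (z + t) * (1 + (m%:R^-1)%:C%C * w t) ^+ m.
have sq t : csquare r t -> csquare s (z + t).
  move=> [t1 t2]; split; rewrite ?ReD ?ImD; apply: le_trans (ler_normD _ _) _; lra.
have dw t : differentiable (fun t => 1 + (m%:R^-1)%:C%C * w t : C) t.
  rewrite (_ : (fun t => _) = (fun t => 1 + t * ((m%:R^-1)%:C%C * (a + d%:C%C * z^*)) + t ^+ 2 * ((m%:R^-1)%:C%C * b) : C)).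
    exact: phi_diff.
  by apply/funext => t'; rewrite /w; ring.
have w0 : w 0 = 0 by rewrite /w expr2 !mulr0 !addr0.
have G0 : G 0 = g z by rewrite /G w0 mulr0 !addr0 expr1n mulr1.
pose B := nrm (g z) * expR (- (d * r ^+ 2 / 4)).
have : nrm (G 0) <= B.
  apply: (@max_modulus R G r) => //; first by rewrite mulr_ge0 ?nrm_ge0 ?expR_ge0.
  - move=> t t1 t2; have [h1 h2] := sq t (conj t1 t2).
    apply: (@differentiableM _ _ (fun t => g (z + t)) (fun t : C => (1 + (m%:R^-1)%:C%C * w t : C) ^+ m)).
      apply: (@differentiable_comp _ _ _ _ (fun t : C => z + t) g); last exact: dg.
      apply: (@differentiableD _ _ _ (fun=> z) (id : C -> C)); first exact: differentiable_cst.
      by apply/derivable1_diffP; exact: derivable_id.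
    have dX (Q : C -> C) k : differentiable Q t -> differentiable (fun t => Q t ^+ k) t; last exact: (dX (fun t0 : C => 1 + (m%:R^-1)%:C%C * w t0)).
    move=> dQ; elim: k => [|k IH].
      by rewrite (_ : (fun t => _) = fun=> 1); [exact: differentiable_cst|apply/funext => x; rewrite expr0].
    rewrite (_ : (fun x => _) = Q * (fun t : C => Q t ^+ k)); last by apply/funext => x; rewrite exprS.
    exact: differentiableM.
  - move=> t tb; have tq := sq_boundary_csquare tb.
    have n1 := sq_boundary_nrm tb; have n2 := nrm_csquare tq.
    have n3 : nrm t <= 1 by lra.
    have h1 := hmax (z + t) (sq t tq); have h2 := hu t n3.
    have h3 := nrm_pow_exp (w t) m0.
    have B0 : 0 <= B by rewrite mulr_ge0 ?nrm_ge0 ?expR_ge0.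
    rewrite -ler_sqr ?nnegrE ?nrm_ge0 // /B exprMn -expRM_natl /G nrmM nrmX exprMn.
    have hw : nrm (w t) <= L * nrm t.
      apply: (le_trans (nrmD _ _)); rewrite /L !mulrDl nrmM; apply: lerD => //.
      apply: (le_trans (nrmD _ _)); rewrite nrmM nrmM; apply: lerD => //.
      apply: ler_wpM2l; first exact: nrm_ge0.
      by rewrite nrmX expr2 ler_piMl // nrm_ge0.
    have hw2 : nrm (w t) ^+ 2 / m%:R <= d / 4 * r ^+ 2.
      apply: (@le_trans _ _ (4 * L ^+ 2 / m%:R * r ^+ 2)); last by apply: ler_wpM2r => //; exact: sqr_ge0.
      rewrite [4 * L ^+ 2 / _ * _]mulrAC; apply: ler_wpM2r; first by rewrite invr_ge0 ler0n.
      rewrite (_ : 4 * L ^+ 2 * r ^+ 2 = (L * (2 * r)) ^+ 2); last by ring.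
      apply: lerXn2r; rewrite ?nnegrE ?nrm_ge0 //; first by rewrite !mulr_ge0 // ltW.
      by apply: (le_trans hw); exact: ler_wpM2l.
    have E : complex.Re (w t) = complex.Re (a * t + b * t ^+ 2) + d * complex.Re (z^* * t).
      by rewrite /w ReD -mulrA Re_realM.
    have n4 : K * nrm t ^+ 3 <= d / 4 * r ^+ 2.
      apply: (@le_trans _ _ (K * (2 * r) ^+ 3)).
        by apply: ler_wpM2l => //; apply: lerXn2r; rewrite ?nnegrE ?nrm_ge0 // mulr_ge0 // ltW.
      rewrite (_ : K * (2 * r) ^+ 3 = 8 * K * r * r ^+ 2); last by ring.
      by apply: ler_wpM2r => //; exact: sqr_ge0.
    have n5 : d * r ^+ 2 <= d * nrm t ^+ 2.
      by apply: ler_wpM2l; [exact: ltW|apply: lerXn2r; rewrite ?nnegrE ?nrm_ge0 // ltW].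
    apply: (@le_trans _ _ (nrm (g (z + t)) ^+ 2 * expR (2 * complex.Re (w t) + nrm (w t) ^+ 2 / m%:R))).
      by apply: ler_wpM2l => //; exact: sqr_ge0.
    apply: (@le_trans _ _ (nrm (g z) ^+ 2 * expR (u z + d * nrm z ^+ 2) * expR (- (u (z + t) + d * nrm (z + t) ^+ 2) + (2 * complex.Re (w t) + nrm (w t) ^+ 2 / m%:R)))).
      rewrite [expR (- _ + _)]expRD expRN mulrA; apply: ler_wpM2r; first exact: expR_ge0.
      by rewrite ler_pdivlMr ?expR_gt0.
    rewrite -mulrA -expRD; apply: ler_wpM2l; first exact: sqr_ge0.
    rewrite ler_expR nrm_sqrD E; move: h2 hw2 n4 n5.
    move: (u z) (u (z + t)) (complex.Re _) (complex.Re _) (nrm (w t) ^+ 2 / m%:R) (nrm z ^+ 2) (nrm t ^+ 2) (K * nrm t ^+ 3) => v1 v2 v3 v4 v5 v6 v7 v8.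
    by move: (r ^+ 2) => rr; lra.
rewrite G0 /B -[X in X <= _]mulr1 ler_pM2l ?nrm_gt0 // leNgt => /negP; apply.
by rewrite expR_lt1 oppr_lt0 divr_gt0 // mulr_gt0 // exprn_gt0.
Qed.

Lemma jet_continuous (u : C -> R) (z a b : C) (la K : R) :
  (forall t, nrm t <= 1 -> `|u (z + t) - (u z + 2 * complex.Re (a * t + b * t ^+ 2) + la * nrm t ^+ 2)| <= K * nrm t ^+ 3) ->
  {for z, continuous u}.
Proof.
move=> hu; apply/cvg_RP => e e0.
pose M := 2 * nrm a + 2 * nrm b + `|la| + `|K| + 1.
have M0 : 0 < M by rewrite ltr_wpDl // !addr_ge0 ?mulr_ge0 ?nrm_ge0 ?normr_ge0.
apply/nbhs_CP; exists (Num.min 1 (e / M)); first by rewrite lt_min ltr01 divr_gt0.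
move=> y; rewrite lt_min => /andP[y1 y2]; set t := y - z in y1 y2.
have -> : y = z + t by rewrite /t addrC subrK.
have ht := hu t (ltW y1).
have n0 := nrm_ge0 t; set N := nrm t in n0 y1 y2 ht.
have N2 : N ^+ 2 <= N by rewrite expr2 ler_piMl // ltW.
have N3 : N ^+ 3 <= N.
  by rewrite exprSr; apply: le_trans N2; apply: ler_piMr; [exact: sqr_ge0|exact: ltW].
have hR : `|complex.Re (a * t + b * t ^+ 2)| <= (nrm a + nrm b) * N.
  apply: (le_trans (Re_le_nrm _)); apply: (le_trans (nrmD _ _)); rewrite !nrmM mulrDl; apply: lerD => //.
  by apply: ler_wpM2l; [exact: nrm_ge0|rewrite -expr2].
have h1 : `|la * N ^+ 2| <= `|la| * N.
  by rewrite normrM [X in _ * X]ger0_norm ?sqr_ge0 //; apply: ler_wpM2l.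
have h2 : K * N ^+ 3 <= `|K| * N.
  by apply: le_trans (ler_wpM2l (normr_ge0 K) N3); apply: ler_wpM2r; [exact: exprn_ge0|exact: ler_norm].
have h3 : N * M < e by rewrite -ltr_pdivlMr.
move: ht hR h1 h2 h3; rewrite /M.
move: (complex.Re _) (la * N ^+ 2) (K * N ^+ 3) (u z) (u (z + t)) => A B D u0 u1.
have -> : N * (2 * nrm a + 2 * nrm b + `|la| + `|K| + 1) = 2 * ((nrm a + nrm b) * N) + `|la| * N + `|K| * N + N by ring.
move: ((nrm a + nrm b) * N) (`|la| * N) (`|K| * N) => P1 P2 P3.
rewrite !ler_norml ltr_norml => /andP[? ?] /andP[? ?] /andP[? ?] ? ?; apply/andP; split; lra.
Qed.

(** The jets with [0 <= la] express subharmonicity of [u]. Adding [d * nrm t ^+ 2] makes it strict,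
    so the maximum on the compact square is a zero of [g] or lies on the boundary; then [d] tends to
    0. *)
Lemma max_modulus_jet (u : C -> R) (g : C -> C) (s B : R) : 0 < s -> 0 <= B ->
  (forall z, csquare s z -> differentiable g z) ->
  (forall z, csquare s z -> exists (a b : C) (la K : R), [/\ 0 <= la, 0 <= K & forall t, nrm t <= 1 ->
     `|u (z + t) - (u z + 2 * complex.Re (a * t + b * t ^+ 2) + la * nrm t ^+ 2)| <= K * nrm t ^+ 3]) ->
  (forall z, sq_boundary s z -> nrm (g z) ^+ 2 * expR (u z) <= B) -> nrm (g 0) ^+ 2 * expR (u 0) <= B.
Proof.
move=> s0 B0 dg ju hB.
have key d : 0 < d -> nrm (g 0) ^+ 2 * expR (u 0) <= B * expR (d * (4 * s ^+ 2)).
  move=> d0; pose Vf t := nrm (g t) ^+ 2 * expR (u t + d * nrm t ^+ 2).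
  have sq0 : csquare s 0 by split; rewrite normr0 ltW.
  have cV : {within csquare s, continuous Vf}.
    apply: continuous_in_subspaceT => z /set_mem zs.
    have [a [b [la [K [_ _ hz]]]]] := ju z zs.
    have cn (f : C -> C) : {for z, continuous f} -> {for z, continuous (fun t => nrm (f t))}.
      move=> /cvg_CP h; apply/cvg_RP => e /h; apply: filterS => y; apply: le_lt_trans.
      rewrite ler_norml; have := nrmD (f y - f z) (f z); have := nrmD (f z - f y) (f y).
      by rewrite !subrK (nrmB (f z)) => ? ?; apply/andP; split; lra.
    have cg := cn _ (differentiable_continuous (dg z zs)).
    have ci : {for z, continuous (fun t : C => nrm t)} by apply: cn.
    apply: (@continuousM _ _ (fun t : C => nrm (g t) ^+ 2) (fun t : C => expR (u t + d * nrm t ^+ 2))).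
      exact: (@continuousM _ _ (fun t : C => nrm (g t)) (fun t : C => nrm (g t)) _ cg cg).
    apply: (continuous_comp (f := fun t : C => u t + d * nrm t ^+ 2)); last exact: continuous_expR.
    apply: (@continuousD _ _ _ u (fun t : C => d * nrm t ^+ 2)); first exact: jet_continuous hz.
    apply: (@continuousM _ _ (fun=> d) (fun t : C => nrm t ^+ 2)); first exact: cst_continuous.
    exact: (@continuousM _ _ (fun t : C => nrm t) (fun t : C => nrm t) _ ci ci).
  have [z /set_mem zs zmax] := compact_EVT_max (ex_intro _ 0 sq0) (@compact_csquare R s) cV.
  have hmax t : csquare s t -> Vf t <= Vf z by move=> ts; apply: zmax; exact/mem_set.
  have V0 : nrm (g 0) ^+ 2 * expR (u 0) = Vf 0 by rewrite /Vf nrm0 expr0n mulr0 addr0.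
  rewrite V0; apply: (le_trans (hmax 0 sq0)).
  have [gz|gz] := eqVneq (g z) 0.
    by rewrite /Vf gz nrm0 expr0n mul0r mulr_ge0 // expR_ge0.
  have nz : nrm z ^+ 2 <= 4 * s ^+ 2.
    have := nrm_csquare zs => h; rewrite (_ : 4 * s ^+ 2 = (2 * s) ^+ 2); last by ring.
    by apply: lerXn2r; rewrite ?nnegrE ?nrm_ge0 // mulr_ge0 // ltW.
  have [zb|zb] := pselect (sq_boundary s z).
    rewrite /Vf expRD mulrA; apply: (le_trans (ler_wpM2r (expR_ge0 _) (hB z zb))); apply: ler_wpM2l => //.
    by rewrite ler_expR; apply: ler_wpM2l => //; exact: ltW.
  exfalso; have [a [b [la [K [la0 K0 hz]]]]] := ju z zs.
  apply: (@no_interior_max u g s d K z a b) => //.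
  - by have [zr zi] := zs; rewrite lt_neqAle zr andbT; apply/negP => /eqP e; apply: zb; split => //; split => //; left.
  - by have [zr zi] := zs; rewrite lt_neqAle zi andbT; apply/negP => /eqP e; apply: zb; split => //; split => //; right.
  - move=> t t1; have := hz t t1; rewrite ler_norml => /andP[+ _].
    have : 0 <= la * nrm t ^+ 2 by rewrite mulr_ge0 ?sqr_ge0.
    move: (la * _) (complex.Re _) (K * _) => x1 x2 x3; lra.
set A := nrm (g 0) ^+ 2 * expR (u 0) in key *.
have A0 : 0 <= A by rewrite mulr_ge0 ?sqr_ge0 ?expR_ge0.
rewrite leNgt; apply/negP => BA.
have Ap : 0 < A by exact: le_lt_trans BA.
(* With $e^{-x} \ge 1-x$ the bound would give $(A+B)/2 \le B$. *)
pose x := (A - B) / (2 * A).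
have x0 : 0 < x by rewrite divr_gt0 ?subr_gt0 // mulr_gt0.
have s4 : 0 < 4 * s ^+ 2 by rewrite mulr_gt0 // exprn_gt0.
have := key (x / (4 * s ^+ 2)) (divr_gt0 x0 s4); rewrite divfK ?gt_eqF // => h.
have h2 : A * expR (- x) <= B by rewrite expRN ler_pdivrMr ?expR_gt0.
have h3 : A * (1 - x) <= B by apply: le_trans h2; apply: ler_wpM2l => //; exact: expR_ge1Dx.
have h4 : A * x = (A - B) / 2 by rewrite /x; field; rewrite gt_eqF.
by move: h3; rewrite mulrBr h4; lra.
Qed.

End JetMaximum.

(** * Lebesgue measure on C^n *)

Section SigmaFinite.
Local Open Scope ereal_scope.

Lemma sigma_finite_prod d1 d2 (T1 : measurableType d1) (T2 : measurableType d2) (R : realType)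
  (m1 : {measure set T1 -> \bar R}) (m2 : {sigma_finite_measure set T2 -> \bar R}) :
  sigma_finite setT m1 -> sigma_finite setT (m1 \x m2).
Proof.
move=> /sigma_finiteP[F [TF ndF Foo]].
have /sigma_finiteP[G [TG ndG Goo]] := sigma_finiteT m2.
exists (fun n => F n `*` G n).
 rewrite -setXTT TF TG predeqE => -[x y]; split.
    move=> [/= [n _ Fnx] [k _ Gky]]; exists (maxn n k) => //; split.
    - by move: x Fnx; exact/subsetPset/ndF/leq_maxl.
    - by move: y Gky; exact/subsetPset/ndG/leq_maxr.
  by move=> [n _ []/= ? ?]; split; exists n.
move=> k; have [? ?] := Foo k; have [? ?] := Goo k.
split; first exact: measurableX.
by rewrite product_measure1E// lte_mul_pinfty// ge0_fin_numE.
Qed.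

Variable R : realType.
Notation T n := (ms_type (lebC R n)).

Lemma lebC_sigma_finite n : sigma_finite setT (ms_meas (lebC R n)).
Proof.
elim: n => [|n IH]; first exact: (@sigma_finiteT _ _ _ (@dirac _ unit tt R)).
by apply: sigma_finite_prod; exact: sigma_finite_prod.
Qed.

(** A name for the measure to which the sigma-finite structure is attached, as Fubini's theorem
    demands. *)
Definition mu n : set (T n) -> \bar R := ms_meas (lebC R n).

HB.instance Definition _ n := Measure.copy (@mu n) (ms_meas (lebC R n)).

HB.instance Definition _ n := Measure_isSigmaFinite.Build _ _ _ (@mu n) (@lebC_sigma_finite n).

End SigmaFinite.

(** * Measurability of maps to C^n *)

Section VecMeasurable.
Variable R : realType.
Local Notation T n := (ms_type (lebC R n)).
Local Notation C := R[i].

(** Measurability through real coordinates; rows over [R[i]] are given no sigma-algebra. *)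
Definition mvec d (Y : measurableType d) n (V : Y -> 'rV[C]_n) :=
  forall p, measurable_fun setT (fun y => complex.Re (V y 0 p) : measurableTypeR R) /\
            measurable_fun setT (fun y => complex.Im (V y 0 p) : measurableTypeR R).

Lemma vecC_S n (u : T n.+1) (p : 'I_n.+1) :
  vecC u 0 p = if unlift 0 p is Some q then vecC u.1.1 0 q else Complex u.1.2 u.2.
Proof.
rewrite /= mxE; case: (unliftP 0 p) => [q ->|->].
  case: splitP => [j e|j e]; first by exfalso; move: e; rewrite (ord1 j).
  by congr (vecC _ 0 _); apply: val_inj; move: e; rewrite /= /bump /= !add1n => -[].
case: splitP => [j e|j e]; last by exfalso; move: e.
by rewrite mxE.
Qed.

Lemma mvec_vecC n : mvec (@vecC R n).
Proof.
elim: n => [|n IH] p; first by case: p.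
case: (unliftP 0 p) => [q ->|->].
  have [h1 h2] := IH q; split.
    rewrite (_ : (fun y => _) = (fun y : T n => complex.Re (vecC y 0 q)) \o (fun y => y.1.1)); last first.
      by apply/funext => y; rewrite (@vecC_S n y) liftK.
    by apply: measurableT_comp => //; apply: measurableT_comp => //; exact: measurable_fst.
  rewrite (_ : (fun y => _) = (fun y : T n => complex.Im (vecC y 0 q)) \o (fun y => y.1.1)); last first.
    by apply/funext => y; rewrite (@vecC_S n y) liftK.
  by apply: measurableT_comp => //; apply: measurableT_comp => //; exact: measurable_fst.
split.
  rewrite (_ : (fun y => _) = (fun y => y.1.2)); last by apply/funext => y; rewrite (@vecC_S n y) unlift_none.
  by apply: measurableT_comp; [exact: measurable_snd|exact: measurable_fst].
rewrite (_ : (fun y => _) = snd); last by apply/funext => y; rewrite (@vecC_S n y) unlift_none.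
exact: measurable_snd.
Qed.

Lemma mvec_comp d d' (Y : measurableType d) (Z : measurableType d') n (V : Z -> 'rV[C]_n) (f : Y -> Z) :
  mvec V -> measurable_fun setT f -> mvec (V \o f).
Proof. by move=> mV mf p; have [h1 h2] := mV p; split; [exact: (measurableT_comp h1 mf)|exact: (measurableT_comp h2 mf)]. Qed.

Lemma mvecB d (Y : measurableType d) n (V W : Y -> 'rV[C]_n) : mvec V -> mvec W -> mvec (fun y => V y - W y).
Proof.
move=> hV hW p; have [a1 a2] := hV p; have [b1 b2] := hW p; split.
  rewrite (_ : (fun y => _) = (fun y => complex.Re (V y 0 p) - complex.Re (W y 0 p))); first exact: measurable_funB.
  by apply/funext => y; rewrite !mxE ReB.
rewrite (_ : (fun y => _) = (fun y => complex.Im (V y 0 p) - complex.Im (W y 0 p))); first exact: measurable_funB.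
by apply/funext => y; rewrite !mxE ImB.
Qed.

Lemma mvec_cst d (Y : measurableType d) n (a : 'rV[C]_n) : mvec (fun _ : Y => a).
Proof. by move=> p; split; exact: measurable_cst. Qed.

Lemma measurable_vec d (Y : measurableType d) n (f : Y -> T n) :
  mvec (@vecC R n \o f) -> measurable_fun setT f.
Proof.
elim: n f => [|n IH] f hf.
  by rewrite (_ : f = fun=> tt); [exact: measurable_cst|apply/funext => y; case: (f y)].
have h0 := hf 0.
apply/measurable_fun_pairP; split; last first.
  have [_ h] := h0; rewrite (_ : snd \o f = fun y => complex.Im (vecC (f y) 0 0)) //.
  by apply/funext => y; rewrite vecC_S unlift_none.
apply/measurable_fun_pairP; split; last first.
  have [h _] := h0; rewrite (_ : snd \o (fst \o f) = fun y => complex.Re (vecC (f y) 0 0)) //.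
  by apply/funext => y; rewrite vecC_S unlift_none.
apply: IH => p; have [h1 h2] := hf (lift 0 p); split.
  rewrite (_ : (fun y => _) = fun y => complex.Re (vecC (f y) 0 (lift 0 p))) //.
  by apply/funext => y; rewrite vecC_S liftK.
rewrite (_ : (fun y => _) = fun y => complex.Im (vecC (f y) 0 (lift 0 p))) //.
by apply/funext => y; rewrite vecC_S liftK.
Qed.

(** Boxes in real coordinates have an exactly computable measure; [cbox_vn] and [vn_cbox] compare
    them with balls of the norm. *)
Definition cbox n (a : 'rV[C]_n) (s : R) : set 'rV[C]_n :=
  [set z | forall p, `|complex.Re (z 0 p) - complex.Re (a 0 p)| < s /\ `|complex.Im (z 0 p) - complex.Im (a 0 p)| < s].

Lemma measurable_cbox d (Y : measurableType d) n (V : Y -> 'rV[C]_n) a s :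
  mvec V -> measurable (V @^-1` cbox a s).
Proof.
move=> hV; pose B p := (fun y => complex.Re (V y 0 p)) @^-1` `]complex.Re (a 0 p) - s, complex.Re (a 0 p) + s[%classic
  `&` (fun y => complex.Im (V y 0 p)) @^-1` `]complex.Im (a 0 p) - s, complex.Im (a 0 p) + s[%classic.
rewrite (_ : _ @^-1` _ = \bigcap_(p in [set: 'I_n]) B p).
  apply: fin_bigcap_measurable; first exact: finite_finset.
  move=> p _; have [h1 h2] := hV p; apply: measurableI; rewrite -[X in measurable X]setTI.
    by apply: h1.
  by apply: h2.
apply/seteqP; split => [y hy p _|y hy p].
  have [h1 h2] := hy p; rewrite /B /= !in_itv /= ; move: h1 h2; rewrite !ltr_norml => /andP[? ?] /andP[? ?].
  by split; apply/andP; split; lra.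
have [] := hy p I; rewrite /= !in_itv /= !ltr_norml => /andP[? ?] /andP[? ?].
by split; apply/andP; split; lra.
Qed.

Lemma rat_between (x y : R) : x < y -> exists q : rat, x < ratr q < y.
Proof. by move=> /rat_in_itvoo[q]; rewrite in_itv /= => h; exists q. Qed.

Definition ratC n (f : {ffun 'I_n -> rat * rat}) : 'rV[C]_n := \row_p Complex (ratr (f p).1) (ratr (f p).2).

Lemma cbox_vn n (a z : 'rV[C]_n) s : 0 < s -> cbox a s z -> vn (z - a) < 2 * s.
Proof.
move=> s0 h; apply: vn_lt => [|p]; first by rewrite mulr_gt0.
by have [h1 h2] := h p; apply: le_lt_trans (nrm_le_ReIm _) _; rewrite !mxE ReB ImB; lra.
Qed.

Lemma vn_cbox n (a z : 'rV[C]_n) s : vn (z - a) < s -> cbox a s z.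
Proof.
move=> h p; have := vn_coord (z - a) p; rewrite !mxE => h1.
by rewrite -ReB -ImB; split; apply: le_lt_trans h; apply: le_trans h1; [exact: Re_le_nrm|exact: Im_le_nrm].
Qed.

Lemma open_cbox n (a : 'rV[C]_n) s : open (cbox a s).
Proof.
rewrite openE => z hz; apply/nbhs_VP.
have [d [d0 hd]] : exists d, 0 < d /\ forall p, `|complex.Re (z 0 p) - complex.Re (a 0 p)| + d <= s /\ `|complex.Im (z 0 p) - complex.Im (a 0 p)| + d <= s.
  suff [d [d0 hd]] : exists d, 0 < d /\ forall p, p \in enum 'I_n -> `|complex.Re (z 0 p) - complex.Re (a 0 p)| + d <= s /\ `|complex.Im (z 0 p) - complex.Im (a 0 p)| + d <= s.
    by exists d; split => // p; apply: hd; rewrite mem_enum.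
  elim: (enum 'I_n) => [|p t [d [d0 hd]]]; first by exists 1.
  have [h1 h2] := hz p.
  exists (Num.min d (Num.min (s - `|complex.Re (z 0 p) - complex.Re (a 0 p)|) (s - `|complex.Im (z 0 p) - complex.Im (a 0 p)|))).
  split; first by rewrite !lt_min d0 !subr_gt0 h1 h2.
  move=> p'; rewrite inE => /orP[/eqP ->|/hd [h3 h4]].
    by split; rewrite addrC -lerBrDr !ge_min lexx ?orbT.
  by split; rewrite addrC -lerBrDr ge_min; apply/orP; left; rewrite lerBrDr addrC.
exists d => // y hy p; have [h1 h2] := hd p; have := vn_coord (y - z) p; rewrite !mxE => h3.
have h4 := Re_le_nrm (y 0 p - z 0 p); have h5 := Im_le_nrm (y 0 p - z 0 p); rewrite ReB in h4; rewrite ImB in h5.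
split; [have := ler_normD (complex.Re (y 0 p) - complex.Re (z 0 p)) (complex.Re (z 0 p) - complex.Re (a 0 p))
      | have := ler_normD (complex.Im (y 0 p) - complex.Im (z 0 p)) (complex.Im (z 0 p) - complex.Im (a 0 p))];
  rewrite addrA subrK => h6; lra.
Qed.

(** Boxes with rational centre and size are enumerated by [unpickle]; codes of no box, or of a box
    leaving [O], contribute the empty set. *)
Lemma open_bigcup_cbox n (O : set 'rV[C]_n) : open O ->
  O = \bigcup_(k in [set: nat]) (if @unpickle ({ffun 'I_n -> rat * rat} * rat)%type k is Some x then
    if asbool (cbox (ratC x.1) (ratr x.2) `<=` O) then cbox (ratC x.1) (ratr x.2) else set0 else set0).
Proof.
move=> oO; apply/seteqP; split => [z Oz|z [k _]]; last first.
  by case: unpickle => // x; case: asboolP => // h; exact: h.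
have [e e0 he] := open_ball oO Oz.
have [s /andP[s0 se]] := rat_between (divr_gt0 e0 (ltr0Sn R 3)).
have q p : {x : rat * rat | `|ratr x.1 - complex.Re (z 0 p)| < ratr s /\ `|ratr x.2 - complex.Im (z 0 p)| < ratr s}.
  apply: cid.
  have [x /andP[x1 x2]] := @rat_between (complex.Re (z 0 p) - ratr s) (complex.Re (z 0 p) + ratr s) ltac:(lra).
  have [y /andP[y1 y2]] := @rat_between (complex.Im (z 0 p) - ratr s) (complex.Im (z 0 p) + ratr s) ltac:(lra).
  by exists (x, y); rewrite /= !ltr_norml; split; apply/andP; split; lra.
pose f := [ffun p => sval (q p)].
have zf : cbox (ratC f) (ratr s) z.
  by move=> p; rewrite !mxE /= ffunE distrC [X in _ /\ X < _]distrC; exact: (svalP (q p)).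
exists (pickle (f, s)) => //; rewrite pickleK /=; case: asboolP => // /(_ _)[]; move=> y hy.
apply: he; have h1 := cbox_vn s0 hy; have h2 := cbox_vn s0 zf.
by have := vnD (y - ratC f) (ratC f - z); rewrite addrA subrK (vnB (ratC f)) => h3; lra.
Qed.

Lemma measurable_open d (Y : measurableType d) n (V : Y -> 'rV[C]_n) O : mvec V -> open O -> measurable (V @^-1` O).
Proof.
move=> hV oO; rewrite (open_bigcup_cbox oO) preimage_bigcup; apply: bigcup_measurable => k _.
case: unpickle => [x|]; last by rewrite preimage_set0.
by case: asboolP => _; [exact: measurable_cbox|rewrite preimage_set0].
Qed.

Lemma measurable_cont d (Y : measurableType d) n (V : Y -> 'rV[C]_n) (g : 'rV[C]_n -> R) : mvec V ->
  continuous g -> measurable_fun setT (fun y => g (V y) : measurableTypeR R).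
Proof.
move=> hV cg; apply: (measurability _ (RGenOInfty.measurableE R)) => _ [_ [x ->] <-].
rewrite setTI (_ : _ @^-1` _ = V @^-1` (g @^-1` `]x, +oo[%classic)) //.
by apply: measurable_open => //; apply: open_comp => [z _|]; [exact: cg|exact: interval_open].
Qed.

End VecMeasurable.

(** A copy of [m] whose sigma-finite structure comes from the proof [h], needed for intermediate
    products. *)
Definition as_sigma_finite d (T : measurableType d) (R : realType) (m : {measure set T -> \bar R})
  (h : sigma_finite setT m) : set T -> \bar R := m.

HB.instance Definition _ d (T : measurableType d) (R : realType) (m : {measure set T -> \bar R}) h :=
  Measure.copy (@as_sigma_finite d T R m h) m.

HB.instance Definition _ d (T : measurableType d) (R : realType) (m : {measure set T -> \bar R}) h :=
  Measure_isSigmaFinite.Build _ _ _ (@as_sigma_finite d T R m h) h.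

(** * Measure of boxes and translation invariance *)

Section Boxes.
Variable R : realType.
Local Notation T n := (ms_type (lebC R n)).
Local Notation C := R[i].

Lemma lebesgue_itvoo (a s : R) : 0 < s -> lebesgue_measure (`]a - s, a + s[%classic : set R) = (2 * s)%:E.
Proof.
move=> s0; rewrite lebesgue_measure_itv /= lte_fin ifT; last by lra.
by rewrite -EFinB; congr (_%:E); ring.
Qed.

Lemma mu_cbox n (a : 'rV[C]_n) s : 0 < s -> mu (@vecC R n @^-1` cbox a s) = ((2 * s) ^+ (2 * n))%:E.
Proof.
move=> s0; elim: n a => [|n IH] a.
  rewrite muln0 expr0 /mu /= diracE mem_set //.
  by move=> [].
pose a' : 'rV[C]_n := \row_q a 0 (lift 0 q).
pose I (x : R) : set (measurableTypeR R) := `]x - s, x + s[%classic.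
have -> : @vecC R n.+1 @^-1` cbox a s = ((@vecC R n @^-1` cbox a' s) `*` I (complex.Re (a 0 0))) `*` I (complex.Im (a 0 0)).
  apply/seteqP; split => u.
    move=> h; have := h 0; rewrite vecC_S unlift_none /I /= !in_itv /= !ltr_norml => -[/andP[? ?] /andP[? ?]].
    split; last by apply/andP; split; lra.
    split; last by apply/andP; split; lra.
    by move=> q; have := h (lift 0 q); rewrite vecC_S liftK mxE.
  move=> [[h]]; rewrite /I /= !in_itv /= => /andP[? ?] /andP[? ?] p.
  rewrite vecC_S; case: (unliftP 0 p) => [q ->|->]; first by have := h q; rewrite mxE.
  by rewrite /= !ltr_norml; split; apply/andP; split; lra.
have m1 : measurable (@vecC R n @^-1` cbox a' s) by apply: measurable_cbox; exact: mvec_vecC.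
have mI x : measurable (I x) by exact: measurable_itv.
have e1 := @product_measure1E _ _ _ _ R (ms_meas (lebC R n)) (@lebesgue_measure R) _ _ m1 (mI (complex.Re (a 0 0))).
have e2 := @product_measure1E _ _ _ _ R (ms_meas (lebC R n) \x @lebesgue_measure R)%E (@lebesgue_measure R) _ _ (measurableX m1 (mI (complex.Re (a 0 0)))) (mI (complex.Im (a 0 0))).
have hI x : lebesgue_measure (I x) = (2 * s)%:E by exact: lebesgue_itvoo.
have e1' := etrans e1 (congr2 (fun x y : \bar R => x * y)%E (IH a') (hI _)).
have e2' := etrans e2 (congr2 (fun x y : \bar R => x * y)%E e1' (hI _)).
apply: (etrans e2'); rewrite -!EFinM; congr (_%:E).
by rewrite mulnS addnC !exprD expr2 !mulrA.
Qed.

(** The image of the product measure takes the right value on rectangles, so uniqueness of the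
    product measure identifies it. *)
Lemma prod_preserve d1 d2 (T1 : measurableType d1) (T2 : measurableType d2)
  (m1 : {measure set T1 -> \bar R}) (m2 : {sigma_finite_measure set T2 -> \bar R}) f1 f2 :
  sigma_finite setT m1 -> measurable_fun setT f1 -> measurable_fun setT f2 ->
  (forall A, measurable A -> m1 (f1 @^-1` A) = m1 A) -> (forall A, measurable A -> m2 (f2 @^-1` A) = m2 A) ->
  forall A, measurable A -> ((m1 \x m2) ((fun x => (f1 x.1, f2 x.2)) @^-1` A) = (m1 \x m2) A)%E.
Proof.
move=> sf1 mf1 mf2 h1 h2 A mA.
have mF : measurable_fun setT (fun x : T1 * T2 => (f1 x.1, f2 x.2)).
  by apply: measurable_fun_pair; apply: measurableT_comp.
apply/esym; apply: (@product_measure_unique _ _ _ _ _ (as_sigma_finite sf1) m2 (measure_function_pushforward__canonical__measure_function_Measure (m1 \x m2)%E mF)) => //.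
move=> B D mB mD; rewrite -[LHS]/((m1 \x m2)%E ((f1 @^-1` B) `*` (f2 @^-1` D))).
have mfB : measurable (f1 @^-1` B) by rewrite -[X in measurable X]setTI; exact: mf1.
have mfD : measurable (f2 @^-1` D) by rewrite -[X in measurable X]setTI; exact: mf2.
apply: (etrans (product_measure1E m1 m2 mfB mfD)).
exact: (congr2 (fun x y : \bar R => x * y)%E (h1 _ mB) (h2 _ mD)).
Qed.

Definition shiftR (c : R) (x : measurableTypeR R) : measurableTypeR R := x + c.

Lemma measurable_shiftR c : measurable_fun setT (shiftR c).
Proof. by apply: measurable_funD => //; exact: measurable_cst. Qed.

Lemma lebesgue_shift (c : R) (A : set (measurableTypeR R)) : measurable A ->
  lebesgue_measure (shiftR c @^-1` A) = lebesgue_measure A.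
Proof.
move=> mA; apply/esym.
apply: (@lebesgue_measure_unique R (measure_function_pushforward__canonical__measure_function_Measure lebesgue_measure (measurable_shiftR c))) => // _ [[a b] _ <-].
rewrite /= /pushforward (_ : _ @^-1` _ = `]a - c, b - c]%classic).
  rewrite !lebesgue_measure_itv /= !lte_fin ltrD2r; case: ifP => // _.
  by rewrite -!EFinB; congr (_%:E); ring.
by apply/seteqP; split => x /=; rewrite !in_itv /= /shiftR => /andP[? ?]; apply/andP; split; lra.
Qed.

Fixpoint shiftT n : 'rV[C]_n -> T n -> T n :=
  match n return 'rV[C]_n -> T n -> T n with
  | 0 => fun _ u => u
  | n'.+1 => fun a u => (shiftT (\row_q a 0 (lift 0 q)) u.1.1, shiftR (complex.Re (a 0 0)) u.1.2, shiftR (complex.Im (a 0 0)) u.2)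
  end.

Lemma vecC_shift n (a : 'rV[C]_n) u : vecC (shiftT a u) = vecC u + a.
Proof.
elim: n a u => [|n IH] a u; first by apply/rowP => -[].
apply/rowP => p; rewrite [RHS]mxE !vecC_S; case: (unliftP 0 p) => [q ->|->].
  by rewrite /= IH mxE mxE.
by rewrite /=; case: (a 0 0) => x y.
Qed.

Lemma measurable_shift n (a : 'rV[C]_n) : measurable_fun setT (shiftT a).
Proof.
apply: measurable_vec; rewrite (_ : _ \o _ = fun u => vecC u - (- a)).
  by apply: mvecB; [exact: mvec_vecC|exact: mvec_cst].
by apply/funext => u; rewrite /= vecC_shift opprK.
Qed.

Lemma mu_shift n (a : 'rV[C]_n) A : measurable A -> mu (shiftT a @^-1` A) = mu A.
Proof.
elim: n a A => [|n IH] a A mA; first by [].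
pose a' : 'rV[C]_n := \row_q a 0 (lift 0 q).
pose f1 (x : T n * measurableTypeR R) := (shiftT a' x.1, shiftR (complex.Re (a 0 0)) x.2).
have mf1 : measurable_fun setT f1.
  apply: measurable_fun_pair; first by apply: measurableT_comp => //; exact: measurable_shift.
  by apply: measurableT_comp => //; exact: measurable_shiftR.
have h1 B : measurable B -> ((@mu R n \x @lebesgue_measure R) (f1 @^-1` B) = (@mu R n \x @lebesgue_measure R) B)%E.
  move=> mB; apply: (@prod_preserve _ _ _ _ (@mu R n) (@lebesgue_measure R) (shiftT a') (shiftR (complex.Re (a 0 0)))) => //.
  - exact: lebC_sigma_finite.
  - exact: measurable_shift.
  - exact: measurable_shiftR.
  - by move=> D mD; exact: IH.
  - by move=> D mD; exact: lebesgue_shift.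
have := @prod_preserve _ _ (T n * measurableTypeR R)%type (measurableTypeR R) (@mu R n \x @lebesgue_measure R)%E (@lebesgue_measure R) f1 (shiftR (complex.Im (a 0 0))) (sigma_finite_prod _ (@lebC_sigma_finite R n)) mf1 (measurable_shiftR _) h1 (@lebesgue_shift _) A mA.
exact: id.
Qed.

End Boxes.

(** * Outer regularity *)

Section Regularity.
Variables (R : realType) (n : nat).
Local Notation T := (ms_type (lebC R n)).
Local Notation C := R[i].
Local Notation V := 'rV[C]_n.
Variable B : set T.
Hypothesis mB : measurable B.
Hypothesis finB : (mu B < +oo)%E.

(** Open covers of [A] and of its complement with small overlap inside [B]. The overlap contains the
    excess of both covers, and the condition is visibly stable under complements. *)
Definition regular (A : set T) := forall e : R, 0 < e -> exists O O' : set V,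
  [/\ open O, open O', A `<=` @vecC R n @^-1` O, ~` A `<=` @vecC R n @^-1` O' &
      (mu (B `&` @vecC R n @^-1` (O `&` O')) < e%:E)%E].

Lemma mO (O : set V) : open O -> measurable (@vecC R n @^-1` O).
Proof. by apply: measurable_open; exact: mvec_vecC. Qed.

Lemma measure_cvg0 (F : (set T)^nat) : (forall k, measurable (F k)) -> nonincreasing_seq F ->
  \bigcap_k F k = set0 -> forall e : R, 0 < e -> exists k, (mu (B `&` F k) < e%:E)%E.
Proof.
move=> mF niF F0 e e0.
have : @mu R n \o (fun k => B `&` F k) @ \oo --> @mu R n (\bigcap_k (B `&` F k)).
  apply: nonincreasing_cvg_mu.
  - apply: le_lt_trans finB; apply: le_measure; rewrite ?inE //; first exact: measurableI.
  - by move=> k; exact: measurableI.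
  - by apply: bigcap_measurable => // k _; exact: measurableI.
  - by move=> k k' kk'; apply/subsetPset; apply: setIS; apply/subsetPset; exact: niF.
rewrite (_ : \bigcap_k _ = set0); last first.
  by rewrite -subset0 => x h; rewrite -F0 => k _; have [] := h k I.
rewrite measure0 => /fine_cvgP[[N1 _ hN1] /cvgrPdist_lt /(_ e e0) [N2 _ hN2]].
exists (maxn N1 N2); have h1 := hN1 _ (leq_maxl N1 N2); have := hN2 _ (leq_maxr N1 N2).
rewrite /= in h1 *; rewrite sub0r normrN ger0_norm ?fine_ge0 ?measure_ge0 // => h2.
by rewrite -(fineK h1) lte_fin.
Qed.

(** The complement is covered by its neighbourhoods of radius $1/(k+1)$, whose traces on [O]
    decrease to the empty set. *)
Lemma regular_open (O : set V) : open O -> regular (@vecC R n @^-1` O).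
Proof.
move=> oO e e0.
pose F (k : nat) : set V := [set z | exists2 y, (~` O) y & vn (z - y) < k.+1%:R^-1].
have oF k : open (F k).
  rewrite openE => z [y Oy zy]; apply/nbhs_VP; exists (k.+1%:R^-1 - vn (z - y)); first by rewrite subr_gt0.
  move=> z' hz; exists y => //; have := vnD (z' - z) (z - y); rewrite addrA subrK => /le_lt_trans; apply.
  by rewrite -ltrBrDr.
have niF : nonincreasing_seq (fun k => @vecC R n @^-1` (O `&` F k)).
  move=> k k' kk'; apply/subsetPset => u [Ou [y Oy uy]]; split => //; exists y => //.
  by apply: lt_le_trans uy _; rewrite lef_pV2 ?posrE ?ltr0n // ler_nat.
have F0 : \bigcap_k (@vecC R n @^-1` (O `&` F k)) = set0.
  rewrite -subset0 => u h; have [Ou _] := h 0%N I.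
  have [d d0 hd] := open_ball oO Ou.
  have := archi_boundP (x := d^-1); rewrite invr_ge0 ltW // => /(_ isT); set k := Num.bound _ => hk.
  have [_ [y Oy uy]] := h k I; apply: Oy; apply: hd; rewrite vnB; apply: lt_le_trans uy _.
  rewrite invf_ple ?posrE ?ltr0n //; apply/ltW/(lt_trans hk); by rewrite ltr_nat.
have [k hk] := measure_cvg0 (fun k => mO (openI oO (oF k))) niF F0 e0.
exists O, (F k); split => //.
by move=> u nu; exists (vecC u) => //; rewrite subrr vn0 invr_gt0 ltr0n.
Qed.

Lemma regular_sigma : sigma_algebra setT regular.
Proof.
split.
- move=> e e0; exists set0, setT; split => //; try exact: open0; try exact: openT.
  by rewrite set0I preimage_set0 setI0 measure0 lte_fin.
- move=> A rA e e0; have [G [G' [oG oG' AG AG' h]]] := rA e e0.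
  by exists G', G; rewrite setTD setCK [G' `&` G]setIC.
- move=> A rA e e0.
  have e4 k : 0 < e / 4 / 2 ^+ k by rewrite divr_gt0 ?divr_gt0 // exprn_gt0.
  have /choice [G hG] : forall k, exists O : set V * set V, [/\ open O.1, open O.2, A k `<=` @vecC R n @^-1` O.1, ~` A k `<=` @vecC R n @^-1` O.2 &
      (mu (B `&` @vecC R n @^-1` (O.1 `&` O.2)) < (e / 4 / 2 ^+ k)%:E)%E].
    by move=> k; have [G [G' h]] := rA k _ (e4 k); exists (G, G').
  pose U := \bigcup_k (G k).1.
  have oU : open U by apply: bigcup_open => k _; have [] := hG k.
  pose UK K := \big[setU/set0]_(k < K) (G k).1.
  have oUK K : open (UK K) by rewrite /UK; apply: big_ind => [|X Y|k _]; [exact: open0|exact: openU|have [] := hG k].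
  have UKE K z : UK K z <-> exists2 k, (k < K)%N & (G k).1 z.
    by rewrite /UK -(bigcup_mkord K (fun k => (G k).1)); split => [[k /= ? ?]|[k ? ?]]; exists k.
  pose F K := @vecC R n @^-1` U `\` @vecC R n @^-1` UK K.
  have mF K : measurable (F K) by apply: measurableD; exact: mO.
  have niF : nonincreasing_seq F.
    move=> k k' kk'; apply/subsetPset; apply: setDS => u /UKE [j jk uj].
    by apply/UKE; exists j => //; exact: leq_trans kk'.
  have F0 : \bigcap_k F k = set0.
    rewrite -subset0 => u h; have [[j _ uj] _] := h 0%N I.
    by have [_] := h j.+1 I; apply; apply/UKE; exists j.
  have [K hK] := measure_cvg0 mF niF F0 (divr_gt0 e0 (ltr0Sn R 1)).
  (* Only finitely many covers of the complements are intersected, so that the result is open; the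
     part of the union beyond [K] is measured by [F K]. *)
  pose O' := \big[setI/setT]_(k < K) (G k).2.
  have oO' : open O' by rewrite /O'; apply: big_ind => [|X Y|k _]; [exact: openT|exact: openI|have [] := hG k].
  exists U, O'; split => //.
  - by move=> u [k _ Au]; exists k => //; have [_ _ + _ _] := hG k; apply.
  - move=> u nu; rewrite /O' /=; elim: (K) => [|k IH]; first by rewrite big_ord0.
    rewrite big_ord_recr; split => //; have [_ _ _ + _] := hG k; apply => Au; apply: nu; by exists k.
  have mOk k : measurable (B `&` @vecC R n @^-1` ((G k).1 `&` (G k).2)).
    by apply: measurableI => //; have [h1 h2 _ _ _] := hG k; apply: mO; exact: openI.
  apply: (@le_lt_trans _ _ (mu ((B `&` F K) `|` \big[setU/set0]_(k < K) (B `&` @vecC R n @^-1` ((G k).1 `&` (G k).2))))).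
    apply: le_measure; rewrite ?inE.
    - by apply: measurableI => //; apply: mO; exact: openI.
    - apply: measurableU; first exact: measurableI.
      by apply: bigsetU_measurable => k _; exact: mOk.
    - move=> u [Bu [Uu O'u]]; have [hu|hu] := pselect ((@vecC R n @^-1` UK K) u); last by left; split => //; split.
      right; have /UKE [k kK uk] := hu; rewrite -(bigcup_mkord K (fun k => B `&` @vecC R n @^-1` ((G k).1 `&` (G k).2))).
      exists k => //; split => //; split => //.
      by move: O'u; rewrite /O' /= -(bigcap_mkord K (fun k => (G k).2)) => /(_ k kK).
  apply: (le_lt_trans (measureU2 _ _ _)); [exact: measurableI|by apply: bigsetU_measurable => k _; exact: mOk|].
  apply: (@lt_le_trans _ _ ((e / 2)%:E + (e / 2)%:E)%E); last by rewrite -EFinD lee_fin; lra.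
  apply: (@le_lt_trans _ _ (mu (B `&` F K) + (e / 2)%:E)%E); last by apply: lte_leD.
  apply: leeD2l.
  apply: (le_trans (@Boole_inequality _ _ _ (@mu R n) (fun k => B `&` @vecC R n @^-1` ((G k).1 `&` (G k).2)) K (fun k _ => mOk k))).
  apply: (@le_trans _ _ (\sum_(k < K) (e / 4 / 2 ^+ k)%:E)%E); first by apply: lee_sum => k _; have [_ _ _ _ /ltW] := hG k.
  rewrite sumEFin lee_fin.
  have : \sum_(k < K) e / 4 / 2 ^+ k = e / 2 - e / 2 / 2 ^+ K.
    elim: (K) => [|k IH]; first by rewrite big_ord0 expr0 divr1 subrr.
    rewrite big_ord_recr /= IH exprS; field; by rewrite expf_neq0.
  move=> ->; rewrite gerBl divr_ge0 ?exprn_ge0 // ltW // divr_gt0 //.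
Qed.

(** With the regular sets as sigma-algebra the coordinates are measurable, since open sets are
    regular; hence so is the identity map to the product space. *)
Lemma measurable_regular (A : set T) : measurable A -> regular A.
Proof.
move=> mA.
pose Y := g_sigma_algebraType regular.
have mY : (@measurable _ Y) = regular by exact: sigma_algebra_id regular_sigma.
have mcoord (g : V -> R) : continuous g -> measurable_fun setT (fun y : Y => g (vecC (y : T)) : measurableTypeR R).
  move=> cg; apply: (measurability _ (RGenOInfty.measurableE R)) => _ [_ [x ->] <-].
  rewrite setTI mY; apply: (@regular_open (g @^-1` `]x, +oo[%classic)).
  by apply: open_comp => [z _|]; [exact: cg|exact: interval_open].
have cRe p : continuous (fun z : V => complex.Re (z 0 p)).
  move=> z; apply: (continuous_comp (g := @complex.Re R)); first exact: coord_continuous.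
  exact: Re_cont.
have cIm p : continuous (fun z : V => complex.Im (z 0 p)).
  move=> z; apply: (continuous_comp (g := @complex.Im R)); first exact: coord_continuous.
  exact: Im_cont.
have : measurable_fun setT ((fun y => y) : Y -> T).
  apply: measurable_vec => p; split; [exact: (mcoord _ (cRe p))|exact: (mcoord _ (cIm p))].
by move=> /(_ measurableT A mA); rewrite setTI mY.
Qed.

Lemma outer_open (A : set T) : measurable A -> exists O : (set V)^nat,
  [/\ forall k, open (O k), forall k, A `<=` @vecC R n @^-1` O k, nonincreasing_seq O &
     mu (B `&` (\bigcap_k (@vecC R n @^-1` O k) `\` A)) = 0%E].
Proof.
move=> mA.
have e0 k : 0 < (k.+1%:R^-1 : R) by rewrite invr_gt0 ltr0n.
have /choice [G hG] : forall k, exists O : set V, [/\ open O, A `<=` @vecC R n @^-1` O & (mu (B `&` (@vecC R n @^-1` O `\` A)) < (k.+1%:R^-1)%:E)%E].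
  move=> k; have [G [G' [oG oG' AG AG' h]]] := measurable_regular mA (e0 k).
  exists G; split => //; apply: le_lt_trans h; apply: le_measure; rewrite ?inE.
  - by apply: measurableI => //; apply: measurableD => //; exact: mO.
  - by apply: measurableI => //; apply: mO; exact: openI.
  - by apply: setIS => u [Ou nAu]; split => //; exact: AG'.
pose P k := \big[setI/setT]_(j < k.+1) G j.
have PE k u : P k u <-> forall j, (j <= k)%N -> G j u.
  rewrite /P -bigcap_mkord; split => [h j jk|h j /= jk]; first exact: (h j).
  exact: h.
exists P; split.
- by move=> k; rewrite /P; apply: big_ind => [|X Y|j _]; [exact: openT|exact: openI|have [] := hG j].
- by move=> k u Au; apply/PE => j _; have [_ + _] := hG j; apply.
- by move=> k k' kk'; apply/subsetPset => u /PE h; apply/PE => j jk; apply: h; exact: leq_trans kk'.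
have mP : measurable (B `&` (\bigcap_k (@vecC R n @^-1` P k) `\` A)).
  apply: measurableI => //; apply: measurableD => //; apply: bigcap_measurable => // k _; apply: mO.
  by rewrite /P; apply: big_ind => [|X Y|j _]; [exact: openT|exact: openI|have [] := hG j].
apply/eqP; rewrite -measure_le0; apply/lee_addgt0Pr => e e00; rewrite add0e.
have := archi_boundP (x := e^-1); rewrite invr_ge0 ltW // => /(_ isT); set k := Num.bound _ => hk.
have [oOk AOk hOk] := hG k.
apply: (@le_trans _ _ (mu (B `&` (@vecC R n @^-1` G k `\` A)))).
  apply: le_measure; rewrite ?inE //; first by apply: measurableI => //; apply: measurableD => //; exact: mO.
  by apply: setIS; apply: setSD => u h; have /PE := h k I; apply.
apply/ltW/(lt_le_trans hOk); rewrite lee_fin invf_ple ?posrE ?ltr0n //.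
by apply/ltW/(lt_trans hk); rewrite ltr_nat.
Qed.

End Regularity.

(** * Tests on open sets and transport of null sets *)

Section OpenTests.
Variables (R : realType) (n : nat).
Local Notation T := (ms_type (lebC R n)).
Local Notation C := R[i].
Local Notation V := 'rV[C]_n.
Local Notation vC := (@vecC R n).

(** The set where [f] is positive is, up to a null set, a decreasing intersection of open sets, and
    dominated convergence carries the inequality over to it. *)
Lemma open_integral_le0 (B : set T) (f : T -> R) : measurable B -> (mu B < +oo)%E ->
  (@mu R n).-integrable B (EFin \o f) ->
  (forall G : set V, open G -> (\int[@mu R n]_(x in B `&` vC @^-1` G) (f x)%:E <= 0)%E) ->
  mu (B `&` [set x | 0 < f x]) = 0%E.
Proof.
move=> mB finB intf hf.
have mf := measurable_int _ intf.
have mA : measurable (B `&` [set x | 0 < f x]).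
  have := mf mB `]0%E, +oo[%classic (emeasurable_itv _); rewrite (_ : _ `&` _ = B `&` [set x | 0 < f x]) //.
  by apply/seteqP; split => x [Bx /=]; rewrite in_itv /= andbT lte_fin.
set A := B `&` _ in mA *.
have [P [oP AP niP P0]] := outer_open mB finB mA.
pose Q := \bigcap_k (vC @^-1` P k).
have mQ : measurable Q by apply: bigcap_measurable => // k _; exact: mO.
have intfB := integrableS mB _ _ intf.
have QB : (\int[@mu R n]_(x in B `&` Q) (f x)%:E <= 0)%E.
  have mfp k : measurable_fun B ((EFin \o f) \_ (vC @^-1` P k)).
    apply/(measurable_restrict _ (mO (oP k)) mB); apply: measurable_funS mf => //; exact: subIsetl.
  have mfQ : measurable_fun B ((EFin \o f) \_ Q).
    by apply/(measurable_restrict _ mQ mB); apply: measurable_funS mf => //; exact: subIsetl.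
  have hcv : {ae @mu R n, forall x, B x -> (fun k => ((EFin \o f) \_ (vC @^-1` P k)) x) @ \oo --> ((EFin \o f) \_ Q) x}.
    apply: aeW => x _.
    have [Qx|nQ] := pselect (Q x).
      by apply: cvg_near_cst; apply: nearW => k; rewrite !patchE !mem_set //; exact: Qx.
    have [k nP] : exists k, ~ P k (vecC x) by apply/existsNP => h; apply: nQ => k _; exact: h.
    apply: cvg_near_cst; exists k => // m /= km; rewrite !patchE !memNset //.
    by move=> h; apply: nP; have /subsetPset := niP _ _ km; apply.
  have hdom : {ae @mu R n, forall x k, B x -> (`|((EFin \o f) \_ (vC @^-1` P k)) x| <= (abse \o (EFin \o f)) x)%E}.
    by apply: aeW => x k _; rewrite patchE; case: ifP => //= _; rewrite normr0 lee_fin.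
  have [_ _ h] := @dominated_convergence _ _ _ (@mu R n) B mB (fun k => (EFin \o f) \_ (vC @^-1` P k))
    ((EFin \o f) \_ Q) (abse \o (EFin \o f)) mfp mfQ hcv (integrable_abse intf) hdom.
  rewrite integral_mkcondr -(cvg_lim _ h) //; apply: lime_le; first by apply/cvg_ex; exists (\int[@mu R n]_(x in B) ((EFin \o f) \_ Q) x)%E.
  by apply: nearW => k; rewrite /= -integral_mkcondr; exact: hf.
have AE : A = (B `&` Q) `\` (B `&` (Q `\` A)).
  apply/seteqP; split => x.
    by move=> Ax; split; [split; [exact: Ax.1|by move=> k _; exact: AP]|move=> [_ [_]]].
  by move=> [[Bx Qx] h]; apply: contrapT => nA; apply: h.
have IA : (\int[@mu R n]_(x in A) (f x)%:E <= 0)%E.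
  rewrite AE -negligible_integral //.
  - by apply: measurableI => //; exact: measurableD.
  - exact: measurableI.
  - by apply: integrableS intf => //; exact: measurableI.
have I0 : (\int[@mu R n]_(x in A) `|(f x)%:E| = 0)%E.
  apply/eqP; rewrite eq_le integral_ge0 // andbT.
  rewrite (eq_integral (fun x => (f x)%:E)) // => x /set_mem [_ /= fx].
  by rewrite /= ger0_norm // ltW.
have mfA : measurable_fun A (EFin \o f) by apply: measurable_funS mf => //; exact: subIsetl.
have /(ae_eq_integral_abs _ mA mfA) [N [mN N0 hN]] := I0.
apply/eqP; rewrite -measure_le0 -N0; apply: le_measure; rewrite ?inE // => x Ax; apply: hN => /= /(_ Ax).
by case: Ax => _ /= fx [] e; rewrite e ltxx in fx.
Qed.

Lemma tonelli_sets (H : set (T * T)) : measurable H ->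
  (\int[@mu R n]_x mu (xsection H x) = \int[@mu R n]_y mu (ysection H y))%E.
Proof.
move=> mH; rewrite -[LHS]/((@mu R n \x @mu R n)%E H) -[RHS]/((@mu R n \x^ @mu R n)%E H).
apply: product_measure_unique => // A D mA mD; exact: product_measure2E.
Qed.

Let lee_cancel_EFin (a b : R) (x y : \bar R) : 0 < a -> (a%:E * x <= (a * b)%:E * y)%E -> (x <= b%:E * y)%E.
Proof. by move=> a0; rewrite EFinM -muleA lee_pmul2l. Qed.

Variables (G0 G1 : set V) (F S : V -> V) (z1 : V) (r1 : R).
Hypotheses (oG0 : open G0) (oG1 : open G1) (r10 : 0 < r1) (G1B : G1 `<=` cbox z1 r1).
Hypotheses (FG : forall z, G0 z -> G1 (F z)) (SF : forall z, G0 z -> S (F z) = z).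
Hypothesis cF : forall z, G0 z -> {for z, continuous F}.
Hypothesis dS : forall z, G1 z -> differentiable S z.

(** The points at which [S] is Lipschitz with constant $k+1$ at scales below $1/(k+1)$; they exhaust
    [G1] because [S] is differentiable. *)
Let Z (k : nat) : set V := [set x | G1 x /\ forall y, G1 y -> vn (y - x) < k.+1%:R^-1 -> vn (S y - S x) <= k.+1%:R * vn (y - x)].

Let vn_continuous (f : V -> V) x : {for x, continuous f} -> forall e : R, 0 < e -> \forall y \near x, vn (f y - f x) < e.
Proof. by move=> cf e e0; have := cf; move=> /(_ _ ((nbhs_VP _ [set y | vn (y - f x) < e]).2 (ex_intro2 _ _ e e0 (fun y h => h)))). Qed.

(** A violation of the Lipschitz condition is a strict inequality, stable under small moves of the
    base point. *)
Let open_compl k : open (G1 `\` Z k).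
Proof.
rewrite openE => x [Gx /not_andP[//|/existsNP[y /not_implyP[Gy /not_implyP[yx /negP]]]]].
rewrite -ltNge => hy; have k0 : 0 < k.+1%:R :> R by rewrite ltr0n.
set d1 := k.+1%:R^-1 - vn (y - x); have d10 : 0 < d1 by rewrite subr_gt0.
set d2 := vn (S y - S x) - k.+1%:R * vn (y - x); have d20 : 0 < d2 by rewrite subr_gt0.
have N1 : \forall x' \near x, vn (x' - x) < Num.min d1 (d2 / (2 * k.+1%:R)).
  by apply/nbhs_VP; exists (Num.min d1 (d2 / (2 * k.+1%:R))) => //; rewrite lt_min d10 divr_gt0 // mulr_gt0.
have N2 := vn_continuous (differentiable_continuous (dS Gx)) (divr_gt0 d20 (ltr0Sn R 1)).
have N3 : nbhs x G1 by apply: open_nbhs_nbhs.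
apply: filterS (filterI N1 (filterI N2 N3)) => x' [+ [h2 h3]]; rewrite lt_min => /andP[h4 h5].
split => // -[_ /(_ y Gy)].
have t1 := vnD (y - x) (x - x'); rewrite addrA subrK (vnB x) in t1.
have t2 := vnD (S y - S x') (S x' - S x); rewrite addrA subrK in t2.
have t3 : vn (y - x') < k.+1%:R^-1 by apply: le_lt_trans t1 _; rewrite -ltrBrDl.
move=> /(_ t3); apply/negP; rewrite -ltNge.
have h6 : k.+1%:R * vn (x' - x) < d2 / 2.
  move: h5; rewrite invfM mulrA ltr_pdivlMr // mulrC; exact.
have : k.+1%:R * vn (y - x') <= k.+1%:R * vn (y - x) + k.+1%:R * vn (x' - x).
  by rewrite -mulrDr; apply: ler_wpM2l => //; exact: ltW.
move: h6 h2 t2; rewrite /d2.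
move: (vn (S y - S x)) (vn (S y - S x')) (vn (S x' - S x)) (_ * vn (y - x)) (_ * vn (x' - x)) (_ * vn (y - x')) => a1 a2 a3 a4 a5 a6; lra.
Qed.

Let cup_Z z : G1 z -> exists k, Z k z.
Proof.
move=> Gz; have [L [d d0 [L0 hd]]] := diff_lipschitz (dS Gz).
have := archi_boundP (x := L + d^-1); rewrite addr_ge0 ?invr_ge0 1?ltW // => /(_ isT).
set k := Num.bound _ => hk; exists k; split => // y _ hy.
have kk : k%:R <= k.+1%:R :> R by rewrite ler_nat.
have d10 : 0 < d^-1 by rewrite invr_gt0.
apply: (le_trans (hd y _)).
  apply: (lt_le_trans hy); rewrite invf_ple ?posrE ?ltr0n //; lra.
by apply: ler_wpM2r; [exact: vn_ge0|lra].
Qed.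

Let open_pre (O : set V) : open O -> open (G0 `&` F @^-1` O).
Proof.
move=> oO; rewrite openE => z [Gz Oz].
have n1 : nbhs z G0 by apply: open_nbhs_nbhs.
have n2 : nbhs z (F @^-1` O) by apply: (cF Gz); apply: open_nbhs_nbhs.
exact: filterI n1 n2.
Qed.

(* Where S expands small distances by at most k, Fubini applied to the pairs
   (x, y) with y in a small box around F x bounds mu (F^-1 O) by a constant
   times mu O for O open; no change of variables formula is needed. *)
Let D k : set T := [set u | G0 (vC u) /\ Z k (F (vC u))].

Let mD k : measurable (D k).
Proof.
rewrite (_ : D k = vC @^-1` G0 `\` vC @^-1` (G0 `&` F @^-1` (G1 `\` Z k))).
  by apply: measurableD; apply: mO => //; apply: open_pre; exact: open_compl.
apply/seteqP; split => u; first by move=> [h1 h2]; split => // -[_ [_]].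
move=> [h1 h2]; split => //; apply: contrapT => h3; apply: h2; split => //; split => //; exact: FG.
Qed.

(** Extended by 0 outside [G0] to have a globally measurable map; the value 0 is never evaluated, as
    [D k] lies over [G0]. *)
Let Fv (u : T) : V := if asbool (G0 (vC u)) then F (vC u) else 0.

Let mFv : mvec Fv.
Proof.
have key (g : V -> R) : continuous g -> g 0 = 0 -> measurable_fun setT (fun u => g (Fv u) : measurableTypeR R).
  move=> cg g0; apply: (measurability _ (RGenOInfty.measurableE R)) => _ [_ [x ->] <-].
  rewrite setTI (_ : _ @^-1` _ = vC @^-1` (G0 `&` F @^-1` (g @^-1` `]x, +oo[%classic)) `|`
     (if x < 0 then ~` (vC @^-1` G0) else set0)).
    apply: measurableU.
      apply: mO; apply: open_pre; apply: open_comp => [z _|]; [exact: cg|exact: interval_open].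
    by case: ifP => _ //; apply: measurableC; exact: mO.
  apply/seteqP; split => u; rewrite /Fv /=; case: asboolP => h; rewrite ?in_itv /= ?andbT.
  - by move=> h2; left.
  - by rewrite g0 => ->; right.
  - by move=> [[_]|] //; case: ifP.
  - by rewrite g0 => -[[]//|]; case: ifP.
have cRe p : continuous (fun z : V => complex.Re (z 0 p)).
  move=> z; apply: (continuous_comp (g := @complex.Re R)); first exact: coord_continuous.
  exact: Re_cont.
have cIm p : continuous (fun z : V => complex.Im (z 0 p)).
  move=> z; apply: (continuous_comp (g := @complex.Im R)); first exact: coord_continuous.
  exact: Im_cont.
by move=> p; split; [apply: (key _ (cRe p))|apply: (key _ (cIm p))]; rewrite mxE.
Qed.

Let E k (s : R) (O1 : set V) : set T := [set u | D k u /\ cbox (F (vC u)) s `<=` O1].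

Let cbox_sym (a b : V) s : cbox a s b -> cbox b s a.
Proof. by move=> h p; have [h1 h2] := h p; rewrite distrC [X in _ /\ X < _]distrC. Qed.

Let mE k s O1 : measurable (E k s O1).
Proof.
pose W := \bigcup_(x in ~` O1) cbox x s.
have oW : open W by apply: bigcup_open => x _; exact: open_cbox.
rewrite (_ : E k s O1 = D k `\` vC @^-1` (G0 `&` F @^-1` W)).
  by apply: measurableD => //; apply: mO; exact: open_pre.
apply/seteqP; split => u.
  by move=> [h1 h2]; split => // -[_ [x nx hx]]; apply: nx; apply: h2; exact: cbox_sym.
move=> [h1 h2]; split => // x hx; apply: contrapT => nx; apply: h2; split; first exact: h1.1.
by exists x => //; exact: cbox_sym.
Qed.

Let E_bound k s (O : set V) : 0 < s -> 4 * s < k.+1%:R^-1 -> open O ->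
  (mu (E k s (O `&` G1)) <= ((5 * k.+1%:R) ^+ (2 * n))%:E * mu (vC @^-1` (O `&` G1)))%E.
Proof.
move=> s0 sk oO; set O1 := O `&` G1.
have oO1 : open O1 by exact: openI.
have k0 : 0 < k.+1%:R :> R by rewrite ltr0n.
pose H : set (T * T) := [set p | O1 (vC p.1) /\ D k p.2 /\ cbox 0 s (vC p.1 - Fv p.2)].
have mH : measurable H.
  rewrite (_ : H = ((vC @^-1` O1) `*` D k) `&` (fun p : T * T => vC p.1 - Fv p.2) @^-1` cbox 0 s).
    apply: measurableI; first by apply: measurableX => //; exact: mO.
    apply: measurable_cbox; apply: mvecB.
      exact: (@mvec_comp R _ _ _ _ n vC fst (@mvec_vecC R n) (@measurable_fst _ _ T T)).
    exact: (@mvec_comp R _ _ _ _ n Fv snd mFv (@measurable_snd _ _ T T)).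
  by apply/seteqP; split => p /=; [move=> [? [? ?]]|move=> [[? ?] ?]].
have box0 (x y : V) : cbox 0 s (x - y) <-> cbox y s x.
  by split => h p; have := h p; rewrite !mxE !subr0 ReB ImB.
have HE y : D k y -> forall x, H (x, y) <-> O1 (vC x) /\ cbox (F (vC y)) s (vC x).
  move=> Dy x; have FvE : Fv y = F (vC y) by rewrite /Fv asboolT //; exact: Dy.1.
  split; first by move=> [/= h1 [h2 h3]]; split => //; apply/box0; rewrite -FvE.
  by move=> [h1 h2]; split => //; split => //=; rewrite FvE; apply/box0.
have b2 : 0 < (2 * s) ^+ (2 * n) by rewrite exprn_gt0 // mulr_gt0.
(* For [y] in [E k s (O & G1)] the section of [H] contains a whole box around [F y]. *)
have L1 : (((2 * s) ^+ (2 * n))%:E * mu (E k s O1) <= \int[@mu R n]_y mu (ysection H y))%E.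
  rewrite -integral_cst; last exact: mE.
  rewrite (integral_mkcond (E k s O1)).
  apply: ge0_le_integral => //.
  - by move=> y _; rewrite patchE; case: ifP => // _; rewrite lee_fin ltW.
  - by apply/(measurable_restrictT _ (mE k s O1)); exact: measurable_cst.
  - exact: measurable_fun_ysection.
  - move=> y _; rewrite patchE; case: (boolP (y \in E k s O1)) => [/set_mem [Dy By]|_]; last exact: measure_ge0.
    rewrite -(mu_cbox (F (vC y)) s0) le_measure ?inE //.
    + by apply: measurable_cbox; exact: mvec_vecC.
    + exact: measurable_ysection.
    + by move=> x hx; apply/ysectionP; apply/HE => //; split => //; exact: By.
(* If [x] is in the boxes around [F y] and [F y0], these are within [4 * s], so [y] and [y0] are
   within [4 * k.+1 * s] by the Lipschitz bound for [S]. The constant 5 absorbs this in an open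
   box. *)
have L2 : (\int[@mu R n]_x mu (xsection H x) <= ((10 * k.+1%:R * s) ^+ (2 * n))%:E * mu (vC @^-1` O1))%E.
  rewrite -integral_cst; last exact: mO.
  rewrite [leRHS]integral_mkcond; apply: ge0_le_integral => //.
  - exact: measurable_fun_xsection.
  - by apply/(measurable_restrictT _ (mO oO1)); exact: measurable_cst.
  - move=> x _; rewrite patchE.
    have b3 : (0 <= ((10 * k.+1%:R * s) ^+ (2 * n))%:E)%E by rewrite lee_fin exprn_ge0 // !mulr_ge0 // ltW.
    have [[y0 Hy0]|nH] := pselect (exists y, H (x, y)); last first.
      rewrite (_ : xsection H x = set0) ?measure0; first by case: ifP.
      by rewrite -subset0 => y /xsectionP hy; apply: nH; exists y.
    have Dy0 : D k y0 by exact: Hy0.2.1.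
    have [xO1 hx0] := (HE y0 Dy0 x).1 Hy0.
    rewrite mem_set //.
    apply: (@le_trans _ _ (mu (vC @^-1` cbox (vC y0) (5 * k.+1%:R * s)))).
      apply: le_measure; rewrite ?inE.
      - exact: measurable_xsection.
      - by apply: measurable_cbox; exact: mvec_vecC.
      - move=> y /xsectionP Hy; have Dy : D k y by exact: Hy.2.1.
        have [_ hx] := (HE y Dy x).1 Hy.
        apply: vn_cbox.
        have d1 : vn (F (vC y) - F (vC y0)) < 4 * s.
          have := vnD (F (vC y) - vC x) (vC x - F (vC y0)); rewrite addrA subrK (vnB (F (vC y))).
          have := cbox_vn s0 hx; have := cbox_vn s0 hx0; lra.
        have [_ [_ hZ]] := Dy0; have := hZ _ (FG Dy.1) (lt_trans d1 sk).
        rewrite (SF Dy.1) (SF Dy0.1) => /le_lt_trans; apply.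
        apply: (@lt_trans _ _ (k.+1%:R * (4 * s))); first by rewrite ltr_pM2l.
        have : 0 < k.+1%:R * s by rewrite mulr_gt0.
        rewrite mulrCA -mulrA; move: (_ * s) => ks; lra.
    rewrite mu_cbox; last by rewrite !mulr_gt0.
    by rewrite lee_fin (_ : 2 * (5 * k.+1%:R * s) = 10 * k.+1%:R * s) //; ring.
have := le_trans L1 (le_trans _ L2); rewrite tonelli_sets // lexx => /(_ isT).
rewrite (_ : 10 * k.+1%:R * s = 2 * s * (5 * k.+1%:R)); last by ring.
rewrite [(2 * s * _) ^+ _]exprMn; exact: lee_cancel_EFin.
Qed.

(** As [s] decreases to 0, the sets [E] increase to the whole preimage, because [O] and [G1] are
    open; the constant does not depend on [s]. *)
Let D_bound k (O : set V) : open O ->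
  (mu (D k `&` (fun u => (O `&` G1) (F (vC u)))) <= ((5 * k.+1%:R) ^+ (2 * n))%:E * mu (vC @^-1` (O `&` G1)))%E.
Proof.
move=> oO; pose s (m : nat) : R := (8 * k.+1%:R * m.+1%:R)^-1.
have k0 : 0 < k.+1%:R :> R by rewrite ltr0n.
have s0 m : 0 < s m by rewrite invr_gt0 !mulr_gt0 // ltr0n.
have sk m : 4 * s m < k.+1%:R^-1.
  have m1 : 1 <= m.+1%:R :> R by rewrite ler1n.
  rewrite /s -mulrA invfM mulrA ltr_pdivrMr ?mulr_gt0 ?ltr0n //.
  rewrite mulrA mulVf ?gt_eqF // mul1r; lra.
have DE : D k `&` (fun u => (O `&` G1) (F (vC u))) = \bigcup_m E k (s m) (O `&` G1).
  apply/seteqP; split => u.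
    move=> [Du Ou]; have [e e0 he] := open_ball (openI oO oG1) Ou.
    have := archi_boundP (x := e^-1); rewrite invr_ge0 ltW // => /(_ isT); set m := Num.bound _ => hm.
    exists m => //; split => // x /(cbox_vn (s0 m)) hx; apply: he; apply: (lt_trans hx).
    have m0 : 0 < m.+1%:R :> R by rewrite ltr0n.
    have me : m.+1%:R^-1 < e.
      by rewrite invf_plt ?posrE //; apply: (lt_trans hm); rewrite ltr_nat.
    apply: lt_trans me; rewrite /s invfM mulrA -[X in _ < X]mul1r ltr_pM2r ?invr_gt0 //.
    rewrite ltr_pdivrMr ?mulr_gt0 // mul1r.
    have : 1 <= k.+1%:R :> R by rewrite ler1n.
    lra.
  move=> [m _ [Du hu]]; split => //; apply: hu => p; by rewrite !subrr normr0.
have ndE : nondecreasing_seq (fun m => E k (s m) (O `&` G1)).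
  move=> m m' mm; apply/subsetPset => u [Du hu]; split => // x hx; apply: hu => p; have [h1 h2] := hx p.
  have ss : s m' <= s m.
    by rewrite lef_pV2 ?posrE ?mulr_gt0 ?ltr0n //; apply: ler_wpM2l; [rewrite mulr_ge0 // ltW|rewrite ler_nat].
  by split; apply: lt_le_trans ss.
rewrite DE.
have := nondecreasing_cvg_mu (mu := @mu R n) (fun m => mE k (s m) (O `&` G1)) (bigcup_measurable (fun m _ => mE k (s m) (O `&` G1))) ndE.
move=> h; rewrite -(cvg_lim _ h) //; apply: lime_le; first by apply/cvg_ex; exists (mu (\bigcup_m E k (s m) (O `&` G1))).
by apply: nearW => m; exact: E_bound.
Qed.

(** Cover the null set by open sets of small measure, bound their preimages on each [D k], and take
    the union over [k]. *)
Lemma null_transport (M : set V) : measurable (vC @^-1` M) -> mu (vC @^-1` M) = 0%E ->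
  (@mu R n).-negligible (vC @^-1` (G0 `&` F @^-1` M)).
Proof.
move=> mM M0.
have mB : measurable (vC @^-1` cbox z1 r1) by apply: measurable_cbox; exact: mvec_vecC.
have finB : (mu (vC @^-1` cbox z1 r1) < +oo)%E by rewrite mu_cbox // ltry.
have [P [oP AP niP P0]] := outer_open mB finB mM.
pose Q := \bigcap_j (vC @^-1` P j).
have mQ : measurable Q by apply: bigcap_measurable => // k _; exact: mO.
have small e : 0 < e -> exists j, (mu (vC @^-1` (P j `&` G1)) < e%:E)%E.
  move=> e0; have mF j : measurable (vC @^-1` P j `\` Q) by apply: measurableD => //; exact: mO.
  have [||j hj] := measure_cvg0 mB finB mF _ _ e0.
  - by move=> j j' jj; apply/subsetPset; apply: setSD => u; have /subsetPset := niP _ _ jj; apply.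
  - by rewrite -subset0 => u h; have [_ nQ] := h 0%N I; apply: nQ => j _; have [] := h j I.
  exists j.
  apply: (@le_lt_trans _ _ (mu ((vC @^-1` cbox z1 r1 `&` (vC @^-1` P j `\` Q)) `|` (vC @^-1` M `|` (vC @^-1` cbox z1 r1 `&` (Q `\` vC @^-1` M)))))).
    apply: le_measure; rewrite ?inE.
    - by apply: mO; exact: openI.
    - apply: measurableU; first exact: measurableI.
      by apply: measurableU => //; apply: measurableI => //; exact: measurableD.
    - move=> u [Pu Gu]; have [Qu|nQ] := pselect (Q u); last by left; split => //; exact: G1B.
      have [Mu|nM] := pselect ((vC @^-1` M) u); right; [by left|right]; split => //; exact: G1B.
  apply: le_lt_trans (measureU2 _ _ _) _; [exact: measurableI|by apply: measurableU => //; apply: measurableI => //; exact: measurableD|].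
  rewrite [X in (_ + X)%E](_ : _ = 0%E) ?adde0 //.
  apply/eqP; rewrite -measure_le0; apply: le_trans (measureU2 _ _ _) _ => //.
    by apply: measurableI => //; exact: measurableD.
  rewrite -[leRHS]adde0; apply: leeD; [exact: (eq_ind_r (fun x => x <= 0)%E (lexx 0%E) M0)|exact: (eq_ind_r (fun x => x <= 0)%E (lexx 0%E) P0)].
have hk k : (@mu R n).-negligible (D k `&` (fun u => M (F (vC u)))).
  pose N := \bigcap_j (D k `&` (fun u => (P j `&` G1) (F (vC u)))).
  have mN j : measurable (D k `&` (fun u => (P j `&` G1) (F (vC u)))).
    rewrite (_ : _ `&` _ = D k `&` vC @^-1` (G0 `&` F @^-1` (P j `&` G1))).
      by apply: measurableI => //; apply: mO; apply: open_pre; exact: openI.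
    by apply/seteqP; split => u; [move=> [[h1 h2] h3]|move=> [h1 [h2 h3]]].
  exists N; split.
  - by apply: bigcap_measurable => // j _; exact: mN.
  - apply/eqP; rewrite -measure_le0; apply/lee_addgt0Pr => e e0; rewrite add0e.
    pose c : R := (5 * k.+1%:R) ^+ (2 * n).
    have c0 : 0 < c by rewrite exprn_gt0 // mulr_gt0 // ltr0n.
    have [j hj] := small (e / c) (divr_gt0 e0 c0).
    apply: (@le_trans _ _ (mu (D k `&` (fun u => (P j `&` G1) (F (vC u)))))).
      by apply: le_measure; rewrite ?inE //; [apply: bigcap_measurable => // i _; exact: mN|move=> u; apply].
    apply: (le_trans (D_bound _ (oP j))); rewrite -/c.
    apply: (@le_trans _ _ (c%:E * (e / c)%:E)%E).
      by apply: lee_wpmul2l; [rewrite lee_fin ltW|exact: ltW].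
    by rewrite -EFinM lee_fin mulrC divfK // gt_eqF.
  - move=> u [Du Mu] j _; split => //; split; last exact: FG Du.1.
    (* The cover is known for points of the product space only; a translate of [u] is such a point
       over the vector [F (vC u)]. *)
    have := AP j (shiftT (F (vC u) - vC u) u); rewrite /= vecC_shift addrC subrK; apply; exact: Mu.
have := negligible_bigcup hk; apply: negligibleS => u [Gu Mu].
by have [k hZ] := cup_Z (FG Gu); exists k.
Qed.

End OpenTests.

(** * Radial kernels *)

Section Gamma.
Variable R : realType.
Local Notation C := R[i].

Definition gam (k : nat) (t : R) : R := if 0 < t then t^-1 ^+ k * expR (- t^-1) else 0.
(** The derivative of $t^{-k}e^{-1/t}$ is a combination of two members of the same family, so
    [gam1], [gam2] and [gam3] are the successive derivatives of [gam]. *)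
Definition gam1 k t := gam k.+2 t - k%:R * gam k.+1 t.
Definition gam2 k t := gam1 k.+2 t - k%:R * gam1 k.+1 t.
Definition gam3 k t := gam2 k.+2 t - k%:R * gam2 k.+1 t.

Lemma gam_ge0 k t : 0 <= gam k t.
Proof. by rewrite /gam; case: ifP => // t0; rewrite mulr_ge0 ?expR_ge0 // exprn_ge0 // invr_ge0 ltW. Qed.

Lemma gam_le0 k t : t <= 0 -> gam k t = 0.
Proof. by rewrite /gam leNgt; case: ifP. Qed.

(** The $m$-th power of $x/m \le e^{x/m}$. *)
Lemma expr_le_expR (x : R) m : 0 <= x -> x ^+ m <= m%:R ^+ m * expR x.
Proof.
move=> x0; case: m => [|m]; first by rewrite !expr0 mul1r -expR0 ler_expR.
have m0 : 0 < m.+1%:R :> R by rewrite ltr0n.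
have h : x / m.+1%:R <= expR (x / m.+1%:R) by apply: le_trans (expR_ge1Dx _); rewrite lerDr.
rewrite -[X in X ^+ _](@divfK _ m.+1%:R) ?gt_eqF // exprMn mulrC; apply: ler_wpM2l; first by rewrite exprn_ge0 // ltW.
have -> : expR x = expR (x / m.+1%:R) ^+ m.+1 by rewrite -expRM_natl mulrC divfK // gt_eqF.
by apply: lerXn2r; rewrite ?nnegrE ?expR_ge0 // divr_ge0 // ltW.
Qed.

Lemma gam_bound k t : gam k t <= k%:R ^+ k.
Proof.
rewrite /gam; case: ifP => [t0|_]; last by rewrite exprn_ge0.
by rewrite expRN ler_pdivrMr ?expR_gt0 // expr_le_expR // invr_ge0 ltW.
Qed.

Lemma gam_shift k t : 0 <= t -> gam k t = t * gam k.+1 t.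
Proof.
rewrite le_eqVlt => /orP[/eqP <-|t0]; first by rewrite mul0r gam_le0.
by rewrite /gam t0 exprS !mulrA divff ?mul1r // gt_eqF.
Qed.

Lemma gam_deriv k t : deriv_at (gam k) t (gam1 k t).
Proof.
have [t0|t0|->] := ltgtP t 0.
- rewrite (_ : gam1 k t = 0); last by rewrite /gam1 !gam_le0 1?ltW // mulr0 subr0.
  apply: (@deriv_at_near _ (fun _ => 0) _ _ _ (- t)); first by rewrite oppr_gt0.
    by move=> h; rewrite ltr_norml opprK => /andP[_ h2]; rewrite gam_le0 //; lra.
  by move=> e e0; exists 1 => // h _; rewrite !(mul0r, subr0) normr0 mulr_ge0 // ltW.
- apply: (@deriv_at_near _ (fun t => t^-1 ^+ k * expR (- t^-1)) _ _ _ t) => //.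
    by move=> h; rewrite ltr_norml => /andP[h2 _]; rewrite /gam ifT //; lra.
  have tn0 : t != 0 by rewrite gt_eqF.
  have dV : is_derive t 1 (fun t : R^o => t^-1 : R^o) (- t ^- 2).
    by have := @is_deriveV R id t 1 1 tn0 (is_derive_id t 1); rewrite /= -[_ *: _]/(_ * _) mulr1.
  have dX : is_derive t 1 (fun t : R^o => t^-1 ^+ k : R^o) (k%:R * t^-1 ^+ k.-1 * (- t ^- 2)).
    have := @is_deriveX R R^o (fun t : R^o => t^-1 : R^o) k t 1 _ dV.
    rewrite (_ : (fun t : R^o => t^-1 ^+ k : R^o) = (fun t : R => t^-1) ^+ k) //.
    by apply/funext => u; rewrite exprfctE.
  have dE : is_derive t 1 (fun t : R^o => expR (- t^-1) : R^o) (expR (- t^-1) * t ^- 2).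
    have dN : is_derive t 1 (fun t : R^o => - t^-1 : R^o) (t ^- 2).
      by have := is_deriveN dV; rewrite opprK.
    have dE0 : is_derive (- t^-1) 1 (expR : R -> R) (expR (- t^-1)) by exact: is_derive_expR.
    exact: (@is_derive1_comp R expR (fun t => - t^-1) t _ _ dE0 dN).
  have := is_deriveM dX dE; rewrite /= => dP.
  have -> : gam1 k t = t^-1 ^+ k *: (expR (- t^-1) * t ^- 2) + expR (- t^-1) *: (k%:R * t^-1 ^+ k.-1 * (- t ^- 2)).
    rewrite /gam1 /gam t0 -![_ *: _]/(_ * _) exprVn.
    case: (k) => [|m] /=; first by rewrite !expr0 exprVn; ring.
    by rewrite -!exprVn !exprS; ring.
  have dd := @ex_derive _ _ _ _ _ _ _ dP; have dv := @derive_val _ _ _ _ _ _ _ dP.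
  by rewrite -dv -derive1E; exact: derivable_deriv_at.
- rewrite (_ : gam1 k 0 = 0); last by rewrite /gam1 !gam_le0 // mulr0 subr0.
  move=> e e0; pose M : R := k.+2%:R ^+ k.+2.
  have M0 : 0 < M by rewrite exprn_gt0.
  exists (e / M); first by rewrite divr_gt0.
  move=> h hh; rewrite add0r mul0r subr0 (gam_le0 _ (lexx 0)) subr0 ger0_norm ?gam_ge0 //.
  have [h0|h0] := leP h 0; first by rewrite gam_le0 // mulr_ge0 // ltW.
  (* At 0 the derivative vanishes since [gam k h] is [h ^+ 2] times the bounded function
     [gam k.+2]. *)
  rewrite gtr0_norm // in hh *; rewrite (gam_shift _ (ltW h0)) (gam_shift _ (ltW h0)) mulrC.
  apply: ler_wpM2r; first exact: ltW.
  apply: (@le_trans _ _ (h * M)); first by apply: ler_wpM2l; [exact: ltW|exact: gam_bound].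
  by rewrite -ler_pdivlMr // ltW.
Qed.

Lemma deriv_atB (F G : R -> R) t c d k : deriv_at F t c -> deriv_at G t d ->
  deriv_at (fun t => F t - k * G t) t (c - k * d).
Proof.
move=> hF hG; have := deriv_atD hF (deriv_atM (- k) hG); rewrite mulNr.
by apply: deriv_at_ext => x; rewrite mulNr.
Qed.

Lemma gam1_deriv k t : deriv_at (gam1 k) t (gam2 k t).
Proof. by apply: deriv_atB; exact: gam_deriv. Qed.

Lemma gam2_deriv k t : deriv_at (gam2 k) t (gam3 k t).
Proof. by apply: deriv_atB; exact: gam1_deriv. Qed.

Definition gamB k : R := k%:R ^+ k.
Definition gam1B k : R := gamB k.+2 + k%:R * gamB k.+1.
Definition gam2B k : R := gam1B k.+2 + k%:R * gam1B k.+1.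
Definition gam3B k : R := gam2B k.+2 + k%:R * gam2B k.+1.

Lemma norm_comb (a b c x y : R) : 0 <= c -> `|a| <= x -> `|b| <= y -> `|a - c * b| <= x + c * y.
Proof.
move=> c0 ax bxy; apply: (le_trans (ler_normB _ _)); apply: lerD => //.
by rewrite normrM ger0_norm //; apply: ler_wpM2l.
Qed.

Lemma gam_norm k t : `|gam k t| <= gamB k. Proof. by rewrite ger0_norm ?gam_ge0 ?gam_bound. Qed.
Lemma gam1_norm k t : `|gam1 k t| <= gam1B k. Proof. by apply: norm_comb => //; exact: gam_norm. Qed.
Lemma gam2_norm k t : `|gam2 k t| <= gam2B k. Proof. by apply: norm_comb => //; exact: gam1_norm. Qed.
Lemma gam3_norm k t : `|gam3 k t| <= gam3B k. Proof. by apply: norm_comb => //; exact: gam2_norm. Qed.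

Lemma deriv_at_shift (F : R -> R) t a c : deriv_at F (t + a) c -> deriv_at (fun s => F (t + s)) a c.
Proof. by move=> h e /h [d d0 hd]; exists d => // x /hd; rewrite addrA. Qed.

Lemma gam_taylor k t h : `|gam k (t + h) - gam k t - h * gam1 k t - h ^+ 2 / 2 * gam2 k t| <= gam3B k * `|h| ^+ 3.
Proof.
have B0 : 0 <= gam3B k by apply: le_trans (gam3_norm k 0).
have := @taylor2_bound R (fun s => gam k (t + s)) (fun s => gam1 k (t + s)) (fun s => gam2 k (t + s)) h (gam2 k t) (gam3B k * `|h|).
rewrite addr0; have -> : gam3B k * `|h| * h ^+ 2 = gam3B k * `|h| ^+ 3.
  by rewrite -(real_normK (num_real h)) -mulrA -exprS.
apply; first by rewrite mulr_ge0.
- by move=> s _; apply: deriv_at_shift; exact: gam_deriv.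
- by move=> s _; apply: deriv_at_shift; exact: gam1_deriv.
move=> s sh; apply: (@le_trans _ _ (gam3B k * `|s|)); last exact: ler_wpM2l.
have := @mean_value_bound R (fun s => gam2 k (t + s)) (fun s => gam3 k (t + s)) s (gam3B k) B0.
rewrite addr0; apply => x _; [by apply: deriv_at_shift; exact: gam2_deriv|exact: gam3_norm].
Qed.

End Gamma.

(** * Kernels on C^n and their Levi forms *)

Section Kernel.
Variables (R : realType) (n : nat).
Local Notation C := R[i].
Local Notation V := 'rV[C]_n.

Definition herm (v w : V) : C := \sum_p v 0 p * (w 0 p)^*.
Definition hn2 (v : V) : R := complex.Re (herm v v).
(** Positive exactly on the open Euclidean ball of radius [s]; composed with [gam] it gives a smooth
    bump there. *)
Definition tau (x : V) (s : R) (y : V) : R := 1 - hn2 (y - x) / s ^+ 2.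

Lemma hermDl v v' w : herm (v + v') w = herm v w + herm v' w.
Proof. by rewrite /herm -big_split; apply: eq_bigr => p _; rewrite mxE mulrDl. Qed.
Lemma hermDr v w w' : herm v (w + w') = herm v w + herm v w'.
Proof. by rewrite /herm -big_split; apply: eq_bigr => p _; rewrite mxE cjD mulrDr. Qed.
Lemma hermZl c v w : herm (c *: v) w = c * herm v w.
Proof. by rewrite /herm mulr_sumr; apply: eq_bigr => p _; rewrite mxE mulrA. Qed.
Lemma hermZr c v w : herm v (c *: w) = c^* * herm v w.
Proof. by rewrite /herm mulr_sumr; apply: eq_bigr => p _; rewrite mxE cjM mulrCA. Qed.
Lemma hermC v w : herm w v = (herm v w)^*.
Proof. by rewrite /herm cj_sum; apply: eq_bigr => p _; rewrite cjM cjK mulrC. Qed.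

Lemma hn2E v : hn2 v = \sum_p nrm (v 0 p) ^+ 2.
Proof.
rewrite /hn2 /herm (eq_bigr (fun p => (nrm (v 0 p) ^+ 2)%:C%C)); last by move=> p _; rewrite mulcJ.
by rewrite -rmorph_sum.
Qed.

Lemma hn2_ge0 v : 0 <= hn2 v.
Proof. by rewrite hn2E sumr_ge0 // => p _; exact: sqr_ge0. Qed.

Lemma Re_cj (z : C) : complex.Re z^* = complex.Re z. Proof. by case: z. Qed.

Lemma hn2D v w : hn2 (v + w) = hn2 v + 2 * complex.Re (herm w v) + hn2 w.
Proof.
rewrite /hn2 hermDl !hermDr !ReD (hermC w v) Re_cj; ring.
Qed.

Lemma hn2Z c v : hn2 (c *: v) = nrm c ^+ 2 * hn2 v.
Proof. by rewrite /hn2 hermZl hermZr mulrA mulcJ Re_realM. Qed.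

Lemma vn_hn2 v r : 0 <= r -> hn2 v < r ^+ 2 -> vn v < r.
Proof.
move=> r0 h; have r00 : 0 < r.
  by rewrite lt_neqAle r0 andbT eq_sym; apply: contraTneq h => ->; rewrite expr0n -leNgt hn2_ge0.
apply: vn_lt => // p; rewrite -ltr_sqr ?nnegrE ?nrm_ge0 //; apply: le_lt_trans h.
by rewrite hn2E (bigD1 p) //= lerDl sumr_ge0 // => q _; exact: sqr_ge0.
Qed.

Lemma hn2_le v r : vn v <= r -> hn2 v <= n%:R * r ^+ 2.
Proof.
move=> h; rewrite hn2E; apply: (@le_trans _ _ (\sum_(p < n) r ^+ 2)); last by rewrite sumr_const card_ord mulr_natl.
apply: ler_sum => p _; apply: lerXn2r; rewrite ?nnegrE ?nrm_ge0 //; last by apply: le_trans h; exact: vn_coord.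
by apply: le_trans h; exact: vn_ge0.
Qed.

Lemma CS v w : nrm (herm v w) <= n%:R * (vn v * vn w).
Proof.
apply: (le_trans (nrm_sum _ _ _)).
apply: (@le_trans _ _ (\sum_(p < n) vn v * vn w)); last by rewrite sumr_const card_ord mulr_natl.
by apply: ler_sum => p _; rewrite nrmM nrmJ; apply: ler_pM; rewrite ?nrm_ge0 ?vn_coord.
Qed.

Lemma tau_supp x s y : 0 < s -> 0 < tau x s y -> vn (y - x) < s.
Proof.
move=> s0; rewrite /tau subr_gt0 ltr_pdivrMr ?exprn_gt0 // mul1r; apply: vn_hn2; exact: ltW.
Qed.

Lemma hn2_line v (w : V) (t : R) : hn2 (v + t%:C%C *: w) = hn2 v + (2 * complex.Re (herm w v)) * t + hn2 w * t ^+ 2.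
Proof.
rewrite hn2D hermZl Re_realM hn2Z nrm_real real_normK ?num_real //; ring.
Qed.

(* Closed under directional derivatives, whence smoothness by induction. *)
Inductive test_fun x s : (V -> R) -> Prop :=
| test_fun_gam k : test_fun x s (fun y => gam k (tau x s y))
| test_fun_cst c : test_fun x s (fun=> c)
| test_fun_lin w : test_fun x s (fun y => complex.Re (herm w (y - x)))
| test_fun_add f g : test_fun x s f -> test_fun x s g -> test_fun x s (fun y => f y + g y)
| test_fun_mul f g : test_fun x s f -> test_fun x s g -> test_fun x s (fun y => f y * g y).

Definition dline (f : V -> R) v y c := deriv_at (fun t : R => f (y + t%:C%C *: v)) 0 c.

Lemma deriv_at_mul (F G : R -> R) t c d : deriv_at F t c -> deriv_at G t d ->
  deriv_at (fun t => F t * G t) t (F t * d + G t * c).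
Proof.
move=> /deriv_atP dF /deriv_atP dG; have dP := is_deriveM dF dG.
have dd := @ex_derive _ _ _ _ _ _ _ dP; have dv := @derive_val _ _ _ _ _ _ _ dP.
rewrite -[X in deriv_at _ _ X]/(F t *: (d : R^o) + G t *: (c : R^o)) -dv -derive1E; exact: derivable_deriv_at.
Qed.

Lemma deriv_at_comp (F G : R -> R) t c d : deriv_at G t c -> deriv_at F (G t) d ->
  deriv_at (fun t => F (G t)) t (d * c).
Proof.
move=> /deriv_atP dG /deriv_atP dF.
have dP := is_derive1_comp dF dG.
have dd := @ex_derive _ _ _ _ _ _ _ dP; have dv := @derive_val _ _ _ _ _ _ _ dP.
by rewrite -dv -derive1E; exact: derivable_deriv_at.
Qed.

Lemma deriv_at_cst (c t : R) : deriv_at (fun=> c) t 0.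
Proof. by move=> e e0; exists 1 => // h _; rewrite mul0r subr0 subrr normr0 mulr_ge0 // ltW. Qed.

Lemma deriv_at_quad (a b c : R) : deriv_at (fun t => a + b * t + c * t ^+ 2) 0 b.
Proof.
have h := deriv_atD (deriv_atD (deriv_at_cst a 0) (deriv_at_lin b 0)) (deriv_atM (2 * c) (deriv_at_sqr (0 : R))).
move: h; rewrite mulr0 addr0 add0r; by apply: deriv_at_ext => t; field.
Qed.

Lemma dline_tau x s v y : dline (tau x s) v y (- (2 * complex.Re (herm v (y - x))) / s ^+ 2).
Proof.
rewrite /dline; have := deriv_at_quad (1 - hn2 (y - x) / s ^+ 2) (- (2 * complex.Re (herm v (y - x))) / s ^+ 2) (- (hn2 v / s ^+ 2)).
apply: deriv_at_ext => t; rewrite /tau [y + _ - x]addrAC hn2_line; ring.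
Qed.

Lemma dline_lin x w v y : dline (fun y => complex.Re (herm w (y - x))) v y (complex.Re (herm w v)).
Proof.
rewrite /dline; have := deriv_at_quad (complex.Re (herm w (y - x))) (complex.Re (herm w v)) 0.
apply: deriv_at_ext => t; rewrite [y + _ - x]addrAC [in RHS]hermDr ReD hermZr.
have -> : (t%:C%C : C)^* = t%:C%C by rewrite /Num.conj /= oppr0.
rewrite Re_realM; ring.
Qed.

Lemma test_fun_deriv x s f v : test_fun x s f -> exists2 f', test_fun x s f' & forall y, dline f v y (f' y).
Proof.
elim => [k|c|w|{}f g _ [f' tf' df] _ [g' tg' dg]|{}f g hf [f' tf' df] hg [g' tg' dg]].
- exists (fun y => (gam k.+2 (tau x s y) + (- k%:R) * gam k.+1 (tau x s y)) * (- (2 / s ^+ 2) * complex.Re (herm v (y - x)))).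
    apply: test_fun_mul; last by apply: test_fun_mul; [exact: test_fun_cst|exact: test_fun_lin].
    by apply: test_fun_add; [exact: test_fun_gam|apply: test_fun_mul; [exact: test_fun_cst|exact: test_fun_gam]].
  move=> y; have dt := dline_tau x s v y; have := deriv_at_comp dt (gam_deriv k _).
  rewrite /dline scale0r addr0 /gam1 mulNr; congr (deriv_at _ _ (_ * _)); ring.
- by exists (fun=> 0); [exact: test_fun_cst|move=> y; exact: deriv_at_cst].
- by exists (fun=> complex.Re (herm w v)); [exact: test_fun_cst|move=> y; exact: dline_lin].
- by exists (fun y => f' y + g' y); [exact: test_fun_add|move=> y; exact: (deriv_atD (df y) (dg y))].
- exists (fun y => f y * g' y + g y * f' y); first by apply: test_fun_add; exact: test_fun_mul.
  by move=> y; have := deriv_at_mul (df y) (dg y); rewrite /= scale0r addr0.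
Qed.

Lemma continuous_herm w : continuous (fun y : V => herm w y).
Proof.
move=> y; apply: continuous_sum => p; apply: continuousM; first exact: cst_continuous.
by apply: continuous_cj; exact: coord_continuous.
Qed.

Lemma continuous_ReF (T : topologicalType) (F : T -> C) (x : T) : {for x, continuous F} -> {for x, continuous (fun y => complex.Re (F y))}.
Proof. by move=> cF; apply/cvg_RP; exact: continuous_Re. Qed.

Lemma deriv_at_cont (F : R -> R) t c : deriv_at F t c -> {for t, continuous F}.
Proof.
move=> /(_ 1 ltr01) [d d0 hd]; apply/cvg_RP => e e0.
have c0 : 0 < 1 + `|c| by rewrite ltr_pwDl.
apply/nbhs_ballP; exists (Num.min d (e / (1 + `|c|))); first by rewrite /= lt_min d0 divr_gt0.
move=> y; rewrite /ball /= lt_min => /andP[y1 y2]; rewrite distrC in y1 y2.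
have := hd (y - t) y1; rewrite [t + _]addrC subrK mul1r => h.
apply: (@le_lt_trans _ _ ((1 + `|c|) * `|y - t|)); last by rewrite mulrC -ltr_pdivlMr.
rewrite mulrDl mul1r -normrM -[X in `|X| <= _](subrK (c * (y - t))).
by apply: (le_trans (ler_normD _ _)); rewrite lerD2r.
Qed.

Lemma continuous_gam k : continuous (gam k : R -> R).
Proof. by move=> t; exact: deriv_at_cont (gam_deriv k t). Qed.

Lemma continuous_tau x s : continuous (tau x s).
Proof.
have cl t : {for t, continuous (fun t : R => 1 - t / s ^+ 2)}.
  have := deriv_atD (deriv_at_cst 1 t) (deriv_at_lin (- (s ^+ 2)^-1) t).
  by move=> /deriv_at_cont; rewrite (_ : (fun t => 1 + - s ^- 2 * t) = (fun t0 : R => 1 - t0 / s ^+ 2)) //; apply/funext => r; rewrite mulNr mulrC.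
move=> y; apply: (continuous_comp (f := fun y : V => hn2 (y - x)) (g := fun t : R => 1 - t / s ^+ 2)); last exact: cl.
apply: continuous_ReF; apply: continuous_sum => p.
have cp : {for y, continuous (fun y : V => (y - x) 0 p)}.
  rewrite (_ : (fun y : V => _) = (fun y : V => y 0 p - x 0 p)); last by apply/funext => z; rewrite !mxE.
  by apply: (@continuousB _ _ _ (fun y : V => y 0 p) (fun=> x 0 p)); [exact: coord_continuous|exact: cst_continuous].
exact: (continuousM cp (continuous_cj cp)).
Qed.

Lemma test_fun_continuous x s f : test_fun x s f -> continuous f.
Proof.
elim => [k|c|w|{}f g _ cf _ cg|{}f g _ cf _ cg] y.
- by apply: (continuous_comp (g := gam k)); [exact: continuous_tau|exact: continuous_gam].
- exact: cst_continuous.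
- rewrite (_ : (fun y0 : V => _) = (fun y : V => complex.Re (herm w y - herm w x))); last first.
    apply/funext => z; rewrite hermDr; congr (complex.Re (_ + _)).
    by rewrite -scaleN1r hermZr cjN rmorph1 mulN1r.
  have ch := @continuous_herm w y.
  have cc : {for y, continuous (fun _ : V => herm w x)} by exact: cst_continuous.
  exact: (continuous_ReF (continuousB ch cc)).
- exact: (continuousD (cf y) (cg y)).
- exact: (continuousM (cf y) (cg y)).
Qed.

Lemma dline_cderiv f v y c : dline f v y c -> cderiv (real_slice (fun y => (f y)%:C%C) y v) 0 (c%:C%C).
Proof. by move=> h; split; [exact: h|exact: deriv_at_cst]. Qed.

Lemma rderive_real f v (f' : V -> R) : (forall y, dline f v y (f' y)) ->
  rderive v (fun y => (f y)%:C%C) = (fun y => (f' y)%:C%C).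
Proof. by move=> h; apply/funext => y; apply: cderivE; exact: dline_cderiv. Qed.

Lemma test_fun_smooth x s f : test_fun x s f -> smooth_on setT (fun y => (f y)%:C%C).
Proof.
move=> hf k; elim: k f hf => [|k IH] f hf; split.
- move=> z _; apply/cvg_CP => e e0; have /cvg_RP /(_ e e0) := (test_fun_continuous hf : continuous f) z;
    by apply: filterS => y; rewrite -rmorphB nrm_real.
- by [].
- move=> z _; apply/cvg_CP => e e0; have /cvg_RP /(_ e e0) := (test_fun_continuous hf : continuous f) z;
    by apply: filterS => y; rewrite -rmorphB nrm_real.
- move=> v; have [f' tf' df] := test_fun_deriv v hf; split; last by rewrite (rderive_real df); exact: IH.
  move=> z _; have [h1 h2] := dline_cderiv (df z).
  by split; [have [] := deriv_at_derive1 h1|have [] := deriv_at_derive1 h2].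
Qed.

(** The Levi form in direction [xi] of the bump [gam k] composed with [tau x s], as [levi_gam]
    shows. The closed form uses that the bump is radial. *)
Definition levi_kernel k (xi x : V) (s : R) (y : V) : R :=
  gam2 k (tau x s y) * (nrm (herm xi (y - x)) ^+ 2 / s ^+ 4) - gam1 k (tau x s y) * (hn2 xi / s ^+ 2).

Lemma levi_gam k (xi x : V) s (y : V) : complex.Re (\sum_p \sum_q xi 0 p * (xi 0 q)^* *
  dz p (dzbar q (fun y => (gam k (tau x s y))%:C%C)) y) = levi_kernel k xi x s y.
Proof.
have sm := test_fun_smooth (test_fun_gam x s k) 2.
rewrite (levi_sum xi openT (I : setT y) sm).
have key v : rderive v (rderive v (fun y => (gam k (tau x s y))%:C%C)) y =
  (gam2 k (tau x s y) * (2 * complex.Re (herm v (y - x)) / s ^+ 2) ^+ 2 - gam1 k (tau x s y) * (2 * hn2 v / s ^+ 2))%:C%C.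
  have d1 z : dline (fun y => gam k (tau x s y)) v z (gam1 k (tau x s z) * (- (2 / s ^+ 2) * complex.Re (herm v (z - x)))).
    have dt := dline_tau x s v z; have := deriv_at_comp dt (gam_deriv k _).
    by rewrite /dline scale0r addr0; congr (deriv_at _ _ (_ * _)); ring.
  rewrite (rderive_real d1); apply: cderivE; apply: dline_cderiv.
  have dt := dline_tau x s v y; have dg := deriv_at_comp dt (gam1_deriv k _).
  have dl := deriv_atM (- (2 / s ^+ 2)) (dline_lin x v v y).
  have := deriv_at_mul dg dl; rewrite /= !scale0r !addr0; congr (deriv_at _ _ _).
  rewrite /hn2; ring.
have key4 (a b : R) : complex.Re (4^-1 * (a%:C%C + b%:C%C)) = (a + b) / 4.
  have -> : (4^-1 : C) = (4^-1 : R)%:C%C by rewrite fmorphV /= rmorph_nat.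
  by rewrite Re_realM ReD mulrC.
rewrite !key key4 /levi_kernel hermZl Re_iM hn2Z nrm_i expr1n mul1r nrm_sqr.
have -> : (s ^+ 4)^-1 = (s ^+ 2)^-1 * (s ^+ 2)^-1 by rewrite -invfM -exprD.
move: (gam2 _ _) (gam1 _ _) ((s ^+ 2)^-1) (complex.Re _) (complex.Im _) (hn2 _) => g2 g1 q a b c.
by field.
Qed.

Lemma nrm_Re2 (z : C) : nrm z ^+ 2 = 2 * complex.Re z ^+ 2 - complex.Re (z ^+ 2).
Proof. by rewrite nrm_sqr expr2 ReM; ring. Qed.

Lemma tau_line (x xi y : V) (s : R) (t : C) : tau (x + t *: xi) s y =
  tau x s y + (2 * complex.Re (t * herm xi (y - x)) - nrm t ^+ 2 * hn2 xi) / s ^+ 2.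
Proof.
rewrite /tau (_ : y - (x + t *: xi) = (y - x) + (- t) *: xi); last by rewrite opprD addrA scaleNr.
rewrite hn2D hermZl hn2Z nrmN mulNr.
have -> : complex.Re (- (t * herm xi (y - x))) = - complex.Re (t * herm xi (y - x)) by case: (t * _).
ring.
Qed.

(** The real inequality behind [kernel_jet]: [T] is the length of [t], [h] the increment of [tau],
    [P] its linear part. Terms of [h ^+ 2] of order at least 3 join the Taylor remainder. *)
Lemma kernel_jet_real (g g1 g2 G rem P N X q A B3 B2 T : R) : 0 <= q -> 0 <= X -> 0 <= T -> T <= 1 -> 0 <= A -> 0 <= B3 -> 0 <= B2 ->
  `|P| <= T * A -> `|g2| <= B2 -> N = T ^+ 2 -> let h := (2 * P - N * X) * q in
  `|G - g - h * g1 - h ^+ 2 / 2 * g2| <= B3 * `|h| ^+ 3 ->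
  `|G - (g + (g1 * (2 * P) * q + g2 * (2 * P ^+ 2) * (q * q) - g1 * (N * X) * q))| <=
   (B3 * ((2 * A + X) * q) ^+ 3 + B2 / 2 * (q * q) * (4 * A * X + X ^+ 2)) * T ^+ 3.
Proof.
move=> q0 X0 T0 T1 A0 B30 B20 hP hg2 -> h hT.
have -> : G - (g + (g1 * (2 * P) * q + g2 * (2 * P ^+ 2) * (q * q) - g1 * (T ^+ 2 * X) * q)) =
   (G - g - h * g1 - h ^+ 2 / 2 * g2) + g2 * (q * q / 2 * (- (4 * P * (T ^+ 2 * X)) + T ^+ 4 * X ^+ 2)).
  by rewrite /h; field.
apply: (le_trans (ler_normD _ _)); rewrite [leRHS]mulrDl; apply: lerD.
  apply: (le_trans hT); rewrite -mulrA; apply: ler_wpM2l => //; rewrite -exprMn.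
  apply: lerXn2r; rewrite ?nnegrE ?mulr_ge0 ?addr_ge0 ?mulr_ge0 //.
  rewrite /h normrM (ger0_norm q0) [leRHS]mulrAC; apply: ler_wpM2r => //.
  apply: (le_trans (ler_normB _ _)); rewrite [leRHS]mulrDl; apply: lerD.
    by rewrite normrM ger0_norm // -mulrA [A * T]mulrC; apply: ler_wpM2l.
  by rewrite ger0_norm ?mulr_ge0 ?sqr_ge0 // mulrC; apply: ler_wpM2l => //; rewrite expr2 ler_piMl.
have -> : B2 / 2 * (q * q) * (4 * A * X + X ^+ 2) * T ^+ 3 = B2 * (q * q / 2 * ((4 * (A * X) + X ^+ 2) * T ^+ 3)) by field.
rewrite normrM; apply: ler_pM => //.
have q2 : 0 <= q * q / 2 by apply: divr_ge0 => //; exact: mulr_ge0.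
rewrite normrM (ger0_norm q2).
apply: ler_wpM2l => //; apply: (le_trans (ler_normD _ _)); rewrite [leRHS]mulrDl normrN; apply: lerD.
  rewrite normrM normrM ger0_norm // [X in _ * X <= _]ger0_norm; last by apply: mulr_ge0 => //; exact: sqr_ge0.
  rewrite (_ : 4 * (A * X) * T ^+ 3 = 4 * (T * A) * (T ^+ 2 * X)); last by ring.
  by apply: ler_wpM2r; [apply: mulr_ge0 => //; exact: sqr_ge0|exact: ler_wpM2l].
rewrite ger0_norm ?mulr_ge0 ?exprn_ge0 // mulrC; apply: ler_wpM2l; first exact: sqr_ge0.
by rewrite [T ^+ 4]exprS ler_piMl // exprn_ge0.
Qed.

(** The kernel depends on [y - x] only, so moving the centre along a complex line shows the same
    Levi form as moving the point. The error is uniform and can be integrated. *)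
Lemma kernel_jet (k : nat) (xi : V) (s r : R) : 0 < s -> 0 <= r -> exists2 K : R, 0 <= K &
  forall (x y : V) (t : C), vn (y - x) <= r -> nrm t <= 1 ->
  `|gam k (tau (x + t *: xi) s y) - (gam k (tau x s y) +
     2 * complex.Re (((gam1 k (tau x s y) / s ^+ 2)%:C%C * herm xi (y - x)) * t +
                     ((gam2 k (tau x s y) / (2 * s ^+ 4))%:C%C * herm xi (y - x) ^+ 2) * t ^+ 2)
     + levi_kernel k xi x s y * nrm t ^+ 2)| <= K * nrm t ^+ 3.
Proof.
move=> s0 r0; pose A := n%:R * (vn xi * r); pose X := hn2 xi; pose q := (s ^+ 2)^-1.
have A0 : 0 <= A by rewrite !mulr_ge0 // vn_ge0.
have q0 : 0 <= q by rewrite invr_ge0 sqr_ge0.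
have B30 : 0 <= gam3B R k by apply: le_trans (gam3_norm k 0).
have B20 : 0 <= gam2B R k by apply: le_trans (gam2_norm k 0).
exists (gam3B R k * ((2 * A + X) * q) ^+ 3 + gam2B R k / 2 * (q * q) * (4 * A * X + X ^+ 2)).
  have X0 : 0 <= X by exact: hn2_ge0.
  have b1 : 0 <= (2 * A + X) * q by apply: mulr_ge0 => //; apply: addr_ge0 => //; exact: mulr_ge0.
  have b2 : 0 <= 4 * A * X + X ^+ 2 by apply: addr_ge0; [apply: mulr_ge0 => //; exact: mulr_ge0|exact: sqr_ge0].
  apply: addr_ge0; apply: mulr_ge0 => //; first exact: exprn_ge0.
  by apply: mulr_ge0; [exact: divr_ge0|exact: mulr_ge0].
move=> x y t hy ht.
have hP : `|complex.Re (t * herm xi (y - x))| <= nrm t * A.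
  apply: (le_trans (Re_le_nrm _)); rewrite nrmM; apply: ler_wpM2l; first exact: nrm_ge0.
  apply: (le_trans (CS _ _)); apply: ler_wpM2l => //; apply: ler_wpM2l => //; exact: vn_ge0.
have := @kernel_jet_real (gam k (tau x s y)) (gam1 k (tau x s y)) (gam2 k (tau x s y)) (gam k (tau (x + t *: xi) s y)) 0
  (complex.Re (t * herm xi (y - x))) (nrm t ^+ 2) X q A (gam3B R k) (gam2B R k) (nrm t) q0 (hn2_ge0 xi) (nrm_ge0 t) ht A0 B30 B20 hP (gam2_norm k _) erefl.
rewrite tau_line => /(_ (gam_taylor k _ _)).
congr (`|_ - _| <= _).
have e4 : (s ^+ 4)^-1 = q * q by rewrite /q -invfM -exprD.
have E1 : complex.Re ((gam1 k (tau x s y) / s ^+ 2)%:C%C * herm xi (y - x) * t) =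
   gam1 k (tau x s y) * q * complex.Re (t * herm xi (y - x)) by rewrite -mulrA Re_realM [_ * t]mulrC.
have E2 : complex.Re ((gam2 k (tau x s y) / (2 * s ^+ 4))%:C%C * herm xi (y - x) ^+ 2 * t ^+ 2) =
   gam2 k (tau x s y) * (q * q) / 2 * (2 * complex.Re (t * herm xi (y - x)) ^+ 2 - nrm (herm xi (y - x)) ^+ 2 * nrm t ^+ 2).
  rewrite -mulrA -exprMn Re_realM [_ * t]mulrC invfM e4.
  have := nrm_Re2 (t * herm xi (y - x)); rewrite nrmM exprMn => e.
  have -> : complex.Re ((t * herm xi (y - x)) ^+ 2) = 2 * complex.Re (t * herm xi (y - x)) ^+ 2 - nrm (herm xi (y - x)) ^+ 2 * nrm t ^+ 2.
    by rewrite [nrm (herm _ _) ^+ 2 * _]mulrC e subKr.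
  by move: (2 * _ - _) => Z; field.
rewrite /levi_kernel ReD E1 E2 e4 -/q -[hn2 xi]/X.
move: (gam _ _) (gam2 _ _) (gam1 _ _) (complex.Re _) (nrm (herm _ _) ^+ 2) (nrm t ^+ 2) => G0 G2 G1 P M N.
by field.
Qed.

End Kernel.

(** * Means against radial kernels *)

Section Regularization.
Variables (R : realType) (n : nat).
Local Notation T := (ms_type (lebC R n)).
Local Notation C := R[i].
Local Notation V := 'rV[C]_n.
Local Notation vC := (@vecC R n).

Lemma test_fun_ext x s (f g : V -> R) : test_fun x s f -> (forall y, f y = g y) -> test_fun x s g.
Proof. by move=> hf h; rewrite (_ : g = f) //; apply/funext => y; rewrite h. Qed.

Lemma test_fun_scale x s c (f : V -> R) : test_fun x s f -> test_fun x s (fun y => c * f y).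
Proof. by move=> hf; apply: test_fun_mul => //; exact: test_fun_cst. Qed.

Lemma test_fun_sub x s (f g : V -> R) : test_fun x s f -> test_fun x s g -> test_fun x s (fun y => f y - g y).
Proof. by move=> hf hg; apply: test_fun_ext (test_fun_add hf (test_fun_scale (-1) hg)) _ => y; rewrite mulN1r. Qed.

Lemma test_fun_gam1 x s k : test_fun x s (fun y : V => gam1 k (tau x s y)).
Proof. by apply: test_fun_sub; [exact: test_fun_gam|apply: test_fun_scale; exact: test_fun_gam]. Qed.

Lemma test_fun_gam2 x s k : test_fun x s (fun y : V => gam2 k (tau x s y)).
Proof. by apply: test_fun_sub; [exact: test_fun_gam1|apply: test_fun_scale; exact: test_fun_gam1]. Qed.

Lemma test_fun_im x s w : test_fun x s (fun y : V => complex.Im (herm w (y - x))).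
Proof.
apply: test_fun_ext (test_fun_lin x s (- 'i%C *: w)) _ => y; rewrite hermZl.
by case: (herm _ _) => a b /=; ring.
Qed.

Lemma test_fun_sum x s (I : Type) (r : seq I) (f : I -> V -> R) : (forall i, test_fun x s (f i)) ->
  test_fun x s (fun y => \sum_(i <- r) f i y).
Proof.
move=> h; elim: r => [|i r IH].
  by apply: test_fun_ext (test_fun_cst x s 0) _ => y; rewrite big_nil.
by apply: test_fun_ext (test_fun_add (h i) IH) _ => y; rewrite big_cons.
Qed.

Lemma herm_delta p (v : V) : herm (delta_mx 0 p) v = (v 0 p)^*.
Proof.
rewrite /herm (bigD1 p) //= big1 ?addr0 ?mxE ?eqxx ?mul1r // => q qp.
by rewrite mxE (negbTE qp) andbF mul0r.
Qed.

Lemma sum_herm_delta (v : V) : \sum_p nrm (herm (delta_mx 0 p) v) ^+ 2 = hn2 v.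
Proof. by rewrite hn2E; apply: eq_bigr => p _; rewrite herm_delta nrmJ. Qed.

Lemma test_fun_nrm x s w : test_fun x s (fun y : V => nrm (herm w (y - x)) ^+ 2).
Proof.
apply: test_fun_ext (test_fun_add (test_fun_mul (test_fun_lin x s w) (test_fun_lin x s w)) (test_fun_mul (test_fun_im x s w) (test_fun_im x s w))) _ => y.
by rewrite nrm_sqr !expr2.
Qed.

Lemma test_fun_hn2 x s : test_fun x s (fun y : V => hn2 (y - x)).
Proof.
by apply: test_fun_ext (test_fun_sum (index_enum 'I_n) (fun p => test_fun_nrm x s (delta_mx 0 p))) _ => y; exact: sum_herm_delta.
Qed.

Lemma test_fun_levi_kernel k xi x s : test_fun x s (fun y : V => levi_kernel k xi x s y).
Proof.
apply: test_fun_sub; [apply: test_fun_mul; first exact: test_fun_gam2|apply: test_fun_mul; first exact: test_fun_gam1].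
  by apply: test_fun_ext (test_fun_scale (s ^+ 4)^-1 (test_fun_nrm x s xi)) _ => y; rewrite mulrC.
exact: test_fun_cst.
Qed.

Variables (z0 : V) (r0 : R) (F : T -> R).
Hypothesis r0_ge0 : 0 <= r0.
Hypothesis intF : (@mu R n).-integrable setT (EFin \o F).
Hypothesis F_supp : forall u, ~ cball z0 r0 (vC u) -> F u = 0.

Definition pair_with (g : V -> R) : R := Rintegral (@mu R n) setT (fun u => F u * g (vC u)).
Local Notation I := pair_with.

Lemma measurable_contv (g : V -> R) : continuous g -> measurable_fun setT (fun u => g (vC u) : measurableTypeR R).
Proof. by apply: measurable_cont; exact: mvec_vecC. Qed.

Lemma compact_bounded (g : V -> R) : continuous g -> exists2 M : R, 0 <= M & forall y, cball z0 r0 y -> `|g y| <= M.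
Proof.
move=> cg; apply: (@compact_exists_bound _ _ _ (fun y m => `|g y| <= m)); first exact: compact_cball.
  by move=> y m m' h1 h2; exact: le_trans h2 h1.
move=> x _; exists (`|g x| + 1).
have /cvg_RP /(_ _ (@ltr01 R)) := cg x; apply: filterS => y h.
rewrite -[g y](subrK (g x)) addrC; apply: (le_trans (ler_normD _ _)).
by rewrite lerD2l; exact: ltW.
Qed.

Lemma integrable_pair (g : V -> R) : continuous g -> (@mu R n).-integrable setT (fun u => (F u * g (vC u))%:E).
Proof.
move=> cg; have [M M0 hM] := compact_bounded cg.
have mF := measurable_int _ intF.
apply: (@le_integrable _ _ _ _ _ measurableT _ (fun u => (M%:E * (F u)%:E)%E)).
- by apply/measurable_EFinP; apply: measurable_funM; [exact/measurable_EFinP|exact: measurable_contv].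
- move=> u _; rewrite -EFinM /= lee_fin !normrM mulrC.
  have [h|h] := pselect (cball z0 r0 (vC u)); last by rewrite F_supp // normr0 !mulr0.
  by apply: ler_wpM2r => //; apply: le_trans (hM _ h) _; exact: ler_norm.
- exact: integrableZl.
Qed.

Lemma pair_add (g h : V -> R) : continuous g -> continuous h -> I (fun y => g y + h y) = I g + I h.
Proof.
move=> cg ch; rewrite /I -RintegralD //; try exact: integrable_pair.
by apply: eq_Rintegral => u _; rewrite mulrDr.
Qed.

Lemma pair_scale c (g : V -> R) : continuous g -> I (fun y => c * g y) = c * I g.
Proof.
move=> cg; rewrite /I -RintegralZl //; try exact: integrable_pair.
by apply: eq_Rintegral => u _; rewrite mulrCA.
Qed.

Lemma pair_sum (J : Type) (r : seq J) (g : J -> V -> R) : (forall i, continuous (g i)) ->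
  I (fun y => \sum_(i <- r) g i y) = \sum_(i <- r) I (g i).
Proof.
move=> cg; elim: r => [|i r IH].
  rewrite big_nil (_ : (fun y => _) = (fun y => 0 * 0)); last by apply/funext => y; rewrite big_nil mulr0.
  by rewrite pair_scale ?mul0r // => y; exact: cst_continuous.
have cs : continuous (fun y => \sum_(i <- r) g i y).
  elim: r {IH} => [|j r IH] y; first by under eq_fun do rewrite big_nil; exact: cst_continuous.
  under eq_fun do rewrite big_cons; exact: (continuousD (cg j y) (IH y)).
by rewrite big_cons -IH -pair_add //; congr I; apply/funext => y; rewrite big_cons.
Qed.

Definition total_mass : R := Rintegral (@mu R n) setT (fun u => `|F u|).

Lemma total_mass_ge0 : 0 <= total_mass. Proof. by apply: Rintegral_ge0 => u _. Qed.

Lemma integrable_norm : (@mu R n).-integrable setT (fun u => `|F u|%:E).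
Proof. exact: (integrable_abse intF). Qed.

Lemma pair_bound (g : V -> R) K : continuous g -> 0 <= K -> (forall y, cball z0 r0 y -> `|g y| <= K) -> `|I g| <= K * total_mass.
Proof.
move=> cg K0 h; apply: le_trans (le_normr_Rintegral measurableT (integrable_pair cg)) _.
rewrite /total_mass -RintegralZl //; last exact: integrable_norm.
apply: le_Rintegral => //.
- exact: (integrable_abse (integrable_pair cg)).
- by have := integrableZl measurableT K integrable_norm; apply.
move=> u _; rewrite normrM mulrC.
have [hu|hu] := pselect (cball z0 r0 (vC u)); last by rewrite F_supp // normr0 !mulr0.
by apply: ler_wpM2r => //; exact: h.
Qed.

Lemma pair_ext (g h : V -> R) : (forall y, g y = h y) -> I g = I h.
Proof. by move=> e; congr I; exact/funext. Qed.

Lemma Re_jet (a b : R) (h H t t2 : C) : complex.Re ((a%:C%C * h) * t + (b%:C%C * H) * t2) =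
  a * (complex.Re h * complex.Re t - complex.Im h * complex.Im t) + b * (complex.Re H * complex.Re t2 - complex.Im H * complex.Im t2).
Proof. by rewrite ReD -!mulrA !Re_realM !ReM. Qed.

(** Integrates [kernel_jet] against [F]. The coefficient of [nrm t ^+ 2] is the pairing with the
    Levi kernel, nonnegative for plurisubharmonic weights; these are the jets that [max_modulus_jet]
    accepts. *)
Lemma pair_jet k xi s : 0 < s -> forall x : V, exists (a b : C) (K : R), 0 <= K /\
  forall t, nrm t <= 1 -> `|I (gam k \o tau (x + t *: xi) s) - (I (gam k \o tau x s) + 2 * complex.Re (a * t + b * t ^+ 2)
    + I (levi_kernel k xi x s) * nrm t ^+ 2)| <= K * nrm t ^+ 3.
Proof.
move=> s0 x; pose r := r0 + vn (z0 - x).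
have r_ge0 : 0 <= r by rewrite addr_ge0 ?vn_ge0.
have [K K0 hK] := kernel_jet k xi s0 r_ge0.
pose c1 y := gam1 k (tau x s y) * (s ^+ 2)^-1; pose c2 y := gam2 k (tau x s y) * (2 * s ^+ 4)^-1.
pose h (y : V) : C := herm xi (y - x).
pose P1 y := c1 y * complex.Re (h y); pose Q1 y := c1 y * complex.Im (h y).
pose P2 y := c2 y * complex.Re (h y ^+ 2); pose Q2 y := c2 y * complex.Im (h y ^+ 2).
have t1 : test_fun x s c1 by apply: test_fun_mul; [exact: test_fun_gam1|exact: test_fun_cst].
have t2 : test_fun x s c2 by apply: test_fun_mul; [exact: test_fun_gam2|exact: test_fun_cst].
have tR : test_fun x s (fun y => complex.Re (h y)) by exact: test_fun_lin.
have tI : test_fun x s (fun y => complex.Im (h y)) by exact: test_fun_im.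
have tP1 : test_fun x s P1 by exact: test_fun_mul.
have tQ1 : test_fun x s Q1 by exact: test_fun_mul.
have tP2 : test_fun x s P2.
  apply: test_fun_mul => //; apply: test_fun_ext (test_fun_sub (test_fun_mul tR tR) (test_fun_mul tI tI)) _ => y.
  by rewrite expr2 ReM.
have tQ2 : test_fun x s Q2.
  apply: test_fun_mul => //; apply: test_fun_ext (test_fun_add (test_fun_mul tR tI) (test_fun_mul tI tR)) _ => y.
  by rewrite expr2; case: (h y) => a b /=; ring.
exists (Complex (I P1) (I Q1)), (Complex (I P2) (I Q2)), (K * total_mass); split; first by rewrite mulr_ge0 ?total_mass_ge0.
move=> t t1'; have N3 : 0 <= nrm t ^+ 3 by rewrite exprn_ge0 ?nrm_ge0.
pose J (y : V) := gam k (tau x s y) + 2 * ((complex.Re t * P1 y - complex.Im t * Q1 y) +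
   (complex.Re (t ^+ 2) * P2 y - complex.Im (t ^+ 2) * Q2 y)) + nrm t ^+ 2 * levi_kernel k xi x s y.
have tJ1 : test_fun x s (fun y => 2 * ((complex.Re t * P1 y - complex.Im t * Q1 y) +
   (complex.Re (t ^+ 2) * P2 y - complex.Im (t ^+ 2) * Q2 y))).
  by apply: test_fun_scale; apply: test_fun_add; apply: test_fun_sub; apply: test_fun_scale.
have tg := test_fun_gam x s k; have tl := test_fun_levi_kernel k xi x s.
have tJ2 := test_fun_add tg tJ1; have tl2 := test_fun_scale (nrm t ^+ 2) tl.
have tJ : test_fun x s J := test_fun_add tJ2 tl2.
have cc f : test_fun x s f -> continuous f by exact: test_fun_continuous.
have EJ : I J = I (gam k \o tau x s) + 2 * complex.Re (Complex (I P1) (I Q1) * t + Complex (I P2) (I Q2) * t ^+ 2)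
    + I (levi_kernel k xi x s) * nrm t ^+ 2.
  rewrite /J (pair_add (cc _ tJ2) (cc _ tl2)) (pair_scale _ (cc _ tl)) (pair_add (cc _ tg) (cc _ tJ1)).
  have sB (a b : R) f g : test_fun x s f -> test_fun x s g -> I (fun y => a * f y - b * g y) = a * I f - b * I g.
    move=> hf hg; rewrite (@pair_ext _ (fun y => a * f y + (- b) * g y)); last by move=> y; rewrite mulNr.
    rewrite (pair_add (cc _ (test_fun_scale a hf)) (cc _ (test_fun_scale (- b) hg))).
    by rewrite (pair_scale _ (cc _ hf)) (pair_scale _ (cc _ hg)) mulNr.
  have tA := test_fun_sub (test_fun_scale (complex.Re t) tP1) (test_fun_scale (complex.Im t) tQ1).
  have tB := test_fun_sub (test_fun_scale (complex.Re (t ^+ 2)) tP2) (test_fun_scale (complex.Im (t ^+ 2)) tQ2).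
  rewrite (pair_scale _ (cc _ (test_fun_add tA tB))) (pair_add (cc _ tA) (cc _ tB)) !sB //.
  rewrite ReD !ReM /= -/(I (gam k \o tau x s)).
  move: (I _) (I _) (I _) (I _) (I _) (I _) (complex.Re t) (complex.Im t) (nrm t) (complex.Re (t ^+ 2)) (complex.Im (t ^+ 2)) => *; ring.
rewrite -EJ.
have tG := test_fun_gam (x + t *: xi) s k.
have -> : I (gam k \o tau (x + t *: xi) s) - I J = I (fun y => gam k (tau (x + t *: xi) s y) + (-1) * J y).
  by rewrite (pair_add (test_fun_continuous tG) (cc _ (test_fun_scale (-1) tJ))) (pair_scale _ (cc _ tJ)) mulN1r.
rewrite mulrAC; apply: pair_bound; last first.
- move=> y hy; have hr : vn (y - x) <= r.
    by have := vnD (y - z0) (z0 - x); rewrite addrA subrK => /le_trans; apply; rewrite lerD2r.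
  have := hK x y t hr t1'; rewrite mulN1r; congr (_ <= _); congr `| _ - _|; rewrite /J.
  rewrite -/(h y) Re_jet /P1 /Q1 /P2 /Q2 /c1 /c2.
  move: (gam k _) (levi_kernel _ _ _ _ _) (gam1 _ _) (gam2 _ _) ((s ^+ 2)^-1) ((2 * s ^+ 4)^-1) (complex.Re (h y)) (complex.Im (h y)) (complex.Re (h y ^+ 2)) (complex.Im (h y ^+ 2)) (complex.Re t) (complex.Im t) (nrm t) (complex.Re (t ^+ 2)) (complex.Im (t ^+ 2)) => *; ring.
- by rewrite mulr_ge0.
- have := test_fun_continuous tG; have := cc _ (test_fun_scale (-1) tJ) => c1' c2' y; exact: (continuousD (c2' y) (c1' y)).
Qed.

Definition scaled_kernel (q r2 : R) : R := q ^+ (2 * n) * gam 2 (1 - r2 * q ^+ 2).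
Definition scaled_kernel_deriv (q r2 : R) : R := (2 * n)%:R * q ^+ (2 * n).-1 * gam 2 (1 - r2 * q ^+ 2) - q ^+ (2 * n) * (gam1 2 (1 - r2 * q ^+ 2) * (r2 * (2 * q))).

Lemma deriv_at_pow m (q : R) : deriv_at (fun q => q ^+ m) q (m%:R * q ^+ m.-1).
Proof.
elim: m => [|m IH].
  by have := deriv_at_cst 1 q; rewrite mul0r; congr deriv_at; apply/funext => t; rewrite expr0.
have := deriv_at_mul IH (deriv_at_ext _ (deriv_at_lin 1 q)).
move=> /(_ id (fun t => mul1r t)) h.
have -> : (fun q : R => q ^+ m.+1) = (fun q => q ^+ m * id q) by apply/funext => t; rewrite exprSr.
move: h; congr deriv_at; rewrite /= mulr1 -natr1.
case: m {IH} => [|m] /=; first by rewrite !mul0r !expr0; ring.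
rewrite exprSr; ring.
Qed.

Lemma scaled_kernel_deriv_at q r2 : deriv_at (fun q => scaled_kernel q r2) q (scaled_kernel_deriv q r2).
Proof.
have dt : deriv_at (fun q : R => 1 - r2 * q ^+ 2) q (- r2 * (2 * q)).
  have := deriv_atD (deriv_at_cst 1 q) (deriv_atM (- r2) (deriv_at_pow 2 q)).
  rewrite /= add0r expr1; congr deriv_at; apply/funext => t; by rewrite mulNr.
have := deriv_at_mul (deriv_at_pow (2 * n) q) (deriv_at_comp dt (gam_deriv 2 _)).
rewrite /scaled_kernel_deriv; congr deriv_at; move: (gam1 _ _) (gam 2 _) => *; ring.
Qed.

Lemma scaled_kernel_deriv_bound q v M r2 : 0 <= q <= v -> 0 <= r2 <= M ->
  `|scaled_kernel_deriv q r2| <= (2 * n)%:R * v ^+ (2 * n).-1 * gamB R 2 + v ^+ (2 * n) * (gam1B R 2 * (M * (2 * v))).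
Proof.
move=> /andP[q0 qv] /andP[r20 r2M]; apply: (le_trans (ler_normB _ _)); have v0 := le_trans q0 qv.
have hp m : q ^+ m <= v ^+ m by apply: lerXn2r.
apply: lerD; rewrite !normrM.
  apply: ler_pM => //; rewrite ?mulr_ge0 //; last exact: gam_norm.
  by rewrite ger0_norm // ger0_norm ?exprn_ge0 //; apply: ler_wpM2l.
apply: ler_pM => //; rewrite ?mulr_ge0 //; first by rewrite ger0_norm ?exprn_ge0.
apply: ler_pM => //; rewrite ?mulr_ge0 //; first exact: gam1_norm.
by rewrite !ger0_norm //; apply: ler_pM => //; rewrite ?mulr_ge0 // ler_wpM2l.
Qed.

(* The derivative of the rescaled kernel q^(2n) gam 2 (1 - q^2 |y-x|^2) in q is
   a negative multiple of the Laplacian of another kernel, so that means of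
   plurisubharmonic functions increase with the radius 1/q. *)
Lemma scaled_kernel_deriv_levi (q : R) (x y : V) : (0 < n)%N -> 0 < q ->
  scaled_kernel_deriv q (hn2 (y - x)) = - (2 * q ^+ (2 * n).-1 / q ^+ 2) * \sum_p levi_kernel 0 (delta_mx 0 p) x q^-1 y.
Proof.
move=> n0 q0; have qn : q != 0 by rewrite gt_eqF.
rewrite /levi_kernel sumrB -mulr_sumr -mulr_suml sum_herm_delta -mulr_sumr -mulr_suml.
have -> : \sum_p hn2 (delta_mx 0 p : V) = n%:R.
  rewrite (eq_bigr (fun=> 1)) ?sumr_const ?card_ord // => p _.
  rewrite hn2E (bigD1 p) //= big1 ?addr0 ?mxE ?eqxx ?nrm1 ?expr1n // => j jp.
  by rewrite mxE (negbTE jp) andbF nrm0 expr0n.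
rewrite /scaled_kernel_deriv /tau exprVn invrK.
(* Since [gam 2] is the derivative of [gam 0], the radial derivative becomes a Laplacian; this fixes
   the index 2 of the averaging kernel. *)
have -> : gam2 0 (1 - hn2 (y - x) * q ^+ 2) = gam1 2 (1 - hn2 (y - x) * q ^+ 2) by rewrite /gam2 mul0r subr0.
have -> : gam1 0 (1 - hn2 (y - x) * q ^+ 2) = gam 2 (1 - hn2 (y - x) * q ^+ 2) by rewrite /gam1 mul0r subr0.
have -> : q ^+ (2 * n) = q ^+ (2 * n).-1 * q by rewrite -exprSr prednK // muln_gt0.
rewrite !exprVn !invrK natrM.
set r2 := hn2 (y - x).
set t := 1 - r2 * q ^+ 2.
set qq := q ^+ (2 * n).-1.
set g1 := gam1 2 t.
set g := gam 2 t.
clearbody g g1; clear t; clearbody r2 qq.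
by field.
Qed.

Lemma tauV x q (y : V) : tau x q^-1 y = 1 - hn2 (y - x) * q ^+ 2.
Proof. by rewrite /tau exprVn invrK. Qed.

(** Differentiation under the integral in [q], the inverse radius: the derivative is minus a sum of
    nonnegative Levi pairings over the coordinate directions. *)
Lemma pair_monotone x (s1 s2 : R) : (0 < n)%N -> 0 < s1 -> s1 <= s2 ->
  (forall s xi, s1 <= s <= s2 -> 0 <= I (levi_kernel 0 xi x s)) ->
  I (gam 2 \o tau x s1) / s1 ^+ (2 * n) <= I (gam 2 \o tau x s2) / s2 ^+ (2 * n).
Proof.
move=> n0 s10 s12 hI; have s20 := lt_le_trans s10 s12.
have [M M0 hM] := compact_bounded (test_fun_continuous (test_fun_hn2 x 1)).
pose f (q : R) (u : T) := F u * scaled_kernel q (hn2 (vC u - x)).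
pose NN (q : R) := Rintegral (@mu R n) setT (f q).
have NNE q : NN q = I (gam 2 \o tau x q^-1) * q ^+ (2 * n).
  rewrite mulrC -pair_scale; last exact: test_fun_continuous (test_fun_gam _ _ _).
  by apply: eq_Rintegral => y _; rewrite /f /scaled_kernel /= tauV.
pose a := s2^-1; pose b := s1^-1.
have ab : a <= b by rewrite lef_pV2 // posrE.
have a0 : 0 < a by rewrite invr_gt0.
(* An open interval around the closed range of [q], still of positive numbers, over which the
   derivative has one integrable majorant. *)
pose u := a / 2; pose v := b + 1.
have hu q : a <= q <= b -> `]u, v[%classic q.
  by move=> /andP[h1 h2]; rewrite /= in_itv /=; apply/andP; split; rewrite /u /v; lra.
have fI q : continuous (fun y : V => scaled_kernel q (hn2 (y - x))).
  have := test_fun_continuous (test_fun_scale (q ^+ (2 * n)) (test_fun_gam x q^-1 2)).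
  by rewrite (_ : (fun y => _ * _) = (fun y : V => scaled_kernel q (hn2 (y - x)))) //; apply/funext => y; rewrite /scaled_kernel tauV.
have fint q : `]u, v[%classic q -> (@mu R n).-integrable setT (EFin \o f q).
  by move=> _; exact: integrable_pair (fI q).
have fder q y : (`]u, v[%classic : set R) q -> setT y -> derivable (f ^~ y : R^o -> R^o) q 1.
  by move=> _ _; have [] := deriv_at_derive1 (deriv_atM (F y) (scaled_kernel_deriv_at q (hn2 (vC y - x)))).
have fder1 q y : partial1of2 f q y = F y * scaled_kernel_deriv q (hn2 (vC y - x)).
  by have [_] := deriv_at_derive1 (deriv_atM (F y) (scaled_kernel_deriv_at q (hn2 (vC y - x)))).
pose G (y : T) := `|F y| * ((2 * n)%:R * v ^+ (2 * n).-1 * gamB R 2 + v ^+ (2 * n) * (gam1B R 2 * (M * (2 * v)))).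
have v0 : 0 <= v by rewrite addr_ge0 // invr_ge0 ltW.
have gB0 : 0 <= gamB R 2 by exact: le_trans (gam_norm 2 0).
have g1B0 : 0 <= gam1B R 2 by exact: le_trans (gam1_norm 2 0).
have G0 y : 0 <= G y by rewrite mulr_ge0 // addr_ge0 ?mulr_ge0 ?exprn_ge0.
have Gint : (@mu R n).-integrable setT (EFin \o G).
  by have := integrableZr measurableT ((2 * n)%:R * v ^+ (2 * n).-1 * gamB R 2 + v ^+ (2 * n) * (gam1B R 2 * (M * (2 * v)))) integrable_norm; apply.
have Gub q y : (`]u, v[%classic : set R) q -> setT y -> `|partial1of2 f q y| <= G y.
  rewrite /= in_itv /= => /andP[h1 h2] _; rewrite fder1 normrM.
  have [hy|hy] := pselect (cball z0 r0 (vC y)); last by rewrite F_supp // normr0 mul0r G0.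
  apply: ler_wpM2l => //; apply: scaled_kernel_deriv_bound; first by apply/andP; split; apply: ltW => //; rewrite (lt_trans _ h1) // divr_gt0.
  by rewrite hn2_ge0; apply: le_trans (hM _ hy); exact: ler_norm.
have dN q : a <= q <= b -> derivable (NN : R^o -> R^o) q 1 /\ derive1 NN q <= 0.
  move=> qab; have hq := hu q qab; have q0 : 0 < q by case/andP: qab => h _; exact: lt_le_trans h.
  split; first exact: (@derivable_under_integral _ _ _ (@mu R n) f setT measurableT q u v hq fint fder G G0 Gint Gub).
  have -> : derive1 NN q = Rintegral (@mu R n) setT (fun y => partial1of2 f q y).
    exact: (@differentiation_under_integral _ _ _ (@mu R n) f setT measurableT q u v hq fint fder G G0 Gint Gub).
  have -> : Rintegral (@mu R n) setT (fun y => partial1of2 f q y) = - (2 * q ^+ (2 * n).-1 / q ^+ 2) * \sum_p I (levi_kernel 0 (delta_mx 0 p) x q^-1).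
    have cl p : continuous (levi_kernel 0 (delta_mx 0 p) x q^-1 : V -> R) by exact: test_fun_continuous (test_fun_levi_kernel _ _ _ _).
    rewrite -pair_sum // -pair_scale; last exact: test_fun_continuous (test_fun_sum _ (fun p => test_fun_levi_kernel 0 (delta_mx 0 p) x q^-1)).
    by apply: eq_Rintegral => y _; rewrite fder1 scaled_kernel_deriv_levi.
  rewrite mulNr oppr_le0; apply: mulr_ge0; first by rewrite divr_ge0 ?mulr_ge0 ?exprn_ge0 // ltW.
  apply: sumr_ge0 => p _; apply: hI; case/andP: qab => h1 h2.
  apply/andP; split; first by rewrite -[s1]invrK lef_pV2 // posrE invr_gt0.
  by rewrite -[s2]invrK lef_pV2 // posrE invr_gt0.
have : NN b <= NN a.
  have cN : {within `[a, b], continuous NN}.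
    apply: continuous_in_subspaceT => q /set_mem /=; rewrite in_itv /= => qab.
    by have [/derivable1_diffP /differentiable_continuous] := dN q qab.
  apply: (@ler0_derive1_le_cc _ NN a b) => //.
  - by move=> q; rewrite in_itv /= => /andP[h1 h2]; apply: (dN q _).1; rewrite !ltW.
  - by move=> q; rewrite in_itv /= => /andP[h1 h2]; apply: (dN q _).2; rewrite !ltW.
  - by rewrite in_itv /= lexx ab.
  - by rewrite in_itv /= lexx ab.
by rewrite !NNE /a /b !invrK !exprVn.
Qed.

End Regularization.

(** * Regularization of plurisubharmonic weights *)

Section KernelMass.
Variables (R : realType) (n : nat).
Local Notation T := (ms_type (lebC R n)).
Local Notation C := R[i].
Local Notation V := 'rV[C]_n.
Local Notation vC := (@vecC R n).

Lemma open_vn_ball (z : V) eta : open [set y : V | vn (y - z) < eta].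
Proof.
rewrite openE => y /= hy; apply/nbhs_VP; exists (eta - vn (y - z)); first by rewrite subr_gt0.
by move=> w hw /=; have := vnD (w - y) (y - z); rewrite addrA subrK; move: hw; rewrite ltrBrDr => h1 h2; exact: le_lt_trans h2 h1.
Qed.

Definition moll (s : R) (v : V) : R := gam 2 (1 - hn2 v / s ^+ 2).
Definition moll_int (s : R) : \bar R := (\int[@mu R n]_u (moll s (vC u))%:E)%E.

Lemma mollE x s y : gam 2 (tau x s y) = moll s (y - x). Proof. by []. Qed.

Lemma moll_ge0 s v : 0 <= moll s v. Proof. exact: gam_ge0. Qed.
Lemma moll_le s v : moll s v <= gamB R 2. Proof. exact: gam_bound. Qed.
Lemma mollN s (v : V) : moll s (- v) = moll s v.
Proof. by have := hn2Z (-1) v; rewrite scaleN1r nrmN nrm1 expr1n mul1r /moll => ->. Qed.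
Lemma moll_supp s v : 0 < s -> s <= vn v -> moll s v = 0.
Proof.
move=> s0 h; apply: gam_le0; rewrite leNgt; apply: contraL h; rewrite -ltNge => h.
by have := @tau_supp R n 0 s v s0; rewrite /tau subr0; apply.
Qed.
Lemma continuous_moll s : continuous (moll s).
Proof.
have := test_fun_continuous (test_fun_gam (0 : V) s 2); rewrite (_ : (fun y => gam 2 (tau 0 s y)) = moll s) //.
by apply/funext => y; rewrite mollE subr0.
Qed.

Lemma measurable_moll d (Y : measurableType d) (W : Y -> V) s : mvec W -> measurable_fun setT (fun y => (moll s (W y))%:E).
Proof. by move=> mW; apply/measurable_EFinP; apply: measurable_cont => //; exact: continuous_moll. Qed.

Lemma mvec_vC : mvec vC. Proof. exact: mvec_vecC. Qed.

Lemma moll_int_shift s x : (\int[@mu R n]_u (moll s (vC u - x))%:E = moll_int s)%E.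
Proof.
have ms := measurable_shift (- x).
have h := @ge0_integral_pushforward _ _ _ _ R (shiftT (- x)) ms (@mu R n) setT (fun u => (moll s (vC u))%:E) measurableT
  (measurable_moll s mvec_vC) (fun u _ => moll_ge0 s (vC u)).
rewrite preimage_setT in h.
transitivity (\int[@mu R n]_u ((fun u => (moll s (vC u))%:E) \o shiftT (- x)) u)%E.
  by apply: eq_integral => u _ /=; rewrite vecC_shift.
rewrite -h; apply: eq_measure_integral => A mA _; exact: mu_shift.
Qed.

Lemma moll_int_shiftN s x : (\int[@mu R n]_u (moll s (x - vC u))%:E = moll_int s)%E.
Proof. by rewrite -(moll_int_shift s x); apply: eq_integral => u _; rewrite -mollN opprB. Qed.

Lemma measurable_cboxv (a : V) s : measurable (vC @^-1` cbox a s).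
Proof. by apply: measurable_cbox; exact: mvec_vC. Qed.

Lemma moll_int_lt s : 0 < s -> (moll_int s < +oo)%E.
Proof.
move=> s0; apply: (@le_lt_trans _ _ (\int[@mu R n]_u (gamB R 2 * \1_(vC @^-1` cbox 0 s) u)%:E)%E).
  apply: ge0_le_integral => //.
  - by move=> u _; rewrite lee_fin moll_ge0.
  - exact: measurable_moll mvec_vC.
  - by apply/measurable_EFinP; apply: measurable_funM => //; exact: measurable_indic (measurable_cboxv _ _).
  move=> u _; rewrite lee_fin indicE; have [h|] := boolP (u \in _).
    by rewrite mulr1; exact: moll_le.
  move=> /negP; rewrite inE /= => h; rewrite mulr0 moll_supp // leNgt; apply/negP => h2.
  by apply: h; apply: vn_cbox; rewrite subr0.
under eq_integral do rewrite EFinM.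
rewrite ge0_integralZl_EFin //.
- rewrite integral_indic ?setIT; last exact: measurable_cboxv.
  by rewrite [X in (_ * X)%E](_ : _ = ((2 * s) ^+ (2 * n))%:E) ?ltry //; exact: mu_cbox.
- by [].
- by apply/measurable_EFinP; exact: measurable_indic (measurable_cboxv _ _).
- by rewrite /gamB exprn_ge0.
Qed.

Lemma moll_int_ge0 s : (0 <= moll_int s)%E.
Proof. by apply: integral_ge0 => u _; rewrite lee_fin moll_ge0. Qed.

Definition moll_mass s : R := fine (moll_int s).

Lemma moll_intE s : 0 < s -> moll_int s = (moll_mass s)%:E.
Proof. by move=> s0; rewrite /moll_mass fineK // ge0_fin_numE ?moll_int_ge0 // moll_int_lt. Qed.

Lemma moll_ge (s : R) v : 0 < s -> vn v <= s / (2 * n.+1%:R) -> expR (- 2) <= moll s v.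
Proof.
move=> s0 hv; have n1 : 0 < n.+1%:R :> R by rewrite ltr0n.
have h2 : hn2 v <= s ^+ 2 / 2.
  apply: le_trans (hn2_le hv) _; rewrite exprMn exprVn exprMn mulrCA; apply: ler_wpM2l; first exact: sqr_ge0.
  rewrite ler_pdivrMr ?mulr_gt0 ?exprn_gt0 // -[n.+1%:R]natr1.
  have : 0 <= n%:R :> R by []. move: (n%:R : R) => N N0; nra.
have t1 : 2^-1 <= 1 - hn2 v / s ^+ 2.
  have : hn2 v / s ^+ 2 <= 2^-1 by rewrite ler_pdivrMr ?exprn_gt0 // mulrC.
  by move: (_ / _) => r hr; lra.
have t2 : 1 - hn2 v / s ^+ 2 <= 1 by rewrite gerBl divr_ge0 ?hn2_ge0 ?sqr_ge0.
rewrite /moll /gam; move: (1 - _) t1 t2 => t t1 t2.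
have t0 : 0 < t by lra.
rewrite t0; apply: (@le_trans _ _ (1 * expR (- t^-1))).
  by rewrite mul1r ler_expR lerN2 -[leRHS]invrK lef_pV2 ?posrE.
by apply: ler_wpM2r; rewrite ?expR_ge0 // exprn_ege1 // invf_ge1.
Qed.

Definition moll_const : R := expR (- 2) * (2^-1 / n.+1%:R) ^+ (2 * n).

Lemma moll_const_gt0 : 0 < moll_const. Proof. by rewrite mulr_gt0 ?expR_gt0 // exprn_gt0 // divr_gt0 // ltr0n. Qed.

(** On the box of half-side [s / (4 * n.+1)] the kernel is at least $e^{-2}$, which gives
    [moll_const]. This scaling bound is what compares [s ^+ (2 * n)] with the mass. *)
Lemma moll_mass_ge s : 0 < s -> moll_const * s ^+ (2 * n) <= moll_mass s.
Proof.
move=> s0; pose r := s / (4 * n.+1%:R).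
have n1 : 0 < n.+1%:R :> R by rewrite ltr0n.
have rp : 0 < r by rewrite divr_gt0 ?mulr_gt0.
rewrite -lee_fin -moll_intE //.
apply: (@le_trans _ _ (\int[@mu R n]_u (expR (- 2) * \1_(vC @^-1` cbox 0 r) u)%:E)%E).
  under eq_integral do rewrite EFinM.
  rewrite ge0_integralZl_EFin //.
  - rewrite integral_indic ?setIT; last exact: measurable_cboxv.
    rewrite [X in (_ * X)%E](_ : _ = ((2 * r) ^+ (2 * n))%:E); last exact: mu_cbox.
    rewrite -EFinM lee_fin /moll_const -mulrA -exprMn; apply: ler_wpM2l; first exact: expR_ge0.
    rewrite (_ : 2^-1 / n.+1%:R * s = 2 * r) // /r; move: (n.+1%:R) n1 => N N0; field; rewrite gt_eqF //.
  - by [].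
  - by apply/measurable_EFinP; exact: measurable_indic (measurable_cboxv _ _).
apply: ge0_le_integral => //.
- by apply/measurable_EFinP; apply: measurable_funM => //; exact: measurable_indic (measurable_cboxv _ _).
- exact: measurable_moll mvec_vC.
move=> u _; rewrite lee_fin indicE; case: (boolP (u \in _)) => /=; last by rewrite mulr0 moll_ge0.
rewrite inE /= => h; rewrite mulr1; apply: moll_ge => //.
have := cbox_vn rp h; rewrite subr0 => /ltW /le_trans; apply; rewrite /r le_eqVlt; apply/orP; left; apply/eqP.
by move: (n.+1%:R) n1 => N N0; field; rewrite gt_eqF.
Qed.

Lemma moll_mass_gt0 s : 0 < s -> 0 < moll_mass s.
Proof. by move=> s0; apply: lt_le_trans (moll_mass_ge s0); rewrite mulr_gt0 ?moll_const_gt0 ?exprn_gt0. Qed.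

Variables (z0 : V) (r0 : R) (F : T -> R).
Hypothesis r0_ge0 : 0 <= r0.
Hypothesis intF : (@mu R n).-integrable setT (EFin \o F).
Hypothesis F_supp : forall u, ~ cball z0 r0 (vC u) -> F u = 0.
Local Notation I := (pair_with F).

(** Means grow with the radius, and the one at [s0] is controlled by the total mass of [F]; this
    bounds all smaller means uniformly. *)
Lemma mean_bound x s0 : (0 < n)%N -> 0 < s0 ->
  (forall s xi, 0 < s <= s0 -> 0 <= I (levi_kernel 0 xi x s)) ->
  forall s, 0 < s <= s0 -> I (gam 2 \o tau x s) <= (gamB R 2 * total_mass F / s0 ^+ (2 * n) / moll_const) * moll_mass s.
Proof.
move=> n0 s00 hI s /andP[sp ss0].
have mono := pair_monotone intF F_supp n0 sp ss0 (fun t xi (h : s <= t <= s0) =>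
   hI t xi (introT andP (conj (lt_le_trans sp (proj1 (elimT andP h))) (proj2 (elimT andP h))))).
have B0 : 0 <= gamB R 2 by rewrite /gamB exprn_ge0.
have hb : I (gam 2 \o tau x s0) <= gamB R 2 * total_mass F.
  apply: le_trans (ler_norm _) _; apply: (pair_bound intF F_supp) => //.
    exact: test_fun_continuous (test_fun_gam x s0 2).
  by move=> y _; exact: gam_norm.
have h1 : I (gam 2 \o tau x s) / s ^+ (2 * n) <= gamB R 2 * total_mass F / s0 ^+ (2 * n).
  by apply: le_trans mono _; apply: ler_wpM2r => //; rewrite invr_ge0 exprn_ge0 // ltW.
set A := gamB R 2 * _ / _ in h1 *.
have A0 : 0 <= A by rewrite /A divr_ge0 ?mulr_ge0 ?total_mass_ge0 ?exprn_ge0 // ltW.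
move: h1; rewrite ler_pdivrMr ?exprn_gt0 // => /le_trans; apply.
rewrite -[leRHS]mulrA; apply: ler_wpM2l => //.
by rewrite mulrC ler_pdivlMr ?moll_const_gt0 // mulrC moll_mass_ge.
Qed.

(** An essential bound on a ball bounds every mean whose kernel is supported in it; [ae_le_of_means]
    is the converse. *)
Lemma pair_le_of_ae (x z : V) s eta m : 0 < s -> vn (x - z) + s <= eta ->
  mu (vC @^-1` [set y | vn (y - z) < eta] `&` [set u | m < F u]) = 0%E ->
  I (gam 2 \o tau x s) <= m * moll_mass s.
Proof.
move=> s0 hx; set N := _ `&` _ => N0.
have mF := measurable_int _ intF.
have oball : open [set y : V | vn (y - z) < eta] by exact: open_vn_ball.
have mN : measurable N.
  apply: measurableI; first exact: mO.
  have := mF measurableT `]m%:E, +oo[%classic (emeasurable_itv _); rewrite setTI (_ : _ @^-1` _ = [set u | m < F u]) //.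
  by apply/seteqP; split => u /=; rewrite in_itv /= andbT lte_fin.
have ck := test_fun_continuous (test_fun_gam x s 2).
have i1 : (@mu R n).-integrable setT (fun u => (F u * gam 2 (tau x s (vC u)))%:E) by exact: (integrable_pair intF F_supp ck).
have mk : measurable_fun setT (fun u => (moll s (vC u - x))%:E).
  by apply: measurable_moll; apply: mvecB; [exact: mvec_vC|exact: mvec_cst].
have ik : (@mu R n).-integrable setT (fun u => (moll s (vC u - x))%:E).
  apply/integrableP; split => //; rewrite (eq_integral (fun u => (moll s (vC u - x))%:E)).
    by rewrite moll_int_shift moll_int_lt.
  by move=> u _; rewrite /= ger0_norm // moll_ge0.
have i2 : (@mu R n).-integrable setT (fun u => (m * moll s (vC u - x))%:E).
  by have := integrableZl measurableT m ik; apply.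
have -> : m * moll_mass s = Rintegral (@mu R n) setT (fun u => m * moll s (vC u - x)).
  have -> := @RintegralZl _ _ _ (@mu R n) setT (fun u => moll s (vC u - x)) m measurableT ik.
  by rewrite /moll_mass -(moll_int_shift s x).
rewrite /I /pair_with /Rintegral (negligible_integral mN measurableT i1 N0) (negligible_integral mN measurableT i2 N0).
apply: le_Rintegral => //.
- exact: measurableD.
- by apply: integrableS i1 => //; exact: measurableD.
- by apply: integrableS i2 => //; exact: measurableD.
move=> u [_ nN] /=; rewrite mollE.
have [h|h] := ltP (vn (vC u - x)) s; last by rewrite moll_supp // !mulr0.
apply: ler_wpM2r; first exact: moll_ge0.
rewrite leNgt; apply/negP => h2; apply: nN; split => //=.
by have := vnD (vC u - x) (x - z); rewrite addrA subrK => /le_lt_trans; apply; apply: lt_le_trans hx; rewrite addrC ltrD2l.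
Qed.
End KernelMass.

(** * From bounds on means to bounds almost everywhere *)

Section Smoothing.
Variables (R : realType) (n : nat).
Local Notation T := (ms_type (lebC R n)).
Local Notation C := R[i].
Local Notation V := 'rV[C]_n.
Local Notation vC := (@vecC R n).

Definition norm_moll (s : R) (v : V) : R := moll s v / moll_mass n s.

Lemma norm_moll_ge0 s v : 0 < s -> 0 <= norm_moll s v.
Proof. by move=> s0; rewrite divr_ge0 ?moll_ge0 // ltW // moll_mass_gt0. Qed.

Lemma measurable_norm_moll d (Y : measurableType d) (W : Y -> V) s : mvec W -> measurable_fun setT (fun y => (norm_moll s (W y))%:E).
Proof.
move=> mW; apply/measurable_EFinP; apply: measurable_funM; last exact: measurable_cst.
by apply: measurable_cont => //; exact: continuous_moll.
Qed.

Lemma norm_moll_shiftN s x : 0 < s -> (\int[@mu R n]_u (norm_moll s (x - vC u))%:E = 1)%E.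
Proof.
move=> s0; have k0 := moll_mass_gt0 n s0.
under eq_integral do rewrite /norm_moll mulrC EFinM.
rewrite ge0_integralZl_EFin //.
- have -> := moll_int_shiftN s x.
  by rewrite moll_intE // -EFinM mulVf // gt_eqF.
- by move=> u _; rewrite lee_fin moll_ge0.
- by apply: measurable_moll; apply: mvecB; [exact: mvec_cst|exact: mvec_vC].
- by rewrite invr_ge0 ltW.
Qed.

(* points of G at distance more than s from the complement *)
Definition inner_points (G : set V) (s : R) : set V := [set x | exists2 r, s < r & cball x r `<=` G].

Lemma open_inner_points G s : open (inner_points G s).
Proof.
rewrite openE => x [r sr h]; apply/nbhs_VP; exists ((r - s) / 2); first by rewrite divr_gt0 // subr_gt0.
move=> y hy; exists ((r + s) / 2); first by lra.
move=> w hw; apply: h; rewrite /cball /= in hw *.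
by have := vnD (w - y) (y - x); rewrite addrA subrK => h; lra.
Qed.

Lemma inner_points_sub G s x : 0 <= s -> inner_points G s x -> cball x s `<=` G.
Proof. by move=> s0 [r sr h]; move=> y hy; apply: h; exact: le_trans hy (ltW sr). Qed.

Lemma mvec_fst : mvec (fun p : T * T => vC p.1).
Proof. exact: (@mvec_comp R _ _ _ _ _ vC fst (@mvec_vC R n) measurable_fst). Qed.
Lemma mvec_snd : mvec (fun p : T * T => vC p.2).
Proof. exact: (@mvec_comp R _ _ _ _ _ vC snd (@mvec_vC R n) measurable_snd). Qed.

Lemma measurable_weight_kernel G s : measurable_fun setT (fun p : T * T => \1_(vC @^-1` inner_points G s) p.1 * norm_moll s (vC p.2 - vC p.1)).
Proof.
apply: measurable_funM.
  by apply: measurableT_comp; [exact: measurable_indic (mO (@open_inner_points G s))|exact: measurable_fst].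
by apply/measurable_EFinP; apply: measurable_norm_moll; apply: mvecB; [exact: mvec_snd|exact: mvec_fst].
Qed.

Section Weight.
Variables (G : set V) (s : R).
Hypothesis s0 : 0 < s.
Let g (p : T * T) : R := \1_(vC @^-1` inner_points G s) p.1 * norm_moll s (vC p.2 - vC p.1).

(** The indicator of the inner points of [G], mollified at scale [s]; it approximates the indicator
    of [G] from below. *)
Definition smooth_weight (y : T) : \bar R := (\int[@mu R n]_x (\1_(vC @^-1` inner_points G s) x * norm_moll s (vC y - vC x))%:E)%E.

Let g_ge0 p : 0 <= g p. Proof. by rewrite mulr_ge0 ?norm_moll_ge0. Qed.

Lemma smooth_weight_ge0 y : (0 <= smooth_weight y)%E.
Proof. by apply: integral_ge0 => x _; rewrite lee_fin; exact: (g_ge0 (x, y)). Qed.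

Lemma measurable_smooth_weight : measurable_fun setT smooth_weight.
Proof.
have mg : measurable_fun setT (EFin \o g) by apply/measurable_EFinP; exact: measurable_weight_kernel.
exact: (@measurable_fun_fubini_tonelli_G _ _ _ _ R (@mu R n) (EFin \o g) mg (fun p => g_ge0 p)).
Qed.

Lemma smooth_weight_le1 y : (smooth_weight y <= 1)%E.
Proof.
rewrite -(norm_moll_shiftN (vC y) s0); apply: ge0_le_integral => //.
- by move=> x _; rewrite lee_fin; exact: (g_ge0 (x, y)).
- apply/measurable_EFinP; apply: measurable_funM; first exact: measurable_indic (mO (@open_inner_points G s)).
  by apply/measurable_EFinP; apply: measurable_norm_moll; apply: mvecB; [exact: mvec_cst|exact: mvec_vC].
- by apply: measurable_norm_moll; apply: mvecB; [exact: mvec_cst|exact: mvec_vC].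
move=> x _; rewrite lee_fin; apply: ler_piMl; first exact: norm_moll_ge0.
by rewrite indicE; case: (_ \in _).
Qed.

Lemma smooth_weight_fin y : smooth_weight y = (fine (smooth_weight y))%:E.
Proof. by rewrite fineK // ge0_fin_numE ?smooth_weight_ge0 // (le_lt_trans (smooth_weight_le1 y)) // ltry. Qed.

(** The kernel reaches to distance [s], and from there a ball of radius [2 * s] must remain in [G],
    hence [3 * s]. *)
Lemma smooth_weight_eq1 y (r : R) : 3 * s < r -> [set z | vn (z - vC y) < r] `<=` G -> smooth_weight y = 1%E.
Proof.
move=> sr h; rewrite -(norm_moll_shiftN (vC y) s0); apply: eq_integral => x _; congr EFin.
have [h2|h2] := leP s (vn (vC y - vC x)); first by rewrite /norm_moll moll_supp // !mul0r mulr0.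
rewrite indicE mem_set ?mul1r //; exists (2 * s); first by rewrite ltr_pMl // ltr1n.
move=> z hz; apply: h; rewrite /cball /= in hz *.
have := vnD (z - vC x) (vC x - vC y); rewrite addrA subrK (vnB (vC x)); lra.
Qed.

Variable Phi : T -> R.
Hypothesis intPhi : (@mu R n).-integrable setT (EFin \o Phi).
Hypothesis Phi_le : forall x, inner_points G s (vC x) -> (\int[@mu R n]_y (Phi y * norm_moll s (vC y - vC x))%:E <= 0)%E.

(** Fubini moves the mollifier from the weight to [Phi]: the integral becomes one of means of [Phi]
    over inner points, each at most 0. *)
Lemma smoothed_le0 : (\int[@mu R n]_y (Phi y * fine (smooth_weight y))%:E <= 0)%E.
Proof.
have mPhi := measurable_int _ intPhi.
pose f (p : T * T) : \bar R := ((Phi p.2) * g p)%:E.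
have mf : measurable_fun setT f.
  apply/measurable_EFinP; apply: measurable_funM; last exact: measurable_weight_kernel.
  by apply: measurableT_comp; [exact/measurable_EFinP|exact: measurable_snd].
have mg y : measurable_fun setT (fun x => (g (x, y))%:E).
  apply/measurable_EFinP; apply: measurable_funM; first exact: measurable_indic (mO (@open_inner_points G s)).
  by rewrite /=; apply/measurable_EFinP; apply: measurable_norm_moll; apply: mvecB; [exact: mvec_cst|exact: mvec_vC].
have ig y : (@mu R n).-integrable setT (fun x => (g (x, y))%:E).
  apply/integrableP; split => //; rewrite (eq_integral (fun x => (g (x, y))%:E)).
    by rewrite -/(smooth_weight y) smooth_weight_fin ltry.
  by move=> u _; rewrite /= ger0_norm.
have intf : (@mu R n \x @mu R n)%E.-integrable setT f.
  apply/(@integrable21ltyP _ _ _ _ R (@mu R n) (@mu R n) f mf).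
  apply: (@le_lt_trans _ _ (\int[@mu R n]_y `|(EFin \o Phi) y|)%E); last by case/integrableP: intPhi.
  have E y : (\int[@mu R n]_x `|f (x, y)| = `|Phi y|%:E * smooth_weight y)%E.
    rewrite -ge0_integralZl_EFin //.
    - by apply: eq_integral => x _; rewrite /f /= normrM (ger0_norm (g_ge0 _)) EFinM.
    - by move=> x _; rewrite lee_fin; exact: (g_ge0 (x, y)).
    - exact: mg.
  under eq_integral do rewrite E.
  apply: ge0_le_integral => //.
  - by move=> y _; rewrite mule_ge0 ?smooth_weight_ge0.
  - apply: emeasurable_funM; last exact: measurable_smooth_weight.
    by apply/measurable_EFinP; apply: measurableT_comp => //; exact/measurable_EFinP.
  - by apply: measurableT_comp.
  - by move=> y _; rewrite /= -[leRHS]mule1; apply: lee_wpmul2l => //; exact: smooth_weight_le1.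
have E2 y : (\int[@mu R n]_x f (x, y) = (Phi y * fine (smooth_weight y))%:E)%E.
  rewrite EFinM -smooth_weight_fin; have h := integralZl measurableT (ig y) (Phi y); apply: etrans h.
  by apply: eq_integral => x _; rewrite -EFinM.
have FB := @Fubini _ _ _ _ R (@mu R n) (@mu R n) f intf.
have -> : (\int[@mu R n]_y (Phi y * fine (smooth_weight y))%:E = \int[@mu R n]_x \int[@mu R n]_y f (x, y))%E.
  by rewrite FB; apply: eq_integral => y _; rewrite E2.
have iF := integrable_fubini_F intf.
have i0 : (\int[@mu R n]_x (cst 0%E x : \bar R) = 0)%E by exact: integral0.
have hi : (@mu R n).-integrable setT (cst 0%E : T -> \bar R) by exact: integrable0.
have iF' : (@mu R n).-integrable setT (fun x => \int[@mu R n]_y f (x, y))%E by exact: iF.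
have fE1 x y : inner_points G s (vC x) -> f (x, y) = (Phi y * norm_moll s (vC y - vC x))%:E.
  move=> h; congr EFin; congr (_ * _); rewrite -[RHS]mul1r; congr (_ * _).
  by rewrite indicE mem_set.
have fE0 x y : ~ inner_points G s (vC x) -> f (x, y) = 0%E.
  move=> h; congr EFin; rewrite -[RHS](mulr0 (Phi y)); congr (_ * _); rewrite -[RHS](mul0r (norm_moll s (vC y - vC x))); congr (_ * _).
  by rewrite indicE memNset.
have key x : (\int[@mu R n]_y f (x, y) <= 0)%E.
  have [h|h] := pselect (inner_points G s (vC x)).
    have -> : (\int[@mu R n]_y f (x, y) = \int[@mu R n]_y (Phi y * norm_moll s (vC y - vC x))%:E)%E.
      by apply: eq_integral => y _; exact: fE1.
    exact: Phi_le.
  have -> : (\int[@mu R n]_y f (x, y) = 0)%E by apply: integral0_eq => y _; exact: fE0.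
  exact: lexx.
apply: (@le_trans _ _ (\int[@mu R n]_x (cst 0%E x : \bar R))%E); last by rewrite i0.
apply: (le_integral measurableT iF' hi) => x _; exact: key.
Qed.

End Weight.

Lemma smoothing_le0 (G : set V) (s0 : R) (Phi : T -> R) : 0 < s0 -> open G ->
  (@mu R n).-integrable setT (EFin \o Phi) -> (forall u, ~ G (vC u) -> Phi u = 0) ->
  (forall x s, 0 < s < s0 -> inner_points G s (vC x) -> (\int[@mu R n]_y (Phi y * norm_moll s (vC y - vC x))%:E <= 0)%E) ->
  (\int[@mu R n]_y (Phi y)%:E <= 0)%E.
Proof.
move=> s00 oG intPhi Phi0 hle; have mPhi := measurable_int _ intPhi.
(* The shift by 2 keeps every radius strictly below [s0]. *)
pose s j : R := s0 / j.+2%:R.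
have sj j : 0 < s j < s0.
  by rewrite divr_gt0 ?ltr0n //= ltr_pdivrMr ?ltr0n // ltr_pMr // ltr1n.
have sj0 j : 0 < s j by case/andP: (sj j).
have mf j : measurable_fun setT (fun y => (Phi y * fine (smooth_weight G (s j) y))%:E).
  apply/measurable_EFinP; apply: measurable_funM; first exact/measurable_EFinP.
  have := @measurable_smooth_weight G (s j) (sj0 j); rewrite (_ : smooth_weight G (s j) = EFin \o (fun y => fine (smooth_weight G (s j) y))).
    by move/measurable_EFinP.
  by apply/funext => y; exact: smooth_weight_fin.
have hcv : {ae @mu R n, forall y, setT y -> (fun j => (Phi y * fine (smooth_weight G (s j) y))%:E) @ \oo --> (Phi y)%:E}.
  apply: aeW => y _; have [Gy|nG] := pselect (G (vC y)); last first.
    by apply: cvg_near_cst; apply: nearW => j; rewrite Phi0 // mul0r.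
  have /nbhs_VP [r rp hr] : nbhs (vC y) G by exact: open_nbhs_nbhs.
  apply: cvg_near_cst; exists (Num.truncn (3 * s0 / r)) => // j /= Nj.
  rewrite (@smooth_weight_eq1 _ _ (sj0 j) y r) ?mulr1 //.
  rewrite mulrA ltr_pdivrMr ?ltr0n // [ltRHS]mulrC -ltr_pdivrMr //.
  by apply: lt_le_trans (truncnS_gt _) _; rewrite ler_nat ltnS ltnW.
have hdom : {ae @mu R n, forall y j, setT y -> (`|(Phi y * fine (smooth_weight G (s j) y))%:E| <= (abse \o (EFin \o Phi)) y)%E}.
  apply: aeW => y j _; rewrite /= lee_fin normrM; apply: ler_piMr => //.
  rewrite ger0_norm -lee_fin -smooth_weight_fin //; [exact: smooth_weight_le1|exact: smooth_weight_ge0].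
have [_ _ h] := @dominated_convergence _ _ _ (@mu R n) setT measurableT (fun j y => (Phi y * fine (smooth_weight G (s j) y))%:E)
    (EFin \o Phi) (abse \o (EFin \o Phi)) mf mPhi hcv (integrable_abse intPhi) hdom.
rewrite -(cvg_lim _ h) //; apply: lime_le; first by apply/cvg_ex; exists (\int[@mu R n]_x (EFin \o Phi) x)%E.
apply: nearW => j /=; apply: smoothed_le0 => //.
by move=> x; exact: hle.
Qed.

Variables (z0 : V) (r0 : R) (F : T -> R).
Hypothesis intF : (@mu R n).-integrable setT (EFin \o F).
Hypothesis F_supp : forall u, ~ cball z0 r0 (vC u) -> F u = 0.
Local Notation I := (pair_with F).

(** By [open_integral_le0] it is enough to integrate [F - m] over open sets, and [smoothing_le0]
    reduces such integrals to means. No differentiation theorem for integrals is involved. *)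
Lemma ae_le_of_means (G0 : set V) m s0 : 0 <= r0 -> 0 < s0 -> open G0 -> G0 `<=` cball z0 r0 ->
  (forall x s, G0 x -> 0 < s < s0 -> I (gam 2 \o tau x s) <= m * moll_mass n s) ->
  mu (vC @^-1` G0 `&` [set u | m < F u]) = 0%E.
Proof.
move=> r00 s00 oG0 G0B hle; have mF := measurable_int _ intF.
have mB := mO oG0.
have finB : (mu (vC @^-1` G0) < +oo)%E.
  apply: (@le_lt_trans _ _ (mu (vC @^-1` cbox z0 (r0 + 1)))); last by rewrite mu_cbox ?ltry // ltr_wpDl.
  apply: le_measure; rewrite ?inE //; first exact: measurable_cboxv.
  by move=> u /G0B h; apply: vn_cbox; apply: le_lt_trans h _; rewrite ltrDl.
have iF1 : (@mu R n).-integrable (vC @^-1` G0) (EFin \o F) by exact: integrableS intF.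
have ic : (@mu R n).-integrable (vC @^-1` G0) (EFin \o cst m).
  apply/integrableP; split; first exact/measurable_EFinP/measurable_cst.
  rewrite (eq_integral (cst `|m|%:E)) // integral_cst //.
  by apply: lte_mul_pinfty.
have iFm : (@mu R n).-integrable (vC @^-1` G0) (EFin \o (fun u => F u - m)).
  by have := integrableB mB iF1 ic; apply: eq_integrable.
have -> : vC @^-1` G0 `&` [set u | m < F u] = vC @^-1` G0 `&` [set u | 0 < F u - m].
  by apply/seteqP; split => u [h1 h2]; split => //=; move: h2; rewrite /= subr_gt0.
apply: open_integral_le0 => // G oG.
rewrite -preimage_setI; set G' := G0 `&` G.
have oG' : open G' by exact: openI.
have mG' := mO oG'.
rewrite integral_mkcond.
pose Phi u := ((fun u => F u - m) \_ (vC @^-1` G')) u.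
have PhiE u : G' (vC u) -> Phi u = F u - m by move=> h; rewrite /Phi patchE mem_set.
have Phi0 u : ~ G' (vC u) -> Phi u = 0 by move=> h; rewrite /Phi patchE memNset.
have iPhi : (@mu R n).-integrable setT (EFin \o Phi).
  rewrite (_ : EFin \o Phi = (EFin \o (fun u => F u - m)) \_ (vC @^-1` G')).
    by apply/(integrable_mkcond _ mG'); apply: integrableS iFm => // u [].
  by apply/funext => u; rewrite /= /Phi !patchE; case: ifP.
rewrite (eq_integral (EFin \o Phi)); last by move=> u _; rewrite /= /Phi !patchE; case: ifP.
apply: (@smoothing_le0 G' s0) => // x s ss hx; have sp : 0 < s by case/andP: ss.
have hG : forall y, vn (y - vC x) < s -> G' y by move=> y hy; apply: (inner_points_sub (ltW sp) hx); exact: ltW.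
have kp := moll_mass_gt0 n sp.
have ik0 : (@mu R n).-integrable setT (fun u => (moll s (vC u - vC x))%:E).
  apply/integrableP; split; first by apply: measurable_moll; apply: mvecB; [exact: mvec_vC|exact: mvec_cst].
  rewrite (eq_integral (fun u => (moll s (vC u - vC x))%:E)).
    by rewrite moll_int_shift moll_int_lt.
  by move=> u _; rewrite /= ger0_norm // moll_ge0.
have i2 : (@mu R n).-integrable setT (fun u => (m * moll s (vC u - vC x))%:E).
  by have := integrableZl measurableT m ik0; apply.
have i1 : (@mu R n).-integrable setT (fun u => (F u * gam 2 (tau (vC x) s (vC u)))%:E).
  exact: (integrable_pair intF F_supp (test_fun_continuous (test_fun_gam (vC x) s 2))).
have E u : (Phi u * norm_moll s (vC u - vC x))%:E = ((moll_mass n s)^-1%:E * (F u * gam 2 (tau (vC x) s (vC u)) - m * moll s (vC u - vC x))%:E)%E.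
  rewrite -EFinM mollE -mulrBl /norm_moll; congr EFin; rewrite [RHS]mulrC mulrA; congr (_ / _).
  have [h|h] := ltP (vn (vC u - vC x)) s; last by rewrite moll_supp // !mulr0.
  by rewrite PhiE //; apply: hG.
under eq_integral do rewrite E.
rewrite integralZl //; last by have := integrableB measurableT i1 i2; apply: eq_integrable.
rewrite (_ : (\int[_]_(x in _) _ = (I (gam 2 \o tau (vC x) s) - m * moll_mass n s)%:E)%E).
  rewrite -EFinM lee_fin pmulr_rle0 ?invr_gt0 // subr_le0; apply: hle => //.
  by have [] := hG (vC x); rewrite ?subrr ?vn0.
have -> : (\int[@mu R n]_y (F y * gam 2 (tau (vC x) s (vC y)) - m * moll s (vC y - vC x))%:E =
   \int[@mu R n]_y (F y * gam 2 (tau (vC x) s (vC y)))%:E - \int[@mu R n]_y (m * moll s (vC y - vC x))%:E)%E.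
  by rewrite -integralB_EFin.
have -> : (\int[@mu R n]_y (m * moll s (vC y - vC x))%:E = (m * moll_mass n s)%:E)%E.
  under eq_integral do rewrite EFinM.
  have h := integralZl measurableT ik0 m; apply: etrans h _; rewrite EFinM; congr (_ * _)%E.
  exact: etrans (moll_int_shift s (vC x)) (moll_intE n sp).
rewrite EFinB; congr (_ - _)%E.
by rewrite /I /pair_with /Rintegral fineK //; exact: integrable_fin_num.
Qed.

End Smoothing.

(** * The maximum principle with essential bounds *)

Section LocalMaximumPrinciple.
Variables (R : realType) (n : nat).
Local Notation T := (ms_type (lebC R n)).
Local Notation C := R[i].
Local Notation V := 'rV[C]_n.
Local Notation vC := (@vecC R n).

Lemma closed_sq_boundary (r : R) : closed (sq_boundary r).
Proof.
have cl (f : C -> R) : (forall z w : C, `|f z - f w| <= nrm (z - w)) -> closed [set z : C | `|f z| = r].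
  move=> hf; rewrite closedE => z; apply: contra_notP => h.
  have h1 : 0 < `| `|f z| - r| by rewrite normr_gt0 subr_eq0; apply/eqP.
  apply/nbhs_CP; exists `| `|f z| - r| => // w hw /= e; move: hw; apply/negP; rewrite -leNgt -e.
  by apply: le_trans (ler_dist_dist _ _) _; rewrite distrC; exact: hf.
have -> : sq_boundary r = csquare r `&` ([set z : C | `|complex.Re z| = r] `|` [set z : C | `|complex.Im z| = r]).
  by apply/seteqP; split => z /=; [move=> [a [b c]]|move=> [[a b] c]].
apply: closedI; first by apply: compact_closed; [exact: norm_hausdorff|exact: compact_csquare].
by apply: closedU; apply: cl => z w; rewrite -?ReB -?ImB; [exact: Re_le_nrm|exact: Im_le_nrm].
Qed.

Lemma compact_sq_boundary (r : R) : compact (sq_boundary r).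
Proof.
by apply: (@subclosed_compact _ _ (csquare r)); [exact: closed_sq_boundary|exact: compact_csquare|move=> z; exact: sq_boundary_csquare].
Qed.

Lemma continuous_nrm2 (S : topologicalType) (g : S -> C) (t : S) : {for t, continuous g} -> {for t, continuous (fun t => nrm (g t) ^+ 2)}.
Proof.
move=> cg; have := continuous_ReF (continuousM cg (continuous_cj cg)).
by rewrite (_ : (fun y => complex.Re _) = (fun t => nrm (g t) ^+ 2)) //; apply/funext => y; rewrite /= mulcJ.
Qed.

Lemma jet_div (A B D X N2 N3 K c : R) : 0 < c -> `|A - (B + 2 * X + D * N2)| <= K * N3 ->
  `|A / c - (B / c + 2 * (c^-1 * X) + D / c * N2)| <= K / c * N3.
Proof.
move=> c0 h.
have -> : A / c - (B / c + 2 * (c^-1 * X) + D / c * N2) = (A - (B + 2 * X + D * N2)) / c by field; rewrite gt_eqF.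
rewrite normrM [X in _ * X]ger0_norm ?invr_ge0 ?(ltW c0) // mulrAC; apply: ler_wpM2r => //.
by rewrite invr_ge0 ltW.
Qed.

Variables (z0 : V) (r0 : R) (F : T -> R).
Hypothesis n_gt0 : (0 < n)%N.
Hypothesis r0_gt0 : 0 < r0.
Hypothesis intF : (@mu R n).-integrable setT (EFin \o F).
Hypothesis F_supp : forall u, ~ cball z0 r0 (vC u) -> F u = 0.
Local Notation I := (pair_with F).
Hypothesis F_psh : forall k xi x s, 0 < s -> vn (x - z0) + s <= r0 -> 0 <= I (levi_kernel k xi x s).

Definition ubF (z : V) (m : R) : Prop :=
  exists2 eta, 0 < eta & mu (vC @^-1` [set y | vn (y - z) < eta] `&` [set u | m < F u]) = 0%E.

(** Local upper boundedness of plurisubharmonic functions. Centres within [r0 / 2] and radii up to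
    [r0 / 2] keep the kernels in the ball where [F_psh] applies. *)
Lemma ubF_exists : exists m, ubF z0 m.
Proof.
pose s0 := r0 / 2; have s00 : 0 < s0 by rewrite divr_gt0.
exists (gamB R 2 * total_mass F / s0 ^+ (2 * n) / moll_const R n), s0 => //.
apply: (ae_le_of_means intF F_supp (ltW r0_gt0) s00 (@open_vn_ball R n z0 s0)).
  have s0r : s0 <= r0 by rewrite /s0 ler_pdivrMr // ler_peMr ?ler1n // ltW.
  by move=> y hy; exact: le_trans (ltW hy) s0r.
move=> x s hx /andP[sp ss]; apply: (mean_bound intF F_supp n_gt0 s00); last by rewrite sp ltW.
move=> s' xi /andP[s'0 s's]; apply: F_psh => //; move: hx s's; rewrite /= /s0; lra.
Qed.

(** For each centre near [p] and small radius, [max_modulus_jet] is applied to the mean of [F] along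
    the translated disc. All these means obey the bound at the centre of the disc, so
    [ae_le_of_means] returns it to [F] around [p]. *)
Lemma ubF_disc (p v : V) (sg : R) (g : C -> C) (Bd r1 : R) : 0 < sg -> 0 < Bd -> r1 < r0 ->
  (forall t, csquare sg t -> differentiable g t) ->
  (forall t, csquare sg t -> cball z0 r1 (p + t *: v)) ->
  (forall t, sq_boundary sg t -> exists2 m, ubF (p + t *: v) m & nrm (g t) ^+ 2 * expR m < Bd) ->
  g 0 != 0 -> ubF p (ln (Bd / nrm (g 0) ^+ 2)).
Proof.
move=> sg0 Bd0 r10 dg hin hbd g0; pose u x s t := I (gam 2 \o tau (x + t *: v) s) / moll_mass n s.
have ng0 : 0 < nrm (g 0) ^+ 2 by rewrite exprn_gt0 // nrm_gt0.
(* The essential bounds hold on neighbourhoods that vary along the boundary. Compactness gives one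
   scale, encoded as [1 / M], for the centre and radius of the means. *)
have [M M0 hM] : exists2 M : R, 0 <= M & forall t, sq_boundary sg t ->
    forall (x : V) s, vn (x - p) * M < 1 -> 0 < s -> s * M < 1 -> nrm (g t) ^+ 2 * expR (u x s t) <= Bd.
  apply: (@compact_exists_bound _ _ _ (fun t M => forall (x : V) s, vn (x - p) * M < 1 -> 0 < s -> s * M < 1 ->
     nrm (g t) ^+ 2 * expR (u x s t) <= Bd)); first exact: compact_sq_boundary.
    move=> t M M' MM h x s h1 h2 h3; apply: h => //.
      by apply: le_lt_trans h1; apply: ler_wpM2l => //; exact: vn_ge0.
    by apply: le_lt_trans h3; apply: ler_wpM2l => //; exact: ltW.
  move=> t0 ht0; have [m [eta e0 ubm] hm] := hbd _ ht0.
  exists (4 / eta).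
  have cg : {for t0, continuous (fun t => nrm (g t) ^+ 2)}.
    by apply: continuous_nrm2; apply: differentiable_continuous; apply: dg; exact: sq_boundary_csquare.
  pose d := Bd / expR m - nrm (g t0) ^+ 2.
  have d0 : 0 < d by rewrite subr_gt0 ltr_pdivlMr ?expR_gt0.
  have /cvg_RP /(_ _ d0) n1 := cg.
  have n2 : \forall t \near t0, nrm (t - t0) < eta / (4 * (vn v + 1)).
    by apply/nbhs_CP; exists (eta / (4 * (vn v + 1))) => //; rewrite divr_gt0 // mulr_gt0 // ltr_wpDl ?vn_ge0.
  apply: filterS2 n1 n2 => t h1 h2 x s.
  rewrite mulrA ltr_pdivrMr // mul1r => hx sp; rewrite mulrA ltr_pdivrMr // mul1r => hs.
  have hg : nrm (g t) ^+ 2 < Bd / expR m.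
    by move: h1; rewrite ltr_norml /d => /andP[_]; rewrite ltrBlDr subrK.
  have hu : u x s t <= m.
    rewrite /u ler_pdivrMr ?moll_mass_gt0 //; apply: (pair_le_of_ae intF F_supp sp _ ubm).
    have -> : x + t *: v - (p + t0 *: v) = (x - p) + (t - t0) *: v.
      by rewrite scalerBl opprD addrACA.
    have := vnD (x - p) ((t - t0) *: v); rewrite vnZ.
    have : nrm (t - t0) * vn v <= eta / 4.
      apply: (@le_trans _ _ (eta / (4 * (vn v + 1)) * (vn v + 1))).
        by apply: ler_pM; rewrite ?nrm_ge0 ?vn_ge0 ?lerDl // ltW.
      rewrite le_eqVlt; apply/orP; left; apply/eqP; have := vn_ge0 v; move: (vn v) => w w0; field.
      by rewrite gt_eqF // ltr_wpDl.
    move: hx hs; move: (vn (x - p)) (nrm _ * vn v) (vn (x - p + _)) => a b c; lra.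
  apply: (@le_trans _ _ (nrm (g t) ^+ 2 * expR m)).
    by apply: ler_wpM2l; [exact: sqr_ge0|rewrite ler_expR].
  by rewrite -ler_pdivlMr ?expR_gt0 // ltW.
(* The first bound keeps the kernels inside the ball of radius [r0] along the whole disc, the second
   is the scale from the boundary. *)
pose eta := Num.min ((r0 - r1) / 2) (M + 1)^-1.
have M1 : 0 < M + 1 by rewrite ltr_wpDl.
have e0 : 0 < eta by rewrite lt_min invr_gt0 M1 divr_gt0 // subr_gt0.
have eM s : 0 <= s -> s < eta -> s * M < 1.
  move=> s0 hs; have : s < (M + 1)^-1 by move: hs; rewrite lt_min => /andP[].
  rewrite -[(M + 1)^-1]mul1r ltr_pdivlMr // => h; apply: le_lt_trans h; apply: ler_wpM2l => //.
  by rewrite lerDl.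
have er s : s < eta -> s < (r0 - r1) / 2 by rewrite lt_min => /andP[].
exists eta => //.
apply: (ae_le_of_means intF F_supp (ltW r0_gt0) e0 (@open_vn_ball R n p eta)).
  move=> y hy; have h0 : cball z0 r1 p.
    by have := hin 0; rewrite scale0r addr0; apply; rewrite /csquare /= normr0; split; exact: ltW.
  have := vnD (y - p) (p - z0); rewrite addrA subrK /cball /=; have := er _ hy; move: h0; rewrite /cball /=; lra.
move=> x s hx /andP[sp se]; have kp := moll_mass_gt0 n sp.
have h : nrm (g 0) ^+ 2 * expR (u x s 0) <= Bd.
  apply: (@max_modulus_jet R (u x s) g sg Bd sg0 (ltW Bd0) dg); last first.
    by move=> t ht; apply: hM => //; apply: eM => //; [exact: vn_ge0|exact: ltW].
  move=> z hz; have [a [b [K [K0 hK]]]] := pair_jet (ltW r0_gt0) intF F_supp 2 v sp (x + z *: v).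
  exists ((moll_mass n s)^-1%:C%C * a), ((moll_mass n s)^-1%:C%C * b), (I (levi_kernel 2 v (x + z *: v) s) / moll_mass n s), (K / moll_mass n s); split.
  - apply: divr_ge0; last exact: ltW.
    apply: F_psh => //; have := hin z hz; have := er _ hx; have := er _ se; rewrite /cball /=.
    have := vnD (x - p) (p + z *: v - z0).
    have -> : x - p + (p + z *: v - z0) = x + z *: v - z0 by rewrite !addrA subrK.
    lra.
  - by rewrite divr_ge0 // ltW.
  move=> t t1; have := hK t t1; rewrite -addrA -scalerDl => ht.
  have -> : (moll_mass n s)^-1%:C%C * a * t + (moll_mass n s)^-1%:C%C * b * t ^+ 2 = (moll_mass n s)^-1%:C%C * (a * t + b * t ^+ 2).
    by rewrite mulrDr !mulrA.
  rewrite Re_realM /u.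
  exact: jet_div kp ht.
have : u x s 0 <= ln (Bd / nrm (g 0) ^+ 2).
  rewrite -ler_expR lnK ?posrE ?divr_gt0 // ler_pdivlMr // mulrC //.
by rewrite /u scale0r addr0 ler_pdivrMr.
Qed.

End LocalMaximumPrinciple.

(** * Weights with nonnegative curvature current *)

Section Plurisubharmonic.
Variables (R : realType) (n : nat).
Local Notation T := (ms_type (lebC R n)).
Local Notation C := R[i].
Local Notation V := 'rV[C]_n.
Local Notation vC := (@vecC R n).

(** Stated with negligible sets, since nothing is known of [f] away from its domain. The infimum of
    such [m] is the essential upper limit of [f] at [z]. *)
Definition ess_ub (f : V -> \bar R) (z : V) (m : R) : Prop :=
  exists2 eta, 0 < eta & (@mu R n).-negligible (vC @^-1` [set y | vn (y - z) < eta /\ (m%:E < f y)%E]).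

Lemma ess_ub_mono f z m m' : m <= m' -> ess_ub f z m -> ess_ub f z m'.
Proof.
move=> mm [eta e0 h]; exists eta => //; apply: negligibleS h => u [h1 h2]; split => //.
by apply: le_lt_trans h2; rewrite lee_fin.
Qed.

Lemma ess_ub_near f z m : ess_ub f z m -> \forall y \near z, ess_ub f y m.
Proof.
move=> [eta e0 h]; apply/nbhs_VP; exists (eta / 2); first by rewrite divr_gt0.
move=> y hy; exists (eta / 2); first by rewrite divr_gt0.
apply: negligibleS h => u [h1 h2]; split => //.
by have := vnD (vC u - y) (y - z); rewrite addrA subrK; move=> h3; move: h1 hy h3; lra.
Qed.

(** Room between a closed ball and the boundary of [W]: shrinking the ball of radius [r + d] by the
    factor [r / (r + d)] moves its points by at most [d]. *)
Lemma cball_margin (W : set V) z r : open W -> 0 <= r -> cball z r `<=` W -> exists2 r', r < r' & cball z r' `<=` W.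
Proof.
move=> oW r0 hW.
have [|||M M0 hM] := @compact_exists_bound R _ (cball z r) (fun y m => forall w, vn (w - y) * m < 1 -> W w).
- exact: compact_cball.
- move=> y m m' mm h w hw; apply: h; apply: le_lt_trans hw; apply: ler_wpM2l => //; exact: vn_ge0.
- move=> y /hW Wy; have [e e0 he] := open_ball oW Wy; exists (2 / e).
  apply/nbhs_VP; exists (e / 2); first by rewrite divr_gt0.
  move=> w hw x; rewrite mulrA ltr_pdivrMr // mul1r => hx; apply: he.
  by have := vnD (x - w) (w - y); rewrite addrA subrK => h3; move: hx hw h3; lra.
pose d := (2 * (M + 1))^-1; have M1 : 0 < M + 1 by rewrite ltr_wpDl.
have d0 : 0 < d by rewrite invr_gt0 mulr_gt0.
exists (r + d); first by rewrite ltrDl.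
move=> w hw; pose c := r / (r + d); have rd : 0 < r + d by rewrite ltr_wpDl.
have c0 : 0 <= c by rewrite divr_ge0 // ltW.
have c1 : 1 - c = d / (r + d) by rewrite /c; field; rewrite gt_eqF.
apply: (hM (z + c%:C%C *: (w - z))).
  rewrite /cball /= (addrC z) addrK vnZ nrm_real ger0_norm //.
  by rewrite /c mulrAC ler_pdivrMr //; apply: ler_wpM2l.
have -> : w - (z + c%:C%C *: (w - z)) = (1 - c)%:C%C *: (w - z).
  by rewrite rmorphB rmorph1 scalerBl scale1r opprD addrA.
rewrite vnZ nrm_real c1 ger0_norm; last by rewrite divr_ge0 // ltW.
have h : d / (r + d) * vn (w - z) <= d by rewrite mulrAC ler_pdivrMr //; apply: ler_wpM2l => //; exact: ltW.
apply: (@le_lt_trans _ _ (d * M)); first exact: ler_wpM2r.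
rewrite /d mulrC ltr_pdivrMr ?mulr_gt0 // mul1r; lra.
Qed.

Variables (W : set V) (f : V -> \bar R).
Hypothesis f_int : Defs.locally_integrable W f.
Hypothesis f_psh : ddbar_nonneg W f.

Section Ball.
Variables (z0 : V) (r : R).
Hypothesis BW : cball z0 r `<=` W.
Let B : set T := vC @^-1` cball z0 r.

(** A real function supported in the ball; [fine] replaces infinite values by 0, which by
    [ball_finite] matters on a null set only. *)
Definition cutoff (u : T) : R := ((fun u => fine (f (vC u))) \_ B) u.

Lemma measurable_B (z : V) s : measurable (vC @^-1` cball z s).
Proof.
have -> : vC @^-1` cball z s = ~` (vC @^-1` (~` cball z s)) by rewrite preimage_setC setCK.
by apply: measurableC; apply: mO; apply: closed_openC; exact: closed_cball.
Qed.
Let mB : measurable B. Proof. exact: measurable_B. Qed.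

Lemma integrable_ball : (@mu R n).-integrable B (f \o vC).
Proof. exact: f_int (@compact_cball _ _ z0 r) BW. Qed.

Lemma cutoffE u : cball z0 r (vC u) -> cutoff u = fine (f (vC u)).
Proof. by move=> h; rewrite /cutoff patchE mem_set. Qed.
Lemma cutoff_supp u : ~ cball z0 r (vC u) -> cutoff u = 0.
Proof. by move=> h; rewrite /cutoff patchE memNset. Qed.

Lemma ball_finite : (@mu R n).-negligible [set u | cball z0 r (vC u) /\ f (vC u) \isn't a fin_num].
Proof.
have := integrable_ae mB integrable_ball; apply: negligibleS => u [h1 h2] /= h.
by move: h2; rewrite h.
Qed.

Lemma integrable_cutoff : (@mu R n).-integrable setT (EFin \o cutoff).
Proof.
rewrite (_ : EFin \o cutoff = (fun u => (fine (f (vC u)))%:E) \_ B); last first.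
  by apply/funext => u; rewrite /= /cutoff !patchE; case: ifP.
apply/(integrable_mkcond _ mB).
have mf := measurable_int _ integrable_ball.
apply: (@le_integrable _ _ _ _ _ mB _ (f \o vC)) => //.
- apply/measurable_EFinP; exact: measurableT_comp mf.
- by move=> u _; rewrite /comp; case: (f (vC u)) => [x| |] /=; rewrite ?normr0 ?leey.
- exact: integrable_ball.
Qed.

(** The bump is an admissible test function supported in the ball, and its Levi form is
    [levi_kernel]; the curvature condition becomes the hypothesis on means. *)
Lemma cutoff_psh k xi x s : 0 < s -> vn (x - z0) + s <= r -> 0 <= pair_with cutoff (levi_kernel k xi x s).
Proof.
move=> s0 hs; pose K := cball x s.
have KB : K `<=` cball z0 r.
  move=> y; rewrite /K /cball /= => hy; have := vnD (y - x) (x - z0); rewrite addrA subrK; lra.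
have levk0 y : ~ K y -> levi_kernel k xi x s y = 0.
  move=> hy; have t0 : tau x s y <= 0.
    by rewrite leNgt; apply/negP => t; apply: hy; exact: ltW (tau_supp s0 t).
  by rewrite /levi_kernel /gam2 /gam1 !gam_le0 // !(mulr0, mul0r, subr0).
have mK : measurable (vC @^-1` K) by exact: measurable_B.
have := f_psh xi (chi := gam k \o tau x s) (@compact_cball _ _ x s) (subset_trans KB BW).
have h1 z : ~ cball x s z -> (gam k \o tau x s) z = 0.
  move=> hz; apply: gam_le0; rewrite leNgt; apply/negP => t; apply: hz; exact: ltW (tau_supp s0 t).
move=> /(_ h1 (fun z => gam_ge0 _ _) (test_fun_smooth (test_fun_gam x s k))).
rewrite /integralC => h.
have cl : continuous (levi_kernel k xi x s : V -> R) by exact: test_fun_continuous (test_fun_levi_kernel _ _ _ _).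
have ip := integrable_pair integrable_cutoff cutoff_supp cl.
have mf := measurable_int _ integrable_ball.
have E : (\int[@mu R n]_(u in vC @^-1` K) (f (vC u) * (levi_kernel k xi x s (vC u))%:E) =
    \int[@mu R n]_(u in vC @^-1` K) (cutoff u * levi_kernel k xi x s (vC u))%:E)%E.
  apply: ae_eq_integral => //.
  - apply: emeasurable_funM.
      by apply: measurable_funS mf => // u; exact: KB.
    by apply/measurable_EFinP; apply: measurable_funTS; exact: measurable_contv.
  - by apply: measurable_funTS; exact: measurable_int ip.
  have := integrable_ae mB integrable_ball; apply: filterS => u hu /KB hB.
  by rewrite EFinM cutoffE // fineK //; exact: hu.
rewrite /pair_with /Rintegral; apply: fine_ge0.
rewrite (_ : (\int[@mu R n]_u (cutoff u * levi_kernel k xi x s (vC u))%:E)%E =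
   (\int[@mu R n]_(u in vC @^-1` K) (cutoff u * levi_kernel k xi x s (vC u))%:E)%E).
  rewrite -E; move: h; congr (0 <= _)%E; apply: eq_integral => u _.
  by congr (_ * _%:E)%E; exact: levi_gam.
rewrite [RHS]integral_mkcond; apply: eq_integral => u _; rewrite patchE.
by case: ifPn => // /negP; rewrite inE => hu; rewrite levk0 ?mulr0.
Qed.

Lemma ess_ub_cutoff z m : vn (z - z0) < r -> ess_ub f z m <-> ubF cutoff z m.
Proof.
move=> hz; split => [[eta e0 h]|[eta e0 h]].
  pose e := Num.min eta (r - vn (z - z0)).
  have ep : 0 < e by rewrite lt_min e0 subr_gt0.
  exists e => //; apply: measure_negligible.
    apply: measurableI; first by apply: mO; exact: open_vn_ball.
    have := measurable_int _ integrable_cutoff measurableT `]m%:E, +oo[%classic (emeasurable_itv _).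
    rewrite setTI (_ : _ @^-1` _ = [set u | m < cutoff u]) //.
    by apply/seteqP; split => u /=; rewrite in_itv /= andbT lte_fin.
  apply: negligibleS (negligibleU h ball_finite) => u [/= h1 h2].
  have hB : cball z0 r (vC u).
    move: h1; rewrite lt_min /cball /= => /andP[_ h1]; have := vnD (vC u - z) (z - z0); rewrite addrA subrK; lra.
  have [fin|fin] := boolP (f (vC u) \is a fin_num); last by right.
  left; split; first by move: h1; rewrite lt_min => /andP[].
  by rewrite -(fineK fin) lte_fin -cutoffE.
pose e := Num.min eta (r - vn (z - z0)).
have ep : 0 < e by rewrite lt_min e0 subr_gt0.
exists e => //.
have hn : (@mu R n).-negligible (vC @^-1` [set y | vn (y - z) < eta] `&` [set u | m < cutoff u]).
  apply/negligibleP => //.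
  apply: measurableI; first by apply: mO; exact: open_vn_ball.
  have := measurable_int _ integrable_cutoff measurableT `]m%:E, +oo[%classic (emeasurable_itv _).
  rewrite setTI (_ : _ @^-1` _ = [set u | m < cutoff u]) //.
  by apply/seteqP; split => u /=; rewrite in_itv /= andbT lte_fin.
apply: negligibleS (negligibleU hn ball_finite) => u [/= h1 h2].
have hB : cball z0 r (vC u).
  move: h1; rewrite lt_min /cball /= => /andP[_ h1]; have := vnD (vC u - z) (z - z0); rewrite addrA subrK; lra.
have [fin|fin] := boolP (f (vC u) \is a fin_num); last by right.
left; split; first by move: h1; rewrite lt_min => /andP[].
by rewrite /= cutoffE // -lte_fin fineK.
Qed.

End Ball.

Hypothesis n_gt0 : (0 < n)%N.
Hypothesis oW : open W.

Lemma psh_ess_ub z : W z -> exists m, ess_ub f z m.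
Proof.
move=> Wz; have [e e0 he] := open_ball oW Wz; pose r := e / 2.
have r0 : 0 < r by rewrite divr_gt0.
have BW : cball z r `<=` W.
  by move=> y hy; apply: he; apply: le_lt_trans hy _; rewrite /r ltr_pdivrMr // ltr_pMr // ltr1n.
have [m hm] := ubF_exists n_gt0 r0 (integrable_cutoff BW) (@cutoff_supp z r) (fun k xi x s s0 h => cutoff_psh BW k xi s0 h).
by exists m; apply/(ess_ub_cutoff BW) => //; rewrite subrr vn0.
Qed.

Lemma psh_disc z0 r (p v : V) (sg : R) (g : C -> C) (Bd : R) : 0 <= r -> cball z0 r `<=` W ->
  0 < sg -> 0 < Bd -> (forall t, csquare sg t -> differentiable g t) ->
  (forall t, csquare sg t -> cball z0 r (p + t *: v)) ->
  (forall t, sq_boundary sg t -> exists2 m, ess_ub f (p + t *: v) m & nrm (g t) ^+ 2 * expR m < Bd) ->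
  g 0 != 0 -> ess_ub f p (ln (Bd / nrm (g 0) ^+ 2)).
Proof.
move=> r0 rW sg0 Bd0 dg hin hbd g0; have [r' rr' BW] := cball_margin oW r0 rW.
have r'0 : 0 < r' by exact: le_lt_trans rr'.
have hp : vn (p - z0) < r'.
  have := hin 0; rewrite scale0r addr0 => h; apply: le_lt_trans rr'; apply: h.
  by rewrite /csquare /= normr0; split; exact: ltW.
apply/(ess_ub_cutoff BW) => //.
have HP k xi x s (s0 : 0 < s) (h : vn (x - z0) + s <= r') := cutoff_psh BW k xi s0 h.
have H := @ubF_disc R n z0 r' (cutoff z0 r') r'0 (integrable_cutoff BW) (@cutoff_supp z0 r') HP p v sg g Bd r sg0 Bd0 rr' dg hin.
apply: H => // t ht.
have [m hm hb] := hbd t ht; exists m => //; apply/(ess_ub_cutoff BW) => //.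
by apply: le_lt_trans rr'; apply: hin; exact: sq_boundary_csquare.
Qed.

(** The filter form of compactness along the filter of almost all points. *)
Lemma ess_ub_compact (K : set V) (g : V -> \bar R) m : compact K -> (forall y, K y -> ess_ub g y m) ->
  (@mu R n).-negligible (vC @^-1` [set y | K y /\ (m%:E < g y)%E]).
Proof.
move=> cK hK.
have := (compact_near_coveringP K).1 cK _ (almost_everywhere (@mu R n)) (fun u y => vC u = y -> ~ (m%:E < g y)%E).
move=> /(_ _ _) h; have {h} : \forall u \near almost_everywhere (@mu R n), K `<=` (fun y => vC u = y -> ~ (m%:E < g y)%E).
  apply: h => y Ky; have [eta e0 hn] := hK y Ky.
  exists ([set w | vn (w - y) < eta], [set u | ~ (vn (vC u - y) < eta /\ (m%:E < g (vC u))%E)]) => /=.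
    split; first by apply/nbhs_VP; exists eta.
    by apply: negligibleS hn => u /= /contrapT.
  by move=> [w u] [/= h1 h2] uw h3; apply: h2; rewrite uw.
by apply: negligibleS => u /= [h1 h2] h3; exact: (h3 (vC u) h1 erefl h2).
Qed.

(** Otherwise [f] would lie below every [- j] almost everywhere on the ball and yet be finite almost
    everywhere, making a box of positive measure null. *)
Lemma ess_ub_unbounded z r : 0 < r -> cball z r `<=` W -> (forall y m, cball z r y -> ess_ub f y m) -> False.
Proof.
move=> r0 BW h.
have h1 := @ball_finite z r BW.
have h2 : (@mu R n).-negligible (\bigcup_j (vC @^-1` [set y | cball z r y /\ ((- (j%:R))%:E < f y)%E])).
  by apply: negligible_bigcup => j; apply: ess_ub_compact; [exact: compact_cball|move=> y; exact: h].
have : (@mu R n).-negligible (vC @^-1` cbox z (r / 2)).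
  apply: negligibleS (negligibleU h1 h2) => u /= hu.
  have r2 : 0 < r / 2 by rewrite divr_gt0.
  have hB : cball z r (vC u) by have := cbox_vn r2 hu; rewrite mulrC divfK // => /ltW.
  have [fin|fin] := boolP (f (vC u) \is a fin_num); last by left.
  right; exists (Num.truncn (- fine (f (vC u)))).+1 => //; split => //.
  by rewrite -(fineK fin) lte_fin ltrNl truncnS_gt.
move/negligibleP => /(_ (measurable_cboxv _ _)) N0.
have r2 : 0 < r / 2 by rewrite divr_gt0.
have := etrans (esym (mu_cbox z r2)) N0.
by move=> /eqP; rewrite eqe mulrC divfK // expf_eq0 gt_eqF // andbF.
Qed.

End Plurisubharmonic.

(** * Invertible subsheaves of the dual *)

Section Transfer.
Variables (R : realType) (X : complex_manifold R).
Local Notation n := (mfd_dim X).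
Local Notation V := 'rV[R[i]]_n.
Local Notation C := R[i].
Implicit Types (c : chart R X n) (O : set X).

(** The exceptional null set is carried to the other chart by [null_transport]. The strict
    inequality for [m'] leaves room for the variation of [theta] near [y]. *)
Lemma ess_ub_transfer c c' (y : X) (phi phi' : X -> \bar R) (theta : X -> R) O m m' :
  atlas c -> atlas c' -> chart_dom c y -> chart_dom c' y -> open O -> O y ->
  Defs.locally_integrable (chart_fun c @` (O `&` chart_dom c)) (phi \o chart_inv c) ->
  (forall x, O x -> phi' x = (phi x - (theta x)%:E)%E) -> {for y, continuous theta} ->
  ess_ub (phi \o chart_inv c) (chart_fun c y) m -> m - theta y < m' ->
  ess_ub (phi' \o chart_inv c') (chart_fun c' y) m'.
Proof.
move=> ac ac' cy c'y oO Oy hint hphi ctheta [eta e0 hn] mm.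
have [e1 e10 hB] := chart_ball oO Oy cy.
pose e2 := Num.min e1 (eta / 2).
have e20 : 0 < e2 by rewrite lt_min e10 divr_gt0.
have BW : cball (chart_fun c y) e2 `<=` chart_fun c @` (O `&` chart_dom c).
  by apply: subset_trans hB; apply: cball_sub; rewrite ge_min lexx.
pose M : set V := [set w | cball (chart_fun c y) e2 w /\ (m%:E < (phi \o chart_inv c) w)%E].
have mM : measurable (@vecC R n @^-1` M).
  have mf := measurable_int _ (integrable_ball hint BW).
  have := mf (measurable_B _ _) `]m%:E, +oo[%classic (emeasurable_itv _).
  rewrite (_ : _ `&` _ = @vecC R n @^-1` M) //.
  by apply/seteqP; split => u [h1 h2]; split => //; move: h2; rewrite /= in_itv /= andbT.
have M0 : mu (@vecC R n @^-1` M) = 0%E.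
  apply: measure_negligible => //; apply: negligibleS hn => u [h1 h2]; split => //.
  apply: le_lt_trans h1 _; rewrite gt_min; apply/orP; right.
  by rewrite ltr_pdivrMr // ltr_pMr // ltr1n.
(* All conditions wanted near [y]; its interior gives the open sets between which the chart changes
   act. *)
pose P x := [/\ O x, chart_dom c x /\ vn (chart_fun c x - chart_fun c y) < e2,
   chart_dom c' x & m - m' < theta x].
have nP : nbhs y P.
  have n1 : nbhs y O by exact: open_nbhs_nbhs.
  have n2 := chart_nbhs cy ((nbhs_VP _ _).2 (ex_intro2 _ _ e2 e20 (fun z hz => hz))).
  have n3 : nbhs y (chart_dom c') by apply: open_nbhs_nbhs; split => //; exact: chart_dom_open.
  have d0 : 0 < theta y - (m - m') by lra.
  have /cvg_RP /(_ _ d0) n4 := ctheta.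
  apply: filterS (filterI n1 (filterI n2 (filterI n3 n4))) => x [h1 [h2 [h3 h4]]]; split => //.
  by move: h4; rewrite ltr_norml => /andP[h4 _]; lra.
pose O1 := interior P; have oO1 : open O1 by exact: open_interior.
have PO1 x : O1 x -> P x by exact: interior_subset.
pose G0 : set V := chart_fun c' @` (O1 `&` chart_dom c'); pose G1 : set V := chart_fun c @` (O1 `&` chart_dom c).
have oG0 : open G0 by exact: chart_img_open_sub.
have oG1 : open G1 by exact: chart_img_open_sub.
have hG1 : G1 `<=` cbox (chart_fun c y) e2 by move=> _ [x [/PO1 [_ [_ h] _ _] _] <-]; exact: vn_cbox.
pose F := chart_fun c \o chart_inv c'; pose S := chart_fun c' \o chart_inv c.
have FG z : G0 z -> G1 (F z).
  move=> [x [hx d'x] <-]; have [_ [dx _] _ _] := PO1 _ hx; exists x => //.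
  by rewrite /F /= chart_funK.
have SF z : G0 z -> S (F z) = z.
  move=> [x [hx d'x] <-]; have [_ [dx _] _ _] := PO1 _ hx.
  by rewrite /S /F /= (chart_funK d'x) (chart_funK dx).
have cF z : G0 z -> {for z, continuous F}.
  move=> [x [hx d'x] <-]; have [_ [dx _] _ _] := PO1 _ hx.
  by apply: differentiable_continuous; exact: atlas_holo.
have dS z : G1 z -> differentiable S z.
  by move=> [x [hx dx] <-]; have [_ _ d'x _] := PO1 _ hx; exact: atlas_holo.
have hnull := null_transport oG0 oG1 e20 hG1 FG SF cF dS mM M0.
have [e ep he] := open_ball oG0 (z := chart_fun c' y) (ex_intro2 _ _ y (conj nP c'y) erefl).
exists e => //; apply: negligibleS hnull => u [h1 h2].
have hu := he _ h1; split => //; move: h2; rewrite /preimage /M /=.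
case: hu => x [hx d'x] <-; have [Ox [dx hx2] _ ht] := PO1 _ hx.
rewrite (chart_funK d'x) /F /= (chart_funK d'x) (chart_funK dx) hphi // => h2.
split; first exact: ltW.
by move: h2; case: (phi x) => [r| |] //; rewrite -?EFinB ?ltry ?lte_fin //= => h; lra.
Qed.

Variables (E : hol_bundle X) (F : invertible_subsheaf E).

(** If [s' = f s] and [s = g s'], then [g f - 1] annihilates the generator [s], hence vanishes, and
    [f] has no zeros. *)
Lemma generator_ratio U U' s s' : is_generator F U s -> is_generator F U' s' ->
  exists f : X -> C, [/\ holo_on (U `&` U') f, eq_section (U `&` U') s' (scale_section f s) &
    forall x, U x -> U' x -> f x != 0].
Proof.
move=> [oU Us gU] [oU' Us' gU'].
have oO : open (U `&` U') by exact: openI.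
have [/(_ s') h1 h2] := gU _ oO (@subIsetl _ U U'); have [/(_ s) h1' _] := gU' _ oO (@subIsetr _ U U').
have [|f hf ef] := h1; first exact: sh_restrict oU' oO (@subIsetr _ U U') Us'.
have [|g hg eg] := h1'; first exact: sh_restrict oU oO (@subIsetl _ U U') Us.
exists f; split => // x Ux U'x; apply/eqP => f0.
have hfg : holo_on (U `&` U') (fun x => g x * f x + (-1)).
  move=> c z ac Oz cz; exact: (differentiableD (holo_onM hg hf ac Oz cz) (holo_on_cst (-1) ac Oz cz)).
have := h2 _ hfg _ x (conj Ux U'x); rewrite f0 mulr0 add0r => h.
have : (-1 : C) = 0.
  apply: h => i z Oz iz; rewrite /scale_section /zero_section scalerDl scaleN1r -scalerA.
  by have := ef i z Oz iz; rewrite /scale_section => <-; have := eg i z Oz iz; rewrite /scale_section => <-; rewrite subrr.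
by move/eqP; rewrite oppr_eq0 oner_eq0.
Qed.

(** If [s] vanished near [x], the function 1 would annihilate it. *)
Lemma generator_nonzero U s x : is_generator F U s -> forall O, open O -> O x -> U x ->
  exists y i a, [/\ O y, U y, triv_dom i y & s i y a 0 != 0].
Proof.
move=> [oU Us gU] O oO Ox Ux; apply: contrapT => hn.
have [_ h] := gU _ (openI oO oU) (@subIsetr _ O U).
have := h (fun=> 1) (holo_on_cst 1) _ x (conj Ox Ux) => h1; have : (1 : C) = 0.
  apply: h1 => i y [Oy Uy] iy; rewrite /scale_section scale1r; apply/matrixP => a b.
  rewrite (ord1 b) [RHS]mxE; apply/eqP/negP => ya; apply: hn; exists y, i, a; split => //; exact/negP.
by move/eqP; rewrite oner_eq0.
Qed.

Lemma weight_transfer phi U U' s s' c c' y : singular_metric F phi ->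
  is_generator F U s -> is_generator F U' s' -> atlas c -> atlas c' ->
  U y -> U' y -> chart_dom c y -> chart_dom c' y ->
  exists2 f : C, f != 0 & (forall i, triv_dom i y -> s' i y = f *: s i y) /\
    forall m m', ess_ub (phi U s \o chart_inv c) (chart_fun c y) m -> m - ln (nrm f ^+ 2) < m' ->
      ess_ub (phi U' s' \o chart_inv c') (chart_fun c' y) m'.
Proof.
move=> [hphi hint] gU gU' ac ac' Uy U'y cy c'y.
have [f [hf ef f0]] := generator_ratio gU gU'.
have oU : open U by case: gU. have oU' : open U' by case: gU'.
have oO : open (U `&` U') by exact: openI.
exists (f y); first exact: f0.
split; first by move=> i iy; exact: ef.
move=> m m' hm hmm; apply: (ess_ub_transfer (phi := phi U s) (theta := fun x => ln (nrm (f x) ^+ 2)) ac ac' cy c'y oO (conj Uy U'y) _ _ _ hm hmm).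
- move=> K cK hK; apply: (hint U s c gU ac) => //; apply: subset_trans hK _.
  by move=> _ [x [[Ux _] cx] <-]; exists x.
- by move=> x Ox; rewrite (hphi U U' (U `&` U') s s' f gU gU' oO (fun _ => id) hf ef x Ox).
- have cf : {for y, continuous f} by exact: holo_continuous (conj Uy U'y) hf.
  apply: (continuous_comp (f := fun x => nrm (f x) ^+ 2) (g := @ln R)); first exact: continuous_nrm2.
  by apply: continuous_ln; rewrite exprn_gt0 // nrm_gt0 f0.
Qed.

End Transfer.

Lemma expR_ln_div (R : realType) (a b : R) : 0 < a -> 0 < b -> expR (ln (a / b)) = a / b.
Proof. by move=> a0 b0; rewrite lnK // posrE divr_gt0. Qed.

(** * Iterated improvement of weight bounds *)

Section NotPseff.
Variables (R : realType) (X : complex_manifold R) (E : hol_bundle X) (h : hermitian_metric E).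
Local Notation n := (mfd_dim X).
Local Notation r := (rank E).
Local Notation V := 'rV[R[i]]_n.
Local Notation C := R[i].

Definition pairing (s : presection (dual E)) i (y : X) (u : 'I_r -> C) : C := \sum_a s i y a 0 * u a.

Lemma pairing_trans s U (i j : bidx E) y u : is_section U s -> U y -> triv_dom i y -> triv_dom j y ->
  pairing s i y u = pairing s j y (fun a => \sum_b trans (h := E) j i y a b * u b).
Proof.
move=> [_ hs] Uy iy jy; rewrite /pairing; have := hs i j y Uy iy jy => ->.
transitivity (\sum_a \sum_b trans (h := E) j i y b a * s j y b 0 * u a).
  by apply: eq_bigr => a _; rewrite mxE mulr_suml; apply: eq_bigr => b _; rewrite /= mxE.
rewrite exchange_big; apply: eq_bigr => b _; rewrite mulr_sumr; apply: eq_bigr => a _.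
by rewrite [RHS]mulrCA mulrA.
Qed.

Lemma pairingZ s i y c u : pairing s i y (fun a => c * u a) = c * pairing s i y u.
Proof. by rewrite /pairing mulr_sumr; apply: eq_bigr => a _; rewrite mulrCA. Qed.

Lemma pairing_scale s s' f i y u : s' i y = f *: s i y -> pairing s' i y u = f * pairing s i y u.
Proof. by move=> e; rewrite /pairing mulr_sumr; apply: eq_bigr => a _; rewrite e mxE mulrA. Qed.

Lemma continuous_pairing s U i y (u : 'rV[C]_r) : is_section U s -> U y -> triv_dom i y ->
  {for (y, u), continuous (fun q : X * 'rV[C]_r => pairing s i q.1 (q.2 0))}.
Proof.
move=> [hs _] Uy iy.
apply: (@continuous_sum _ _ _ _ (fun a (q : X * 'rV[C]_r) => s i q.1 a 0 * q.2 0 a)) => a.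
apply: (@continuousM _ _ (fun q : X * 'rV[C]_r => s i q.1 a 0) (fun q : X * 'rV[C]_r => q.2 0 a)).
  apply: (continuous_comp (f := fst) (g := fun y => s i y a 0)); first exact: cvg_fst.
  exact: holo_continuous (conj Uy iy) (hs i a).
by apply: (continuous_comp (g := fun v : 'rV_r => v 0 a)); [exact: cvg_snd|exact: coord_continuous].
Qed.

Variable F : invertible_subsheaf (dual E).
Variable phi : set X -> presection (dual E) -> X -> \bar R.
Hypothesis hphi : singular_metric F phi.
Hypothesis hpsh : forall U s c, is_generator F U s -> atlas c ->
  ddbar_nonneg (chart_fun c @` (U `&` chart_dom c)) (phi U s \o chart_inv c).
Hypothesis n_gt0 : (0 < n)%N.

Section OnePatch.
Variables (U : set X) (s : presection (dual E)) (x : X) (p : patch h U x).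
Hypothesis gs : is_generator F U s.
Let c := pc p.
Let i := pi p.
Let K := patch_set p.

Definition weight_ub (y : X) (m : R) := ess_ub (phi U s \o chart_inv c) (chart_fun c y) m.

Let oU : open U. Proof. by case: gs. Qed.
Let ss : is_section U s. Proof. by case: gs => _ Us _; exact: sh_section oU Us. Qed.
Let W : set V := chart_fun c @` (U `&` chart_dom c).
Let oW : open W. Proof. exact: chart_img_open_sub. Qed.
Let fint : Defs.locally_integrable W (phi U s \o chart_inv c).
Proof. by case: hphi => _ H; exact: H gs (p_atlas p). Qed.
Let fpsh : ddbar_nonneg W (phi U s \o chart_inv c).
Proof. exact: hpsh gs (p_atlas p). Qed.
Let BW : cball (chart_fun c x) (pR p) `<=` W.
Proof. by move=> z /p_sub [y [[Uy _] cy] <-]; exists y. Qed.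

Lemma weight_ub_ex y : U y -> chart_dom c y -> exists m, weight_ub y m.
Proof. by move=> Uy cy; apply: (psh_ess_ub fint fpsh n_gt0 oW); exists y. Qed.

(* |s_y(u)|^2 exp(phi) <= M h_y(u), with phi replaced by its essential upper limit at y *)
Definition weight_bd (M : R) := forall y, K y -> forall u m,
  M * hform h i y u < nrm (pairing s i y u) ^+ 2 * expR m -> weight_ub y m.

Lemma weight_ub_bound : exists m0, forall y, K y -> weight_ub y m0.
Proof.
have [||m0 _ hm] := @compact_exists_bound R _ K (fun y m => weight_ub y m) (@patch_set_compact _ _ _ _ _ _ p).
- by move=> y m m'; exact: ess_ub_mono.
- move=> y /patch_set_dom [Uy [_ cy]]; have [m hm] := weight_ub_ex Uy cy; exists m.
  by have := chart_nbhs cy (ess_ub_near hm); apply: filterS => z [].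
- by exists m0.
Qed.

(** Compactness on the unit sphere bundle over the patch set, extended by homogeneity of degree
    2. *)
Lemma pairing_bound : exists2 S, 0 <= S & forall y, K y -> forall u, nrm (pairing s i y u) ^+ 2 <= S * hform h i y u.
Proof.
pose Q (q : X * 'rV[C]_r) (m : R) := 0 <= hform h i q.1 (q.2 0) /\ nrm (pairing s i q.1 (q.2 0)) ^+ 2 <= m * hform h i q.1 (q.2 0).
have [||M M0 hM] := compact_exists_bound (P := Q) (compact_setX (@patch_set_compact _ _ _ _ _ _ p) (@compact_sphere R r)).
- move=> q m m' mm [h0 hp]; split => //; apply: (le_trans hp); exact: ler_wpM2r.
- move=> [y u] [/= /patch_set_dom [Uy [iy cy]] hu].
  have nu : exists a, u 0 a != 0.
    apply: contrapT => nu; have : u = 0.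
      by apply/rowP => a; rewrite mxE; apply/eqP/negP => ua; apply: nu; exists a; exact/negP.
    by move=> u0; move: hu; rewrite u0 vn0 => /eqP; rewrite eq_sym oner_eq0.
  have h0 := hform_gt0 h iy nu.
  have N1 : nbhs ((y, u) : X * 'rV[C]_r) (fun q : X * 'rV[C]_r => hform h i y (u 0) / 2 < hform h i q.1 (q.2 0)).
    have := continuous_Re (continuous_hform (h := h) (u := u) iy) (divr_gt0 h0 (ltr0Sn _ 1)); apply: filterS => q; rewrite /hform.
    by rewrite ltr_norml => /andP[+ _]; move: (complex.Re _) (complex.Re _) => a' b'; lra.
  pose a1 := nrm (pairing s i y (u 0)) + 1.
  have N2 : nbhs ((y, u) : X * 'rV[C]_r) (fun q : X * 'rV[C]_r => nrm (pairing s i q.1 (q.2 0)) < a1).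
    have /cvg_CP /(_ _ ltr01) := continuous_pairing (u := u) ss Uy iy; apply: filterS => q hq.
    rewrite -(subrK (pairing s i y (u 0)) (pairing s i q.1 (q.2 0))).
    by apply: le_lt_trans (nrmD _ _) _; rewrite addrC; exact: ler_ltD.
  have h2 : 0 < hform h i y (u 0) / 2 by rewrite divr_gt0.
  exists (a1 ^+ 2 / (hform h i y (u 0) / 2)).
  apply: filterS (filterI N1 N2) => q [q1 q2].
  have hp0 : 0 <= hform h i q.1 (q.2 0) by apply: ltW; apply: lt_trans q1.
  split => //.
  apply: (@le_trans _ _ (a1 ^+ 2)).
    by apply: lerXn2r; rewrite ?nnegrE ?nrm_ge0 //; [apply: le_trans (ltW q2); exact: nrm_ge0|exact: ltW].
  rewrite mulrAC ler_pdivlMr //; apply: ler_wpM2l; first exact: sqr_ge0.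
  exact: ltW.
exists M => // y Ky u.
have [u0|u0] := eqVneq (\row_a u a : 'rV[C]_r) 0.
  have -> : u = fun=> 0 by apply/funext => a; have := congr1 (fun v : 'rV[C]_r => v 0 a) u0; rewrite !mxE.
  by rewrite /pairing big1 ?nrm0 ?expr0n ?hform0 ?mulr0 // => a _; rewrite mulr0.
pose v := vn (\row_a u a : 'rV[C]_r); have v0 : 0 < v by rewrite vn_gt0.
pose u' := (v^-1)%:C%C *: (\row_a u a : 'rV[C]_r).
have v1 : vn u' = 1 by rewrite vnZ nrm_real ger0_norm ?invr_ge0 1?ltW // mulVf // gt_eqF.
have uE : u = fun a => v%:C%C * u' 0 a.
  by apply/funext => a; rewrite !mxE mulrA -rmorphM divff ?gt_eqF // rmorph1 mul1r.
have [_] := hM (y, u') (conj Ky v1).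
rewrite /= uE /hform sesqZl sesqZr mulrA mulcJ Re_realM pairingZ nrmM nrm_real (ger0_norm (ltW v0)).
move: (pairing _ _ _ _) (sesq _ _ _) => a1 a2 hh.
by rewrite exprMn [leRHS]mulrCA ler_wpM2l // sqr_ge0.
Qed.

Lemma weight_bd_ex : exists2 M, 0 <= M & weight_bd M.
Proof.
have [m0 hm0] := weight_ub_bound; have [S S0 hS] := pairing_bound.
exists (S * expR m0); first by rewrite mulr_ge0 // expR_ge0.
move=> y Ky u m hm; apply: ess_ub_mono (hm0 y Ky); rewrite leNgt; apply/negP => lt.
have [_ [iy _]] := patch_set_dom Ky.
have h0 := hform_ge0 h u iy.
have e : expR m <= expR m0 by rewrite ler_expR ltW.
move: hm; apply/negP; rewrite -leNgt.
apply: (@le_trans _ _ (S * hform h i y u * expR m)).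
  by apply: ler_wpM2r; [exact: expR_ge0|exact: hS].
by rewrite [leRHS]mulrAC; apply: ler_wpM2l => //; exact: mulr_ge0.
Qed.

(** The disc of the patch carries the holomorphic function [G], the pairing with the quadratic lift.
    Its boundary obeys the bound [M] with length reduced by [pq p], and [psh_disc] brings this to
    the centre. *)
Lemma weight_bd_disc M y u m : 0 <= M -> weight_bd M -> chart_dom c y -> vn (chart_fun c y - chart_fun c x) < pe p ->
  pq p * M * hform h i y u < nrm (pairing s i y u) ^+ 2 * expR m -> weight_ub y m.
Proof.
move=> M0 hM cy ey hlt.
have Ky : K y by exact: patch_set_mem.
have [Uy [iy _]] := patch_set_dom Ky.
have q0 : 0 < pq p by case/andP: (p_q p).
have g00 : 0 < nrm (pairing s i y u) ^+ 2.
  have : 0 <= pq p * M * hform h i y u by rewrite !mulr_ge0 ?hform_ge0 // ltW.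
  by move/le_lt_trans => /(_ _ hlt); rewrite pmulr_lgt0 // expR_gt0.
have hu : exists a, u a != 0.
  apply: contrapT => nu; have u0 : u = fun=> 0.
    by apply/funext => a; apply/eqP/negP => ua; apply: nu; exists a; exact/negP.
  by move: g00; rewrite u0 /pairing big1 ?nrm0 ?expr0n ?ltxx // => a _; rewrite mulr0.
have [v [bb [d [sg sg0 [hd1 hd2]]]]] := p_disc ey hu.
pose z := chart_fun c y.
pose vphi t a := u a + t * bb a + t ^+ 2 * d a.
pose G t := pairing s i (chart_inv c (z + t *: v)) (vphi t).
have G0 : G 0 = pairing s i y u.
  rewrite /G scale0r addr0 chart_funK //; congr (pairing _ _ _ _).
  by apply/funext => a; rewrite /vphi expr2 !mul0r !addr0.
pose Bd := nrm (pairing s i y u) ^+ 2 * expR m.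
have Bd0 : 0 < Bd by rewrite mulr_gt0 // expR_gt0.
have R0 : 0 <= pR p by apply: le_trans (p_eR p); exact: ltW (p_e p).
(* The constant [Bd] is chosen so that the conclusion of [psh_disc] is exactly the required
   bound. *)
have -> : m = ln (Bd / nrm (G 0) ^+ 2).
  by rewrite G0 /Bd mulrAC divff ?gt_eqF // mul1r expRK.
apply: (psh_disc fint fpsh oW R0 BW sg0 Bd0 (g := G) (v := v)).
- move=> t ht; have hy := hd1 t ht.
  rewrite /G /pairing.
  apply: (@differentiable_sumC R C _ _ (fun a (t : C) => s i (chart_inv c (z + t *: v)) a 0 * vphi t a)) => a.
  apply: (@differentiableM _ _ (fun t : C => s i (chart_inv c (z + t *: v)) a 0) (fun t : C => vphi t a)); last exact: phi_diff.
  apply: (@disc_diff _ _ (U `&` triv_dom i) (fun y => s i y a 0) c z v t (p_atlas p)); first by case: ss => H _; exact: H.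
  by have := p_sub hy.
- exact: hd1.
- move=> t ht; have hq := hd2 t ht.
  have Kt : K (chart_inv c (z + t *: v)) by exists (z + t *: v) => //; apply: hd1; exact: sq_boundary_csquare.
  have [Ut [it ct]] := patch_set_dom Kt.
  have zt : chart_fun c (chart_inv c (z + t *: v)) = z + t *: v.
    by have [_ _] := img_inv (p_sub (hd1 t (sq_boundary_csquare ht))).
  (* At a zero of [G] any local upper bound of the weight will do. *)
  have [Gt0|Gt0] := eqVneq (G t) 0.
    have [m1 hm1] := weight_ub_ex Ut ct; exists m1; last by rewrite Gt0 nrm0 expr0n mul0r.
    by move: hm1; rewrite /weight_ub zt.
  have Gp : 0 < nrm (G t) ^+ 2 by rewrite exprn_gt0 // nrm_gt0.
  (* Both [weight_bd] and [psh_disc] ask for strict inequalities, so a value strictly between the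
     two sides is needed. *)
  pose mid := (M * hform h i (chart_inv c (z + t *: v)) (vphi t) + Bd) / 2.
  have hMB : M * hform h i (chart_inv c (z + t *: v)) (vphi t) < Bd.
    apply: le_lt_trans hlt; rewrite (mulrC (pq p)) -mulrA; apply: ler_wpM2l => //.
    move: hq; rewrite /= /hmat_chart -/i -/c -/z -/(hform h i (chart_inv c z) u) /z chart_funK //.
  have h0 : 0 <= M * hform h i (chart_inv c (z + t *: v)) (vphi t) by rewrite mulr_ge0 // hform_ge0.
  have mid1 : M * hform h i (chart_inv c (z + t *: v)) (vphi t) < mid by rewrite /mid; move: hMB; lra.
  have mid2 : mid < Bd by rewrite /mid; move: hMB; lra.
  have mid0 : 0 < mid by exact: le_lt_trans mid1.
  have em : nrm (G t) ^+ 2 * expR (ln (mid / nrm (G t) ^+ 2)) = mid.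
    by rewrite expR_ln_div // mulrCA divff ?mulr1 // gt_eqF.
  exists (ln (mid / nrm (G t) ^+ 2)); last by rewrite em.
  have := hM _ Kt (vphi t) (ln (mid / nrm (G t) ^+ 2)); rewrite -/(G t) em /weight_ub zt; exact.
by rewrite G0 -nrm_gt0; move: g00; rewrite exprn_even_gt0 //= lt_def nrm_ge0 => ->.
Qed.

(** Near a point where [s] does not vanish, a fixed vector has a pairing bounded away from 0; as the
    constants tend to 0, every real number becomes an essential upper bound of the weight. *)
Lemma weight_bd_contra M q : RC_positive_metric h -> 0 <= M -> 0 < q < 1 -> (forall k, weight_bd (M * q ^+ k)) -> U x -> False.
Proof.
move=> hRC M0 q01 hM Ux.
have nx := chart_nbhs (p_dom p) ((nbhs_VP _ _).2 (ex_intro2 _ _ (pe p) (p_e p) (fun z hz => hz))).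
have [y [i' [a0 [ny Uy i'y sy0]]]] := generator_nonzero gs (@open_interior _ _) nx Ux.
have [cy ey] := interior_subset ny.
have Ky : K y by exact: patch_set_mem.
have [_ [iy _]] := patch_set_dom Ky.
have [a sa] : exists a, s i y a 0 != 0.
  apply: contrapT => na; case: ss => _ /(_ i' i y Uy i'y iy) e.
  move: sy0; rewrite e (_ : s i y = 0) ?mulmx0 ?mxE ?eqxx //.
  apply/matrixP => b b'; rewrite (ord1 b') [RHS]mxE; apply/eqP/negP => nb; apply: na; exists b; exact/negP.
pose u : 'rV[C]_r := delta_mx 0 a.
have hu : exists b, u 0 b != 0 by exists a; rewrite mxE !eqxx oner_eq0.
have pu : pairing s i y (u 0) != 0.
  rewrite /pairing (bigD1 a) //= big1 ?addr0 ?mxE ?eqxx ?mulr1 // => b ba.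
  by rewrite mxE eqxx (negbTE ba) mulr0.
have slice (A : set (X * 'rV[C]_r)) : nbhs ((y, u) : X * 'rV[C]_r) A -> nbhs y [set y' | A (y', u)].
  move=> [[A1 A2] [/= h1 h2] h12]; apply: filterS h1 => y' hy'; apply: h12; split => //=.
  exact: nbhs_singleton h2.
pose d := nrm (pairing s i y (u 0)) ^+ 2; have d0 : 0 < d by rewrite exprn_gt0 // nrm_gt0.
have d2 : 0 < d / 2 by rewrite divr_gt0.
have N1 := slice _ ((cvg_RP _ _).1 (continuous_nrm2 (continuous_pairing (u := u) ss Uy iy)) _ d2).
pose H := hform h i y (u 0) + 1.
have N2 := slice _ (continuous_Re (continuous_hform (h := h) (u := u) iy) ltr01).
have N3 : nbhs y U by exact: open_nbhs_nbhs.
have [e e0 he] := chart_ball (@open_interior _ _) (filterI (filterI N1 N2) (filterI N3 ny)) cy.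
have BW' : cball (chart_fun c y) e `<=` W.
  by move=> w /he [y' [/interior_subset [_ [Uy' _]] cy'] <-]; exists y'.
apply: (ess_ub_unbounded fint e0 BW') => w m /he [y' [/interior_subset [[n1 n2] [Uy' [_ ey']]] cy'] <-].
have Ky' : K y' by exact: patch_set_mem.
have h0 : 0 <= hform h i y' (u 0) by apply: hform_ge0; have [_ []] := patch_set_dom Ky'.
have h1 : hform h i y' (u 0) <= H.
  by move: n2; rewrite /H /hform /= ltr_norml => /andP[_]; move: (complex.Re _) (complex.Re _) => r1 r2; lra.
have h2 : d / 2 <= nrm (pairing s i y' (u 0)) ^+ 2.
  move: n1; rewrite /= ltr_norml => /andP[+ _]; rewrite -/i -/d.
  by move: (nrm _ ^+ 2) => r1; clearbody d; lra.
have em := expR_gt0 m.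
have [k [_ hk]] := pow_small (M * H / (d / 2 * expR m)) q01.
apply: (hM k y' Ky' (u 0)).
have de : 0 < d / 2 * expR m by rewrite mulr_gt0.
apply: (@le_lt_trans _ _ (M * H * q ^+ k)).
  rewrite mulrAC; apply: ler_wpM2r; first by rewrite exprn_ge0 // ltW //; case/andP: q01.
  exact: ler_wpM2l.
apply: (@lt_le_trans _ _ (d / 2 * expR m)); last by apply: ler_wpM2r => //; exact: ltW.
move: hk; rewrite mulrAC ler_pdivrMr // => hk; apply: le_lt_trans hk _.
by rewrite gtr_pMl // ltr_pdivrMr // mul1r ltr1n.
Qed.

End OnePatch.

(** A new generator multiplies the pairing by [f] and lowers the weight by [ln (nrm f ^+ 2)], so the
    product is unchanged. The improvement found in the patch [p'] therefore holds in [p] without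
    loss. *)
Lemma weight_bd_step (U U' : set X) s s' x x' (p : patch h U x) (p' : patch h U' x') M q y u m :
  is_generator F U s -> is_generator F U' s' -> 0 <= M -> pq p' <= q -> weight_bd s' p' M ->
  patch_set p y -> chart_dom (pc p') y -> vn (chart_fun (pc p') y - chart_fun (pc p') x') < pe p' ->
  M * q * hform h (pi p) y u < nrm (pairing s (pi p) y u) ^+ 2 * expR m -> weight_ub s p y m.
Proof.
move=> gs gs' M0 hq hM Ky c'y e'y hlt.
have K'y : patch_set p' y by exact: patch_set_mem.
have [Uy [iy cy]] := patch_set_dom Ky; have [U'y [i'y _]] := patch_set_dom K'y.
have [f f0 [hf ht]] := weight_transfer hphi gs' gs (p_atlas p') (p_atlas p) U'y Uy c'y cy.
have ss' : is_section U' s' by case: gs' => oU Us _; exact: sh_section oU Us.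
pose u' a := \sum_b trans (h := E) (pi p') (pi p) y a b * u b.
pose P := pairing s' (pi p') y u'.
have eP : pairing s (pi p) y u = f * P.
  by rewrite (pairing_scale u (hf _ iy)) (pairing_trans u ss' U'y iy i'y).
have eh : hform h (pi p) y u = hform h (pi p') y u' := hform_trans h u i'y iy.
have q0 : 0 <= q by apply: le_trans hq; apply: ltW; case/andP: (p_q p').
have h0 : 0 <= M * q * hform h (pi p') y u' by rewrite !mulr_ge0 ?hform_ge0.
move: hlt; rewrite eP eh nrmM exprMn => hlt.
have fp : 0 < nrm f ^+ 2 by rewrite exprn_gt0 // nrm_gt0.
have Pp : 0 < nrm P ^+ 2.
  by have := le_lt_trans h0 hlt; rewrite pmulr_lgt0 ?expR_gt0 // pmulr_rgt0.
pose A := M * q * hform h (pi p') y u'; pose N := nrm f ^+ 2 * nrm P ^+ 2.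
have Np : 0 < N by rewrite mulr_gt0.
(* Room is needed once more, as [weight_transfer] passes only to strictly larger bounds. *)
pose mid := (A + N * expR m) / 2.
have mid1 : A < mid by rewrite /mid; move: hlt; rewrite -/A -/N; lra.
have mid2 : mid < N * expR m by rewrite /mid; move: hlt; rewrite -/A -/N; lra.
have mid0 : 0 < mid by exact: le_lt_trans mid1.
pose m1 := ln (mid / N); have em1 : expR m1 = mid / N by exact: expR_ln_div.
have m1m : m1 < m by rewrite -ltr_expR em1 ltr_pdivrMr // mulrC.
apply: (ht (m1 + ln (nrm f ^+ 2))); last by rewrite addrK.
apply: (weight_bd_disc gs' M0 hM c'y e'y (u := u')).
rewrite -/P expRD em1 lnK ?posrE //.
have -> : nrm P ^+ 2 * (mid / N * nrm f ^+ 2) = mid.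
  by rewrite /N; move: (nrm P ^+ 2) (nrm f ^+ 2) Pp fp => a b a0 b0; field; rewrite !gt_eqF.
apply: le_lt_trans mid1; rewrite /A; apply: ler_wpM2r; first exact: hform_ge0.
by rewrite mulrC; apply: ler_wpM2l.
Qed.

End NotPseff.

(** In dimension 0 the curvature form is an empty sum, which is not positive. The averaging lemmas
    need this positive dimension. *)
Lemma RC_positive_dim (R : realType) (X : complex_manifold R) (E : hol_bundle X) (h : hermitian_metric E) :
  RC_positive_metric h -> (0 < rank E)%N -> (0 < mfd_dim X)%N.
Proof.
move=> hRC r0; have [x _] := mfd_nonempty X.
have [c ac cx] := atlas_cover x; have [i ix] := triv_cover E x.
have [|v] := hRC x c i ac cx ix (const_mx 1).
  by apply/eqP => /matrixP /(_ (Ordinal r0) 0); rewrite !mxE => /eqP; rewrite oner_eq0.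
case: (posnP (mfd_dim X)) => // n0; rewrite /chern_form big1 ?ltxx // => p _.
by case: p => k hk; exfalso; move: hk; rewrite n0.
Qed.

Theorem not_pseudo_effective (R : realType) (X : complex_manifold R) (E : hol_bundle X) :
  compact [set: X] -> RC_positive E -> forall F : invertible_subsheaf (dual E), ~ pseudo_effective F.
Proof.
move=> cX [h hRC] F [phi hphi hpsh].
have /choice [G hG] : forall x, exists G : set X * presection (dual E), G.1 x /\ is_generator F G.1 G.2.
  by move=> x; have [U [s h0]] := sh_locally_free F x; exists (U, s).
have gs x : is_generator F (G x).1 (G x).2 by case: (hG x).
have Gx x : (G x).1 x by case: (hG x).
have [x0 _] := mfd_nonempty X.
(* A generator with a nonzero coordinate shows that the rank is positive. *)
have n0 : (0 < mfd_dim X)%N.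
  have [y [i [a _]]] := generator_nonzero (gs x0) (@openT X) I (Gx x0).
  by apply: (RC_positive_dim hRC); exact: leq_ltn_trans (leq0n _) (ltn_ord a).
have pt x : patch h (G x).1 x.
  have /cid[] // : exists p : patch h (G x).1 x, True.
  by have [p] := patch_ex hRC (let: And3 oU _ _ := gs x in oU) (Gx x); exists p.
have [s0 hs0] := finite_cover cX (N := fun x => [set y | chart_dom (pc (pt x)) y /\
   vn (chart_fun (pc (pt x)) y - chart_fun (pc (pt x)) x) < pe (pt x)]) (fun x =>
   chart_nbhs (p_dom (pt x)) ((nbhs_VP _ _).2 (ex_intro2 _ _ (pe (pt x)) (p_e (pt x)) (fun y hy => hy)))).
have [q q01 hq] := finite_bound_lt1 s0 (fun x => p_q (pt x)).
have /andP[q0 q1] := q01.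
have /choice [M0 hM0] x : exists M, weight_bd phi (G x).2 (pt x) M.
  by have [M _ hM] := weight_bd_ex hphi hpsh n0 (pt x) (gs x); exists M.
have [M M1 hM] := finite_bound s0 M0.
have M00 : 0 <= M by exact: le_trans M1.
have it k : forall x, x \in s0 -> weight_bd phi (G x).2 (pt x) (M * q ^+ k).
  elim: k => [|k IH] x xs y Ky u m.
    rewrite expr0 mulr1 => hlt; apply: (hM0 x y Ky u); apply: le_lt_trans hlt.
    apply: ler_wpM2r; last exact: hM.
    by apply: hform_ge0; have [_ []] := patch_set_dom Ky.
  rewrite exprSr mulrA => hlt; have [x' xs' [cy' ey']] := hs0 y.
  have Mk0 : 0 <= M * q ^+ k by rewrite mulr_ge0 // exprn_ge0 // ltW.
  have H := (@weight_bd_step R X E h F phi hphi hpsh n0 (G x).1 (G x').1 (G x).2 (G x').2 x x' (pt x) (pt x') _ q y u m (gs x) (gs x') Mk0 (hq x' xs') (IH x' xs') Ky cy' ey' hlt).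
  exact: H.
have [x xs _] := hs0 x0.
exact: (weight_bd_contra hphi (gs x) hRC M00 q01 (fun k => it k x xs) (Gx x)).
Qed.

Theorem theorem1p3 (R : realType) (X : complex_manifold R) (E : hol_bundle X) :
  compact [set: X] -> RC_positive E ->
  (forall A : hol_bundle X, exists cA : nat, (0 < cA)%N /\
     forall l k : nat, (cA * (k + 1) <= l)%N ->
       H0_vanishes (tensor (sym_power l (dual E)) (tensor_power A k))) /\
  (projective_manifold X ->
     forall F : invertible_subsheaf (dual E), ~ pseudo_effective F).
Proof.
move=> cX hE; split => [A|_ F]; first exact: sym_tensor_vanishing.
exact: not_pseudo_effective.
Qed.
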